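(* Let $X,X_1,X_2,\ldots$ be i.i.d. with density $f$ on $[0,1]$, and let $k\in\mathbb{N}$. As $n\to\infty$, $$n^{-1}\operatorname{Var}[S^g_{n,\log,k}]\to\tau_k+\operatorname{Var}\Big[\log\Big(\frac{f(X)}{g(X)}\Big)\Big]$$ and $$n^{-1/2}\big(S^g_{n,\log,k}-\mathbb{E}S^g_{n,\log,k}\big)\xrightarrow{\mathcal{D}}N\Big(0,\ \tau_k+\operatorname{Var}\Big[\log\Big(\frac{f(X)}{g(X)}\Big)\Big]\Big),$$ where $\tau_k:=(2k^2-2k+1)\psi'(k)-2k+1$.
   Context: $f$ and $g$ are probability densities with common support $[0,1]$ (both vanish outside it), bounded, and bounded away from zero on $[0,1]$; $G$ is the distribution function of $g$. $X_{(1)}\le\cdots\le X_{(n)}$ are the order statistics of $X_1,\ldots,X_n$. For $n>k$, $$S^g_{n,\log,k}:=\sum_{i=1}^{n-k}\log\big(n[G(X_{(i+k)})-G(X_{(i)})]\big).$$ $\psi'(k):=\frac{\pi^2}{6}-\sum_{i=1}^{k-1}i^{-2}$ (trigamma function at $k$); $\log$ is the natural logarithm; $N(0,\sigma^2)$ is the centered normal law with variance $\sigma^2$. *)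

(* Defs.v *)
From mathcomp Require Export all_boot all_order all_algebra finmap.
From mathcomp Require Export all_classical all_reals all_analysis.

Set Implicit Arguments.
Unset Strict Implicit.
Unset Printing Implicit Defensive.

Import Order.TTheory GRing.Theory Num.Theory.
Import numFieldNormedType.Exports.

Local Open Scope classical_set_scope.
Local Open Scope ring_scope.

(* The bounds are required everywhere on [0, 1], not merely almost everywhere. *)
Record unit_interval_density (R : realType) (f : R -> R) : Prop := {
  density_measurable : measurable_fun [set: R] f ;
  density_vanish : forall x, x \notin `[0, 1] -> f x = 0 ;
  density_bounded : exists M, forall x, x \in `[0, 1] -> f x <= M ;
  density_away0 : exists2 m, 0 < m & forall x, x \in `[0, 1] -> m <= f x ;
  density_total : (\int[lebesgue_measure]_x (f x)%:E = 1)%E }.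

Definition has_density d (T : measurableType d) (R : realType)
    (P : probability T R) (X : {RV P >-> R}) (f : R -> R) : Prop :=
  forall A : set R, measurable A ->
    (distribution P X A = \int[lebesgue_measure]_(x in A) (f x)%:E)%E.

Definition mutually_independent d (T : measurableType d) (R : realType)
    (P : probability T R) (I : choiceType) (X : I -> {RV P >-> R}) : Prop :=
  forall (J : {fset I}) (A : I -> set R), (forall i, measurable (A i)) ->
    (P (\bigcap_(i in [set` J]) (X i @^-1` A i)) =
     \prod_(i <- J) P (X i @^-1` A i))%E.

Definition iid_with_density d (T : measurableType d) (R : realType)
    (P : probability T R) (X : nat -> {RV P >-> R}) (f : R -> R) : Prop :=
  mutually_independent X /\ forall i, has_density (X i) f.

Definition dist_fun (R : realType) (g : R -> R) (x : R) : R :=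
  \int[lebesgue_measure]_(y in `]-oo, x]) g y.

(* i-th smallest (1 <= i <= n) among x 1, ..., x n; x 0 is not in the sample. *)
Definition order_stat (R : realType) (x : nat -> R) (n i : nat) : R :=
  nth 0 (sort <=%R [seq x j | j <- iota 1 n]) i.-1.

(* Ties among the sample points, where the library sets ln 0 = 0, have
   probability zero under the hypotheses of the theorem. *)
Definition log_spacings d (T : measurableType d) (R : realType)
    (P : probability T R) (g : R -> R) (k : nat)
    (X : nat -> {RV P >-> R}) (n : nat) (w : T) : R :=
  let Xo := order_stat (fun j => X j w) n in
  \sum_(1 <= i < (n - k).+1)
    ln (n%:R * (dist_fun g (Xo (i + k)%N) - dist_fun g (Xo i))).

Definition trigamma_nat (R : realType) (k : nat) : R :=
  pi ^+ 2 / 6 - \sum_(1 <= i < k) i%:R ^- 2.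

Definition tau (R : realType) (k : nat) : R :=
  (2 * k%:R ^+ 2 - 2 * k%:R + 1) * trigamma_nat R k - 2 * k%:R + 1.

(* normal_prob takes the standard deviation, and normal_prob 0 0 is by
   convention the uniform law on [0, 1] rather than the Dirac mass. *)
Definition centered_normal (R : realType) (v : R) :
    probability (measurableTypeR R) R :=
  if v == 0 then (@dirac _ (measurableTypeR R) 0 R : probability _ _)
  else (normal_prob 0 (Num.sqrt v) : probability _ _).

Definition cvg_in_distribution d (T : measurableType d) (R : realType)
    (P : probability T R) (Y : nat -> T -> R)
    (Q : probability (measurableTypeR R) R) : Prop :=
  forall h : R -> R, continuous h -> (exists M, forall x, `|h x| <= M) ->
    ('E_P[h \o Y n] @[n --> \oo] --> \int[Q]_x (h x)%:E)%E.

(* Main.v *)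
Require Import Defs.
From HB Require Import structures.
From mathcomp Require Import measurable_realfun ring lra zify.
Set Implicit Arguments.
Unset Strict Implicit.
Unset Printing Implicit Defensive.

Import Order.TTheory GRing.Theory Num.Theory.
Import numFieldNormedType.Exports.

Local Open Scope classical_set_scope.
Local Open Scope ring_scope.

(* Put l_i = - ln (1 - F (X_(i))) and l_0 = 0. By Renyi's representation the
   normalized gaps e_j = (n - j) (l_(j+1) - l_j) are i.i.d. standard exponential.
   Write phi = ln (g / f). By the Efron-Stein inequality and Lebesgue's
   differentiation theorem, up to an error of variance o(n),
     S_n = sum_i ln (n (F (X_(i+k)) - F (X_(i)))) + sum_i phi (X_(i)).
   With W_i = e_i + ... + e_(i+k-1), the first sum is sum_i (ln W_i - e_i) plus a
   constant, up to an error of L2 norm O(ln n). For the second sum, phi is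
   approximated in L2 by a smooth function of l; a Taylor expansion of that
   function around E l_i turns the sum into a constant plus sum_j b_j (e_j - 1)
   with bounded b_j. As this sum approximates a sum of n i.i.d. terms,
   sum_j b_j^2 is close to n Var (phi X) without any further computation.
   Since Cov (ln W_i, e_j) = 1/k for j in the window of W_i, the two parts are
   uncorrelated up to O(1). By Frullani's integral, Cov (ln W_i, ln W_(i+r)) is
   the sum over m of C(k-r+m, m+1) B(m+1, k)^2; summing over r leaves a series
   that evaluates to tau_k + 1. The summands are k-dependent, and after
   truncation the central limit theorem follows by Stein's method. *)

(** * Square-integrable random variables *)

(** The transform l is built from F rather than G because only the distribution function of the
    sample itself makes the gaps exactly independent. G then enters through the ratio of a G-spacing
    to the F-spacing over the same pair of order statistics. Neither density is continuous, so this
    ratio is close to g / f only at almost every point and at no known rate, which rules out a term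
    by term comparison. The Efron-Stein inequality avoids a rate: deleting one sample point alters
    about k terms of the sum of deviations, so it suffices that a local mean square deviation tends
    to 0. For the same reason phi is merely bounded and measurable. Its smooth approximant is fixed
    before n grows, so that every later constant may depend on it but not on n. All remainders are
    compared in standard deviation, which ignores constants; the centring constants of the
    linearizations therefore never have to be computed. The variables ln W_i are unbounded near 0
    and at infinity. A bound on fourth moments makes their truncation uniform in n. *)

Section real_expectation.
Context d (T : measurableType d) (R : realType) (P : probability T R).
Implicit Types (Y Z : T -> R) (c : R).

Definition L1 Y : Prop := P.-integrable [set: T] (EFin \o Y).

(** [fine] sends infinite values to 0, hence the [L1] hypotheses in the algebraic rules below. *)
Definition Ex Y : R := fine (\int[P]_w (Y w)%:E)%E.

(** Measurability is a separate conjunct because integrability of the square does not imply it. *)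
Definition L2 Y : Prop := measurable_fun [set: T] Y /\ L1 (fun w => Y w ^+ 2).

Lemma L1_mf Y : L1 Y -> measurable_fun [set: T] Y.
Proof. by move=> /measurable_int/measurable_EFinP. Qed.

Lemma L1_fin Y : L1 Y -> (\int[P]_w (Y w)%:E)%E \is a fin_num.
Proof. by move=> h; apply: integrable_fin_num. Qed.

Lemma ExE Y : L1 Y -> (\int[P]_w (Y w)%:E)%E = (Ex Y)%:E.
Proof. by move=> h; rewrite /Ex fineK// L1_fin. Qed.

Lemma eq_Ex Y Z : Y =1 Z -> Ex Y = Ex Z.
Proof. by move=> /funext ->. Qed.

Lemma eq_L1 Y Z : Y =1 Z -> L1 Y -> L1 Z.
Proof. by move=> /funext ->. Qed.

Lemma eq_L2 Y Z : Y =1 Z -> L2 Y -> L2 Z.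
Proof. by move=> /funext ->. Qed.

Lemma L1D Y Z : L1 Y -> L1 Z -> L1 (fun w => Y w + Z w).
Proof. by move=> hY hZ; have := integrableD measurableT hY hZ. Qed.

Lemma L1Z c Y : L1 Y -> L1 (fun w => c * Y w).
Proof. by move=> hY; have := integrableZl measurableT c hY. Qed.

Lemma L1N Y : L1 Y -> L1 (fun w => - Y w).
Proof. by move/(@L1Z (-1)); apply: eq_L1 => w; rewrite mulN1r. Qed.

Lemma L1B Y Z : L1 Y -> L1 Z -> L1 (fun w => Y w - Z w).
Proof. by move=> hY hZ; apply: L1D => //; apply: L1N. Qed.

Lemma L1_cst c : L1 (fun=> c).
Proof. exact: finite_measure_integrable_cst. Qed.

Lemma L1_le Y Z : measurable_fun [set: T] Y -> (forall w, `|Y w| <= Z w) ->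
  L1 Z -> L1 Y.
Proof.
move=> mY YZ hZ; apply: (le_integrable measurableT _ _ hZ).
  exact/measurable_EFinP.
move=> w _ /=; rewrite lee_fin (le_trans (YZ w))//; exact: ler_norm.
Qed.

Lemma L1_bounded c Y : measurable_fun [set: T] Y -> (forall w, `|Y w| <= c) ->
  L1 Y.
Proof. by move=> mY h; apply: (L1_le mY h); exact: L1_cst. Qed.

Lemma L1_norm Y : L1 Y -> L1 (fun w => `|Y w|).
Proof. by move=> h; have := integrable_abse h. Qed.

Lemma L1_sum I (s : seq I) (p : pred I) (Y : I -> T -> R) :
  (forall i, p i -> L1 (Y i)) -> L1 (fun w => \sum_(i <- s | p i) Y i w).
Proof.
move=> h; elim: s => [|i s ih].
  by under [X in L1 X]funext do rewrite big_nil; exact: L1_cst.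
under [X in L1 X]funext do rewrite big_cons.
by case pi : (p i) => //; apply: L1D => //; exact: h.
Qed.

Lemma ExD Y Z : L1 Y -> L1 Z -> Ex (fun w => Y w + Z w) = Ex Y + Ex Z.
Proof.
move=> hY hZ; have := @RintegralD _ T R P setT Y Z measurableT hY hZ.
by rewrite /Rintegral.
Qed.

Lemma ExZ c Y : L1 Y -> Ex (fun w => c * Y w) = c * Ex Y.
Proof.
move=> hY; have := @RintegralZl _ T R P setT Y c measurableT hY.
by rewrite /Rintegral.
Qed.

Lemma ExN Y : L1 Y -> Ex (fun w => - Y w) = - Ex Y.
Proof.
by move=> hY; rewrite -mulN1r -ExZ//; apply: eq_Ex => w; rewrite mulN1r.
Qed.

Lemma ExB Y Z : L1 Y -> L1 Z -> Ex (fun w => Y w - Z w) = Ex Y - Ex Z.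
Proof. by move=> hY hZ; rewrite ExD ?ExN//; exact: L1N. Qed.

Lemma Ex_cst c : Ex (fun=> c) = c.
Proof. by rewrite /Ex integral_cst//= probability_setT mule1. Qed.

Lemma Ex_sum I (s : seq I) (p : pred I) (Y : I -> T -> R) :
  (forall i, p i -> L1 (Y i)) ->
  Ex (fun w => \sum_(i <- s | p i) Y i w) = \sum_(i <- s | p i) Ex (Y i).
Proof.
move=> h; elim: s => [|i s ih].
  by under eq_Ex do rewrite big_nil; rewrite big_nil Ex_cst.
under eq_Ex do rewrite big_cons.
rewrite big_cons; case: ifP => // pi; rewrite ExD ?ih//; first exact: h.
exact: L1_sum.
Qed.

Lemma Ex_le Y Z : L1 Y -> L1 Z -> (forall w, Y w <= Z w) -> Ex Y <= Ex Z.
Proof.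
move=> hY hZ h.
by have := @le_Rintegral _ T R P setT Y Z measurableT hY hZ (fun w _ => h w).
Qed.

Lemma Ex_ge0 Y : (forall w, 0 <= Y w) -> 0 <= Ex Y.
Proof.
move=> h; apply: fine_ge0; apply: integral_ge0 => w _; by rewrite lee_fin.
Qed.

Lemma Ex_norm_le Y : L1 Y -> `|Ex Y| <= Ex (fun w => `|Y w|).
Proof.
move=> hY; rewrite ler_norml; apply/andP; split.
  rewrite lerNl -ExN//; apply: Ex_le; [exact: L1N|exact: L1_norm|].
  by move=> w; rewrite -normrN ler_norm.
by apply: Ex_le => // [|w]; [exact: L1_norm|exact: ler_norm].
Qed.

Lemma Ex_bounded c Y : measurable_fun [set: T] Y -> (forall w, `|Y w| <= c) ->
  `|Ex Y| <= c.
Proof.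
move=> mY h; have hY := L1_bounded mY h; rewrite (le_trans (Ex_norm_le hY))//.
rewrite -[leRHS]Ex_cst; apply: Ex_le => //; [exact: L1_norm|exact: L1_cst].
Qed.

Lemma L2M Y Z : L2 Y -> L2 Z -> L1 (fun w => Y w * Z w).
Proof.
move=> [mY hY] [mZ hZ]; apply: (L1_le _ _ (L1D hY hZ)).
  exact: measurable_funM.
move=> w; rewrite ler_norml; apply/andP; split.
  by have := sqr_ge0 (Y w + Z w); have := sqr_ge0 (Y w - Z w); nra.
by have := sqr_ge0 (Y w + Z w); have := sqr_ge0 (Y w - Z w); nra.
Qed.

Lemma L2D Y Z : L2 Y -> L2 Z -> L2 (fun w => Y w + Z w).
Proof.
move=> hY hZ; split; first by apply: measurable_funD; [case: hY|case: hZ].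
have h := L1D (L1D hY.2 hZ.2) (L1Z 2 (L2M hY hZ)).
by apply: eq_L1 h => w; ring.
Qed.

Lemma L2Z c Y : L2 Y -> L2 (fun w => c * Y w).
Proof.
move=> hY; split; first by apply: measurable_funM => //; case: hY.
by apply: eq_L1 (L1Z (c ^+ 2) hY.2) => w; ring.
Qed.

Lemma L2N Y : L2 Y -> L2 (fun w => - Y w).
Proof. by move/(@L2Z (-1)); apply: eq_L2 => w; rewrite mulN1r. Qed.

Lemma L2B Y Z : L2 Y -> L2 Z -> L2 (fun w => Y w - Z w).
Proof. by move=> hY hZ; apply: L2D => //; exact: L2N. Qed.

Lemma L2_bounded c Y : measurable_fun [set: T] Y -> (forall w, `|Y w| <= c) ->
  L2 Y.
Proof.
move=> mY h; split => //; apply: (@L1_bounded (c ^+ 2)).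
  exact: measurable_funX.
move=> w; rewrite normrX ler_pXn2r// nnegrE//.
by rewrite (le_trans _ (h w)).
Qed.

Lemma L2_cst c : L2 (fun=> c).
Proof. by apply: (@L2_bounded `|c|). Qed.

Lemma L2_sum I (s : seq I) (p : pred I) (Y : I -> T -> R) :
  (forall i, p i -> L2 (Y i)) -> L2 (fun w => \sum_(i <- s | p i) Y i w).
Proof.
move=> h; elim: s => [|i s ih].
  by under [X in L2 X]funext do rewrite big_nil; exact: L2_cst.
under [X in L2 X]funext do rewrite big_cons.
by case pi : (p i) => //; apply: L2D => //; exact: h.
Qed.

Lemma L2_L1 Y : L2 Y -> L1 Y.
Proof. by move=> h; apply: eq_L1 (L2M h (L2_cst 1)) => w; rewrite mulr1. Qed.

Lemma L2_le Y Z : measurable_fun [set: T] Y -> (forall w, `|Y w| <= Z w) ->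
  L2 Z -> L2 Y.
Proof.
move=> mY h hZ; split => //; apply: (L1_le _ _ hZ.2).
  exact: measurable_funX.
by move=> w; rewrite normrX ler_pXn2r// nnegrE//; rewrite (le_trans _ (h w)).
Qed.

(** The quadratic polynomial t -> E (t Y - Z)^2 is nonnegative, so its discriminant is not positive.
    The case E Y^2 = 0, where it is affine, is treated apart. *)
Lemma cauchy_schwarz Y Z : L2 Y -> L2 Z ->
  Ex (fun w => Y w * Z w) ^+ 2 <= Ex (fun w => Y w ^+ 2) * Ex (fun w => Z w ^+ 2).
Proof.
move=> hY hZ; set a := Ex _; set b := Ex _; set c := Ex _.
have b0 : 0 <= b by apply: Ex_ge0 => w; exact: sqr_ge0.
have c0 : 0 <= c by apply: Ex_ge0 => w; exact: sqr_ge0.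
have q t : 0 <= b * t ^+ 2 - 2 * t * a + c.
  have -> : b * t ^+ 2 - 2 * t * a + c = Ex (fun w => (t * Y w - Z w) ^+ 2).
    have h1 := L1Z (t ^+ 2) hY.2; have h2 := L1Z (2 * t) (L2M hY hZ).
    transitivity (Ex (fun w => (t ^+ 2 * Y w ^+ 2 - 2 * t * (Y w * Z w)) + Z w ^+ 2)).
      have e1 := ExD (L1B h1 h2) hZ.2; have e2 := ExB h1 h2.
      have e3 := ExZ (t ^+ 2) hY.2; have e4 := ExZ (2 * t) (L2M hY hZ).
      by rewrite e1 e2 e3 e4 -/a -/b -/c; ring.
    by apply: eq_Ex => w; ring.
  by apply: Ex_ge0 => w; exact: sqr_ge0.
have [b0'|b0'] := eqVneq b 0.
  (* With b = 0 the polynomial is affine and takes the value -1 at this point, unless a = 0. *)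
  have q1 := q ((c + 1) / (2 * a)).
  have [->|a0] := eqVneq a 0; first by rewrite expr0n/= mulr_ge0.
  move: q1; rewrite b0' mul0r.
  have -> : 2 * ((c + 1) / (2 * a)) * a = c + 1 by field.
  by move=> ?; exfalso; lra.
have bp : 0 < b by rewrite lt_neqAle eq_sym b0'.
have := q (a / b).
have -> : b * (a / b) ^+ 2 - 2 * (a / b) * a + c = (b * c - a ^+ 2) / b by field.
by rewrite pmulr_lge0 ?invr_gt0// subr_ge0.
Qed.

Definition norm2 Y : R := Num.sqrt (Ex (fun w => Y w ^+ 2)).

Lemma nm_ge0 Y : 0 <= norm2 Y. Proof. exact: sqrtr_ge0. Qed.

Lemma sqr_nm Y : norm2 Y ^+ 2 = Ex (fun w => Y w ^+ 2).
Proof. by rewrite sqr_sqrtr//; apply: Ex_ge0 => w; exact: sqr_ge0. Qed.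

Lemma eq_nm Y Z : Y =1 Z -> norm2 Y = norm2 Z.
Proof. by move=> /funext ->. Qed.

Lemma normr_Ex_mul Y Z : L2 Y -> L2 Z ->
  `|Ex (fun w => Y w * Z w)| <= norm2 Y * norm2 Z.
Proof.
move=> hY hZ; rewrite -(@ler_pXn2r _ 2)// ?nnegrE ?mulr_ge0 ?nm_ge0//.
by rewrite exprMn !sqr_nm -normrX ger0_norm ?sqr_ge0// cauchy_schwarz.
Qed.

Lemma nmD Y Z : L2 Y -> L2 Z -> norm2 (fun w => Y w + Z w) <= norm2 Y + norm2 Z.
Proof.
move=> hY hZ; rewrite -(@ler_pXn2r _ 2)// ?nnegrE ?addr_ge0 ?nm_ge0//.
rewrite sqr_nm.
have -> : Ex (fun w => (Y w + Z w) ^+ 2) =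
    Ex (fun w => Y w ^+ 2) + Ex (fun w => Z w ^+ 2) + 2 * Ex (fun w => Y w * Z w).
  have e1 := ExD (L1D hY.2 hZ.2) (L1Z 2 (L2M hY hZ)); have e2 := ExD hY.2 hZ.2.
  have e3 := ExZ 2 (L2M hY hZ); rewrite -e3 -e2 -e1.
  by apply: eq_Ex => w; ring.
rewrite -!sqr_nm.
have := normr_Ex_mul hY hZ; have := ler_norm (Ex (fun w => Y w * Z w)); nra.
Qed.

Lemma nmZ c Y : L2 Y -> norm2 (fun w => c * Y w) = `|c| * norm2 Y.
Proof.
move=> hY; rewrite /norm2 -(sqrtr_sqr c) -sqrtrM ?sqr_ge0//; congr Num.sqrt.
by have e := ExZ (c ^+ 2) hY.2; rewrite -e; apply: eq_Ex => w; ring.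
Qed.

Lemma nm_cst c : norm2 (fun=> c) = `|c|.
Proof. by rewrite /norm2 Ex_cst sqrtr_sqr. Qed.

Lemma nm_le Y Z : L2 Y -> L2 Z -> (forall w, `|Y w| <= Z w) -> norm2 Y <= norm2 Z.
Proof.
move=> hY hZ h; rewrite /norm2 ler_wsqrtr//; apply: Ex_le; [exact: hY.2|exact: hZ.2|].
move=> w; rewrite -[leLHS]ger0_norm ?sqr_ge0// normrX ler_pXn2r// nnegrE//.
by rewrite (le_trans _ (h w)).
Qed.

Lemma nm_sum I (s : seq I) (p : pred I) (Y : I -> T -> R) :
  (forall i, p i -> L2 (Y i)) ->
  norm2 (fun w => \sum_(i <- s | p i) Y i w) <= \sum_(i <- s | p i) norm2 (Y i).
Proof.
move=> h; elim: s => [|i s ih].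
  by under eq_nm do rewrite big_nil; rewrite big_nil nm_cst normr0.
under eq_nm do rewrite big_cons.
rewrite big_cons; case: ifP => // pi.
rewrite (le_trans (nmD _ _))//; [exact: h|exact: L2_sum|exact: lerD].
Qed.

Lemma normr_Ex_le_nm Y : L2 Y -> `|Ex Y| <= norm2 Y.
Proof.
move=> hY; have := normr_Ex_mul hY (L2_cst 1).
rewrite nm_cst normr1 mulr1 => h; apply: le_trans h.
by rewrite [X in _ <= `|X|](_ : _ = Ex Y)//; apply: eq_Ex => w; rewrite mulr1.
Qed.

Definition Cov Y Z : R := Ex (fun w => Y w * Z w) - Ex Y * Ex Z.

Definition Var Y : R := Cov Y Y.

Lemma CovC Y Z : Cov Y Z = Cov Z Y.
Proof.
by rewrite /Cov [Ex Y * _]mulrC; congr (_ - _); apply: eq_Ex => w; rewrite mulrC.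
Qed.

Lemma CovDl Y Y' Z : L2 Y -> L2 Y' -> L2 Z ->
  Cov (fun w => Y w + Y' w) Z = Cov Y Z + Cov Y' Z.
Proof.
move=> hY hY' hZ; rewrite /Cov.
have e1 := ExD (L2M hY hZ) (L2M hY' hZ); have e2 := ExD (L2_L1 hY) (L2_L1 hY').
have e3 : Ex (fun w => (Y w + Y' w) * Z w) = Ex (fun w => Y w * Z w + Y' w * Z w).
  by apply: eq_Ex => w; rewrite mulrDl.
by rewrite e3 e1 e2; ring.
Qed.

Lemma CovZl c Y Z : L2 Y -> L2 Z -> Cov (fun w => c * Y w) Z = c * Cov Y Z.
Proof.
move=> hY hZ; rewrite /Cov.
have e1 := ExZ c (L2M hY hZ); have e2 := ExZ c (L2_L1 hY).
have e3 : Ex (fun w => c * Y w * Z w) = Ex (fun w => c * (Y w * Z w)).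
  by apply: eq_Ex => w; rewrite mulrA.
by rewrite e3 e1 e2; ring.
Qed.

Lemma CovNl Y Z : L2 Y -> L2 Z -> Cov (fun w => - Y w) Z = - Cov Y Z.
Proof.
move=> hY hZ; rewrite -mulN1r -CovZl//; congr Cov; apply/funext => w.
by rewrite mulN1r.
Qed.

Lemma CovBl Y Y' Z : L2 Y -> L2 Y' -> L2 Z ->
  Cov (fun w => Y w - Y' w) Z = Cov Y Z - Cov Y' Z.
Proof. by move=> hY hY' hZ; rewrite CovDl ?CovNl//; exact: L2N. Qed.

Lemma Cov_cstl c Y : L2 Y -> Cov (fun=> c) Y = 0.
Proof.
by move=> hY; rewrite /Cov; have e := ExZ c (L2_L1 hY); rewrite e Ex_cst subrr.
Qed.

Lemma Cov_suml I (s : seq I) (p : pred I) (Y : I -> T -> R) Z :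
  (forall i, p i -> L2 (Y i)) -> L2 Z ->
  Cov (fun w => \sum_(i <- s | p i) Y i w) Z = \sum_(i <- s | p i) Cov (Y i) Z.
Proof.
move=> h hZ; elim: s => [|i s ih].
  rewrite big_nil (_ : (fun w => _) = fun=> 0) ?Cov_cstl//; apply/funext => w.
  by rewrite big_nil.
rewrite (_ : (fun w => _) = fun w => (if p i then Y i w else 0) +
    \sum_(j <- s | p j) Y j w); last first.
  by apply/funext => w; rewrite big_cons; case: ifP => //; rewrite add0r.
rewrite big_cons; case: ifP => pi.
  by rewrite CovDl ?ih//; [exact: h|exact: L2_sum].
by rewrite CovDl ?ih ?Cov_cstl ?add0r//; [exact: L2_cst|exact: L2_sum].
Qed.

Lemma CovDr Y Y' Z : L2 Y -> L2 Y' -> L2 Z ->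
  Cov Z (fun w => Y w + Y' w) = Cov Z Y + Cov Z Y'.
Proof. by move=> *; rewrite !(CovC Z) CovDl. Qed.

Lemma CovZr c Y Z : L2 Y -> L2 Z -> Cov Z (fun w => c * Y w) = c * Cov Z Y.
Proof. by move=> *; rewrite !(CovC Z) CovZl. Qed.

Lemma CovBr Y Y' Z : L2 Y -> L2 Y' -> L2 Z ->
  Cov Z (fun w => Y w - Y' w) = Cov Z Y - Cov Z Y'.
Proof. by move=> *; rewrite !(CovC Z) CovBl. Qed.

Lemma Cov_sumr I (s : seq I) (p : pred I) (Y : I -> T -> R) Z :
  (forall i, p i -> L2 (Y i)) -> L2 Z ->
  Cov Z (fun w => \sum_(i <- s | p i) Y i w) = \sum_(i <- s | p i) Cov Z (Y i).
Proof.
by move=> h hZ; rewrite CovC Cov_suml//; apply: eq_bigr => i _; rewrite CovC.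
Qed.

Lemma VarE Y : L2 Y -> Var Y = Ex (fun w => (Y w - Ex Y) ^+ 2).
Proof.
move=> hY; rewrite /Var /Cov; set m := Ex Y.
have -> : Ex (fun w => (Y w - m) ^+ 2) =
    Ex (fun w => Y w * Y w) - (2 * m) * Ex Y + m ^+ 2.
  have h1 := L2M hY hY; have h2 := L1Z (2 * m) (L2_L1 hY).
  have e1 := ExD (L1B h1 h2) (L1_cst (m ^+ 2)); have e2 := ExB h1 h2.
  have e3 := ExZ (2 * m) (L2_L1 hY); have e4 := Ex_cst (m ^+ 2).
  by rewrite -e3 -e2 -[in RHS]e4 -e1; apply: eq_Ex => w; ring.
by rewrite -/m; ring.
Qed.

Lemma Var_ge0 Y : L2 Y -> 0 <= Var Y.
Proof. by move=> hY; rewrite VarE//; apply: Ex_ge0 => w; exact: sqr_ge0. Qed.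

Lemma Var_le Y : L2 Y -> Var Y <= Ex (fun w => Y w ^+ 2).
Proof.
move=> hY; rewrite /Var /Cov -expr2.
by under eq_Ex do rewrite -expr2; rewrite gerBl sqr_ge0.
Qed.

Definition sd Y : R := Num.sqrt (Var Y).

Definition ctr Y : T -> R := fun w => Y w - Ex Y.

Lemma L2_ctr Y : L2 Y -> L2 (ctr Y).
Proof. by move=> hY; apply: L2B => //; exact: L2_cst. Qed.

Lemma Ex_ctr Y : L1 Y -> Ex (ctr Y) = 0.
Proof. by move=> hY; rewrite ExB ?Ex_cst ?subrr//; exact: L1_cst. Qed.

Lemma sdE Y : L2 Y -> sd Y = norm2 (ctr Y).
Proof. by move=> hY; rewrite /sd VarE. Qed.

Lemma sd_ge0 Y : 0 <= sd Y. Proof. exact: sqrtr_ge0. Qed.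

Lemma sqr_sd Y : L2 Y -> sd Y ^+ 2 = Var Y.
Proof. by move=> hY; rewrite sqr_sqrtr// Var_ge0. Qed.

Lemma sd_le_nm Y : L2 Y -> sd Y <= norm2 Y.
Proof. by move=> hY; rewrite ler_wsqrtr// Var_le. Qed.

Lemma sdD Y Z : L2 Y -> L2 Z -> sd (fun w => Y w + Z w) <= sd Y + sd Z.
Proof.
move=> hY hZ; rewrite !sdE//; last exact: L2D.
rewrite (_ : ctr _ = fun w => ctr Y w + ctr Z w); last first.
  apply/funext => w; rewrite /ctr; have e := ExD (L2_L1 hY) (L2_L1 hZ).
  by rewrite e; ring.
by apply: nmD; exact: L2_ctr.
Qed.

Lemma VarD_cst c Y : L2 Y -> Var (fun w => Y w + c) = Var Y.
Proof.
move=> hY; rewrite (VarE hY) (VarE (L2D hY (L2_cst c))).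
have e := ExD (L2_L1 hY) (L1_cst c).
by rewrite e Ex_cst; apply: eq_Ex => w; congr (_ ^+ 2); ring.
Qed.

Lemma VarZ c Y : L2 Y -> Var (fun w => c * Y w) = c ^+ 2 * Var Y.
Proof.
by move=> hY; rewrite /Var CovZl ?CovZr//; [ring|exact: L2Z].
Qed.

Lemma expectationE Y : L1 Y -> ('E_P[Y] = (Ex Y)%:E)%E.
Proof. by move=> hY; rewrite unlock ExE. Qed.

Lemma fine_expectation Y : fine ('E_P[Y])%E = Ex Y.
Proof. by rewrite unlock. Qed.

Lemma varianceE Y : L2 Y -> ('V_P[Y] = (Var Y)%:E)%E.
Proof.
move=> hY; rewrite /variance unlock fine_expectation.
rewrite expectationE; last exact/(L2M (L2_ctr hY) (L2_ctr hY)).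
by congr EFin; rewrite VarE//; apply: eq_Ex => w; rewrite expr2.
Qed.

Lemma Ex_ae Y Z : measurable_fun [set: T] Y -> measurable_fun [set: T] Z ->
  {ae P, forall w, Y w = Z w} -> Ex Y = Ex Z.
Proof.
move=> mY mZ h; rewrite /Ex (@ae_eq_integral _ T R P setT (EFin \o Z))//.
- exact/measurable_EFinP.
- exact/measurable_EFinP.
- by apply: filterS h => w /= -> .
Qed.

Lemma L1_ae Y Z : measurable_fun [set: T] Y -> measurable_fun [set: T] Z ->
  {ae P, forall w, Y w = Z w} -> L1 Z -> L1 Y.
Proof.
move=> mY mZ h /integrableP[_ hZ]; apply/integrableP; split.
  exact/measurable_EFinP.
rewrite (@ae_eq_integral _ T R P setT (fun w => `|(EFin \o Z) w|%E))//.
- by apply: measurableT_comp => //; exact/measurable_EFinP.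
- by apply: measurableT_comp => //; exact/measurable_EFinP.
- by apply: filterS h => w /= -> .
Qed.

Lemma L2_ae Y Z : measurable_fun [set: T] Y -> measurable_fun [set: T] Z ->
  {ae P, forall w, Y w = Z w} -> L2 Z -> L2 Y.
Proof.
move=> mY mZ h hZ; split => //; apply: (L1_ae _ _ _ hZ.2).
- exact: measurable_funX.
- exact: measurable_funX.
- by apply: filterS h => w /= -> .
Qed.

Lemma Ex_dominated (Y : (T -> R)^nat) Z c :
  (forall n, measurable_fun [set: T] (Y n)) -> measurable_fun [set: T] Z ->
  (forall n w, `|Y n w| <= c) ->
  {ae P, forall w, Y n w @[n --> \oo] --> Z w} ->
  Ex (Y n) @[n --> \oo] --> Ex Z.
Proof.
move=> mY mZ h YZ.
have [] := @dominated_convergence _ T R P setT measurableT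
  (fun n => EFin \o Y n) (EFin \o Z) (EFin \o cst c) _ _ _ (L1_cst c) _.
- by move=> n; exact/measurable_EFinP.
- exact/measurable_EFinP.
- by apply: filterS YZ => w hw _; apply: cvg_EFin => //; exact: nearW.
- by apply: aeW => w n _ /=; rewrite lee_fin.
move=> intZ _ cv; apply: fine_cvg; rewrite /= -/(Ex Z) -ExE//.
Qed.

End real_expectation.

(** * Independence *)

Section generated_by_coordinates.
Context (Om : pointedType) (R : realType).
Implicit Types (e : nat -> Om -> R) (I J : set nat).

(* [gens] generates the sigma-algebra of the coordinates e_i with i in I; the
   cylinders [cyls] form a pi-system generating the same one. *)
Definition gens I e : set (set Om) :=
  [set B | exists2 i, I i & exists2 A, measurable A & B = e i @^-1` A].

Definition cyls n I e : set (set Om) :=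
  [set B | exists2 A : nat -> set R, (forall i, measurable (A i)) &
    B = \bigcap_(i in `I_n `&` I) e i @^-1` A i].

Lemma gens_sub I J e : I `<=` J -> gens I e `<=` gens J e.
Proof. by move=> IJ B [i Ii h]; exists i => //; exact: IJ. Qed.

Lemma gens_cyls n I e : I `<=` `I_n -> gens I e `<=` cyls n I e.
Proof.
move=> In B [i Ii [A mA ->]].
exists (fun j => if j == i then A else setT) => [j|]; first by case: ifP.
apply/seteqP; split => w /=.
  by move=> Aw j [_ Ij]; case: ifPn => // /eqP ->.
by move=> /(_ i (conj (In _ Ii) Ii)); rewrite eqxx.
Qed.

Lemma cylsT n I e : cyls n I e setT.
Proof. by exists (fun=> setT) => //; rewrite bigcap_mkcond; apply/seteqP; split => // w _ i _; case: ifP. Qed.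

Lemma setI_closed_cyls n I e : setI_closed (cyls n I e).
Proof.
move=> _ _ [A mA ->] [B mB ->]; exists (fun i => A i `&` B i).
  by move=> i; exact: measurableI.
by rewrite -bigcapI.
Qed.

Lemma sg_coord I e i : I i ->
  measurable_fun [set: g_sigma_algebraType (gens I e)] (e i).
Proof.
move=> Ii _ A mA; rewrite setTI; apply: sub_sigma_algebra.
by exists i => //; exists A.
Qed.

Lemma sg_subset I J e (A : set Om) : I `<=` J ->
  measurable (A : set (g_sigma_algebraType (gens I e))) ->
  measurable (A : set (g_sigma_algebraType (gens J e))).
Proof.
move=> IJ; have H : <<s gens I e>> `<=` <<s gens J e>>.
  by apply: sub_smallest2r; [exact: smallest_sigma_algebra|exact: gens_sub].
exact: H.
Qed.

Lemma sg_mfS I J e d' (S : measurableType d') (Y : Om -> S) : I `<=` J ->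
  measurable_fun [set: g_sigma_algebraType (gens I e)] Y ->
  measurable_fun [set: g_sigma_algebraType (gens J e)] Y.
Proof. by move=> IJ mY mD A mA; apply: (sg_subset IJ); exact: mY. Qed.

End generated_by_coordinates.

Section independence.
Context d (T : measurableType d) (R : realType) (P : probability T R).
Implicit Types (e : nat -> T -> R) (I J : set nat).

(** Only the full block of the first n indices is mentioned; subfamilies are reached by taking
    [A i = setT]. *)
Definition indep n e : Prop := forall A : nat -> set R,
  (forall i, measurable (A i)) ->
  P (\bigcap_(i in `I_n) e i @^-1` A i) = (\prod_(i < n) P (e i @^-1` A i))%E.

Lemma gens_measurable I e : (forall i, measurable_fun [set: T] (e i)) ->
  gens I e `<=` measurable.
Proof.
by move=> me B [i _ [A mA ->]]; rewrite -[_ @^-1` _]setTI; exact: me.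
Qed.

Lemma cyls_measurable n I e : (forall i, measurable_fun [set: T] (e i)) ->
  cyls n I e `<=` measurable.
Proof.
move=> me B [A mA ->]; apply: bigcap_measurableType => i _.
by rewrite -[_ @^-1` _]setTI; exact: me.
Qed.

Lemma sg_measurable I e (A : set T) : (forall i, measurable_fun [set: T] (e i)) ->
  measurable (A : set (g_sigma_algebraType (gens I e))) -> measurable A.
Proof.
move=> me; apply: smallest_sub; first exact: sigma_algebra_measurable.
exact: gens_measurable.
Qed.

Lemma sg_mf I e d' (S : measurableType d') (Y : T -> S) :
  (forall i, measurable_fun [set: T] (e i)) ->
  measurable_fun [set: g_sigma_algebraType (gens I e)] Y ->
  measurable_fun [set: T] Y.
Proof. by move=> me mY mD A mA; apply: (sg_measurable me); exact: mY. Qed.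

(** Padding with [setT] outside the index sets turns both cylinders into rectangles over the first n
    coordinates; by disjointness at most one of the two factors is nontrivial at each index. *)
Lemma indep_cyls n I J e A B : indep n e -> I `&` J = set0 ->
  cyls n I e A -> cyls n J e B -> P (A `&` B) = (P A * P B)%E.
Proof.
move=> ie IJ [A' mA' ->] [B' mB' ->].
pose r (K : set nat) (C : nat -> set R) i := if i \in K then C i else setT.
have E K C : \bigcap_(i in `I_n `&` K) e i @^-1` C i =
    \bigcap_(i in `I_n) e i @^-1` r K C i.
  apply/seteqP; split => w /= h i.
    move=> ni; rewrite /r; case: ifPn => // /set_mem iK; exact: h.
  by move=> [ni Ki]; have := h i ni; rewrite /r mem_set.
have mr K C : (forall i, measurable (C i)) -> forall i, measurable (r K C i).
  by move=> mC i; rewrite /r; case: ifP.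
rewrite !E -bigcapI.
have -> : \bigcap_(i in `I_n) (e i @^-1` r I A' i `&` e i @^-1` r J B' i) =
    \bigcap_(i in `I_n) e i @^-1` (r I A' i `&` r J B' i) by [].
rewrite !ie; [|by move=> i; exact: mr|by move=> i; exact: mr|]; last first.
  by move=> i; apply: measurableI; exact: mr.
rewrite -big_split/=; apply: eq_bigr => i _.
have [iI|iI] := boolP (val i \in I).
  have iJ : (val i \in J) = false.
    apply/negbTE/negP => iJ.
    have : (I `&` J) (val i) by split; exact: set_mem.
    by rewrite IJ.
  by rewrite {2 4}/r iJ setIT preimage_setT probability_setT mule1.
by rewrite {1 3}/r (negbTE iI) setTI preimage_setT probability_setT mul1e.
Qed.

(** The pi-lambda argument is used twice. For a fixed event B, the probability of A and B and the
    product P A P B are finite measures in A that agree on cylinders; the first pass frees the left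
    event, the second the right one. *)
Lemma indep_sg n I J e : (forall i, measurable_fun [set: T] (e i)) ->
  indep n e -> I `<=` `I_n -> J `<=` `I_n -> I `&` J = set0 ->
  forall A B, <<s gens I e>> A -> <<s gens J e>> B ->
  P (A `&` B) = (P A * P B)%E.
Proof.
move=> me ie In Jn IJ.

(* [K] is the side being extended from cylinders to its sigma-algebra, [H] the class of events
   allowed on the other side. *)
have key (K : set nat) (H : set (set T)) : K `<=` `I_n ->
    (forall B, H B -> measurable B) ->
    (forall A B, cyls n K e A -> H B -> P (A `&` B) = (P A * P B)%E) ->
    forall A B, <<s gens K e>> A -> H B -> P (A `&` B) = (P A * P B)%E.
  move=> Kn mH h A B sA HB.
  have mB := mH _ HB.
  pose m1 : {measure set T -> \bar R} := mrestr P mB.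
  pose m2 : {measure set T -> \bar R} := mscale (NngNum (fine_ge0 (measure_ge0 P B))) P.
  suff : m1 A = m2 A.
    rewrite /m1 /m2 /= /mrestr /mscale /= => ->.
    by rewrite fineK ?fin_num_measure// muleC.
  apply: (@g_sigma_algebra_measure_unique _ R T (cyls n K e)
    (cyls_measurable me) (fun=> setT) (fun=> cylsT n K e) _ m1 m2
    (@setI_closed_cyls _ _ n K e)); rewrite /m1 /m2 /= /mrestr /mscale /=.
  - by apply/seteqP; split => // w _; exists 0%N.
  - by move=> X cX; rewrite h// fineK ?fin_num_measure// muleC.
  - by move=> _; rewrite (le_lt_trans (probability_le1 P _)) ?ltry//; exact: measurableI.
  - have G : <<s gens K e>> `<=` <<s cyls n K e>>.
      by apply: sub_smallest2r; [exact: smallest_sigma_algebra|exact: gens_cyls].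
    exact: G.
have s1 := key I (cyls n J e) In (cyls_measurable me)
  (fun A B => @indep_cyls n I J e A B ie IJ).
have := key J (<<s gens I e>>) Jn (fun A => @sg_measurable I e A me).
move=> s2 A B sA sB; rewrite setIC muleC; apply: s2 => // {A B sA sB} B A cB sA.
by rewrite setIC muleC; apply: s1.
Qed.

(** The joint law is the product of the marginal laws, to which Tonelli's theorem applies. The
    targets are arbitrary measurable spaces so that one variable can carry a whole block of
    coordinates, as in [prob_gaps]. *)
Lemma indep_pair n I J e d1 d2 (S1 : measurableType d1) (S2 : measurableType d2)
    (Y : T -> S1) (Z : T -> S2) (F : S1 * S2 -> \bar R) :
  (forall i, measurable_fun [set: T] (e i)) ->
  indep n e -> I `<=` `I_n -> J `<=` `I_n -> I `&` J = set0 ->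
  measurable_fun [set: g_sigma_algebraType (gens I e)] Y ->
  measurable_fun [set: g_sigma_algebraType (gens J e)] Z ->
  measurable_fun setT F -> (forall x, (0 <= F x)%E) ->
  (\int[P]_w F (Y w, Z w) = \int[P]_w \int[P]_w' F (Y w, Z w'))%E.
Proof.
move=> me ie In Jn IJ mY mZ mF F0.
have mY' : measurable_fun [set: T] Y := sg_mf me mY.
have mZ' : measurable_fun [set: T] Z := sg_mf me mZ.
have mYZ : measurable_fun [set: T] (fun w => (Y w, Z w)).
  exact: measurable_fun_pair.
pose Yr : {RV P >-> S1} := HB.pack Y (isMeasurableFun.Build _ _ _ _ Y mY').
pose Zr : {RV P >-> S2} := HB.pack Z (isMeasurableFun.Build _ _ _ _ Z mZ').
pose YZr : {RV P >-> (S1 * S2)%type} :=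
  HB.pack (fun w => (Y w, Z w)) (isMeasurableFun.Build _ _ _ _ _ mYZ).
pose m1 := distribution P Yr; pose m2 := distribution P Zr.
pose m := distribution P YZr.
have E X : measurable X -> (m1 \x m2)%E X = m X.
  move=> mX; apply: (@product_measure_unique _ _ _ _ R m1 m2 m) => // A B mA mB.
  rewrite /m /m1 /m2 /distribution /pushforward /=.
  rewrite -(indep_sg me ie In Jn IJ)//.
  - by rewrite -[_ @^-1` _]setTI; exact: mY.
  - by rewrite -[_ @^-1` _]setTI; exact: mZ.
transitivity (\int[m]_z F z)%E.
  by rewrite ge0_integral_distribution.
rewrite (eq_measure_integral (m1 \x m2)%E); last first.
  by move=> A mA _; (exact: E || exact/esym/E).
rewrite fubini_tonelli1// ge0_integral_distribution//=; last 2 first.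
- exact: measurable_fun_fubini_tonelli_F.
- by move=> x; apply: integral_ge0 => y _.
apply: eq_integral => w _ /=; rewrite /fubini_F ge0_integral_distribution//.
by apply: measurableT_comp mF _; exact: measurable_pair1.
Qed.

Lemma indep_ExM_ge0 n I J e (Y Z : T -> R) :
  (forall i, measurable_fun [set: T] (e i)) ->
  indep n e -> I `<=` `I_n -> J `<=` `I_n -> I `&` J = set0 ->
  measurable_fun [set: g_sigma_algebraType (gens I e)] Y ->
  measurable_fun [set: g_sigma_algebraType (gens J e)] Z ->
  (forall w, 0 <= Y w) -> (forall w, 0 <= Z w) ->
  L1 P Y -> L1 P Z ->
  Ex P (fun w => Y w * Z w) = Ex P Y * Ex P Z.
Proof.
move=> me ie In Jn IJ mY mZ Y0 Z0 hY hZ; rewrite {1}/Ex.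
have mF : measurable_fun [set: R * R] (fun x : R * R => (`|x.1 * x.2|%:E)).
  apply/measurable_EFinP; apply: measurableT_comp => //.
  by apply: measurable_funM; [exact: measurable_fst|exact: measurable_snd].
have := indep_pair me ie In Jn IJ mY mZ mF (fun=> normr_ge0 _ : (0 <= _%:E)%E).
rewrite (eq_integral (fun w => (Y w * Z w)%:E)); last first.
  by move=> w _ /=; rewrite ger0_norm// mulr_ge0.
move=> ->.
rewrite (eq_integral (fun w => (Ex P Z)%:E * (Y w)%:E)%E); last first.
  move=> w _ /=; rewrite (eq_integral (fun w' => (Y w)%:E * (Z w')%:E)%E).
    rewrite ge0_integralZl ?ExE// ?lee_fin//; first by rewrite muleC.
      exact/measurable_EFinP/(L1_mf hZ).
    by move=> x _; rewrite lee_fin.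
  by move=> w' _; rewrite ger0_norm ?mulr_ge0.
rewrite ge0_integralZl//.
- by rewrite ExE//= mulrC.
- exact/measurable_EFinP/(L1_mf hY).
- by move=> w _; rewrite lee_fin.
- by rewrite lee_fin; exact: Ex_ge0.
Qed.

(** Reduction to the nonnegative case by positive and negative parts. Integrability of the product
    replaces square integrability, as cubes of exponential sums require. *)
Lemma indep_ExM_L1 n I J e (Y Z : T -> R) :
  (forall i, measurable_fun [set: T] (e i)) ->
  indep n e -> I `<=` `I_n -> J `<=` `I_n -> I `&` J = set0 ->
  measurable_fun [set: g_sigma_algebraType (gens I e)] Y ->
  measurable_fun [set: g_sigma_algebraType (gens J e)] Z ->
  L1 P Y -> L1 P Z -> L1 P (fun w => Y w * Z w) ->
  Ex P (fun w => Y w * Z w) = Ex P Y * Ex P Z.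
Proof.
move=> me ie In Jn IJ mY mZ hY hZ hYZ.
pose p (x : R) := Num.max x 0; pose q (x : R) := Num.max (- x) 0.
have pq x : x = p x - q x.
  by rewrite /p /q /Num.max; case: ifPn; case: ifPn; lra.
have p0 x : 0 <= p x by rewrite /p le_max lexx orbT.
have q0 x : 0 <= q x by rewrite /q le_max lexx orbT.
have px x : `|p x| <= `|x|.
  rewrite ger0_norm// /p /Num.max; case: ifPn => //; rewrite ?normr_ge0//.
  by rewrite ler_norm.
have qx x : `|q x| <= `|x|.
  rewrite ger0_norm// /q /Num.max; case: ifPn => //; rewrite ?normr_ge0//.
  by rewrite -normrN ler_norm.
have mp : measurable_fun [set: R] p by exact: measurable_maxr.
have mq : measurable_fun [set: R] q.
  by apply: measurable_maxr => //; exact: measurableT_comp.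
have L1x X U : (X = p \/ X = q) -> L1 P U -> L1 P (fun w => X (U w)).
  move=> hX hU; have mU := L1_mf hU.
  apply: (L1_le _ _ (L1_norm hU)); first by case: hX => ->; exact: measurableT_comp.
  by move=> w; case: hX => ->.
have L1xx X X' : (X = p \/ X = q) -> (X' = p \/ X' = q) -> L1 P (fun w => X (Y w) * X' (Z w)).
  move=> hX hX'; apply: (L1_le _ _ (L1_norm hYZ)).
    by apply: measurable_funM; apply: L1_mf; exact: L1x.
  by move=> w; rewrite !normrM ler_pM//; [case: hX => ->|case: hX' => ->].
have M X X' : (X = p \/ X = q) -> (X' = p \/ X' = q) ->
    Ex P (fun w => X (Y w) * X' (Z w)) = Ex P (fun w => X (Y w)) * Ex P (fun w => X' (Z w)).
  move=> hX hX'; apply: (indep_ExM_ge0 me ie In Jn IJ); try exact: L1x.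
  - by case: hX => ->; apply: measurableT_comp.
  - by case: hX' => ->; apply: measurableT_comp.
  - by case: hX => ->.
  - by case: hX' => ->.
have pp : p = p \/ p = q by left. have qq : q = p \/ q = q by right.
have eY : Ex P Y = Ex P (fun w => p (Y w)) - Ex P (fun w => q (Y w)).
  have e1 := ExB (L1x _ _ pp hY) (L1x _ _ qq hY).
  by rewrite -e1; apply: eq_Ex => w; exact: pq.
have eZ : Ex P Z = Ex P (fun w => p (Z w)) - Ex P (fun w => q (Z w)).
  have e1 := ExB (L1x _ _ pp hZ) (L1x _ _ qq hZ).
  by rewrite -e1; apply: eq_Ex => w; exact: pq.
have h1 := L1xx _ _ pp pp; have h2 := L1xx _ _ pp qq.
have h3 := L1xx _ _ qq pp; have h4 := L1xx _ _ qq qq.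
have e1 := ExB h1 h2; have e2 := ExB h3 h4.
have e3 := ExB (L1B h1 h2) (L1B h3 h4).
rewrite eY eZ; move: e3; rewrite e1 e2 !M//.
move=> e3; transitivity (Ex P (fun w => p (Y w) * p (Z w) - p (Y w) * q (Z w) -
     (q (Y w) * p (Z w) - q (Y w) * q (Z w)))).
  by apply: eq_Ex => w; rewrite {1}(pq (Y w)) {1}(pq (Z w)); ring.
by rewrite e3; ring.
Qed.

Lemma indep_ExM n I J e (Y Z : T -> R) :
  (forall i, measurable_fun [set: T] (e i)) ->
  indep n e -> I `<=` `I_n -> J `<=` `I_n -> I `&` J = set0 ->
  measurable_fun [set: g_sigma_algebraType (gens I e)] Y ->
  measurable_fun [set: g_sigma_algebraType (gens J e)] Z ->
  L2 P Y -> L2 P Z ->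
  Ex P (fun w => Y w * Z w) = Ex P Y * Ex P Z.
Proof.
move=> me ie In Jn IJ mY mZ hY hZ.
by apply: (indep_ExM_L1 me ie In Jn IJ) => //; [exact: L2_L1|exact: L2_L1|exact: L2M].
Qed.

(** Coordinates are freed one at a time: in the induction the first m sets are arbitrary and the
    others still rays, and a finite measure in the next set is determined by its values on rays. *)
Lemma indep_rays n e : (forall i, measurable_fun [set: T] (e i)) ->
  (forall c : nat -> R, P (\bigcap_(i in `I_n) e i @^-1` `]c i, +oo[) =
    (\prod_(i < n) P (e i @^-1` `]c i, +oo[))%E) ->
  indep n e.
Proof.
move=> me h.
suff H m : forall (A : nat -> set R) (c : nat -> R), (forall i, measurable (A i)) ->
    P (\bigcap_(i in `I_n) e i @^-1` (if (i < m)%N then A i else `]c i, +oo[%classic)) =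
    (\prod_(i < n) P (e i @^-1` (if (i < m)%N then A i else `]c i, +oo[%classic)))%E.
  move=> A mA; have := H n A (fun=> 0) mA.
  under eq_bigcapr do rewrite /=.
  have -> : \bigcap_(i in `I_n) e i @^-1` (if (i < n)%N then A i else `]0, +oo[%classic) =
      \bigcap_(i in `I_n) e i @^-1` A i.
    by apply: eq_bigcapr => i /= ->.
  by move=> ->; apply: eq_bigr => i _; rewrite ltn_ord.
elim: m => [A c mA|m ih A c mA]; first by rewrite -h; congr (P _); apply: eq_bigcapr.
have [norm2|mn] := leqP n m.
  have E i : (i < n)%N -> (i < m.+1)%N = (i < m)%N.
    by move=> ni; rewrite (leq_trans ni norm2) (leq_trans ni)// ltnW.
  rewrite (eq_bigcapr (G := fun i => e i @^-1` (if (i < m)%N then A i else `]c i, +oo[%classic))); last first.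
    by move=> i /= ni; rewrite E.
  by rewrite ih//; apply: eq_bigr => i _; rewrite E.
pose B i := if (i < m)%N then A i else `]c i, +oo[%classic.
have mB i : measurable (B i) by rewrite /B; case: ifP.
pose D := \bigcap_(i in `I_n `\ m) e i @^-1` B i.
have mD : measurable D.
  apply: bigcap_measurableType => i _; rewrite -[_ @^-1` _]setTI; exact: me.
pose k := (\prod_(i < n | i != Ordinal mn) P (e i @^-1` B i))%E.
have k0 : (0 <= k)%E by apply: prode_ge0.
have kfin : k \is a fin_num.
  rewrite /k; elim/big_ind : _ => // [x y|i _]; first exact: fin_numM.
  rewrite fin_num_measure// -[_ @^-1` _]setTI; exact: me.
have S X (C := fun i => if (i == m)%N then X else B i) :
   \bigcap_(i in `I_n) e i @^-1` C i = e m @^-1` X `&` D.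
  apply/seteqP; split => w /=.
    move=> hw; split; first by have := hw m mn; rewrite /C eqxx.
    by move=> i [/= ni im]; have := hw i ni; rewrite /C; case: eqP => // E; exfalso; exact: im.
  move=> [Xw hw] i ni; rewrite /C; case: eqP => [->//|im].
  by apply: hw.
have S' X (C := fun i => if (i == m)%N then X else B i) :
   (\prod_(i < n) P (e i @^-1` C i))%E = (k * P (e m @^-1` X))%E.
  rewrite (bigD1 (Ordinal mn))//= /C eqxx muleC; congr (_ * _)%E.
  apply: eq_bigr => i im; case: eqP => // E.
  by move: im; rewrite -val_eqE/= E eqxx.
pose er : {RV P >-> R} := HB.pack (e m) (isMeasurableFun.Build _ _ _ _ _ (me m)).
pose m0 : {measure set R -> \bar R} := pushforward (mrestr P mD) er.
pose m1 := m0 (me m).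
pose m2 : {measure set R -> \bar R} := mscale (NngNum (fine_ge0 k0)) (distribution P er).
have E X : measurable X -> m1 X = m2 X.
  apply: (@measure_unique _ R _ [set X | exists c : R, X = `]c, +oo[%classic]
    (fun n => `](- n%:R), +oo[%classic)) => //=.
  - exact: RGenOInfty.measurableE.
  - move=> _ _ [x ->] [y ->]; exists (Num.max x y).
    by apply/seteqP; split => z /=; rewrite !in_itv/= !andbT gt_max => /andP.
  - by move=> i; exists (- i%:R).
  - apply/seteqP; split => // x _; exists (Num.bound `|x|) => //=.
    rewrite in_itv/= andbT ltrNl (le_lt_trans (ler_norm _))// normrN.
    exact: archi_boundP.
  - move=> _ [x ->]; rewrite /m1 /m0 /m2 /= /pushforward /mrestr /mscale /=.
    have := ih A (fun i => if i == m then x else c i) mA.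
    have -> : \bigcap_(i in `I_n) e i @^-1` (if (i < m)%N then A i
        else `](if i == m then x else c i), +oo[%classic) = e m @^-1` `]x, +oo[ `&` D.
      rewrite -S; apply: eq_bigcapr => i _; rewrite /B; case: eqP => // ->.
      by rewrite ltnn.
    move=> ->; rewrite fineK// -S'; apply: eq_bigr => i _; congr (P (_ @^-1` _)).
    by rewrite /B; case: eqP => // ->; rewrite ltnn.
  - move=> i; rewrite /m1 /m0 /= /pushforward /mrestr.
    rewrite (le_lt_trans (probability_le1 P _)) ?ltry//.
    by apply: measurableI => //; rewrite -[_ @^-1` _]setTI; exact: (me m).
have := E (A m) (mA m); rewrite /m1 /m0 /m2 /= /pushforward /mrestr /mscale /= fineK//.
rewrite -S -S' => E'; rewrite (eq_bigcapr (G := fun i => e i @^-1` (if i == m then A m else B i))).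
  rewrite E'; apply: eq_bigr => i _; congr (P (_ @^-1` _)).
  rewrite /B; case: (eqVneq (i : nat) m) => [im|im]; first by rewrite im ltnSn.
  by rewrite [in RHS]ltnS [in RHS]leq_eqVlt (negbTE im).
move=> i _; rewrite /B; case: (eqVneq i m) => [->|im]; first by rewrite ltnSn.
by rewrite [in LHS]ltnS [in LHS]leq_eqVlt (negbTE im).
Qed.

(** Independence and equal marginals determine the law of the first n coordinates. [F] lives on
    sequences with the sigma-algebra of these coordinates, so it may be any measurable statistic of
    them. *)
Lemma indep_law n (Y Y' : nat -> T -> R)
    (F : g_sigma_algebraType (gens `I_n (fun i (x : nat -> R) => x i)) -> \bar R) :
  (forall i, measurable_fun [set: T] (Y i)) ->
  (forall i, measurable_fun [set: T] (Y' i)) ->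
  indep n Y -> indep n Y' ->
  (forall i A, measurable A -> P (Y i @^-1` A) = P (Y' i @^-1` A)) ->
  measurable_fun setT F ->
  (\int[P]_w F (fun i => Y i w) = \int[P]_w F (fun i => Y' i w))%E.
Proof.
move=> mY mY' iY iY' YY' mF.
pose V := g_sigma_algebraType (gens `I_n (fun i (x : nat -> R) => x i)).
have mv (Z : nat -> T -> R) : (forall i, measurable_fun [set: T] (Z i)) ->
    measurable_fun [set: T] ((fun w i => Z i w) : T -> V).
  move=> mZ; apply: (@measurability _ _ T (g_sigma_algebraType (gens `I_n (fun i (x : nat -> R) => x i))) setT _ (gens `I_n (fun i (x : nat -> R) => x i))) => //.
  move=> _ [_ [i ni [A mA ->]] <-]; rewrite -[X in measurable X]/(setT `&` (Z i @^-1` A)).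
  exact: mZ.
pose r (Z : nat -> T -> R) (mZ : forall i, measurable_fun [set: T] (Z i)) :
  {RV P >-> V} := HB.pack ((fun w i => Z i w) : T -> V)
    (isMeasurableFun.Build _ _ _ _ _ (mv Z mZ)).
pose m1 := distribution P (r Y mY); pose m2 := distribution P (r Y' mY').
have cm : cyls n `I_n (fun i (x : nat -> R) => x i) `<=` @measurable _ V.
  move=> B [A mA ->]; apply: bigcap_measurableType => i [ni _].
  by rewrite -[_ @^-1` _]setTI; apply: sg_coord.
have E X : measurable X -> m1 X = m2 X.
  move=> mX; apply: (@g_sigma_algebra_measure_unique _ R V
    (cyls n `I_n (fun i (x : nat -> R) => x i)) cm (fun=> setT)
    (fun=> cylsT n `I_n _)) => //.
  - by apply/seteqP; split => // w _; exists 0%N.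
  - exact: setI_closed_cyls.
  - move=> _ [A mA ->]; rewrite /m1 /m2 /distribution /pushforward/= setIid.
    transitivity (P (\bigcap_(i in `I_n) Y i @^-1` A i)); first by [].
    rewrite iY//; transitivity (P (\bigcap_(i in `I_n) Y' i @^-1` A i)); last by [].
    by rewrite iY'//; apply: eq_bigr => i _; exact: YY'.
  - by move=> _; rewrite (le_lt_trans (probability_le1 _ _)) ?ltry.
  - have H : <<s gens `I_n (fun i (x : nat -> R) => x i)>> `<=`
        <<s cyls n `I_n (fun i (x : nat -> R) => x i)>>.
      by apply: sub_smallest2r; [exact: smallest_sigma_algebra|exact: gens_cyls].
    exact: H.
have G (H : V -> \bar R) : measurable_fun setT H -> (forall x, 0 <= H x)%E ->
    (\int[P]_w H (fun i => Y i w) = \int[P]_w H (fun i => Y' i w))%E.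
  move=> mH H0; transitivity (\int[m1]_z H z)%E.
    by rewrite ge0_integral_distribution.
  rewrite (eq_measure_integral m2); last by move=> A mA _; exact: E.
  by rewrite ge0_integral_distribution.
rewrite integralE [in RHS]integralE; congr (_ - _)%E.
  by have := G _ (measurable_funepos mF) (funepos_ge0 F); rewrite !funepos.unlock.
by have := G _ (measurable_funeneg mF) (funeneg_ge0 F); rewrite !funeneg.unlock.
Qed.

End independence.

(** * Exponential variables *)

Section density.
Context d (S : measurableType d) (R : realType).
Local Open Scope ereal_scope.
Import HBNNSimple.

(** Both sides are monotone limits over simple functions, on which the identity is the definition of
    a density. *)
Lemma ge0_integral_density (m mu : {measure set S -> \bar R}) (p : S -> R)
    (f : S -> \bar R) :
  measurable_fun setT p -> (forall x, (0 <= p x)%R) ->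
  (forall A, measurable A -> m A = \int[mu]_(x in A) (p x)%:E) ->
  measurable_fun setT f -> (forall x, 0 <= f x) ->
  \int[m]_x f x = \int[mu]_x (f x * (p x)%:E).
Proof.
move=> mp p0 mE mf f0.
have mpE : measurable_fun setT (EFin \o p) by exact/measurable_EFinP.
pose h := nnsfun_approx measurableT mf.
have -> : \int[m]_x f x = lim (\int[m]_x (h n x)%:E @[n --> \oo]).
  have fE x : f x = lim ((h n x)%:E @[n --> \oo]).
    by apply/esym/cvg_lim => //; exact: cvg_nnsfun_approx.
  under eq_integral do rewrite fE.
  apply: monotone_convergence => //.
  - by move=> n; apply/measurable_EFinP.
  - by move=> n x _ //=; rewrite lee_fin.
  - by move=> x _ a b ab; rewrite lee_fin; exact/lefP/nd_nnsfun_approx.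
have -> : \int[mu]_x (f x * (p x)%:E) =
    lim (\int[mu]_x ((h n x)%:E * (p x)%:E) @[n --> \oo]).
  have fg x : f x * (p x)%:E = lim ((h n x)%:E * (p x)%:E @[n --> \oo]).
    apply/esym/cvg_lim => //; apply: cvgeZr => //.
    exact: cvg_nnsfun_approx.
  under eq_integral do rewrite fg.
  apply: monotone_convergence => //.
  - by move=> n; apply: emeasurable_funM => //; exact/measurable_EFinP.
  - by move=> n x _; rewrite mule_ge0 ?lee_fin.
  - move=> x _ a b ab/=; rewrite lee_wpmul2r ?lee_fin//.
    exact/lefP/nd_nnsfun_approx.
suff suf n : \int[mu]_x ((h n x)%:E * (p x)%:E) = \int[m]_x (h n x)%:E.
  by congr (limn _); apply/funext => n; rewrite suf.
transitivity (\int[m]_x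
   (\sum_(y \in range (h n)) (y * \1_(h n @^-1` [set y]) x)%:E)); last first.
  by apply: eq_integral => t tE; rewrite /= fimfunE -fsumEFin.
have indich r : measurable_fun setT (fun x => (r * \1_(h n @^-1` [set r]) x)%:E).
  by apply/measurable_EFinP; exact: measurable_funM.
rewrite ge0_integral_fsum//; last by move=> y x _; exact: nnfun_muleindic_ge0.
transitivity (\int[mu]_x (\sum_(y \in range (h n))
    (y * \1_(h n @^-1` [set y]) x)%:E * (p x)%:E)).
  under [RHS]eq_integral => x xE.
    rewrite -ge0_mule_fsuml => [|y]; last exact: nnfun_muleindic_ge0.
    rewrite fsumEFin // -(fimfunE _ x); over.
  by [].
rewrite ge0_integral_fsum//; last 2 first.
  - by move=> y; apply: emeasurable_funM.
  - by move=> y x _; rewrite mule_ge0 ?lee_fin ?p0// -lee_fin nnfun_muleindic_ge0.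
apply: eq_fsbigr => r rhn.
under [RHS]eq_integral do rewrite EFinM.
rewrite integralZl_indic_nnsfun => //.
under eq_integral do rewrite EFinM -muleA.
have r0 : 0 <= r%:E by move/set_mem: rhn => [x _ <-]; rewrite lee_fin.
rewrite ge0_integralZl//.
- under eq_integral do rewrite muleC.
  rewrite (eq_integral ((EFin \o p) \_ (h n @^-1` [set r]))); last first.
    by move=> x xE; rewrite epatch_indic.
  by rewrite -integral_mkcond integral_indic// setIT mE.
- by apply: emeasurable_funM => //; exact/measurable_EFinP.
- by move=> x _; rewrite mule_ge0 ?lee_fin.
Qed.

End density.

Section exponential_integrals.
Context (R : realType).
Local Notation mu := (@lebesgue_measure R).
Implicit Types (a t : R).

Let cexp a : continuous (fun x : R => expR (- (a * x))).
Proof.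
move=> x; apply: continuous_comp; last exact: continuous_expR.
by apply: (@continuousN _ R^o); apply: continuousM => //; exact: cst_continuous.
Qed.

Lemma cvg_expRNM a : 0 < a -> expR (- (a * x)) @[x --> +oo] --> (0 : R).
Proof.
move=> a0; apply: (@cvg_comp _ _ _ (fun x => a * x) (fun z => expR (- z)) _ (pinfty_nbhs R)).
  exact: gt0_cvgMry.
exact: cvgr_expR.
Qed.

Lemma expR_ge_id (x : R) : x <= expR x.
Proof. by rewrite (le_trans _ (expR_ge1Dx x))// lerDr. Qed.

(** With b = a / 4, x <= (1 + 1/b) exp (b x), and squaring this costs only half of the decay exp (-
    a x). The factor is 1 + 1/b rather than 1/b to make the right side at least 1, so that lower
    powers are dominated by the square. *)
Lemma cvg_xexpRNM a n : 0 < a -> (n <= 2)%N ->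
  x ^+ n * expR (- (a * x)) @[x --> +oo] --> (0 : R).
Proof.
move=> a0 n2; pose b := a / 4.
have b0 : 0 < b by rewrite divr_gt0.
pose C := (1 + b^-1) ^+ 2.
have C1 : 1 <= (1 + b^-1) by rewrite lerDl invr_ge0 ltW.
apply: (@squeeze_cvgr _ _ _ _ (fun=> 0) (fun x => C * expR (- ((a / 2) * x)))).
- near=> x; have x0 : 0 <= x by near: x; exact: nbhs_pinfty_ge.
  rewrite mulr_ge0 ?exprn_ge0 ?expR_ge0//=.
  have xb : x <= (1 + b^-1) * expR (b * x).
    have := expR_ge_id (b * x); have := expR_gt0 (b * x) => e0 h.
    have {1}-> : x = b^-1 * (b * x) by rewrite mulKf// gt_eqF.
    have bi : 0 <= b^-1 by rewrite invr_ge0 ltW.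
    rewrite (le_trans (ler_wpM2l bi h))// ler_wpM2r ?expR_ge0//.
    by rewrite lerDr.
  have e1 : 1 <= (1 + b^-1) * expR (b * x).
    rewrite mulr_ege1// -expR0 ler_expR mulr_ge0// ltW//.
  have xn : x ^+ n <= ((1 + b^-1) * expR (b * x)) ^+ 2.
    apply: (@le_trans _ _ (((1 + b^-1) * expR (b * x)) ^+ n)).
      by apply: lerXn2r => //; rewrite nnegrE (le_trans x0).
    by rewrite ler_weXn2l.
  rewrite (le_trans (ler_wpM2r (expR_ge0 _) xn))// exprMn -/C -[leLHS]mulrA.
  apply: ler_wpM2l; first by rewrite sqr_ge0.
  by rewrite -expRM_natl -expRD ler_expR /b; lra.
- exact: cvg_cst.
- rewrite -[X in _ --> X](mulr0 C); apply: cvgMr.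
  by apply: cvg_expRNM; rewrite divr_gt0.
Unshelve. all: by end_near. Qed.

Lemma integral_expR_tail a t : 0 < a ->
  (\int[mu]_(x in `[t, +oo[) (expR (- (a * x)))%:E = (expR (- (a * t)) / a)%:E)%E.
Proof.
move=> a0.
pose F (x : R) := - (a^-1 * expR (- (a * x))).
have dF (x : R) : is_derive x 1 F (expR (- (a * x))).
  rewrite /F; apply: is_derive_eq.
  by rewrite /GRing.scale/=; field; rewrite gt_eqF.
rewrite (@ge0_continuous_FTC2y _ _ F _ 0)//.
- by rewrite /F EFinN oppeK add0e mulrC.
- by apply: continuous_subspaceT; exact: cexp.
- rewrite /F -oppr0 -(mulr0 a^-1); apply: cvgN; apply: cvgMr.
  exact: cvg_expRNM.
- apply: cvg_at_right_filter; apply: differentiable_continuous.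
  exact/derivable1_diffP.
- by move=> x _; rewrite derive1E; apply: derive_val.
Qed.

Lemma integral_xexpR a : 0 < a ->
  (\int[mu]_(x in `[0%R, +oo[) (x * expR (- (a * x)))%:E = (a ^- 2)%:E)%E.
Proof.
move=> a0; have an : a != 0 by rewrite gt_eqF.
pose F (x : R) := - (a^-1 * (x * expR (- (a * x)))) - a ^- 2 * expR (- (a * x)).
have dF (x : R) : is_derive x 1 F (x * expR (- (a * x))).
  rewrite /F; apply: is_derive_eq.
  rewrite /GRing.scale/=; field; done.
rewrite (@ge0_continuous_FTC2y _ _ F _ 0)//.
- by rewrite /F mul0r mulr0 oppr0 sub0r mulr0 oppr0 expR0 mulr1 EFinN oppeK add0e.
- by move=> x x0; rewrite mulr_ge0 ?expR_ge0.
- by apply: continuous_subspaceT => x; apply: cvgM; [exact: cvg_id|exact: cexp].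
- have -> : 0 = - (a^-1 * 0) - a ^- 2 * 0 :> R by ring.
  apply: cvgB; last by apply: cvgMr; exact: cvg_expRNM.
  by apply: cvgN; apply: cvgMr; exact: (@cvg_xexpRNM a 1 a0 isT).
- apply: cvg_at_right_filter; apply: differentiable_continuous.
  exact/derivable1_diffP.
- by move=> x _; rewrite derive1E; apply: derive_val.
Qed.

Lemma integral_x2expR :
  (\int[mu]_(x in `[0%R, +oo[) (x ^+ 2 * expR (- (1 * x)))%:E = 2%:E)%E.
Proof.
pose F (x : R) := - ((x ^+ 2 + 2 * x + 2) * expR (- (1 * x))).
have dF (x : R) : is_derive x 1 F (x ^+ 2 * expR (- (1 * x))).
  rewrite /F; apply: is_derive_eq.
  rewrite /GRing.scale/=; ring.
rewrite (@ge0_continuous_FTC2y _ _ F _ 0)//.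
- rewrite -EFinB; congr EFin; rewrite /F (_ : - (1 * 0) = 0); last by ring.
  by rewrite expR0; ring.
- by move=> x x0; rewrite mulr_ge0 ?expR_ge0 ?sqr_ge0.
- apply: continuous_subspaceT => x; apply: cvgM; last exact: cexp.
  exact: exprn_continuous.
- have -> : F = fun x => - ((x ^+ 2 * expR (- (1 * x)) + 2 * (x ^+ 1 * expR (- (1 * x))))
      + 2 * (x ^+ 0 * expR (- (1 * x)))).
    by apply/funext => x; rewrite /F; ring.
  rewrite -oppr0; apply: cvgN; rewrite -[X in _ --> X](addr0 0) -{1}(addr0 0).
  apply: cvgD; last first.
    by rewrite -(mulr0 2); apply: cvgMr; exact: cvg_xexpRNM.
  apply: cvgD; first exact: cvg_xexpRNM.
  by rewrite -(mulr0 2); apply: cvgMr; exact: cvg_xexpRNM.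
- apply: cvg_at_right_filter; apply: differentiable_continuous.
  exact/derivable1_diffP.
- by move=> x _; rewrite derive1E; apply: derive_val.
Qed.

End exponential_integrals.

Section exponential_variables.
Context d (T : measurableType d) (R : realType) (P : probability T R).
Implicit Types e : T -> R.
Local Notation mu := (@lebesgue_measure R).

(** Nonnegativity is asked at every point, so that pointwise bounds have no exceptional set. *)
Definition expo e : Prop := [/\ measurable_fun [set: T] e, forall w, 0 <= e w &
  forall t, 0 <= t -> P [set w | t < e w] = (expR (- t))%:E].

Lemma expo_integral e (F : R -> \bar R) : expo e ->
  measurable_fun [set: R] F -> (forall x, 0 <= F x)%E ->
  (\int[P]_w F (e w) = \int[mu]_(x in `[0%R, +oo[) (F x * (expR (- x))%:E))%E.
Proof.
move=> [me e0 he] mF F0.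
pose er : {RV P >-> measurableTypeR R} :=
  HB.pack (e : T -> measurableTypeR R) (isMeasurableFun.Build _ _ T (measurableTypeR R) _ me).
transitivity (\int[distribution P er]_x F x)%E.
  by rewrite ge0_integral_distribution.
pose m0 : {measure set (measurableTypeR R) -> \bar R} := exponential_prob (1 : R).
pose m2 := m0 ltr01.
have m2T : m2 setT = 1%E by rewrite /m2 /m0 /= /exponential_prob integral_exponential_pdf.
have tail c : 0 <= c -> m2 `]c, +oo[%classic = (expR (- c))%:E.
  move=> c0; rewrite /m2 /m0 /= /exponential_prob integral_itv_obnd_cbnd; last first.
    by apply/measurable_funTS/measurable_EFinP; exact: measurable_exponential_pdf.
  have := integral_expR_tail c (@ltr01 R); rewrite divr1 mul1r => <-.
  apply: eq_integral => x /[!inE]/=; rewrite in_itv/= andbT => cx.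
  by rewrite exponential_pdfE ?(le_trans c0)// !mul1r mulN1r.
have E X : measurable X -> distribution P er X = m2 X.
  pose m1 : {measure set (measurableTypeR R) -> \bar R} := distribution P er.
  rewrite -[distribution P er]/(m1 : set R -> \bar R).
  apply: (@measure_unique _ R (measurableTypeR R)
    [set X | exists c : R, X = `]c, +oo[%classic]
    (fun n => `](- n%:R), +oo[%classic) _ _ _ _ m1 m2) => //=.
  - exact: RGenOInfty.measurableE.
  - move=> _ _ [x ->] [y ->]; exists (Num.max x y).
    by apply/seteqP; split => z /=; rewrite !in_itv/= !andbT gt_max => /andP.
  - by move=> i; exists (- i%:R).
  - apply/seteqP; split => // x _; exists (Num.bound `|x|) => //=.
    rewrite in_itv/= andbT ltrNl (le_lt_trans (ler_norm _))// normrN.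
    exact: archi_boundP.
  - move=> _ [c ->]; rewrite -/m2 /distribution /pushforward/=.
    have -> : e @^-1` `]c, +oo[%classic = [set w | c < e w].
      by apply/seteqP; split => w /=; rewrite in_itv/= andbT.
    have [c0|c0] := leP 0 c; first by rewrite he// tail.
    have -> : [set w | c < e w] = setT.
      by apply/seteqP; split => // w _ /=; rewrite (lt_le_trans c0).
    rewrite probability_setT; apply/esym/eqP; rewrite eq_le; apply/andP; split.
      by rewrite -m2T le_measure ?inE.
    rewrite (_ : 1%E = (expR (- 0))%:E); last by rewrite oppr0 expR0.
    rewrite -tail// le_measure ?inE// => x/=; rewrite !in_itv/= !andbT.
    exact: lt_trans.
  - by move=> i; rewrite (le_lt_trans (probability_le1 _ _)) ?ltry.
rewrite (@ge0_integral_density _ _ R (distribution P er) mu (exponential_pdf 1))//.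
- rewrite [RHS]integral_mkcond; apply: eq_integral => x _.
  rewrite patchE /exponential_pdf patchE; case: ifPn => // _; last by rewrite mule0.
  by rewrite mul1r mulN1r.
- exact: measurable_exponential_pdf.
- by move=> x; exact: exponential_pdf_ge0.
Qed.

Lemma expo_ae_gt0 e : expo e -> {ae P, forall w, 0 < e w}.
Proof.
move=> [me e0 he]; have m0 : measurable [set w | 0 < e w].
  by rewrite -[X in measurable X]setTI; apply: measurable_fun_ltr.
exists (~` [set w | 0 < e w]); split => //; first exact: measurableC.
by rewrite probability_setC//= he// oppr0 expR0 subee.
Qed.

Lemma expo_L1_ge0 e (F : R -> R) c : expo e ->
  measurable_fun [set: R] F -> (forall x, 0 <= x -> 0 <= F x) ->
  (\int[mu]_(x in `[0%R, +oo[) (F x * expR (- x))%:E = c%:E)%E ->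
  L1 P (fun w => F (e w)) /\ Ex P (fun w => F (e w)) = c.
Proof.
move=> he mF F0 h; have [me e0 _] := he.
have mFe : measurable_fun [set: T] (fun w => F (e w)) by exact: measurableT_comp.
have E : (\int[P]_w (F (e w))%:E = c%:E)%E.
  rewrite -h; transitivity (\int[P]_w (`|F (e w)|%:E))%E.
    by apply: eq_integral => w _; rewrite ger0_norm// F0.
  rewrite (@expo_integral e (fun x => `|F x|%:E) he)//; last first.
    by apply/measurable_EFinP; exact: measurableT_comp.
  apply: eq_integral => x /[!inE]/=; rewrite in_itv/= andbT => x0.
  by rewrite ger0_norm ?F0.
split; last by rewrite /Ex E.
apply/integrableP; split; first exact/measurable_EFinP.
rewrite (eq_integral (fun w => (F (e w))%:E)) ?E ?ltry// => w _ /=.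
by rewrite ger0_norm// F0.
Qed.

Lemma expo_laplace e t : expo e -> 0 <= t ->
  L1 P (fun w => expR (- (t * e w))) /\ Ex P (fun w => expR (- (t * e w))) = (1 + t)^-1.
Proof.
move=> he t0; apply: (@expo_L1_ge0 e (fun x => expR (- (t * x)))) => //.
  by apply: measurableT_comp => //; apply: measurableT_comp => //; exact: measurable_funM.
have a0 : 0 < 1 + t by rewrite ltr_pwDl.
have := integral_expR_tail 0 a0; rewrite mulr0 oppr0 expR0 mul1r => <-.
by apply: eq_integral => x _; rewrite -expRD; congr (expR _)%:E; ring.
Qed.

(** One integration step of the recursion in [prob_gaps]: the next variable x exceeds c, weighted by
    the probability exp (- t x) that t further variables lie above it. *)
Lemma expo_laplace_tail e t c : expo e -> 0 <= t -> 0 <= c ->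
  (\int[P]_w ((c < e w)%R%:R * expR (- (t * e w)))%:E =
    (expR (- ((1 + t) * c)) / (1 + t))%:E)%E.
Proof.
move=> he t0 c0; rewrite (@expo_integral e (fun x => ((c < x)%R%:R * expR (- (t * x)))%:E))//.
- rewrite -integral_expR_tail ?ltr_wpDr// -integral_itv_obnd_cbnd; last first.
    apply/measurable_funTS/measurable_EFinP; apply: measurableT_comp => //.
    by apply: measurableT_comp => //; exact: measurable_funM.
  rewrite integral_mkcond [RHS]integral_mkcond; apply: eq_integral => x _.
  rewrite !patchE !mem_setE !in_itv/= !andbT.
  have [x0|x0] := leP 0 x.
    case: ifPn => cx; last by rewrite mul0r mul0e.
    by rewrite mul1r -EFinM -expRD; congr (expR _)%:E; ring.
  by rewrite ifF//; apply/negbTE; rewrite -leNgt (le_trans (ltW x0)).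
- apply/measurable_EFinP; apply: measurable_funM.
    apply: (measurableT_comp (f := fun b : bool => b%:R : R)) => //.
    exact: measurable_fun_ltr.
  by apply: measurableT_comp => //; apply: measurableT_comp => //; exact: measurable_funM.
Qed.

Lemma expo_xlaplace e t : expo e -> 0 <= t ->
  L1 P (fun w => e w * expR (- (t * e w))) /\
  Ex P (fun w => e w * expR (- (t * e w))) = (1 + t) ^- 2.
Proof.
move=> he t0; apply: (@expo_L1_ge0 e (fun x => x * expR (- (t * x)))) => //.
- apply: measurable_funM => //.
  by apply: measurableT_comp => //; apply: measurableT_comp => //; exact: measurable_funM.
- by move=> x x0; rewrite mulr_ge0// expR_ge0.
have a0 : 0 < 1 + t by rewrite ltr_pwDl.
have <- := integral_xexpR a0; apply: eq_integral => x _.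
by rewrite -mulrA -expRD; congr (_ * expR _)%:E; ring.
Qed.

Lemma expo_mean e : expo e -> L1 P e /\ Ex P e = 1.
Proof.
move=> he; apply: (@expo_L1_ge0 e id) => //.
have := integral_xexpR (@ltr01 R); rewrite expr1n invr1 => <-.
by apply: eq_integral => x _; rewrite mul1r.
Qed.

Lemma expo_L2 e : expo e -> L2 P e /\ Ex P (fun w => e w ^+ 2) = 2.
Proof.
move=> he; have [me _ _] := he.
have [] := @expo_L1_ge0 e (fun x => x ^+ 2) 2 he.
- exact: measurable_funX.
- by move=> x _; exact: sqr_ge0.
- by rewrite -integral_x2expR; apply: eq_integral => x _; rewrite mul1r.
by move=> h1 h2; split.
Qed.

(** From x <= 8 exp (x / 8) follows x^4 <= 8^4 exp (x / 2), and exp (e / 2) has mean 2. *)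
Lemma expo_pow4 e : expo e -> L1 P (fun w => e w ^+ 4) /\ Ex P (fun w => e w ^+ 4) <= 2 * 8 ^+ 4.
Proof.
move=> he; have [me e0 _] := he.
suff [h1 h2] : L1 P (fun w => 8 ^+ 4 * expR (e w / 2)) /\ Ex P (fun w => 8 ^+ 4 * expR (e w / 2)) = 2 * 8 ^+ 4.
  have bd w : e w ^+ 4 <= 8 ^+ 4 * expR (e w / 2).
    have h : e w <= 8 * expR (e w / 8) by have := expR_ge_id (e w / 8); lra.
    have := lerXn2r 4 (_ : e w \is Num.nneg) (_ : 8 * expR (e w / 8) \is Num.nneg) h.
    rewrite !nnegrE e0 mulr_ge0 ?expR_ge0// => /(_ isT isT) /le_trans; apply.
    rewrite exprMn -expRM_natl.
    have -> : 4 * (e w / 8) = e w / 2 by field.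
    by [].
  have m4 : measurable_fun [set: T] (fun w => e w ^+ 4) by exact: measurable_funX.
  have l1 : L1 P (fun w => e w ^+ 4).
    by apply: (L1_le m4 _ h1) => w; rewrite ger0_norm ?exprn_ge0.
  by split => //; rewrite -h2; apply: Ex_le.
apply: (@expo_L1_ge0 e (fun x => 8 ^+ 4 * expR (x / 2))) => //.
- apply: measurable_funM => //; apply: measurableT_comp => //.
  exact: measurable_funM.
- transitivity ((8 ^+ 4)%:E * \int[mu]_(x in `[0%R, +oo[) (expR (- (2^-1 * x)))%:E)%E.
    rewrite -(@ge0_integralZl _ _ _ mu)//=.
    - apply: eq_integral => x _; rewrite -EFinM -mulrA -expRD.
      by congr (_ * expR _)%:E; field.
    - apply/measurable_funTS/measurable_EFinP; apply: measurableT_comp => //.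
      by apply: measurableT_comp => //; exact: measurable_funM.
  by rewrite integral_expR_tail// mulr0 oppr0 expR0 -EFinM; congr EFin; field.
Qed.

End exponential_variables.

(** * Renyi's representation *)

Section normalized_gaps.
Context (R : realType).
Implicit Types (y c : R) (vs cs : seq R).

(* [gaps y vs cs]: along y :: vs every normalized gap exceeds the corresponding
   entry of cs. *)
Fixpoint gaps y vs cs : bool :=
  match vs, cs with
  | v :: vs', c :: cs' => (c < (size vs)%:R * (v - y)) && gaps v vs' cs'
  | [::], [::] => true
  | _, _ => false
  end.

Lemma gapsP y vs cs : size vs = size cs ->
  reflect (forall i, (i < size vs)%N ->
     nth 0 cs i < (size vs - i)%:R * (nth 0 vs i - nth 0 (y :: vs) i))
  (gaps y vs cs).
Proof.
elim: vs y cs => [|v vs ih] y [|c cs]//=; first by move=> _; apply: ReflectT.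
move=> [e]; apply: (iffP andP) => [[h1 /(ih _ _ e) h2] [|i]|h].
- by rewrite subn0.
- by rewrite ltnS subSS => /h2.
- split; first by have := h 0%N isT; rewrite subn0.
  by apply/(ih _ _ e) => i ilt; have := h i.+1; rewrite ltnS subSS; exact.
Qed.

Lemma gaps_path y vs cs : all (>= 0) cs -> gaps y vs cs -> path <%R y vs.
Proof.
elim: vs y cs => [|v vs ih] y [|c cs]//= /andP[c0 cs0] /andP[h1 h2].
rewrite (ih _ _ cs0 h2) andbT -subr_gt0.
by have := le_lt_trans c0 h1; rewrite pmulr_rgt0.
Qed.

End normalized_gaps.

Section sorted_measurability.
Context d (T : measurableType d) (R : realType).

Lemma measurable_fun_gaps I (s : seq I) (v : I -> T -> R) (y : T -> R) cs :
  (forall i, measurable_fun [set: T] (v i)) -> measurable_fun [set: T] y ->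
  measurable_fun [set: T] (fun w => gaps (y w) [seq v i w | i <- s] cs).
Proof.
move=> mv; elim: s y cs => [|i s ih] y [|c cs] my //=.
apply: measurable_and; last exact: ih.
under eq_fun do rewrite size_map.
apply: measurable_fun_ltr => //.
by apply: measurable_funM => //; exact: measurable_funB.
Qed.

Lemma nth_sorted_le (s : seq R) (x : R) i : sorted <=%R s -> (i < size s)%N ->
  (nth 0 s i <= x) = (i < count (fun z => (z <= x)%R) s)%N.
Proof.
elim: s i => [//|a s ih] i /= pas; have ps := path_sorted pas.
have [ax|xa] := leP a x; first by case: i => [|i]; rewrite ?ax// !ltnS => /(ih _ ps) ->.
have c0 : count (fun z => z <= x) s = 0%N.
  apply/eqP; rewrite -leqn0 leqNgt -has_count; apply/hasPn => z zs.
  rewrite -ltNge (lt_le_trans xa)//.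
  by have /allP := order_path_min le_trans pas; exact.
rewrite c0 addn0 ltn0; case: i => [|i]; rewrite /= ?ltnS.
  by move=> _; apply/negbTE; rewrite -ltNge.
move=> ilt; apply/negbTE; rewrite -ltNge (lt_le_trans xa)//.
by have /allP := order_path_min le_trans pas; apply; exact: mem_nth.
Qed.

(** The entry of rank i exceeds x exactly when at most i of the values are <= x, a condition on a
    finite sum of indicators. *)
Lemma measurable_nth_sort I (s : seq I) (v : I -> T -> R) i :
  (forall j, measurable_fun [set: T] (v j)) ->
  measurable_fun [set: T] (fun w => nth 0 (sort <=%R [seq v j w | j <- s]) i).
Proof.
move=> mv; have [si|si] := leqP (size s) i.
  rewrite (_ : (fun w => _) = fun=> 0)//; apply/funext => w.
  by rewrite nth_default// size_sort size_map.
apply: (measurability _ (RGenOInfty.measurableE R)) => //.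
move=> _ [_ [x ->] <-]; rewrite setTI.
have -> : (fun w => nth 0 (sort <=%R [seq v j w | j <- s]) i) @^-1` `]x, +oo[%classic =
    [set w | (\sum_(j <- s) (v j w <= x)%R%:R <= i%:R :> R)].
  have so w : sorted <=%R (sort <=%R [seq v j w | j <- s]).
    by apply: sort_sorted; exact: le_total.
  apply/seteqP; split => w /=; rewrite in_itv/= andbT ltNge nth_sorted_le ?size_sort ?size_map//.
  - rewrite -leqNgt count_sort count_map -sum1_count -natr_sum -big_mkcond/=.
    by rewrite ler_nat => h; rewrite (leq_trans _ h)// [leqRHS]big_mkcond/=; apply/eq_leq/eq_bigr => j _; case: ifP.
  - rewrite -leqNgt count_sort count_map -sum1_count -natr_sum.
    by rewrite ler_nat => h; rewrite (leq_trans _ h)// [leqLHS]big_mkcond/=; apply/eq_leq/eq_bigr => j _; case: ifP.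
rewrite -[X in measurable X]setTI; apply: measurable_fun_ler => //.
apply: measurable_sum => j.
apply: (measurableT_comp (f := fun b : bool => b%:R : R)) => //.
exact: measurable_fun_ler.
Qed.

End sorted_measurability.

Section renyi.
Context d (T : measurableType d) (R : realType) (P : probability T R).

Lemma integral_bool (b : T -> bool) : measurable_fun [set: T] b ->
  (\int[P]_w (b w)%:R%:E = P [set w | b w])%E.
Proof.
move=> mb; have mB : measurable [set w | b w].
  by rewrite -[X in measurable X]setTI; exact: (mb measurableT [set true]).
rewrite -[X in _ = P X]setIT -integral_indic//; apply: eq_integral => w _.
by rewrite indicE; congr ((nat_of_bool _)%:R%:E); apply/idP/idP; rewrite inE.
Qed.

(** Conditioning on the first, smallest variable leaves the same event for the rest of the list,
    started at that variable; hence the parameter y. For y = 0 and zero thresholds the value is 1 /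
    m!, the probability of one given ordering of m variables. *)
Lemma prob_gaps N (L : nat -> T -> R) (l : seq nat) cs y :
  (forall i, measurable_fun [set: T] (L i)) -> indep P N L ->
  (forall i, (i < N)%N -> expo P (L i)) ->
  uniq l -> all (fun i => (i < N)%N) l -> size l = size cs -> all (>= 0) cs -> 0 <= y ->
  P [set w | gaps y [seq L a w | a <- l] cs] =
  (expR (- ((size l)%:R * y)) * (\prod_(c <- cs) expR (- c)) / (size l)`!%:R)%:E.
Proof.
move=> mL iL eL; elim: l cs y => [|a l ih] [|c cs] y//=.
  move=> _ _ _ _ y0; rewrite big_nil mul0r oppr0 expR0 mulr1 fact0 divr1.
  have -> : [set w : T | true] = setT by apply/seteqP; split.
  exact: probability_setT.
move=> /andP[al ul] /andP[aN lN] [lcs] /andP[c0 cs0] y0.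
pose m := (size l).+1.
pose J := [set i | i \in l].
pose F (x : R * g_sigma_algebraType (gens J L)) : \bar R :=
  ((c < m%:R * (x.1 - y)) && gaps x.1 [seq L b x.2 | b <- l] cs)%:R%:E.
have mF : measurable_fun setT F.
  apply/measurable_EFinP.
  apply: (measurableT_comp (f := fun b : bool => b%:R : R)) => //.
  apply: measurable_and.
    apply: measurable_fun_ltr => //; apply: measurable_funM => //.
    by apply: measurable_funB => //; exact: measurable_fst.
  (* Only the coordinates listed in [l] are measurable for this sigma-algebra; the others are first
     replaced by 0. *)
  have E : (fun x : R * g_sigma_algebraType (gens J L) => gaps x.1 [seq L b x.2 | b <- l] cs) =
      (fun x => gaps x.1 [seq (if b \in l then L b x.2 else 0) | b <- l] cs).
    apply/funext => x; congr gaps; apply/eq_in_map => b bl; by rewrite bl.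
  rewrite E; apply: measurable_fun_gaps; last exact: measurable_fst.
  move=> b; case bl : (b \in l) => //.
  have h : measurable_fun [set: g_sigma_algebraType (gens J L)] (L b).
    exact: sg_coord.
  exact: (measurableT_comp h measurable_snd).
have Jn : J `<=` `I_N by move=> i /= il; have /allP := lN; exact.
have an : [set a] `<=` `I_N by move=> _ ->.
have aJ : [set a] `&` J = set0.
  by apply/seteqP; split => // i [-> /= h]; move: al; rewrite h.
have mid : measurable_fun [set: g_sigma_algebraType (gens J L)] (id : T -> g_sigma_algebraType (gens J L)).
  by [].
have mb : measurable_fun [set: T] (fun w => (c < m%:R * (L a w - y)) &&
    gaps (L a w) [seq L b w | b <- l] cs).
  apply: measurable_and; last exact: measurable_fun_gaps.
  by apply: measurable_fun_ltr => //; apply: measurable_funM => //; exact: measurable_funB.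
have F0 x : (0 <= F x)%E by rewrite lee_fin.
transitivity (P [set w | (c < m%:R * (L a w - y)) &&
    gaps (L a w) [seq L b w | b <- l] cs]).
  by congr (P _); apply/seteqP; split => w /=; rewrite size_map.
rewrite -integral_bool//.
have -> := indep_pair mL iL an Jn aJ (@sg_coord T R [set a] L a erefl) mid mF F0.
have ea := eL a aN; have [_ La0 _] := ea.
pose K := \prod_(c <- cs) expR (- c) / (size l)`!%:R.
have K0 : 0 <= K.
  by rewrite divr_ge0// prodr_ge0// => i _; exact: expR_ge0.
have m0 : 0 < m%:R :> R by [].
transitivity (\int[P]_w (((y + c / m%:R < L a w)%R%:R *
    expR (- ((size l)%:R * L a w)))%:E * K%:E))%E.
  apply: eq_integral => w _ /=; rewrite /F/=.
  have -> : (c < m%:R * (L a w - y)) = (y + c / m%:R < L a w).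
    by rewrite -ltrBrDl ltr_pdivrMr// mulrC.
  case: ltP => _ /=; last by rewrite mul0r mul0e integral0.
  rewrite integral_bool; last exact: measurable_fun_gaps.
  by rewrite ih// mul1r -EFinM mulrA.
rewrite ge0_integralZr//; last first.
  apply/measurable_EFinP; apply: measurable_funM.
    apply: (measurableT_comp (f := fun b : bool => b%:R : R)) => //.
    exact: measurable_fun_ltr.
  apply: measurableT_comp => //; apply: measurableT_comp => //.
  exact: measurable_funM.
rewrite expo_laplace_tail//; last by rewrite addr_ge0// divr_ge0.
rewrite -EFinM; congr EFin.
have -> : 1 + (size l)%:R = m%:R :> R by rewrite /m -[in RHS]add1n natrD.
have -> : m%:R * (y + c / m%:R) = m%:R * y + c by field; rewrite gt_eqF.
rewrite /K big_cons factS natrM opprD expRD -/m; field.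
by rewrite !gt_eqF// ltr0n fact_gt0.
Qed.

Lemma prob_setI1 (A B : set T) : measurable A -> measurable B -> P B = 1%E ->
  P (A `&` B) = P A.
Proof.
move=> mA mB PB; have PC : P (~` B) = 0%E.
  by rewrite probability_setC// PB subee.
apply/eqP; rewrite eq_le le_measure ?inE//=; last exact: measurableI.
rewrite -{1}(setIT A) -(setUv B) setIUr.
rewrite (le_trans (measureU2 _ _ _))//; [exact: measurableI| |].
  by apply: measurableI => //; exact: measurableC.
rewrite -[leRHS]adde0 leeD2l// -PC le_measure ?inE//.
- by apply: measurableI => //; exact: measurableC.
- exact: measurableC.
Qed.

Section order_statistics.
Variables (n : nat) (X : nat -> T -> R) (ell : R -> R).
Hypothesis mX : forall i, measurable_fun [set: T] (X i).
Hypothesis mell : measurable_fun [set: R] ell.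
Hypothesis ell_mono : forall i j w, X i w < X j w -> ell (X i w) < ell (X j w).
Hypothesis eL : forall i, (i < n.+1)%N -> expo P (fun w => ell (X i w)).
Hypothesis iL : indep P n.+1 (fun i w => ell (X i w)).

Definition sample w := [seq X j w | j <- iota 1 n].

Definition lam i w : R :=
  if i is i'.+1 then ell (nth 0 (sort <=%R (sample w)) i') else 0.

Definition normalized_gap i w : R := (n - i)%:R * (lam i.+1 w - lam i w).

Let L i w := ell (X i w).

Lemma measurable_lam i : measurable_fun [set: T] (lam i).
Proof.
case: i => [|i]; first exact: measurable_cst.
have h := measurable_nth_sort (iota 1 n) i mX.
exact: (measurableT_comp mell h).
Qed.

Lemma measurable_egap i : measurable_fun [set: T] (normalized_gap i).
Proof.
by apply: measurable_funM => //; apply: measurable_funB; exact: measurable_lam.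
Qed.

Let size_s w : size (sort <=%R (sample w)) = n.
Proof. by rewrite size_sort size_map size_iota. Qed.

Let sorted_s w : sorted <=%R (sort <=%R (sample w)).
Proof. by apply: sort_sorted; exact: le_total. Qed.

Lemma gaps_sort w c :
  gaps 0 [seq ell x | x <- sort <=%R (sample w)] (mkseq c n) <->
  forall i, (i < n)%N -> c i < normalized_gap i w.
Proof.
have sz : size [seq ell x | x <- sort <=%R (sample w)] = n by rewrite size_map size_s.
have E i : (i < n)%N -> nth 0 (mkseq c n) i = c i by move=> ?; rewrite nth_mkseq.
have E1 i : (i < n)%N -> nth 0 [seq ell x | x <- sort <=%R (sample w)] i = lam i.+1 w.
  by move=> ?; rewrite (nth_map 0) ?size_s.
have E2 i : (i < n)%N -> nth 0 (0 :: [seq ell x | x <- sort <=%R (sample w)]) i = lam i w.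
  by case: i => [//|i] h; rewrite /= E1// ltnW.
have H := @gapsP R 0 [seq ell x | x <- sort <=%R (sample w)] (mkseq c n).
rewrite sz size_mkseq in H; split.
  by move=> /(H erefl) h i ilt; have := h i ilt; rewrite E// E1// E2.
by move=> h; apply/(H erefl) => i ilt; rewrite E// E1// E2//; exact: h.
Qed.

Let XleP i j w : (L i w < L j w) = (X i w < X j w).
Proof.
apply/idP/idP; last exact: ell_mono.
apply: contraTT; rewrite -!leNgt le_eqVlt => /orP[/eqP ji|].
  by rewrite /L ji.
by move=> /ell_mono/ltW.
Qed.

(** [l0] ranks the sample. Nonnegative thresholds force a strict increase, so no other ordering can
    contribute, and in the presence of ties both sides vanish. *)
Lemma gaps_perm w cs : all (>= 0) cs -> size cs = n ->
  (gaps 0 [seq ell x | x <- sort <=%R (sample w)] cs)%:R =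
  \sum_(l <- permutations (iota 1 n)) (gaps 0 [seq L a w | a <- l] cs)%:R :> R.
Proof.
move=> cs0 szcs; set s := sort _ _.
pose l0 := sort (relpre (X^~ w) <=%R) (iota 1 n).
have l0p : l0 \in permutations (iota 1 n) by rewrite mem_permutations perm_sort.
have l0E : [seq X a w | a <- l0] = s by rewrite /l0 /s /sample sort_map.
have l0L : [seq L a w | a <- l0] = [seq ell x | x <- s] by rewrite -l0E -map_comp.
have key l : l \in permutations (iota 1 n) -> gaps 0 [seq L a w | a <- l] cs -> l = l0.
  rewrite mem_permutations => pl gl.
  have := gaps_path cs0 gl => /path_sorted.
  rewrite sorted_map => sL.
  have sX : sorted <%R [seq X a w | a <- l].
    rewrite sorted_map; apply: sub_sorted sL => i j /=.
    by rewrite XleP.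
  have pX : perm_eq [seq X a w | a <- l] (sample w) by exact: perm_map.
  have sE : [seq X a w | a <- l] = s.
    apply: (sorted_eq le_trans le_anti _ (sorted_s w)).
      by apply: sub_sorted sX => ? ?; exact: ltW.
    by rewrite (perm_trans pX)// perm_sym perm_sort.
  have uX : uniq [seq X a w | a <- iota 1 n].
    rewrite -(perm_uniq pX); exact: (sorted_uniq lt_trans ltxx).
  have inj : {in iota 1 n &, injective (X^~ w)}.
    move=> i j ii ij /= Xij; rewrite -(nth_index 0%N ii) -(nth_index 0%N ij).
    congr nth; apply/eqP; rewrite -(@nth_uniq _ 0 [seq X a w | a <- iota 1 n]) ?size_map ?index_mem//.
    by rewrite !(nth_map 0%N) ?index_mem// !nth_index// Xij.
  apply: (inj_in_map (A := mem (iota 1 n)) inj); last by rewrite sE l0E.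
  - by rewrite inE; apply/allP => x; rewrite (perm_mem pl).
  - by rewrite inE; apply/allP => x; rewrite mem_sort.
rewrite (bigD1_seq l0)//= ?permutations_uniq// l0L big1_seq ?addr0// => l /andP[ll0 lp].
by case gl : (gaps _ _ _) => //; move: ll0; rewrite (key l lp gl) eqxx.
Qed.

(** All n! orderings contribute the same amount, and their number cancels the factor 1 / n! of
    each. *)
Lemma renyi_prob c : (forall i, 0 <= c i) ->
  P [set w | forall i, (i < n)%N -> c i < normalized_gap i w] =
  (\prod_(i < n) expR (- c i))%:E.
Proof.
move=> c0; pose cs := mkseq c n.
have cs0 : all (>= 0) cs by apply/allP => x /mapP[i _ ->].
have szcs : size cs = n by rewrite size_mkseq.
have mL i : measurable_fun [set: T] (L i) by exact: measurableT_comp.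
have mg l : measurable_fun [set: T] (fun w => gaps 0 [seq L a w | a <- l] cs).
  exact: measurable_fun_gaps.
have mb : measurable_fun [set: T]
   (fun w => gaps 0 [seq ell x | x <- sort <=%R (sample w)] cs).
  rewrite (_ : (fun w => _) = fun w => (gaps 0 [seq ell (nth 0 (sort <=%R (sample w)) i) | i <- iota 0 n] cs)).
    apply: measurable_fun_gaps => // i; apply: measurableT_comp => //.
    exact: measurable_nth_sort.
  apply/funext => w; congr gaps; apply: (@eq_from_nth _ 0).
    by rewrite !size_map size_s size_iota.
  move=> i; rewrite size_map size_s => ilt; rewrite (nth_map 0) ?size_s//.
  by rewrite (nth_map 0%N) ?size_iota// nth_iota.
transitivity (P [set w | gaps 0 [seq ell x | x <- sort <=%R (sample w)] cs]).
  by congr (P _); apply/seteqP; split => w /= /gaps_sort.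
rewrite -integral_bool//.
transitivity (\int[P]_w (\sum_(l <- permutations (iota 1 n))
    (gaps 0 [seq L a w | a <- l] cs)%:R%:E))%E.
  by apply: eq_integral => w _; rewrite gaps_perm// sumEFin.
rewrite ge0_integral_sum//; last first.
  move=> l; apply/measurable_EFinP.
  exact: (measurableT_comp (f := fun b : bool => b%:R : R)).
transitivity (\sum_(l <- permutations (iota 1 n))
    (\prod_(i < n) expR (- c i) / n`!%:R)%:E)%E.
  rewrite big_seq [RHS]big_seq; apply: eq_bigr => l.
  rewrite mem_permutations => pl; rewrite integral_bool//.
  rewrite (@prob_gaps n.+1)//.
  - rewrite mulr0 oppr0 expR0 mul1r (perm_size pl) size_iota.
    congr (_ / _)%:E; rewrite /cs /mkseq big_map.
    by rewrite -(big_mkord xpredT (fun i => expR (- c i))) /index_iota subn0.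
  - by rewrite (perm_uniq pl) iota_uniq.
  - by apply/allP => i; rewrite (perm_mem pl) mem_iota add1n => /andP[].
  - by rewrite (perm_size pl) size_iota.
rewrite sumEFin big_const_seq count_predT size_permutations ?iota_uniq// size_iota.
by rewrite iter_addr_0 -[_ *+ _]mulr_natr divfK.
Qed.

Lemma egap_ge0 i w : 0 <= normalized_gap i w.
Proof.
rewrite /normalized_gap; have [ni|ilt] := leqP n i; first by rewrite (eqP ni) mul0r.
rewrite mulr_ge0// subr_ge0.
have smem j : (j < n)%N -> exists2 k, (k < n.+1)%N & nth 0 (sort <=%R (sample w)) j = X k w.
  move=> jn; have : nth 0 (sort <=%R (sample w)) j \in sort <=%R (sample w).
    by rewrite mem_nth// size_s.
  rewrite mem_sort => /mapP[k]; rewrite mem_iota add1n => /andP[_ kn] ->.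
  by exists k.
case: i ilt => [|i] ilt /=.
  by have [k kn ->] := smem _ ilt; have [_ + _] := eL kn; exact.
have : nth 0 (sort <=%R (sample w)) i <= nth 0 (sort <=%R (sample w)) i.+1.
  by apply: (sorted_leq_nth le_trans lexx) => //; rewrite inE size_s// ltnW.
have [k kn ->] := smem _ ilt; have [k' kn' ->] := smem i (ltnW ilt).
by rewrite le_eqVlt => /orP[/eqP ->//|/ell_mono/ltW].
Qed.

Let Om1 := [set w | forall i, (i < n)%N -> 0 < normalized_gap i w].

Let mlt (c : nat -> R) : measurable [set w | forall i, (i < n)%N -> c i < normalized_gap i w].
Proof.
rewrite (_ : [set _ | _] = \bigcap_(i in `I_n) [set w | c i < normalized_gap i w])//.
apply: bigcap_measurableType => i _; rewrite -[X in measurable X]setTI.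
by apply: measurable_fun_ltr => //; exact: measurable_egap.
Qed.

Let POm1 : P Om1 = 1%E.
Proof.
rewrite renyi_prob//; under eq_bigr do rewrite oppr0 expR0.
by rewrite big1.
Qed.

Lemma egap_ae_gt0 : {ae P, forall w, forall i, (i < n)%N -> 0 < normalized_gap i w}.
Proof.
exists (~` Om1); split => //; first exact/measurableC/mlt.
by rewrite probability_setC ?POm1 ?subee//; exact: mlt.
Qed.

(** The gaps are almost surely positive, so a negative threshold acts as 0. Arbitrary real
    thresholds are what [indep_rays] asks for. *)
Lemma renyi_prob_real (c : nat -> R) :
  P [set w | forall i, (i < n)%N -> c i < normalized_gap i w] =
  (\prod_(i < n) expR (- Num.max 0 (c i)))%:E.
Proof.
rewrite -(renyi_prob (c := fun i => Num.max 0 (c i))); last first.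
  by move=> i; rewrite le_max lexx.
rewrite -(prob_setI1 (mlt _) (mlt _) POm1); congr (P _).
apply/seteqP; split => w /=.
  by move=> [h1 h2] i ilt; rewrite gt_max h1// h2.
by move=> h; split => i ilt; have := h i ilt; rewrite gt_max => /andP[].
Qed.

Lemma egap_tail i (c : R) : (i < n)%N ->
  P [set w | c < normalized_gap i w] = (expR (- Num.max 0 c))%:E.
Proof.
move=> ilt; have mc : measurable [set w | c < normalized_gap i w].
  rewrite -[X in measurable X]setTI.
  by apply: measurable_fun_ltr => //; exact: measurable_egap.
rewrite -(prob_setI1 mc (mlt _) POm1).
transitivity (P [set w | forall j, (j < n)%N -> (if j == i then Num.max 0 c else 0) < normalized_gap j w]).
  congr (P _); apply/seteqP; split => w /=.
    by move=> [h1 h2] j jlt; case: eqP => [->|_]; rewrite ?gt_max ?h1 ?h2.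
  move=> h; split; first by have := h i ilt; rewrite eqxx gt_max => /andP[].
  by move=> j jlt; have := h j jlt; case: eqP => [->|//]; rewrite gt_max => /andP[].
rewrite (renyi_prob (c := fun j => if j == i then Num.max 0 c else 0)); last first.
  by move=> j; case: eqP => // _; rewrite le_max lexx.
rewrite (bigD1 (Ordinal ilt))//= eqxx big1 ?mulr1// => j.
by rewrite -val_eqE/= => /negbTE ->; rewrite oppr0 expR0.
Qed.

Theorem renyi_expo i : (i < n)%N -> expo P (normalized_gap i).
Proof.
move=> ilt; split; [exact: measurable_egap|exact: egap_ge0|].
by move=> t t0; rewrite egap_tail// max_r.
Qed.

Theorem renyi_indep : indep P n normalized_gap.
Proof.
apply: indep_rays; first exact: measurable_egap.
move=> c; transitivity (P [set w | forall i, (i < n)%N -> c i < normalized_gap i w]).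
  congr (P _); apply/seteqP; split => w /= h i ilt; have := h i ilt;
    by rewrite /= in_itv/= andbT.
rewrite renyi_prob_real -prodEFin; apply: eq_bigr => i _.
rewrite -(egap_tail _ (ltn_ord i)); congr (P _).
by apply/seteqP; split => w /=; rewrite in_itv/= andbT.
Qed.

End order_statistics.

End renyi.

(** * The Efron-Stein inequality *)

Definition coords (R : realType) : nat -> (nat -> R) -> R := fun i x => x i.

Lemma measurable_coords d (Om : measurableType d) (R : realType) n (Z : nat -> Om -> R) :
  (forall j, (j < n)%N -> measurable_fun [set: Om] (Z j)) ->
  measurable_fun [set: Om]
    ((fun w j => Z j w) : Om -> g_sigma_algebraType (gens `I_n (@coords R))).
Proof.
move=> mZ; apply: (@measurability _ _ Om (g_sigma_algebraType (gens `I_n (@coords R)))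
  setT _ (gens `I_n (@coords R))) => //.
move=> _ [_ [i ni [A mA ->]] <-].
rewrite -[X in measurable X]/(setT `&` (Z i @^-1` A)); exact: mZ.
Qed.

Section efron_stein.
Context d (T : measurableType d) (R : realType) (P : probability T R).
Variables (n : nat) (X : nat -> T -> R).
Hypothesis mX : forall i, measurable_fun [set: T] (X i).
Hypothesis iX : indep P (n + n) X.
Hypothesis dX : forall i j A, measurable A -> P (X i @^-1` A) = P (X j @^-1` A).

Let V m := g_sigma_algebraType (gens `I_m (@coords R)).
Implicit Types F : (nat -> R) -> R.

Let E F := Ex P (fun w => F (fun i => X i w)).

(* X_n, ..., X_(2n-1) serve as the independent copies of X_0, ..., X_(n-1);
   [swaps A] exchanges the coordinates in A with their copies. *)
Definition swaps (A : pred nat) (j : nat) : nat :=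
  if (j < n)%N then (if A j then j + n else j)%N
  else if (j < n + n)%N then (if A (j - n)%N then j - n else j)%N else j.

Let swapsK A : involutive (swaps A).
Proof.
move=> j; rewrite /swaps; case jn: (j < n)%N.
  case Aj: (A j); last by rewrite jn Aj.
  have -> : (j + n < n)%N = false by lia.
  by rewrite ltn_add2r jn addnK Aj.
case jnn: (j < n + n)%N; last by rewrite jn jnn.
case Aj: (A (j - n)%N); last by rewrite jn jnn Aj.
have -> : (j - n < n)%N by lia.
by rewrite Aj subnK//; lia.
Qed.

Let swaps_lt A j : (j < n + n)%N -> (swaps A j < n + n)%N.
Proof.
rewrite /swaps => h; case: (ltnP j n) => jn; first by case: (A j); lia.
by rewrite h; case: (A _); lia.
Qed.

Let indep_swaps A : indep P (n + n) (fun i => X (swaps A i)).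
Proof.
move=> B mB; transitivity (P (\bigcap_(j in `I_(n + n)) X j @^-1` B (swaps A j))).
  congr (P _); apply/seteqP; split => w h j jlt.
    by have := h _ (swaps_lt A jlt); rewrite /= swapsK.
  by have := h _ (swaps_lt A jlt); rewrite /= swapsK.
rewrite iX//; pose s (i : 'I_(n + n)) := Ordinal (swaps_lt A (ltn_ord i)).
have sK : involutive s by move=> i; apply: val_inj; rewrite /= swapsK.
rewrite (reindex_inj (inv_inj sK))/=; apply: eq_bigr => i _.
by rewrite swapsK.
Qed.

Let E_swaps A F : measurable_fun [set: V (n + n)] F ->
  E (fun x => F (x \o swaps A)) = E F.
Proof.
move=> mF; rewrite /E /Ex; congr fine.
apply: (@indep_law _ T R P (n + n) (fun i => X (swaps A i)) X (fun x => (F x)%:E)) => //.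
- by move=> i B mB; exact: dX.
- exact/measurable_EFinP.
Qed.

Let mE F : measurable_fun [set: V (n + n)] F ->
  measurable_fun [set: T] (fun w => F (fun i => X i w)).
Proof.
move=> mF; apply: (measurableT_comp mF).
by apply: measurable_coords => j _.
Qed.

Let m_swaps A F : measurable_fun [set: V (n + n)] F ->
  measurable_fun [set: V (n + n)] (fun x => F (x \o swaps A)).
Proof.
move=> mF; apply: (measurableT_comp mF).
apply: (@measurable_coords _ (V (n + n)) R (n + n) (fun j x => x (swaps A j))) => j jn.
by apply: (@sg_coord _ R `I_(n + n) (@coords R)); exact: swaps_lt.
Qed.

(** The variance telescopes along [Z i], which passes from [D] to an independent copy of [D]. Each
    increment is antisymmetric under the exchange of coordinate i with its copy, so [D] can be
    replaced there by half of [D - D']. As [DD i] does not see coordinate i, [D - D'] is a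
    difference of two copies of [D - DD i]; this gives the factor 2. *)
Lemma efron_stein (D : (nat -> R) -> R) (DD : nat -> (nat -> R) -> R) (C : R) :
  measurable_fun [set: V n] D -> (forall i, measurable_fun [set: V n] (DD i)) ->
  (forall x, `|D x| <= C) -> (forall i x, `|DD i x| <= C) ->
  (forall i x y, (i < n)%N -> (forall j, (j < n)%N -> j != i -> x j = y j) ->
     DD i x = DD i y) ->
  Var P (fun w => D (fun i => X i w)) <=
  2 * \sum_(i < n) Ex P (fun w => (D (fun j => X j w) - DD i (fun j => X j w)) ^+ 2).
Proof.
move=> mD mDD bD bDD hDD.
have VV F : measurable_fun [set: V n] F -> measurable_fun [set: V (n + n)] F.
  by apply: sg_mfS => i /= h; rewrite (leq_trans h)// leq_addr.
have mD2 := VV _ mD; have mDD2 i := VV _ (mDD i).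
(* Measurability for the first n coordinates forces [D] to depend on them alone: [q] zeroes the
   others, and the sets invariant under [q] form a sigma-algebra containing the generators. *)
have Dn x y : (forall j, (j < n)%N -> x j = y j) -> D x = D y.
  move=> xy.
  have := (measurable_coords (Om := V n) (n := n)); move=> _.
  pose q (z : nat -> R) := fun j => if (j < n)%N then z j else 0.
  suff Dq z : D z = D (q z).
    by rewrite Dq (Dq y); congr D; apply/funext => j; rewrite /q; case: ifP => // /xy.
  pose A := D @^-1` [set D (q z)].
  have mA : measurable (A : set (V n)).
    by rewrite -[A]setTI; apply: mD => //; exact: measurable_set1.
  have key (B : set (nat -> R)) : <<s gens `I_n (@coords R)>> B -> forall z, B z <-> B (q z).
    move=> sB; apply: (sB [set B | forall z, B z <-> B (q z)]); split.
      split => //.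
      - by move=> B' /= h z'; have := h z'; rewrite /setD/=; tauto.
      - move=> F h z'; split => -[k kk Fk]; exists k => //;
          have [h1 h2] := h k z'; by [exact: h1|exact: h2].
    move=> _ [i ni [C' mC ->]] z' /=; rewrite /coords /q.
    by rewrite ni.
  by have /(key A mA z) : A (q z) by []; exact.
have C0 : 0 <= C by rewrite (le_trans _ (bD (fun=> 0))).
have L2F F (c : R) : measurable_fun [set: V (n + n)] F -> (forall x, `|F x| <= c) ->
    L2 P (fun w => F (fun i => X i w)).
  by move=> mF bF; apply: (@L2_bounded _ _ _ P c _ (mE mF)) => w; exact: bF.
(* [Z i] is [D] with its first i arguments replaced by their copies. *)
pose Z i x := D (x \o swaps (fun j => j < i)%N).
have mZ i : measurable_fun [set: V (n + n)] (Z i) by exact: m_swaps.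
have L2D : L2 P (fun w => D (fun i => X i w)) by apply: (L2F D C).
have L2Z i : L2 P (fun w => Z i (fun i => X i w)) by apply: (L2F (Z i) C) => // x; exact: bD.
have Z0 x : Z 0%N x = D x.
  by apply: Dn => j jn; rewrite /= /swaps jn.
have EZn : E (Z n) = E D by exact: (E_swaps _ mD2).
have EDZn : E (fun x => D x * Z n x) = E D * E (Z n).
  apply: (@indep_ExM _ T R P (n + n) `I_n [set j | (n <= j < n + n)%N] X) => //.
  - by move=> i /= h; rewrite (leq_trans h)// leq_addr.
  - by move=> i /= /andP[].
  - by apply/seteqP; split => // i [/= h1 /andP[h2 _]]; move: h1; rewrite ltnNge h2.
  - apply: (measurableT_comp mD).
    apply: (@measurable_coords _ (g_sigma_algebraType (gens `I_n X)) R n X) => j jn.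
    exact: sg_coord.
  - apply: (measurableT_comp mD).
    apply: (@measurable_coords _ (g_sigma_algebraType (gens [set j | (n <= j < n + n)%N] X)) R n
      (fun j => X (swaps (fun j => j < n)%N j))) => j jn.
    by apply: sg_coord => /=; rewrite /swaps jn; lia.
have -> : Var P (fun w => D (fun i => X i w)) = E (fun x => D x * D x) - E (fun x => D x * Z n x).
  by rewrite EDZn EZn.
have tele : E (fun x => D x * D x) - E (fun x => D x * Z n x) =
    \sum_(i < n) (E (fun x => D x * Z i x) - E (fun x => D x * Z i.+1 x)).
  rewrite -(big_mkord xpredT (fun i => E (fun x => D x * Z i x) - E (fun x => D x * Z i.+1 x))).
  rewrite (@telescope_sumr_eq _ 0 n (fun i => - E (fun x => D x * Z i x)))//; last first.
    by move=> i _; ring.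
  have -> : E (fun x => D x * Z 0%N x) = E (fun x => D x * D x).
    by apply: eq_Ex => w; rewrite Z0.
  by ring.
rewrite tele mulr_sumr; apply: ler_sum => -[i ilt] _ /=.
set s := swaps (pred1 i).
pose D' x := D (x \o s).
have sZ x : Z i (x \o s) = Z i.+1 x.
  apply: Dn => j jn /=; congr x; rewrite /s /swaps jn /=.
  have -> : (j < i.+1)%N = (j == i) || (j < i)%N by rewrite ltnS leq_eqVlt.
  case: (eqVneq j i) => [->|ji] /=.
    by rewrite ltnn ilt eqxx.
  case: (ltnP j i) => ji'; last by rewrite jn (negbTE ji).
  have -> : (j + n < n)%N = false by lia.
  by rewrite ltn_add2r jn addnK (negbTE ji).
have sZ' x : Z i.+1 (x \o s) = Z i x.
  rewrite -sZ; congr (Z i _); apply/funext => j /=.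
  by rewrite /s swapsK.
have mD' : measurable_fun [set: V (n + n)] D' by exact: m_swaps.
have L2D' : L2 P (fun w => D' (fun i => X i w)) by apply: (L2F D' C) => // x; exact: bD.
set t := _ - _; pose W x := D x - D' x.
have mW : measurable_fun [set: V (n + n)] W by exact: measurable_funB.
have L2W : L2 P (fun w => W (fun i => X i w)) by exact: L2B.
have L2WZ : L2 P (fun w => Z i (fun i => X i w) - Z i.+1 (fun i => X i w)) by exact: L2B.
have t1 : t = E (fun x => D x * (Z i x - Z i.+1 x)).
  rewrite /t /E -ExB; [|exact: L2M|exact: L2M].
  by apply: eq_Ex => w; rewrite mulrBr.
(* Exchanging coordinate i with its copy preserves the law and swaps [Z i] with [Z i.+1]. *)
have t2 : t = - E (fun x => D' x * (Z i x - Z i.+1 x)).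
  rewrite t1 -(E_swaps (pred1 i)); last first.
    by apply: measurable_funM => //; exact: measurable_funB.
  rewrite /E -ExN; last exact: L2M.
  by apply: eq_Ex => w; rewrite -/s sZ sZ' -mulrN opprB.
have t3 : 2 * t = E (fun x => W x * (Z i x - Z i.+1 x)).
  have e : 2 * t = E (fun x => D x * (Z i x - Z i.+1 x)) - E (fun x => D' x * (Z i x - Z i.+1 x)).
    by rewrite -t1 -t2; ring.
  rewrite e /E -ExB; [|exact: L2M|exact: L2M].
  by apply: eq_Ex => w; rewrite -mulrBl.
(* [Z i - Z i.+1] is [W] after the exchange of the first i coordinates, hence has the same second
   moment. *)
have WZ : E (fun x => (Z i x - Z i.+1 x) ^+ 2) = E (fun x => W x ^+ 2).
  rewrite -[RHS](E_swaps (fun j => j < i)%N); last exact: measurable_funX.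
  apply: eq_Ex => w; congr (_ ^+ 2); congr (_ - _).
  apply: Dn => j jn; rewrite /= /s /swaps jn /=.
  have -> : (j < i.+1)%N = (j == i) || (j < i)%N by rewrite ltnS leq_eqVlt.
  case: (eqVneq j i) => [->|ji] /=; last by rewrite jn.
  have -> : (i + n < n)%N = false by lia.
  by rewrite ltn_add2r ilt addnK ltnn.
pose U x := D x - DD i x.
have mU : measurable_fun [set: V (n + n)] U by exact: measurable_funB.
have L2DD : L2 P (fun w => DD i (fun i => X i w)) by apply: (L2F (DD i) C).
have L2U : L2 P (fun w => U (fun i => X i w)) by exact: L2B.
have mUs : measurable_fun [set: V (n + n)] (fun x => U (x \o s)) by exact: m_swaps.
have L2Us : L2 P (fun w => U ((fun i => X i w) \o s)).
  apply: (L2F (fun x => U (x \o s)) (C + C)) => // x.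
  by rewrite (le_trans (ler_normB _ _))// lerD// ?bD ?bDD.
have WU x : W x = U x - U (x \o s).
  rewrite /W /U /D'; rewrite (hDD i (x \o s) x ilt); first by ring.
  by move=> j jn ji; rewrite /= /s /swaps jn /= (negbTE ji).
have EW : E (fun x => W x ^+ 2) <= 4 * E (fun x => U x ^+ 2).
  have e1 : E (fun x => U (x \o s) ^+ 2) = E (fun x => U x ^+ 2).
    by apply: (E_swaps (pred1 i) (F := fun x => U x ^+ 2)); exact: measurable_funX.
  have h1 := L1Z 2 L2U.2; have h2 := L1Z 2 L2Us.2.
  have e2 := ExD h1 h2; have e3 := ExZ 2 L2U.2; have e4 := ExZ 2 L2Us.2.
  apply: (@le_trans _ _ (Ex P (fun w => 2 * U (fun i => X i w) ^+ 2 + 2 * U ((fun i => X i w) \o s) ^+ 2))).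
    apply: Ex_le; [exact: L2W.2|exact: L1D|].
    by move=> w; rewrite WU; have := sqr_ge0 (U (fun i => X i w) + U ((fun i => X i w) \o s)); nra.
  rewrite e2 e3 e4 -/(E (fun x => U x ^+ 2)) -/(E (fun x => U (x \o s) ^+ 2)) e1.
  by rewrite -mulrDl; have -> : (2 + 2 = 4 :> R) by ring.
have cs : 2 * t <= E (fun x => W x ^+ 2).
  rewrite t3; have h1 := L2W.2; have h2 := L2WZ.2.
  have e2 := ExD (L1Z 2^-1 h1) (L1Z 2^-1 h2); have e3 := ExZ 2^-1 h1; have e4 := ExZ 2^-1 h2.
  apply: (@le_trans _ _ (Ex P (fun w => 2^-1 * W (fun i => X i w) ^+ 2 +
    2^-1 * (Z i (fun i => X i w) - Z i.+1 (fun i => X i w)) ^+ 2))).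
    apply: Ex_le; [exact: L2M|by apply: L1D; exact: L1Z|].
    move=> w; set a := W _; set b := (Z i _ - _).
    by have := sqr_ge0 (a - b); nra.
  rewrite e2 e3 e4 -/(E (fun x => W x ^+ 2)) -/(E (fun x => (Z i x - Z i.+1 x) ^+ 2)) WZ.
  lra.
rewrite -/(E (fun x => U x ^+ 2)); lra.
Qed.

End efron_stein.

(** * Sums over neighbouring order statistics *)

Section local_sums.
Context (R : realType).
Implicit Types (s : seq R) (dl : R -> R -> R).

Definition locsum dl k s : R :=
  \sum_(0 <= i < size s - k) dl (nth 0 s i) (nth 0 s (i + k)).

Definition del r s := take r s ++ drop r.+1 s.

Lemma sqr_sum_le I (l : seq I) (x : I -> R) :
  (\sum_(i <- l) x i) ^+ 2 <= (size l)%:R * \sum_(i <- l) x i ^+ 2.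
Proof.
elim: l => [|i l ih]; first by rewrite !big_nil expr0n mulr0.
rewrite !big_cons /= -natr1; set S := \sum_(_ <- _) x _; set Q := \sum_(_ <- _) _.
have Q0 : 0 <= Q by apply: sumr_ge0 => j _; exact: sqr_ge0.
have [l0|l0] := posnP (size l).
  have l0' := size0nil l0.
  by rewrite /S /Q l0' /= !big_nil; nra.
have ln : 0 < (size l)%:R :> R by rewrite ltr0n.
set m := (size l)%:R in ih ln *.
have : 0 <= (m * x i - S) ^+ 2 / m by rewrite divr_ge0 ?sqr_ge0// ltW.
have -> : (m * x i - S) ^+ 2 / m = m * x i ^+ 2 - 2 * x i * S + S ^+ 2 / m.
  by field; rewrite gt_eqF.
have : S ^+ 2 / m <= Q by rewrite ler_pdivrMr// mulrC.
by rewrite -/S -/Q in ih; nra.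
Qed.

Lemma nth_del r s i : (r < size s)%N -> nth 0 (del r s) i = nth 0 s (bump r i).
Proof.
move=> rs; rewrite /del nth_cat size_take rs /bump; case: ltnP => ir.
  by rewrite nth_take// add0n.
by rewrite nth_drop add1n; congr nth; lia.
Qed.

Lemma size_del r s : (r < size s)%N -> size (del r s) = (size s).-1.
Proof. by move=> rs; rewrite size_cat size_take size_drop rs; lia. Qed.

(** The pairs (i, i + k) that straddle rank r: deleting rank r turns such a pair into (i, i + k +
    1). *)
Let win k r i := ((i < r) && (r <= i + k))%N.

(** Pairs left of r are untouched and pairs right of r are shifted by one; what remains is one lost
    term and the pairs that straddle r. The lost term is taken at [minn r M] because M is the last
    index of the sum. *)
Lemma locsum_del dl k s r M : (0 < k)%N -> size s = (M.+1 + k)%N -> (r < size s)%N ->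
  let a i := dl (nth 0 s i) (nth 0 s (i + k)) in
  let c i := dl (nth 0 s i) (nth 0 s (i + k.+1)) in
  locsum dl k s - locsum dl k (del r s) =
  a (minn r M) + \sum_(i <- iota 0 M | win k r i) (a i - c i).
Proof.
move=> k0 sz rs a c.
rewrite /locsum size_del// sz addnK (_ : ((M.+1 + k).-1 - k = M)%N); last by lia.
pose p := minn r M; have pM : (p <= M)%N by rewrite geq_minr.
have -> : \sum_(0 <= i < M.+1) dl (nth 0 s i) (nth 0 s (i + k)) =
    a p + \sum_(0 <= i < M) a (bump p i).
  rewrite (@big_cat_nat _ _ _ p)/= ?leqW// (@big_ltn _ _ _ p)//=.
  rewrite addrCA; congr (_ + _).
  rewrite [in RHS](@big_cat_nat _ _ _ p)//=; congr (_ + _).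
    by apply: eq_big_nat => i /andP[_ ip]; rewrite /bump leqNgt ip.
  rewrite big_add1 /=; apply: eq_big_nat => i /andP[ip _].
  by rewrite /bump ip add1n.
rewrite -addrA; congr (_ + _).
rewrite -sumrB [RHS]big_mkcond/= [in RHS](_ : iota 0 M = index_iota 0 M); last first.
  by rewrite /index_iota subn0.
apply: eq_big_nat => i /andP[_ iM].
rewrite !nth_del// /win /a /c /p /bump.
case: (ltnP i r) => ir /=.
  have -> : (minn r M <= i)%N = false by rewrite leqNgt; lia.
  rewrite !add0n; case: (leqP r (i + k)) => irk /=; last by rewrite !add0n subrr.
  by rewrite add1n addnS.
have -> : (minn r M <= i)%N by lia.
have -> : (r <= i + k)%N by lia.
by rewrite !add1n addSn subrr.
Qed.

Lemma size_win k r M : (size [seq i <- iota 0 M | win k r i] <= k)%N.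
Proof.
have h : {subset [seq i <- iota 0 M | win k r i] <= iota (r - k) k}.
  by move=> i; rewrite mem_filter !mem_iota /win => /andP[/andP[? ?] ?]; lia.
rewrite -[leqRHS](size_iota (r - k) k); apply: uniq_leq_size h.
by rewrite filter_uniq// iota_uniq.
Qed.

Lemma count_win k i n : (size [seq r <- iota 0 n | win k r i] <= k)%N.
Proof.
have h : {subset [seq r <- iota 0 n | win k r i] <= iota i.+1 k}.
  by move=> j; rewrite mem_filter !mem_iota /win => /andP[/andP[? ?] ?]; lia.
rewrite -[leqRHS](size_iota i.+1 k); apply: uniq_leq_size h.
by rewrite filter_uniq// iota_uniq.
Qed.

(** Cauchy-Schwarz over at most 2k + 1 terms gives one factor 2k + 1. The other counts repetitions:
    a pair straddles at most k ranks, and the last term is the lost one for k + 1 ranks. *)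
Lemma sum_locsum_del dl k s : (0 < k)%N ->
  \sum_(0 <= r < size s) (locsum dl k s - locsum dl k (del r s)) ^+ 2 <=
  (2 * k%:R + 1) ^+ 2 *
  (locsum (fun x y => dl x y ^+ 2) k s + locsum (fun x y => dl x y ^+ 2) k.+1 s).
Proof.
move=> k0.
have ls0 k' : 0 <= locsum (fun x y => dl x y ^+ 2) k' s.
  by apply: sumr_ge0 => i _; exact: sqr_ge0.
have [sk|ks] := leqP (size s) k.
  rewrite big_nat_cond big1 ?mulr_ge0 ?addr_ge0 ?sqr_ge0// => r /andP[/andP[_ rs] _].
  rewrite /locsum size_del// !big_geq ?subrr ?expr0n//; lia.
pose M := (size s - k).-1.
have sz : size s = (M.+1 + k)%N by rewrite /M; lia.
pose a i := dl (nth 0 s i) (nth 0 s (i + k)).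
pose c i := dl (nth 0 s i) (nth 0 s (i + k.+1)).
set K := 2 * k%:R + 1.
have K0 : 0 <= K by rewrite /K addr_ge0// mulr_ge0.
pose Q := \sum_(0 <= i < M.+1) a i ^+ 2; pose Q' := \sum_(0 <= i < M) c i ^+ 2.
have -> : locsum (fun x y => dl x y ^+ 2) k s = Q by rewrite /locsum sz addnK.
have -> : locsum (fun x y => dl x y ^+ 2) k.+1 s = Q'.
  by rewrite /locsum sz (_ : ((M.+1 + k) - k.+1 = M)%N)//; lia.
have B r : (r < size s)%N -> (locsum dl k s - locsum dl k (del r s)) ^+ 2 <=
    K * (a (minn r M) ^+ 2 + \sum_(i <- iota 0 M | win k r i) (a i ^+ 2 + c i ^+ 2)).
  move=> rs; rewrite (locsum_del dl k0 sz rs) -/a -/c.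
  set l := [seq i <- iota 0 M | win k r i].
  have -> : \sum_(i <- iota 0 M | win k r i) (a i - c i) = \sum_(i <- l) (a i - c i).
    by rewrite big_filter.
  have -> : \sum_(i <- iota 0 M | win k r i) (a i ^+ 2 + c i ^+ 2) =
      \sum_(i <- l) (a i ^+ 2 + c i ^+ 2) by rewrite big_filter.
  pose x := a (minn r M) :: [seq a i | i <- l] ++ [seq - c i | i <- l].
  have := sqr_sum_le x id.
  have -> : \sum_(i <- x) id i = a (minn r M) + \sum_(i <- l) (a i - c i).
    by rewrite /x big_cons big_cat/= !big_map sumrB sumrN.
  have -> : \sum_(i <- x) id i ^+ 2 = a (minn r M) ^+ 2 + \sum_(i <- l) (a i ^+ 2 + c i ^+ 2).
    rewrite /x big_cons big_cat/= !big_map big_split/=; congr (_ + (_ + _)).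
    by apply: eq_bigr => i _; rewrite sqrrN.
  move=> /le_trans; apply; apply: ler_wpM2r.
    by rewrite addr_ge0 ?sqr_ge0// sumr_ge0// => i _; rewrite addr_ge0 ?sqr_ge0.
  rewrite /x /= size_cat !size_map -natr1 lerD2r natrD.
  have : (size l)%:R <= k%:R :> R by rewrite ler_nat size_win.
  by lra.
apply: (@le_trans _ _ (\sum_(0 <= r < size s)
    K * (a (minn r M) ^+ 2 + \sum_(i <- iota 0 M | win k r i) (a i ^+ 2 + c i ^+ 2)))).
  by apply: ler_sum_nat => r /andP[_ rs]; exact: B.
rewrite -mulr_sumr expr2 -mulrA ler_wpM2l// big_split/=.
have Q0 : 0 <= Q by apply: sumr_ge0 => i _; exact: sqr_ge0.
have Q'0 : 0 <= Q' by apply: sumr_ge0 => i _; exact: sqr_ge0.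
have aM : a M ^+ 2 <= Q.
  by rewrite /Q big_nat_recr//= lerDr sumr_ge0// => i _; exact: sqr_ge0.
have H1 : \sum_(0 <= r < size s) a (minn r M) ^+ 2 <= (k%:R + 1) * Q.
  rewrite (@big_cat_nat _ _ _ M.+1)/= ?sz ?leq_addr// mulrDl mul1r addrC lerD//.
    rewrite big_nat_cond (eq_bigr (fun=> a M ^+ 2)); last first.
      by move=> r /andP[/andP[Mr _] _]; rewrite (minn_idPr _)// ltnW.
    rewrite -big_nat_cond sumr_const_nat addKn -[a M ^+ 2 *+ k]mulr_natl.
    by rewrite ler_wpM2l.
  rewrite le_eqVlt; apply/orP; left; apply/eqP.
  by apply: eq_big_nat => r /andP[_ rM]; rewrite (minn_idPl _).
have H2 : \sum_(0 <= r < size s) \sum_(i <- iota 0 M | win k r i) (a i ^+ 2 + c i ^+ 2) <=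
    k%:R * (Q + Q').
  under eq_bigr do rewrite big_mkcond/=.
  rewrite exchange_big/=.
  apply: (@le_trans _ _ (\sum_(i <- iota 0 M) k%:R * (a i ^+ 2 + c i ^+ 2))).
    apply: ler_sum => i _; rewrite -big_mkcond/= -big_filter.
    rewrite big_const_seq count_predT iter_addr_0 -[_ *+ _]mulr_natl ler_wpM2r//.
      by rewrite addr_ge0 ?sqr_ge0.
    by rewrite ler_nat /index_iota subn0 count_win.
  rewrite -mulr_sumr ler_wpM2l// big_split/= lerD//.
    rewrite /Q big_nat_recr//= /index_iota subn0 lerDl sqr_ge0//.
  by rewrite /Q' /index_iota subn0.
apply: (le_trans (lerD H1 H2)); rewrite /K.
have : 0 <= k%:R * Q' + Q' :> R by rewrite addr_ge0// mulr_ge0.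
by nra.
Qed.

End local_sums.

Section deletion.
Context (R : realType).
Implicit Types (s : seq R).

Lemma perm_del r s : (r < size s)%N -> perm_eq (nth 0 s r :: del r s) s.
Proof.
move=> rs; rewrite /del -[X in perm_eq _ X](cat_take_drop r s) (drop_nth 0 rs).
by rewrite -cat1s perm_catCA.
Qed.

Lemma sort_del r s : (r < size s)%N -> sorted <=%R s -> sort <=%R (del r s) = del r s.
Proof.
move=> rs ss; apply: sort_le_id; apply: (subseq_sorted le_trans _ ss).
rewrite /del -[X in subseq _ X](cat_take_drop r s) cat_subseq//.
by rewrite (drop_nth 0 rs) subseq_cons.
Qed.

(** Deleting each sample point once deletes each rank once. Ties do no harm, since only the multiset
    of values matters. *)
Lemma sum_delete (l : seq nat) (x : nat -> R) (Psi : seq R -> R) :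
  uniq l ->
  \sum_(i <- l) Psi (sort <=%R [seq x j | j <- rem i l]) =
  \sum_(0 <= q < size l) Psi (del q (sort <=%R [seq x j | j <- l])).
Proof.
move=> ul; set s := sort _ _.
have sE u v : perm_eq u v -> sort <=%R u = sort <=%R v :> seq R.
  by move=> uv; apply/(perm_sortP le_total le_trans le_anti).
have szs : size s = size l by rewrite /s size_sort size_map.
have ss : sorted <=%R s by apply: sort_sorted; exact: le_total.
pose G v := Psi (sort <=%R (rem v s)).
transitivity (\sum_(i <- l) G (x i)).
  rewrite big_seq [RHS]big_seq; apply: eq_bigr => i il; congr Psi; apply: sE.
  rewrite -(perm_cons (x i)).
  have xs : x i \in s by rewrite mem_sort; apply/mapP; exists i.
  have h1 := perm_to_rem xs; have h2 := perm_map x (perm_to_rem il).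
  rewrite (perm_trans _ h1)// perm_sym (perm_trans _ h2)//.
  by rewrite /s perm_sort.
transitivity (\sum_(v <- s) G v).
  by rewrite -(big_map x xpredT G); apply: perm_big; rewrite perm_sym perm_sort.
rewrite (big_nth 0) szs; apply: eq_big_nat => q /andP[_ ql].
have qs : (q < size s)%N by rewrite szs.
rewrite /G; congr Psi; rewrite -(sort_del qs ss); apply: sE.
rewrite -(perm_cons (nth 0 s q)).
have := perm_to_rem (mem_nth 0 qs) => h1.
by rewrite perm_sym (perm_trans (perm_del qs)).
Qed.

End deletion.

Section variance_of_local_sums.
Context d (T : measurableType d) (R : realType) (P : probability T R).

Lemma measurable_locsum d' (Om : measurableType d') I (l : seq I) (v : I -> Om -> R)
    (dl : R -> R -> R) k :
  measurable_fun [set: R * R] (fun p : R * R => dl p.1 p.2) ->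
  (forall j, measurable_fun [set: Om] (v j)) ->
  measurable_fun [set: Om] (fun w => locsum dl k (sort <=%R [seq v j w | j <- l])).
Proof.
move=> mdl mv; rewrite /locsum.
under eq_fun do rewrite size_sort size_map.
apply: measurable_sum => i.
have h : measurable_fun [set: Om] (fun w => (nth 0 (sort <=%R [seq v j w | j <- l]) i,
    nth 0 (sort <=%R [seq v j w | j <- l]) (i + k))).
  by apply: measurable_fun_pair; exact: measurable_nth_sort.
exact: (measurableT_comp mdl h).
Qed.

(** In the Efron-Stein inequality the function free of coordinate i is the local sum of the sample
    without point i; the sum over i becomes a sum over deleted ranks. *)
Lemma Var_locsum n (X : nat -> T -> R) (dl : R -> R -> R) k (C : R) :
  (forall i, measurable_fun [set: T] (X i)) -> indep P (n + n) X ->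
  (forall i j A, measurable A -> P (X i @^-1` A) = P (X j @^-1` A)) ->
  measurable_fun [set: R * R] (fun p : R * R => dl p.1 p.2) ->
  (forall x y, `|dl x y| <= C) -> (0 < k)%N ->
  Var P (fun w => locsum dl k (sort <=%R [seq X j w | j <- iota 0 n])) <=
  2 * (2 * k%:R + 1) ^+ 2 *
  Ex P (fun w =>
    locsum (fun x y => dl x y ^+ 2) k (sort <=%R [seq X j w | j <- iota 0 n]) +
    locsum (fun x y => dl x y ^+ 2) k.+1 (sort <=%R [seq X j w | j <- iota 0 n])).
Proof.
move=> mX iX dX mdl bdl k0; pose s w := sort <=%R [seq X j w | j <- iota 0 n].
have C0 : 0 <= C by rewrite (le_trans _ (bdl 0 0)).
pose D (x : nat -> R) := locsum dl k (sort <=%R [seq x j | j <- iota 0 n]).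
pose DD i (x : nat -> R) := locsum dl k (sort <=%R [seq x j | j <- rem i (iota 0 n)]).
have bL l : `|locsum dl k l| <= (size l)%:R * C.
  rewrite /locsum (le_trans (ler_norm_sum _ _ _))//.
  apply: (@le_trans _ _ (\sum_(0 <= i < size l - k) C)); first exact: ler_sum.
  by rewrite sumr_const_nat subn0 -[_ *+ _]mulr_natl ler_wpM2r// ler_nat leq_subr.
have bD x : `|D x| <= n%:R * C.
  by rewrite (le_trans (bL _))// size_sort size_map size_iota.
have bDD i x : `|DD i x| <= n%:R * C.
  rewrite (le_trans (bL _))// size_sort size_map ler_wpM2r// ler_nat.
  by rewrite -[leqRHS](size_iota 0 n); apply: size_subseq; exact: rem_subseq.
(* Coordinates from n on are set to 0: only the first n are measurable for this sigma-algebra. *)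
pose xx j (x : nat -> R) : R := if (j < n)%N then x j else 0.
have mxx j : measurable_fun [set: g_sigma_algebraType (gens `I_n (@coords R))] (xx j).
  rewrite /xx; case jn : (j < n)%N => //.
  exact: (@sg_coord _ R `I_n (@coords R)).
have mL l : {subset l <= iota 0 n} ->
    measurable_fun [set: g_sigma_algebraType (gens `I_n (@coords R))]
    (fun x => locsum dl k (sort <=%R [seq x j | j <- l])).
  move=> ln; rewrite (_ : (fun x => _) = fun x => locsum dl k (sort <=%R [seq xx j x | j <- l])).
    exact: measurable_locsum.
  apply/funext => x; congr (locsum _ _ (sort _ _)); apply/eq_in_map => j /ln.
  by rewrite mem_iota add0n /xx => /andP[_ ->].
have mD : measurable_fun [set: g_sigma_algebraType (gens `I_n (@coords R))] D.
  exact: mL.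
have mDD i : measurable_fun [set: g_sigma_algebraType (gens `I_n (@coords R))] (DD i).
  by apply: mL => j; exact: mem_rem.
have hDD i x y : (i < n)%N -> (forall j, (j < n)%N -> j != i -> x j = y j) ->
    DD i x = DD i y.
  move=> ilt xy; congr (locsum _ _ (sort _ _)); apply/eq_in_map => j.
  rewrite mem_rem_uniq ?iota_uniq// inE mem_iota add0n => /andP[ji /andP[_ jn]].
  exact: xy.
apply: (le_trans (efron_stein mX iX dX mD mDD bD bDD hDD)).
rewrite -mulrA; apply: ler_wpM2l => //.
have mDx : measurable_fun [set: T] (fun w => D (fun j => X j w)).
  exact: measurable_locsum.
have mDDx i : measurable_fun [set: T] (fun w => DD i (fun j => X j w)).
  exact: measurable_locsum.
have h1 i : L1 P (fun w => (D (fun j => X j w) - DD i (fun j => X j w)) ^+ 2).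
  apply: (L2B (Y := fun w => D (fun j => X j w)) _ _).2.
    by apply: (@L2_bounded _ _ _ P (n%:R * C) _ mDx) => w; exact: bD.
  by apply: (@L2_bounded _ _ _ P (n%:R * C) _ (mDDx i)) => w; exact: bDD.
have h2 k' : L1 P (fun w => locsum (fun x y => dl x y ^+ 2) k' (s w)).
  apply: (@L1_bounded _ _ _ _ (n%:R * C ^+ 2)).
    apply: measurable_locsum => //; exact: measurable_funX.
  move=> w; rewrite /locsum (le_trans (ler_norm_sum _ _ _))//.
  apply: (@le_trans _ _ (\sum_(0 <= i < size (s w) - k') C ^+ 2)).
    apply: ler_sum => i _; rewrite normrX ler_pXn2r// nnegrE//.
  rewrite sumr_const_nat subn0 -[_ *+ _]mulr_natl ler_wpM2r ?sqr_ge0// ler_nat.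
  by rewrite (leq_trans (leq_subr _ _))// size_sort size_map size_iota.
have h3 := ExZ ((2 * k%:R + 1) ^+ 2) (L1D (h2 k) (h2 k.+1)); rewrite -h3.
have es := @Ex_sum _ T R P 'I_n (index_enum 'I_n) xpredT
  (fun (i : 'I_n) w => (D (X^~ w) - DD i (X^~ w)) ^+ 2) (fun i _ => h1 i).
rewrite -es; apply: Ex_le.
- by apply: L1_sum => i _.
- by apply: L1Z; exact: L1D.
move=> w; have := sum_locsum_del dl (s w) k0.
have szs : size (s w) = n by rewrite size_sort size_map size_iota.
apply: le_trans; rewrite szs.
pose Psi l := (locsum dl k (s w) - locsum dl k l) ^+ 2.
have := sum_delete (fun j => X j w) Psi (iota_uniq 0 n).
rewrite size_iota => <-.
rewrite -(big_mkord xpredT (fun i => (D (X^~ w) - DD i (X^~ w)) ^+ 2)).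
by rewrite /index_iota subn0.
Qed.

End variance_of_local_sums.

Lemma derive_bound_lipschitz (R : realType) (F F1 : R -> R) (c : R) :
  (forall x : R, is_derive x 1 F (F1 x)) ->
  (forall x, `|F1 x| <= c) -> forall x y, `|F x - F y| <= c * `|x - y|.
Proof.
move=> dF bF; suff H x y : x < y -> `|F x - F y| <= c * `|x - y|.
  move=> x y; have [/H//|/H|->] := ltgtP x y; last by rewrite !subrr normr0 mulr0.
  by rewrite (distrC (F x)) (distrC x).
move=> xy; rewrite (distrC (F x)) (distrC x).
have [z _ ->] : exists2 z, z \in `]x, y[%R & F y - F x = F1 z * (y - x).
  apply: MVT => //; apply: continuous_subspaceT => z.
  by apply: differentiable_continuous; apply/derivable1_diffP; have := dF z => ?; exact: ex_derive.
by rewrite normrM ler_wpM2r.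
Qed.

(** * Stein's method *)

Section stein_equation.
Context (R : realType).
Notation mu := (@lebesgue_measure R).
Variable v : R.
Hypothesis v_gt0 : 0 < v.
Let s := Num.sqrt v.
Let p := normal_pdf 0 s : R -> R.

Let s_neq0 : s != 0. Proof. by rewrite gt_eqF// sqrtr_gt0. Qed.
Let sqr_s : s ^+ 2 = v. Proof. by rewrite sqr_sqrtr// ltW. Qed.

Let pE (x : R) : p x = normal_peak s * expR (- (x ^+ 2) / (v *+ 2)).
Proof.
by rewrite /p normal_pdfE//= /normal_fun sqr_s subr0.
Qed.

Let p_gt0 (x : R) : 0 < p x.
Proof. by rewrite pE mulr_gt0 ?expR_gt0// normal_peak_gt0. Qed.

Let p_even (x : R) : p (- x) = p x. Proof. by rewrite !pE sqrrN. Qed.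

Let p_derive (x : R) : is_derive x 1 p (- (x / v) * p x).
Proof.
have -> : p = fun x => normal_peak s * expR (- (x ^+ 2) / (v *+ 2)).
  by apply/funext => y; rewrite pE.
apply: is_derive_eq; rewrite /GRing.scale/=.
have v0 : v != 0 by rewrite gt_eqF.
by field.
Qed.

Let p_le (x : R) : p x <= normal_peak s.
Proof. exact: normal_pdf_ub. Qed.

Let p_cont : continuous p.
Proof. exact: continuous_normal_pdf. Qed.

Let p_int : mu.-integrable setT (EFin \o p).
Proof. exact: integrable_normal_pdf. Qed.

Let p_cvg0 : p x @[x --> +oo] --> (0 : R).
Proof.
apply: (@squeeze_cvgr _ _ _ _ (fun=> 0) (fun x => normal_peak s * expR (- ((v *+ 2)^-1 * x)))).
- near=> x; rewrite ltW//= pE ler_wpM2l ?normal_peak_ge0// ler_expR.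
  rewrite mulNr lerN2 mulrC ler_wpM2r// ?invr_ge0 ?mulrn_wge0 ?(ltW v_gt0)//.
  have x1 : 1 <= x by near: x; exact: nbhs_pinfty_ge.
  by rewrite expr2 ler_peMl// (le_trans ler01).
- exact: cvg_cst.
- rewrite -(mulr0 (normal_peak s)); apply: cvgM; first exact: cvg_cst.
  by apply: cvg_expRNM; rewrite invr_gt0 mulrn_wgt0.
Unshelve. all: by end_near. Qed.

Let Q (x : R) := \int[mu]_(y in `[x, +oo[) p y.

Let p_intS D : measurable D -> mu.-integrable D (EFin \o p).
Proof. by move=> mD; apply: integrableS p_int. Qed.

(** Mills' ratio: x <= y on the tail, and y p(y) has the primitive - v p(y). *)
Let Q_le (x : R) : 0 <= x -> x * Q x <= v * p x.
Proof.
move=> x0; rewrite -lee_fin.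
have e : (\int[mu]_(y in `[x, +oo[) (y * p y)%:E = 0%:E - (- v * p x)%:E)%E.
  apply: (@ge0_continuous_FTC2y _ _ (fun y => - v * p y)).
  - by move=> y xy; apply: mulr_ge0; [exact: le_trans xy|exact: ltW].
  - apply: continuous_subspaceT => y; apply: cvgM; [exact: cvg_id|exact: p_cont].
  - by rewrite -(mulr0 (- v)); apply: cvgM; [exact: cvg_cst|exact: p_cvg0].
  - move=> y _; have := p_derive y => ?; exact: ex_derive.
  - apply: cvg_at_right_filter; apply: cvgM; [exact: cvg_cst|exact: p_cont].
  - move=> y _; rewrite derive1E; have := p_derive y => ?.
    rewrite derive_val /GRing.scale/=; have v0 : v != 0 by rewrite gt_eqF.
    by field.
have {e}e : (\int[mu]_(y in `[x, +oo[) (y * p y)%:E = (v * p x)%:E)%E.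
  by rewrite e -EFinB; congr EFin; ring.
rewrite -e EFinM /Q /Rintegral fineK ?integrable_fin_num//; last exact: p_intS.
rewrite -ge0_integralZl//=; last 2 first.
- by apply/measurable_EFinP; apply: measurable_funTS; exact: measurable_normal_pdf.
- by move=> y _; rewrite lee_fin ltW.
apply: ge0_le_integral => //=.
- by move=> y _; rewrite lee_fin mulr_ge0// ltW.
- apply/measurable_EFinP; apply: measurable_funTS; apply: measurable_funM => //.
  exact: measurable_normal_pdf.
- apply/measurable_EFinP; apply: measurable_funTS; apply: measurable_funM => //.
  exact: measurable_normal_pdf.
- by move=> y; rewrite in_itv/= andbT => xy; rewrite lee_fin ler_wpM2r// ltW.
Qed.

Let Q_ge0 (x : R) : 0 <= Q x.
Proof. by apply: Rintegral_ge0 => y _; rewrite ltW. Qed.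

Let p_int1 : (\int[mu]_y (p y)%:E = 1)%E.
Proof. exact: integral_normal_pdf. Qed.

Let Q_le1 (x : R) : Q x <= 1.
Proof.
rewrite -lee_fin /Q /Rintegral fineK ?integrable_fin_num//; last exact: p_intS.
rewrite -p_int1; apply: ge0_subset_integral => //=.
- by apply/measurable_EFinP; exact: measurable_normal_pdf.
- by move=> y _; rewrite lee_fin ltW.
Qed.

Let C0 := v + (p 1)^-1.

(** For x >= 1 the previous bound applies, as Q x <= x Q x; below 1, Q x <= 1 <= p x / p 1. *)
Let Q_leC (x : R) : 0 <= x -> Q x <= C0 * p x.
Proof.
move=> x0; rewrite /C0 mulrDl; have [x1|x1] := leP 1 x.
  rewrite (@le_trans _ _ (v * p x))//; last first.
    by rewrite lerDl mulr_ge0 ?invr_ge0// ltW.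
  by rewrite (le_trans _ (Q_le x0))// ler_peMl.
rewrite (le_trans (Q_le1 x))// -[1]add0r lerD//.
  by rewrite mulr_ge0// ltW.
rewrite mulrC ler_pdivlMr// mul1r !pE ler_wpM2l ?normal_peak_ge0// ler_expR.
rewrite !mulNr lerN2 ler_wpM2r ?invr_ge0 ?mulrn_wge0 ?(ltW v_gt0)//.
by rewrite ler_pXn2r// ?nnegrE ?addr_ge0// ?add0r ltW.
Qed.

Let Qneg (x : R) : \int[mu]_(y in `]-oo, x]) p y = Q (- x).
Proof.
rewrite /Q /Rintegral; congr fine.
have := @ge0_integration_by_substitutionNy R p (- x); rewrite opprK => ->.
- by apply: eq_integral => y _ /=; rewrite p_even.
- exact: continuous_subspaceT.
- by move=> y _; rewrite ltW.
Qed.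

Section solution.
Variables (h : R -> R) (B L : R).
Hypothesis h_bd : forall x, `|h x| <= B.
Hypothesis h_lip : forall x y, `|h x - h y| <= L * `|x - y|.

Let N : R := \int[mu]_y (h y * p y).
Let hb (x : R) := h x - N.

Let B_ge0 : 0 <= B. Proof. exact: le_trans (h_bd 0). Qed.
Let L_ge0 : 0 <= L.
Proof. by have := h_lip 1 0; rewrite subr0 normr1 mulr1; exact: le_trans. Qed.

Let h_cont : continuous h.
Proof.
move=> x; apply/cvgrPdist_le => e e0; near=> y.
rewrite (le_trans (h_lip x y))//.
rewrite (@le_trans _ _ ((L + 1) * `|x - y|))//.
  by rewrite ler_wpM2r// lerDl.
rewrite mulrC -ler_pdivlMr ?ltr_wpDl//.
near: y; apply: cvgr_dist_le => //; by rewrite divr_gt0// ltr_wpDl.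
Unshelve. all: by end_near. Qed.

Let mh : measurable_fun setT h. Proof. exact: continuous_measurable_fun. Qed.

Let mp : measurable_fun setT p. Proof. exact: measurable_normal_pdf. Qed.

Let hp_int : mu.-integrable setT (EFin \o (fun y => h y * p y)).
Proof.
have i : mu.-integrable setT (fun y => B%:E * (p y)%:E)%E by exact: integrableZl.
apply: (le_integrable _ _ _ i) => //=.
  by apply/measurable_EFinP; exact: measurable_funM.
by move=> y _; rewrite lee_fin !normrM (ger0_norm B_ge0) ler_wpM2r.
Qed.

Let N_le : `|N| <= B.
Proof.
rewrite (le_trans (le_normr_Rintegral _ _))//.
have e : B = \int[mu]_y (B * p y).
  by rewrite RintegralZl// /Rintegral p_int1 mulr1.
rewrite [leRHS]e; apply: le_Rintegral => //.
- by have := integrable_abse hp_int.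
- by have := integrableZl measurableT B p_int.
- by move=> y _ /=; rewrite normrM (gtr0_norm (p_gt0 y)) ler_wpM2r// ltW.
Qed.

Let hb_le (x : R) : `|hb x| <= 2 * B.
Proof. by rewrite (le_trans (ler_normB _ _))// mulr_natl mulr2n lerD// N_le. Qed.

Let hbp_int : mu.-integrable setT (EFin \o (fun y => hb y * p y)).
Proof.
have i : mu.-integrable setT (fun y => (2 * B)%:E * (p y)%:E)%E by exact: integrableZl.
apply: (le_integrable _ _ _ i) => //=.
  by apply/measurable_EFinP; apply: measurable_funM => //; exact: measurable_funB.
move=> y _; rewrite lee_fin !normrM (ger0_norm B_ge0) normr_nat ler_wpM2r// ?hb_le.
Qed.

Let hbp_intS D : measurable D -> mu.-integrable D (EFin \o (fun y => hb y * p y)).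
Proof. by move=> mD; apply: integrableS hbp_int. Qed.

Let U (x : R) := \int[mu]_(y in `]-oo, x]) (hb y * p y).

Let U_le D : measurable D -> `|\int[mu]_(y in D) (hb y * p y)| <= 2 * B * \int[mu]_(y in D) p y.
Proof.
move=> mD; rewrite (le_trans (le_normr_Rintegral _ _))//; first exact: hbp_intS.
rewrite -RintegralZl//; last exact: p_intS.
apply: le_Rintegral => //.
- by have := integrable_abse (hbp_intS mD).
- by have := integrableZl mD (2 * B) (p_intS mD).
- by move=> y _ /=; rewrite normrM (gtr0_norm (p_gt0 y)) ler_wpM2r ?hb_le// ltW.
Qed.

Let hbp0 : \int[mu]_y (hb y * p y) = 0.
Proof.
have -> : (fun y => hb y * p y) = (fun y => h y * p y - N * p y).
  by apply/funext => y; rewrite /hb mulrBl.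
rewrite RintegralB//; last by have := integrableZl measurableT N p_int.
rewrite RintegralZl// [X in _ - N * X](_ : _ = 1) ?mulr1 ?subrr//.
by rewrite /Rintegral p_int1.
Qed.

(** [hb] has mean 0 under the normal law, so for x >= 0 the integral up to x is minus the integral
    over the right tail; in both cases only the tail beyond |x| counts. *)
Let U_leQ (x : R) : `|U x| <= 2 * B * Q `|x|.
Proof.
have [x0|x0] := leP 0 x.
  have -> : U x = - \int[mu]_(y in `]x, +oo[) (hb y * p y).
    have := @Rintegral_itvB _ (fun y => hb y * p y) -oo%O +oo%O x.
    rewrite set_itvNyy hbp0 => <- //.
    by rewrite sub0r opprK.
  rewrite normrN Rintegral_itv_obnd_cbnd; last exact: hbp_intS.
  by rewrite (ger0_norm x0); exact: U_le.
by rewrite (ltr0_norm x0) (le_trans (U_le _))// Qneg.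
Qed.

(** [f] solves v f' = x f + h - N, the Stein equation of the centred normal law of variance v; [f1]
    is the derivative read off from the equation. *)
Let f (x : R) := U x / (v * p x).
Let f1 (x : R) := (hb x + x * f x) / v.

Let hbp_cont (x : R) : {for x, continuous (fun y => hb y * p y)}.
Proof.
apply: cvgM; last exact: p_cont.
by apply: cvgB; [exact: h_cont|exact: cvg_cst].
Qed.

Let U_derive (x : R) : is_derive x 1 U (hb x * p x).
Proof.
have [|||d e] := @continuous_FTC1 R (fun y => hb y * p y) -oo%O x (x + 1) _ _ _ (@hbp_cont x).
- by rewrite ltrDl.
- exact: hbp_intS.
- by rewrite ltNyr.
by apply: (DeriveDef d); rewrite -derive1E; exact: e.
Qed.

Let f_derive (x : R) : is_derive x 1 f (f1 x).
Proof.
have ? := p_derive x; have ? := U_derive x.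
have v0 : v != 0 by rewrite gt_eqF.
have p0 : p x != 0 by rewrite gt_eqF.
have vp : v * p x != 0 by rewrite mulf_neq0.
have dV : is_derive x 1 (fun y => (v * p y)^-1) (- (v * p x) ^- 2 *: (v * (- (x / v) * p x))).
  by apply: is_deriveV.
have -> : f = (U * (fun y => (v * p y)^-1))%R by [].
apply: is_derive_eq; rewrite /GRing.scale/= /f1 /f.
by field; rewrite v0 p0.
Qed.

Let C0_ge0 : 0 <= C0.
Proof. by rewrite addr_ge0 ?invr_ge0// ltW. Qed.

Let p_norm (x : R) : p `|x| = p x.
Proof. by case: (ger0P x) => // _; rewrite p_even. Qed.

Let f_normE (x : R) : `|f x| = `|U x| / (v * p x).
Proof. by rewrite /f normrM normfV (@ger0_norm _ (v * p x))// mulr_ge0// ltW. Qed.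

Let f_le (x : R) : `|f x| <= 2 * B * C0 / v.
Proof.
have v0 : v != 0 by rewrite gt_eqF.
rewrite f_normE ler_pdivrMr ?mulr_gt0// (le_trans (U_leQ x))//.
have -> : 2 * B * C0 / v * (v * p x) = 2 * B * (C0 * p `|x|).
  by rewrite p_norm; field.
by rewrite ler_wpM2l ?mulr_ge0 ?Q_leC.
Qed.

Let xf_le (x : R) : `|x * f x| <= 2 * B.
Proof.
rewrite normrM f_normE mulrA ler_pdivrMr ?mulr_gt0//.
rewrite (@le_trans _ _ (`|x| * (2 * B * Q `|x|)))//.
  by rewrite ler_wpM2l// U_leQ.
by rewrite mulrCA ler_wpM2l ?mulr_ge0// -(p_norm x) Q_le.
Qed.

Let f1_le (x : R) : `|f1 x| <= 4 * B / v.
Proof.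
rewrite /f1 normrM normfV (gtr0_norm v_gt0) ler_wpM2r ?invr_ge0 ?(ltW v_gt0)//.
rewrite (le_trans (ler_normD _ _))// (_ : 4 * B = 2 * B + 2 * B); last by ring.
by rewrite lerD// ?hb_le ?xf_le.
Qed.

(** Through the term x F x of the equation, the modulus of continuity of [F1] grows linearly, hence
    the factor 1 + |x|. [C] is simply the sum of the constants met. *)
Lemma stein_solution : exists (F F1 : R -> R) (C : R),
  [/\ 0 <= C,
    forall x : R, is_derive x 1 F (F1 x),
    (forall x, v * F1 x = x * F x + h x - N),
    (forall x, `|F x| <= C /\ `|F1 x| <= C) &
    forall x y, `|F1 x - F1 y| <= C * (1 + `|x|) * `|x - y|].
Proof.
pose c1 := 4 * B / v; pose c2 := 2 * B * C0 / v.
have v0 : v != 0 by rewrite gt_eqF.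
have vi0 : 0 <= v^-1 by rewrite invr_ge0 ltW.
have c10 : 0 <= c1 by rewrite !mulr_ge0.
have c20 : 0 <= c2 by rewrite !mulr_ge0.
pose c3 := c1 / v; have c30 : 0 <= c3 by rewrite mulr_ge0.
pose c4 := c2 / v; have c40 : 0 <= c4 by rewrite mulr_ge0.
pose c5 := L / v; have c50 : 0 <= c5 by rewrite mulr_ge0.
exists f, f1, (c1 + c2 + c3 + c4 + c5); split => //.
- by rewrite !addr_ge0.
- by move=> x; rewrite /f1 /hb; field.
- move=> x; split.
    rewrite (le_trans (f_le x))// -/c2; lra.
  rewrite (le_trans (f1_le x))// -/c1; lra.
- move=> x y.
  have e : f1 x - f1 y = v^-1 * ((h x - h y) + (x * (f x - f y) + (x - y) * f y)).
    by rewrite /f1 /hb; field.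
  rewrite e normrM (ger0_norm vi0).
  have h1 := h_lip x y; have h2 := f_le y.
  have h3 := @derive_bound_lipschitz R f f1 c1 f_derive f1_le x y.
  have h4 : `|(h x - h y) + (x * (f x - f y) + (x - y) * f y)| <=
      L * `|x - y| + (`|x| * (c1 * `|x - y|) + `|x - y| * c2).
    rewrite (le_trans (ler_normD _ _))// lerD//.
    rewrite (le_trans (ler_normD _ _))// !(normrM _ (f _)) normrM lerD//.
      by rewrite ler_wpM2l.
    by rewrite ler_wpM2l.
  rewrite (le_trans (ler_wpM2l vi0 h4))//.
  have -> : v^-1 * (L * `|x - y| + (`|x| * (c1 * `|x - y|) + `|x - y| * c2)) =
     (c5 + `|x| * c3 + c4) * `|x - y| by rewrite /c5 /c3 /c4; ring.
  rewrite ler_wpM2r//.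
  have -> : (c1 + c2 + c3 + c4 + c5) * (1 + `|x|) =
    (c5 + `|x| * c3 + c4) + (c1 + c2 + c3 + `|x| * (c1 + c2 + c4 + c5)) by ring.
  by rewrite lerDl !addr_ge0// mulr_ge0// !addr_ge0.
Qed.
End solution.
End stein_equation.

Lemma size_near (r N i : nat) :
  (count (fun j => (i <= j + r) && (j <= i + r))%N (iota 0 N) <= 2 * r + 1)%N.
Proof.
rewrite -size_filter -[leqRHS](size_iota (i - r)); apply: uniq_leq_size.
  by rewrite filter_uniq// iota_uniq.
by move=> j; rewrite mem_filter !mem_iota; lia.
Qed.

Lemma ler_sum_near (R : realType) (r N i : nat) (F : nat -> R) (c : R) : 0 <= c ->
  (forall j, (j < N)%N -> `|F j| <= c) ->
  `|\sum_(j < N | (i <= j + r)%N && (j <= i + r)%N) F j| <= (2 * r + 1)%:R * c.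
Proof.
move=> c0 h; rewrite (le_trans (ler_norm_sum _ _ _))//.
rewrite (@le_trans _ _ (\sum_(j < N | (i <= j + r)%N && (j <= i + r)%N) c))//.
  by apply: ler_sum => j _; exact: h.
rewrite -(big_mkord (fun j => (i <= j + r)%N && (j <= i + r)%N) (fun=> c)) /index_iota subn0.
rewrite big_const_seq iter_addr_0 -[c *+ _]mulr_natl ler_wpM2r// ler_nat.
exact: size_near.
Qed.

(** The mean value theorem. The modulus [K] may depend on the base point x, as it does for solutions
    of the Stein equation. *)
Lemma second_order_bound (R : realType) (F F1 K : R -> R) :
  (forall x : R, is_derive x 1 F (F1 x)) ->
  (forall x y, `|F1 x - F1 y| <= K x * `|x - y|) -> (forall x, 0 <= K x) ->
  forall x t, `|F x - F (x - t) - t * F1 x| <= K x * t ^+ 2.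
Proof.
move=> dF lF K0 x t.
have cF (a b : R) : {within `[a, b], continuous F}.
  apply: continuous_subspaceT => z; apply: differentiable_continuous.
  by apply/derivable1_diffP; have := dF z => ?; exact: ex_derive.
have [z zt ->] : exists2 z, `|x - z| <= `|t| & F x - F (x - t) = t * F1 z.
  have [t0|t0|t0] := ltgtP 0 t; last by exists x; rewrite -t0 ?subrr ?normr0// subr0 mul0r subrr.
  - have [|z] := @MVT _ F F1 (x - t) x _ (fun z _ => dF z) (cF _ _); first by lra.
    rewrite in_itv/= => /andP[h1 h2] ez; exists z; last by rewrite ez; ring.
    by rewrite (gtr0_norm t0) ler_norml; lra.
  - have [|z] := @MVT _ F F1 x (x - t) _ (fun z _ => dF z) (cF _ _); first by lra.
    rewrite in_itv/= => /andP[h1 h2] ez; exists z; last by rewrite -[LHS]opprB ez; ring.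
    by rewrite (ltr0_norm t0) ler_norml; lra.
have -> : t * F1 z - t * F1 x = - (t * (F1 x - F1 z)) by ring.
rewrite normrN normrM.
have -> : K x * t ^+ 2 = `|t| * (K x * `|t|).
  by rewrite -[t ^+ 2]real_normK ?num_real//; ring.
by rewrite ler_wpM2l// (le_trans (lF _ _))// ler_wpM2l.
Qed.

Section absolute_value.
Context d (T : measurableType d) (R : realType) (P : probability T R).
Implicit Types Y : T -> R.

Lemma L2_norm Y : L2 P Y -> L2 P (fun w => `|Y w|).
Proof.
move=> [mY hY]; split; first exact: measurableT_comp.
by apply: eq_L1 hY => w; rewrite real_normK ?num_real.
Qed.

Lemma Ex_norm_le_nm Y : L2 P Y -> Ex P (fun w => `|Y w|) <= norm2 P Y.
Proof.
move=> hY; rewrite (le_trans (ler_norm _))// (le_trans (normr_Ex_le_nm (L2_norm hY)))//.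
by rewrite /norm2; under eq_Ex do rewrite real_normK ?num_real//.
Qed.

End absolute_value.

(** * Stein's method for sums of locally dependent variables *)

Section dependent_sums.
Context d (T : measurableType d) (R : realType) (P : probability T R).
Variables (n : nat) (e : nat -> T -> R).
Hypothesis me : forall i, measurable_fun [set: T] (e i).
Hypothesis ie : indep P n e.

Definition sgm (I : set nat) (Y : T -> R) : Prop :=
  measurable_fun [set: g_sigma_algebraType (gens I e)] Y.

(** Nonnegativity of the variances of Y + Z and Y - Z bounds 2 |Cov| by Var Y + Var Z. *)
Lemma normr_Cov_le (Y Z : T -> R) (c : R) : L2 P Y -> L2 P Z ->
  Var P Y <= c -> Var P Z <= c -> `|Cov P Y Z| <= c.
Proof.
move=> hY hZ vY vZ.
have h1 := Var_ge0 (L2D hY hZ); have h2 := Var_ge0 (L2B hY hZ).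
have e1 : Var P (fun w => Y w + Z w) = Var P Y + Var P Z + 2 * Cov P Y Z.
  rewrite /Var (CovDl hY hZ (L2D hY hZ)) (CovDr hY hZ hY) (CovDr hY hZ hZ) (CovC _ Z Y); ring.
have e2 : Var P (fun w => Y w - Z w) = Var P Y + Var P Z - 2 * Cov P Y Z.
  rewrite /Var (CovBl hY hZ (L2B hY hZ)) (CovBr hY hZ hY) (CovBr hY hZ hZ) (CovC _ Z Y); ring.
rewrite e1 in h1; rewrite e2 in h2; rewrite ler_norml; lra.
Qed.

Lemma Cov_indep (I J : set nat) (Y Z : T -> R) : I `<=` `I_n -> J `<=` `I_n ->
  I `&` J = set0 -> sgm I Y -> sgm J Z -> L2 P Y -> L2 P Z -> Cov P Y Z = 0.
Proof.
by move=> In Jn IJ sY sZ hY hZ; rewrite /Cov (indep_ExM me ie In Jn IJ sY sZ hY hZ) subrr.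
Qed.

(** Summands more than r apart are independent, so each has at most 2r + 1 correlated partners,
    itself included. *)
Lemma Var_sum_dependent (N r : nat) (W : nat -> set nat) (Y : nat -> T -> R) (c : R) :
  (forall i, (i < N)%N -> W i `<=` `I_n) ->
  (forall i j, (i + r < j)%N -> (j < N)%N -> W i `&` W j = set0) ->
  (forall i, (i < N)%N -> sgm (W i) (Y i)) ->
  (forall i, (i < N)%N -> L2 P (Y i)) ->
  (forall i, (i < N)%N -> Var P (Y i) <= c) -> 0 <= c ->
  Var P (fun w => \sum_(i < N) Y i w) <= N%:R * ((2 * r + 1)%:R * c).
Proof.
move=> Wn WW sY hY vY c0; rewrite /Var.
have L i : L2 P (Y (nat_of_ord (i : 'I_N))) by exact: hY.
have LS : L2 P (fun w => \sum_(i < N) Y i w) by apply: L2_sum => i _.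
rewrite Cov_suml//.
rewrite -[in leRHS](card_ord N) -sum1_card natr_sum mulr_suml.
apply: ler_sum => i _; rewrite mul1r Cov_sumr//.
rewrite (bigID (fun j : 'I_N => (i <= j + r)%N && (j <= i + r)%N))/= [X in _ + X]big1 ?addr0.
  rewrite (le_trans (ler_norm _))//.
  apply: (@ler_sum_near _ r N i (fun j => Cov P (Y i) (Y j))) => // j jN.
  by apply: normr_Cov_le; rewrite ?vY//; exact: hY.
move=> j ij; have [h|h] : (i + r < j)%N \/ (j + r < i)%N by lia.
  by apply: (@Cov_indep (W i) (W j)) => //; [exact: Wn|exact: Wn|exact: WW|exact: sY|exact: sY].
rewrite CovC; apply: (@Cov_indep (W j) (W i)) => //;
  by [exact: Wn|exact: WW|exact: sY].
Qed.

Section stein.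
Variables (N k : nat) (xi : nat -> T -> R) (kap : R).
Hypothesis Nk : (N + k <= n)%N.
Hypothesis xi_sg : forall i, (i < N)%N -> sgm [set j | (i <= j <= i + k)%N] (xi i).
Hypothesis xi_bd : forall i w, (i < N)%N -> `|xi i w| <= kap.
Hypothesis xi_ctr : forall i, (i < N)%N -> Ex P (xi i) = 0.
Hypothesis kap0 : 0 <= kap.

Let near i j := ((i <= j + k) && (j <= i + k))%N.
Let W w := \sum_(i < N) xi i w.
(** The summands that may share a coordinate with [xi i]; the rest, [W - eta i], is independent of
    [xi i]. *)
Let eta i w := \sum_(j < N | near i j) xi j w.
Let b : R := (2 * k + 1)%:R * kap.

Let b0 : 0 <= b. Proof. by rewrite mulr_ge0. Qed.

Let eta_bd i w : `|eta i w| <= b.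
Proof. by apply: (@ler_sum_near _ k N i (fun j => xi j w)) => // j jN; exact: xi_bd. Qed.

Let mxi i : (i < N)%N -> measurable_fun [set: T] (xi i).
Proof. by move=> iN; apply: (sg_mf me (xi_sg iN)). Qed.

Let meta i : measurable_fun [set: T] (eta i).
Proof.
rewrite (_ : eta i = fun w => \sum_(j < N) (if near i j then xi j w else 0)); last first.
  by apply/funext => w; rewrite /eta big_mkcond.
apply: measurable_sum => j; case pi : (near i j); last exact: measurable_cst.
exact: mxi.
Qed.

Let mW : measurable_fun [set: T] W.
Proof. by apply: measurable_sum => j; exact: mxi. Qed.

Let W_bd w : `|W w| <= N%:R * kap.
Proof.
rewrite (le_trans (ler_norm_sum _ _ _))//.
rewrite -[in leRHS](card_ord N) -sum1_card natr_sum mulr_suml.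
by apply: ler_sum => i _; rewrite mul1r xi_bd.
Qed.

Let L2W : L2 P W. Proof. exact: (@L2_bounded _ _ _ P _ _ mW W_bd). Qed.

Let L2xi i : (i < N)%N -> L2 P (xi i).
Proof. by move=> iN; apply: (@L2_bounded _ _ _ P kap _ (mxi iN)) => w; exact: xi_bd. Qed.

Let L2eta i : L2 P (eta i).
Proof. exact: (@L2_bounded _ _ _ P b _ (meta i) (eta_bd i)). Qed.

Let Ex_xi_far (G : R -> R) i : (i < N)%N -> measurable_fun setT G ->
  L2 P (fun w => G (W w - eta i w)) -> Ex P (fun w => xi i w * G (W w - eta i w)) = 0.
Proof.
move=> iN mG LG.
pose I := [set j | (i <= j <= i + k)%N].
pose J := [set l | exists j, [/\ (j < N)%N, ~~ near i j & (j <= l <= j + k)%N]].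
rewrite (@indep_ExM _ T R P n I J e (xi i)) ?xi_ctr ?mul0r//.
- by move=> j; rewrite /I/=; lia.
- by move=> l [j []] /=; lia.
- by apply/seteqP; split => // l [/= h [j []]]; move: h; rewrite /I /near/=; lia.
- exact: xi_sg.
- apply: (measurableT_comp mG).
  have -> : (fun w => W w - eta i w) = fun w => \sum_(j < N | ~~ near i j) xi j w.
    by apply/funext => w; rewrite /W /eta (bigID (fun j : 'I_N => near i j))/= addrAC subrr add0r.
  have Lj (j : 'I_N) : ~~ near i j -> sgm J (xi j).
    by move=> ij; apply: (sg_mfS _ (xi_sg (ltn_ord j))) => l /= h; exists j.
  rewrite (_ : (fun w => _) = fun w => \sum_(j < N) (if ~~ near i j then xi j w else 0)); last first.
    by apply/funext => w; rewrite big_mkcond.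
  apply: measurable_sum => j; case pi : (~~ near i j); first exact: Lj.
  exact: measurable_cst.
- exact: L2xi.
Qed.

Let Q w := \sum_(i < N) xi i w * eta i w.

Let L1xi_eta i : (i < N)%N -> L2 P (fun w => xi i w * eta i w).
Proof.
move=> iN; apply: (@L2_bounded _ _ _ P (kap * b)); first exact: measurable_funM (mxi iN) (meta i).
by move=> w; rewrite normrM ler_pM// ?xi_bd.
Qed.

Let L2Q : L2 P Q. Proof. by apply: L2_sum => i _; exact: L1xi_eta. Qed.

Let Ex_W : Ex P W = 0.
Proof.
rewrite Ex_sum; first by rewrite big1// => i _; exact: xi_ctr.
by move=> i _; apply: L2_L1; exact: L2xi.
Qed.

Let Ex_W_mul (G : R -> R) : measurable_fun setT G -> L2 P (fun w => G (W w)) ->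
  (forall i, (i < N)%N -> L2 P (fun w => G (W w - eta i w))) ->
  Ex P (fun w => W w * G (W w)) =
  Ex P (fun w => \sum_(i < N) xi i w * (G (W w) - G (W w - eta i w))).
Proof.
move=> mG LG LGi.
have -> : Ex P (fun w => W w * G (W w)) = \sum_(i < N) Ex P (fun w => xi i w * G (W w)).
  rewrite -Ex_sum; last by move=> i _; apply: L2M => //; exact: L2xi.
  by apply: eq_Ex => w; rewrite mulr_suml.
rewrite Ex_sum; last by move=> i _; apply: L2M; [exact: L2xi|apply: L2B => //; exact: LGi].
apply: eq_bigr => i _.
have e1 := ExB (L2M (L2xi (ltn_ord i)) LG) (L2M (L2xi (ltn_ord i)) (LGi _ (ltn_ord i))).
rewrite (Ex_xi_far (ltn_ord i) mG (LGi _ (ltn_ord i))) subr0 in e1.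
by rewrite -e1; apply: eq_Ex => w; rewrite mulrBr.
Qed.

Let Ex_Q : Ex P Q = Var P W.
Proof.
rewrite /Var /Cov Ex_W mulr0 subr0 (Ex_W_mul (G := id))//; last first.
  by move=> i _; apply: L2B.
by apply: eq_Ex => w; apply: eq_bigr => i _; congr (_ * _); ring.
Qed.

(** [xi i * eta i] involves coordinates from i - k to i + 2k, so these products are 3k-dependent. *)
Let sd_Q : sd P Q <= Num.sqrt (N%:R * ((2 * (3 * k) + 1)%:R * (kap * b) ^+ 2)).
Proof.
apply: ler_wsqrtr.
apply: (@Var_sum_dependent N (3 * k) (fun i => [set l | (i <= l + k)%N /\ (l <= i + 2 * k)%N /\ (l < n)%N])
  (fun i w => xi i w * eta i w)); last exact: sqr_ge0.
- by move=> i iN l /= [_ []].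
- by move=> i j ij jN; apply/seteqP; split => // l /= [[h1 [h2 _]] [h3 [h4 _]]]; lia.
- move=> i iN; apply: measurable_funM.
    by apply: (sg_mfS _ (xi_sg iN)) => l /=; lia.
  rewrite (_ : eta i = fun w => \sum_(j < N) (if near i j then xi j w else 0)); last first.
    by apply/funext => w; rewrite /eta big_mkcond.
  apply: measurable_sum => j; case pi : (near i j); last exact: measurable_cst.
  apply: (sg_mfS _ (xi_sg (ltn_ord j))) => l /=; move: pi; rewrite /near.
  by have := ltn_ord j; lia.
- by move=> i iN; exact: L1xi_eta.
- move=> i iN; rewrite (le_trans (Var_le (L1xi_eta iN)))//.
  rewrite -[leRHS](Ex_cst P); apply: Ex_le; [exact: (L1xi_eta iN).2|exact: L1_cst|].
  move=> w; rewrite -[leLHS]ger0_norm ?sqr_ge0// normrX ler_pXn2r// ?nnegrE ?mulr_ge0//.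
  by rewrite normrM ler_pM// xi_bd.
Qed.

(** Independence of xi_i and W - eta_i gives E W F(W) as the sum of E xi_i (F(W) - F(W - eta_i)). A
    first-order expansion turns it into E Q F1(W) plus a quadratic remainder, and replacing Q by its
    mean Var W costs sd Q. *)
Lemma stein_dependent (F F1 : R -> R) (C : R) :
  (forall x : R, is_derive x 1 F (F1 x)) ->
  (forall x, `|F x| <= C /\ `|F1 x| <= C) -> 0 <= C ->
  measurable_fun setT F1 ->
  (forall x y, `|F1 x - F1 y| <= C * (1 + `|x|) * `|x - y|) ->
  `|Ex P (fun w => W w * F (W w)) - Var P W * Ex P (fun w => F1 (W w))| <=
    C * (N%:R * (kap * b ^+ 2 * (1 + norm2 P W)) +
         Num.sqrt (N%:R * ((2 * (3 * k) + 1)%:R * (kap * b) ^+ 2))).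
Proof.
move=> dF bF C0 mF1 lF.
have mF : measurable_fun setT F.
  apply: continuous_measurable_fun => z; apply: differentiable_continuous.
  by apply/derivable1_diffP; have := dF z => ?; exact: ex_derive.
have LFW : L2 P (fun w => F (W w)).
  by apply: (@L2_bounded _ _ _ P C) => [|w]; [exact: measurableT_comp|exact: (bF _).1].
have LFi i : (i < N)%N -> L2 P (fun w => F (W w - eta i w)).
  move=> iN; apply: (@L2_bounded _ _ _ P C) => [|w]; last exact: (bF _).1.
  by apply: (measurableT_comp mF); exact: measurable_funB.
have LF1 : L2 P (fun w => F1 (W w)).
  by apply: (@L2_bounded _ _ _ P C) => [|w]; [exact: measurableT_comp|exact: (bF _).2].
rewrite (Ex_W_mul mF LFW LFi) -Ex_Q.
set A := fun w => \sum_(i < N) xi i w * (F (W w) - F (W w - eta i w)).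
have LA : L2 P A.
  apply: L2_sum => i _; apply: (@L2_bounded _ _ _ P (kap * (C + C))).
    apply: measurable_funM; first exact: mxi.
    by apply: measurable_funB; [exact: LFW.1|exact: (LFi _ (ltn_ord i)).1].
  move=> w; rewrite normrM ler_pM// ?xi_bd//.
  by rewrite (le_trans (ler_normB _ _))// lerD ?(bF _).1.
have LQF := L2M L2Q LF1.
have e1 := ExB (L2_L1 LA) LQF.
have -> : Ex P A - Ex P Q * Ex P (fun w => F1 (W w)) =
   Ex P (fun w => A w - Q w * F1 (W w)) + Cov P Q (fun w => F1 (W w)).
  by rewrite e1 /Cov; ring.
rewrite mulrDr (le_trans (ler_normD _ _))// lerD//.
  rewrite (le_trans (Ex_norm_le (L1B (L2_L1 LA) LQF)))//.
  have LW1 : L1 P (fun w => 1 + `|W w|).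
    by apply: L1D; [exact: L1_cst|apply: L1_norm; exact: L2_L1].
  have h : Ex P (fun w => `|A w - Q w * F1 (W w)|) <=
      Ex P (fun w => C * (N%:R * (kap * b ^+ 2)) * (1 + `|W w|)).
    apply: Ex_le; [apply: L1_norm; exact: L1B (L2_L1 LA) LQF|exact: L1Z|].
    move=> w; rewrite /A /Q mulr_suml -sumrB (le_trans (ler_norm_sum _ _ _))//.
    have -> : C * (N%:R * (kap * b ^+ 2)) * (1 + `|W w|) =
        N%:R * (kap * (C * (1 + `|W w|) * b ^+ 2)) by ring.
    rewrite -[in leRHS](card_ord N) -sum1_card natr_sum mulr_suml.
    apply: ler_sum => i _; rewrite mul1r.
    have -> : xi i w * (F (W w) - F (W w - eta i w)) - xi i w * eta i w * F1 (W w) =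
        xi i w * (F (W w) - F (W w - eta i w) - eta i w * F1 (W w)) by ring.
    rewrite normrM ler_pM// ?xi_bd// (le_trans (second_order_bound dF lF _ _ _))//.
      by move=> x; rewrite mulr_ge0 ?addr_ge0.
    rewrite ler_wpM2l ?mulr_ge0 ?addr_ge0// -[leLHS]ger0_norm ?sqr_ge0// normrX.
    by rewrite ler_pXn2r// ?nnegrE.
  rewrite (le_trans h)// ExZ// -mulrA ler_wpM2l//.
  have e2 := ExD (L1_cst P 1) (L1_norm (L2_L1 L2W)).
  rewrite e2 Ex_cst -mulrA ler_wpM2l// ler_wpM2l ?mulr_ge0 ?sqr_ge0// lerD2l.

  exact: Ex_norm_le_nm.
have -> : Cov P Q (fun w => F1 (W w)) = Ex P (fun w => ctr P Q w * F1 (W w)).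
  rewrite /Cov.
  have e2 := ExB (L2M L2Q LF1) (L1Z (Ex P Q) (L2_L1 LF1)).
  rewrite ExZ in e2; last exact: L2_L1.
  by rewrite -e2; apply: eq_Ex => w; rewrite /ctr; ring.
rewrite (le_trans (normr_Ex_mul (L2_ctr L2Q) LF1))// -sdE// mulrC ler_pM ?nm_ge0 ?sd_ge0//.
have LC := L2_cst P C.
rewrite (le_trans (nm_le LF1 LC (fun w => (bF (W w)).2)))// nm_cst ger0_norm//.
Qed.

End stein.
End dependent_sums.

(** * Reduction of weak convergence to bounded Lipschitz test functions *)

Lemma lipschitz_continuous (R : realType) (h : R -> R) (L : R) :
  (forall x y, `|h x - h y| <= L * `|x - y|) -> continuous h.
Proof.
move=> h_lip; have L_ge0 : 0 <= L.
  by have := h_lip 1 0; rewrite subr0 normr1 mulr1; exact: le_trans.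
move=> x; apply/cvgrPdist_le => e e0; near=> y.
rewrite (le_trans (h_lip x y))//.
rewrite (@le_trans _ _ ((L + 1) * `|x - y|))//.
  by rewrite ler_wpM2r// lerDl.
rewrite mulrC -ler_pdivlMr ?ltr_wpDl//.
near: y; apply: cvgr_dist_le => //; by rewrite divr_gt0// ltr_wpDl.
Unshelve. all: by end_near. Qed.

Section inf_convolution.
Context (R : realType).
Variables (h : R -> R) (B : R).
Hypothesis h_bd : forall x, `|h x| <= B.

(* The infimal convolution is m-Lipschitz and increases to h, which reduces weak
   convergence to bounded Lipschitz test functions. *)
Definition infconv (m x : R) : R := inf [set h y + m * `|x - y| | y in [set: R]].

Variable m : R.
Hypothesis m0 : 0 <= m.

Let lb (x : R) : lbound [set h y + m * `|x - y| | y in [set: R]] (- B).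
Proof.
move=> _ [y _ <-]; have := h_bd y; rewrite ler_norml => /andP[h1 _].
by rewrite (le_trans h1)// lerDl mulr_ge0.
Qed.

Let ne (x : R) : [set h y + m * `|x - y| | y in [set: R]] !=set0.
Proof. by exists (h x + m * `|x - x|), x. Qed.

Lemma infconv_le (x y : R) : infconv m x <= h y + m * `|x - y|.
Proof. by apply: ge_inf; [exists (- B); exact: lb|exists y]. Qed.

Lemma infconv_ge (x c : R) : (forall y, c <= h y + m * `|x - y|) -> c <= infconv m x.
Proof. by move=> H; apply: lb_le_inf; [exact: ne|move=> _ [y _ <-]]. Qed.

Lemma infconv_le_self (x : R) : infconv m x <= h x.
Proof. by have := infconv_le x x; rewrite subrr normr0 mulr0 addr0. Qed.

Lemma infconv_bounded (x : R) : `|infconv m x| <= B.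
Proof.
rewrite ler_norml; apply/andP; split; last first.
  by rewrite (le_trans (infconv_le_self x))// (le_trans (ler_norm _)).
by apply: infconv_ge => y; apply: lb; exists y.
Qed.

Lemma infconv_lipschitz (x y : R) : `|infconv m x - infconv m y| <= m * `|x - y|.
Proof.
suff H (a b : R) : infconv m a <= infconv m b + m * `|a - b|.
  have h1 := H x y; have := H y x; rewrite (distrC y) => h2.
  by rewrite ler_norml; lra.
rewrite -lerBlDr; apply: infconv_ge => z.
rewrite lerBlDr (le_trans (infconv_le a z))// -addrA -mulrDr lerD2l ler_wpM2l//.
have -> : a - z = (b - z) + (a - b) by ring.
exact: ler_normD.
Qed.

End inf_convolution.

(** Points y at distance at least [dl] pay a penalty n |x - y| >= 2 B once n >= 2 B / dl, so they
    cannot bring the infimum below h x; near points change h by at most e. *)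
Lemma infconv_cvg (R : realType) (h : R -> R) (B : R) : continuous h ->
  (forall x, `|h x| <= B) -> forall x, infconv h n%:R x @[n --> \oo] --> h x.
Proof.
move=> ch bh x; apply/cvgrPdist_le => e e0.
have [dl dl0 H] : exists2 dl : R, 0 < dl & forall y, `|x - y| < dl -> `|h x - h y| <= e.
  have /cvgrPdist_le /(_ e e0) [dl /= dl0 H] := ch x.
  by exists dl => // y xy; exact: H.
have B0 : 0 <= B by rewrite (le_trans _ (bh 0)).
near=> n; have n2 : 2 * B / dl <= n%:R by near: n; exact: nbhs_infty_ger.
rewrite ger0_norm ?subr_ge0 ?(infconv_le_self bh)// lerBlDr addrC -lerBlDr.
apply: infconv_ge => // y; have [xy|xy] := ltP `|x - y| dl.
  have := H _ xy; rewrite ler_norml => /andP[_ h1].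
  have h2 : 0 <= n%:R * `|x - y| by rewrite mulr_ge0.
  lra.
have h3 : 2 * B <= n%:R * `|x - y|.
  by rewrite -[2 * B](@divfK _ dl) ?gt_eqF// ler_pM// ?mulr_ge0 ?invr_ge0// ltW.
have := bh x; have := bh y; rewrite !ler_norml => /andP[h4 h5] /andP[h6 h7].
lra.
Unshelve. all: by end_near. Qed.

Section lipschitz_test_functions.
Context d (T : measurableType d) (R : realType) (P : probability T R).
Variables (W : nat -> T -> R) (Q : probability (measurableTypeR R) R).
Hypothesis mW : forall n, measurable_fun [set: T] (W n).
Hypothesis W_lip : forall (h : R -> R) (B L : R), (forall x, `|h x| <= B) ->
  (forall x y, `|h x - h y| <= L * `|x - y|) ->
  Ex P (fun w => h (W n w)) @[n --> \oo] --> Ex Q h.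

(** Infimal convolutions lie below h, so convergence for one of them bounds the expectations of h
    from below; which one is decided by dominated convergence under Q. *)
Let liminf_ge (h : R -> R) B e : continuous h -> (forall x, `|h x| <= B) -> 0 < e ->
  \forall n \near \oo, Ex Q h - e <= Ex P (fun w => h (W n w)).
Proof.
move=> ch bh e0.
have mh : measurable_fun setT h by exact: continuous_measurable_fun.
have lipm m := @infconv_lipschitz R h B bh m%:R (ler0n _ m).
have bm (m : nat) := @infconv_bounded R h B bh m%:R (ler0n _ m).
have mm (m : nat) : measurable_fun setT (infconv h m%:R).
  by apply: continuous_measurable_fun; apply: lipschitz_continuous; exact: lipm.
have e20 : 0 < e / 2 by rewrite divr_gt0.
have cQ : Ex Q (infconv h m%:R) @[m --> \oo] --> Ex Q h.
  apply: (@Ex_dominated _ _ _ Q (fun m => infconv h m%:R) h B) => //.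
  by apply: aeW => x; exact: (infconv_cvg ch bh).
have /cvgrPdist_le /(_ _ e20) [m _ /(_ m (leqnn m)) /= hm] := cQ.
have /cvgrPdist_le /(_ _ e20) := W_lip (bm m) (lipm m).
apply: filterS => n hn.
have h1 : Ex P (fun w => infconv h m%:R (W n w)) <= Ex P (fun w => h (W n w)).
  apply: Ex_le.
  - by apply: (@L1_bounded _ _ _ P B) => [|w]; [exact: measurableT_comp|exact: bm].
  - by apply: (@L1_bounded _ _ _ P B) => [|w]; [exact: measurableT_comp|exact: bh].
  - by move=> w; exact: (infconv_le_self bh).
by move: hm hn; rewrite !ler_norml; lra.
Qed.

(** The upper bound is the lower bound for - h. *)
Lemma cvg_in_distribution_lipschitz : cvg_in_distribution P W Q.
Proof.
move=> h ch [B bh].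
have mh : measurable_fun setT h by exact: continuous_measurable_fun.
have LQ : L1 Q h by apply: (@L1_bounded _ _ _ Q B).
have LP n : L1 P (h \o W n).
  by apply: (@L1_bounded _ _ _ P B) => [|w]; [exact: measurableT_comp|exact: bh].
rewrite (ExE LQ) (_ : (fun n => 'E_P[h \o W n])%E = fun n => (Ex P (h \o W n))%:E); last first.
  by apply/funext => n; rewrite expectationE.
apply: cvg_EFin; first by apply: nearW.
apply/cvgrPdist_le => e e0.
have chN : continuous (fun x => - h x) by move=> x; apply: cvgN; exact: ch.
have bhN x : `|- h x| <= B by rewrite normrN.
have H1 := liminf_ge ch bh e0; have H2 := liminf_ge chN bhN e0.
near=> n.
have h1 : Ex Q h - e <= Ex P (h \o W n) by near: n.
have h2 : Ex Q (fun x => - h x) - e <= Ex P (fun w => - h (W n w)) by near: n.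
rewrite (ExN LQ) in h2; have e2 := ExN (LP n); rewrite [X in _ <= X]e2 in h2.
by rewrite ler_norml /=; lra.
Unshelve. all: by end_near. Qed.

End lipschitz_test_functions.

(** * Convergence to the centred normal law *)

Section normal_approximation.
Context d (T : measurableType d) (R : realType) (P : probability T R).
Notation mu := (@lebesgue_measure R).

Lemma Ex_centered_normal0 (h : R -> R) : measurable_fun setT h ->
  Ex (centered_normal 0) h = h 0.
Proof.
move=> mh; rewrite /Ex /centered_normal eqxx.
rewrite integral_dirac//=.
  by rewrite indicT mul1r.
exact/measurable_EFinP.
Qed.

Lemma Ex_centered_normal (v : R) (h : R -> R) (B : R) : 0 < v ->
  measurable_fun setT h -> (forall x, `|h x| <= B) ->
  Ex (centered_normal v) h = \int[mu]_y (h y * normal_pdf 0 (Num.sqrt v) y).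
Proof.
move=> v0 mh bh; rewrite /centered_normal gt_eqF//.
set s := Num.sqrt v; set p := normal_pdf 0 s; set Q := (X in Ex X).
have mp : measurable_fun setT p by exact: measurable_normal_pdf.
have p0 x : 0 <= p x by exact: normal_pdf_ge0.
have ip : mu.-integrable setT (EFin \o p) by exact: integrable_normal_pdf.
have ihp : mu.-integrable setT (EFin \o (fun y => h y * p y)).
  have i : mu.-integrable setT (fun y => B%:E * (p y)%:E)%E by exact: integrableZl.
  apply: (le_integrable _ _ _ i) => //=.
    by apply/measurable_EFinP; exact: measurable_funM.
  move=> y _; rewrite lee_fin !normrM ler_wpM2r//.
  by rewrite (le_trans (bh y))// ler_norm.
have LQ : L1 Q h by apply: (@L1_bounded _ _ _ Q B).
have e1 := ExD LQ (L1_cst Q B); rewrite Ex_cst in e1.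
(* The density formula is available for nonnegative functions, so h is shifted by B. *)
have e2 : Ex Q (fun x => h x + B) = \int[mu]_y (h y * p y + B * p y).
  rewrite /Ex /Rintegral; congr fine.
  rewrite (@ge0_integral_density _ _ _ Q mu p)//.
  - by apply: eq_integral => y _; rewrite -EFinM mulrDl.
  - by apply/measurable_EFinP; exact: measurable_funD.
  - by move=> x; rewrite lee_fin; have := bh x; rewrite ler_norml; lra.
rewrite RintegralD// in e2; last by have := integrableZl measurableT B ip.
rewrite RintegralZl// [X in _ + _ * X](_ : _ = 1) in e2; last first.
  by rewrite /Rintegral integral_normal_pdf.
by rewrite e1 mulr1 in e2; apply: (addIr B).
Qed.

Lemma Ex_lipschitz_le (h : R -> R) (B L : R) (Y Z : T -> R) :
  (forall x, `|h x| <= B) -> (forall x y, `|h x - h y| <= L * `|x - y|) ->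
  L2 P Y -> L2 P Z ->
  `|Ex P (fun w => h (Y w)) - Ex P (fun w => h (Z w))| <= L * norm2 P (fun w => Y w - Z w).
Proof.
move=> bh lh hY hZ.
have L_ge0 : 0 <= L.
  by have := lh 1 0; rewrite subr0 normr1 mulr1; exact: le_trans.
have mh : measurable_fun setT h.
  by apply: continuous_measurable_fun; exact: lipschitz_continuous lh.
have Lh X : L2 P X -> L1 P (fun w => h (X w)).
  by move=> [mX _]; apply: (@L1_bounded _ _ _ P B) => [|w]; [exact: measurableT_comp|exact: bh].
rewrite -ExB; [|exact: Lh|exact: Lh].
have LYZ := L2B hY hZ.
rewrite (le_trans (Ex_norm_le (L1B (Lh _ hY) (Lh _ hZ))))//.
have h1 : Ex P (fun w => `|h (Y w) - h (Z w)|) <= Ex P (fun w => L * `|Y w - Z w|).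
  apply: Ex_le => [||w]; last exact: lh.
  - by apply: L1_norm; exact: L1B (Lh _ hY) (Lh _ hZ).
  - by apply: L1Z; apply: L1_norm; exact: L2_L1.
rewrite (le_trans h1)// ExZ ?ler_wpM2l ?Ex_norm_le_nm//.
by apply: L1_norm; exact: L2_L1.
Qed.

(** [K] and [k] are chosen before n. With summands of size K / sqrt n, the error of Stein's method
    is of order n^(-1/2), while the L2 error and the variance error stay below a tolerance fixed in
    advance. *)
Lemma cvg_centered_normal (v : R) (W : nat -> T -> R) : 0 <= v ->
  (forall n, L2 P (W n)) ->
  (forall eps : R, 0 < eps -> exists (K : R) (k : nat), 0 <= K /\
    \forall n \near \oo, exists (m N : nat) (e xi : nat -> T -> R),
    [/\ (forall i, measurable_fun [set: T] (e i)) /\ indep P m e,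
      (N + k <= m)%N /\ (N <= n)%N,
      (forall i, (i < N)%N -> [/\ sgm e [set j | (i <= j <= i + k)%N] (xi i),
         (forall w, `|xi i w| <= K / Num.sqrt n%:R) & Ex P (xi i) = 0]),
      norm2 P (fun w => W n w - \sum_(i < N) xi i w) <= eps &
      `|Var P (fun w => \sum_(i < N) xi i w) - v| <= eps]) ->
  cvg_in_distribution P W (centered_normal v).
Proof.
move=> v_ge0 LW H; apply: cvg_in_distribution_lipschitz => [n|h B L bh lh]; first exact: (LW n).1.
have L_ge0 : 0 <= L.
  by have := lh 1 0; rewrite subr0 normr1 mulr1; exact: le_trans.
have B_ge0 : 0 <= B := le_trans (normr_ge0 _) (bh 0).
have mh : measurable_fun setT h.
  by apply: continuous_measurable_fun; exact: lipschitz_continuous lh.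
apply/cvgrPdist_le => eta eta0.
have LS n N K (xi : nat -> T -> R) : (forall i, (i < N)%N -> measurable_fun [set: T] (xi i)) ->
    (forall i, (i < N)%N -> (forall w, `|xi i w| <= K / Num.sqrt n%:R) /\ Ex P (xi i) = 0) ->
    L2 P (fun w => \sum_(i < N) xi i w) /\ Ex P (fun w => \sum_(i < N) xi i w) = 0.
  move=> mxi hxi.
  have Li (i : 'I_N) : L2 P (xi i).
    by apply: (@L2_bounded _ _ _ P _ _ (mxi i (ltn_ord i)) (hxi i (ltn_ord i)).1).
  split; first by apply: L2_sum.
  by rewrite Ex_sum ?big1// => i _; [exact: (hxi _ _).2|exact: L2_L1].
have nmS (S : T -> R) : L2 P S -> Ex P S = 0 -> norm2 P S ^+ 2 = Var P S.
  move=> LS' E0; rewrite sqr_nm /Var /Cov E0 mulr0 subr0.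
  by apply: eq_Ex => w; rewrite expr2.
move: v_ge0; rewrite le_eqVlt => /predU1P[v0|v0].
  (* A degenerate limit has no Stein equation; the sum then has small variance and is compared with
     0. The tolerance dl^2 on the variance gives a norm at most dl. *)
  subst v; rewrite Ex_centered_normal0//.
  pose dl : R := Num.min 1 (eta / (2 * (L + 1))).
  have dl0 : 0 < dl by rewrite lt_min ltr01 divr_gt0// mulr_gt0// ltr_wpDl.
  have dl1 : dl <= 1 by rewrite ge_min lexx.
  have dl2 : (L + L) * dl <= eta.
    have : dl <= eta / (2 * (L + 1)) by rewrite ge_min lexx orbT.
    rewrite ler_pdivlMr ?mulr_gt0 ?ltr_wpDl// => h1.
    by rewrite (le_trans _ h1)// mulrC ler_wpM2l ?(ltW dl0)//; lra.
  have [K [k [K0 HK]]] := H (dl ^+ 2) (exprn_gt0 _ dl0).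
  apply: filterS HK => n [m [N [e [xi [[me ie] [Nm Nn] hxi Wn vn]]]]].
  have [LSn ESn] : L2 P (fun w => \sum_(i < N) xi i w) /\ Ex P (fun w => \sum_(i < N) xi i w) = 0.
    apply: (LS n N K) => i iN; have [h1 h2 h3] := hxi i iN => //.
    exact: (sg_mf me h1).
  have h1 := Ex_lipschitz_le bh lh (LW n) LSn.
  have h2 := Ex_lipschitz_le bh lh LSn (L2_cst P 0).
  rewrite Ex_cst in h2.
  have e2 : norm2 P (fun w => \sum_(i < N) xi i w - 0) = norm2 P (fun w => \sum_(i < N) xi i w).
    by apply: eq_nm => w; rewrite subr0.
  rewrite e2 in h2; have e3 := nmS _ LSn ESn.
  have h3 : norm2 P (fun w => \sum_(i < N) xi i w) <= dl.
    rewrite -(@ler_pXn2r _ 2)// ?nnegrE ?nm_ge0 ?(ltW dl0)// e3.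
    by move: vn; rewrite subr0; exact: le_trans (ler_norm _).
  have h4 : dl ^+ 2 <= dl by rewrite expr2 ler_piMr// ltW.
  have h5 := ler_wpM2l L_ge0 (le_trans Wn h4).
  have h6 := ler_wpM2l L_ge0 h3.
  rewrite distrC.
  have -> : Ex P (fun w => h (W n w)) - h 0 =
    (Ex P (fun w => h (W n w)) - Ex P (fun w => h (\sum_(i < N) xi i w))) +
    (Ex P (fun w => h (\sum_(i < N) xi i w)) - h 0) by ring.
  by rewrite (le_trans (ler_normD _ _))//; lra.
rewrite (Ex_centered_normal v0 mh bh).
have [F [F1 [C [C0 dF eF bF lF]]]] := stein_solution v0 bh lh.
set I := \int[mu]_y _ in eF *.
have mF : measurable_fun setT F.
  apply: continuous_measurable_fun => z; apply: differentiable_continuous.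
  by apply/derivable1_diffP; have := dF z => ?; exact: ex_derive.
have mF1 : measurable_fun setT F1.
  rewrite (_ : F1 = fun x => v^-1 * (x * F x + h x - I)).
    by apply: measurable_funM => //; apply: measurable_funB => //; apply: measurable_funD => //;
      exact: measurable_funM.
  by apply/funext => x; rewrite -eF mulKf// gt_eqF.
(* The L2 error costs L eps and the variance error C eps, together half of eta; the other half is
   for Stein's error. *)
pose eps := eta / (2 * (L + C + 1)).
have LC0 : 0 < L + C + 1 by rewrite ltr_wpDl// addr_ge0.
have eps0 : 0 < eps by rewrite divr_gt0// mulr_gt0.
have epsE : (L + C) * eps <= eta / 2.
  rewrite (@le_trans _ _ ((L + C + 1) * eps))// ?ler_wpM2r ?lerDl ?(ltW eps0)//.
  by rewrite le_eqVlt; apply/orP; left; apply/eqP; rewrite /eps; field; rewrite gt_eqF.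
have [K [k [K0 HK]]] := H eps eps0.
pose q : R := (2 * k + 1)%:R.
(* [D / sqrt n] dominates the bound of [stein_dependent] at kap = K / sqrt n, with the norm of the
   sum bounded by v + eps + 1. *)
pose D := C * (K ^+ 3 * q ^+ 2 * (1 + (v + eps + 1)) +
   K ^+ 2 * q * Num.sqrt (2 * (3 * k) + 1)%:R).
have D0 : 0 <= D.
  rewrite mulr_ge0// addr_ge0// !mulr_ge0 ?exprn_ge0 ?sqrtr_ge0//.
  by rewrite !addr_ge0// ltW.
have hn : \forall n \near \oo, D / Num.sqrt n%:R <= eta / 2 /\ (0 < n)%N.
  have := nbhs_infty_ger ((D / (eta / 2)) ^+ 2); move=> h1; near=> n.
  have n0 : (0 < n)%N by near: n; exists 1%N.
  split => //; have c0 : 0 < Num.sqrt n%:R :> R by rewrite sqrtr_gt0 ltr0n.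
  rewrite ler_pdivrMr// mulrC -ler_pdivrMr ?divr_gt0//.
  rewrite -[leLHS]ger0_norm ?divr_ge0 ?(ltW eta0)// -sqrtr_sqr; apply: ler_wsqrtr.
  by near: n.
apply: filterS2 HK hn => n [m [N [e [xi [[me ie] [Nm Nn] hxi Wn vn]]]]] [Dn n0].
set S := fun w => \sum_(i < N) xi i w in Wn vn.
have [LSn ESn] : L2 P S /\ Ex P S = 0.
  apply: (LS n N K) => i iN; have [h1 h2 h3] := hxi i iN => //.
  exact: (sg_mf me h1).
have h1 := Ex_lipschitz_le bh lh (LW n) LSn.
set c := Num.sqrt n%:R in hxi Dn.
have c0 : 0 < c by rewrite sqrtr_gt0 ltr0n.
have cn : c ^+ 2 = n%:R by rewrite sqr_sqrtr.
have kap0 : 0 <= K / c by rewrite divr_ge0// ltW.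
have h2 := @stein_dependent _ T R P m e me ie N k xi (K / c) Nm
  (fun i iN => let: And3 x _ _ := hxi i iN in x)
  (fun i w iN => let: And3 _ x _ := hxi i iN in x w)
  (fun i iN => let: And3 _ _ x := hxi i iN in x) kap0 F F1 C dF bF C0 mF1 lF.
rewrite -/S in h2.
have LFS : L2 P (fun w => F (S w)).
  apply: (@L2_bounded _ _ _ P C) => [|w]; last exact: (bF _).1.
  by apply: (measurableT_comp mF); exact: LSn.1.
have LF1 : L1 P (fun w => F1 (S w)).
  apply: (@L1_bounded _ _ _ P C) => [|w]; last exact: (bF _).2.
  by apply: (measurableT_comp mF1); exact: LSn.1.
have LhS : L1 P (fun w => h (S w)).
  by apply: (@L1_bounded _ _ _ P B) => [|w]; [exact: (measurableT_comp mh LSn.1)|exact: bh].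
have e1 : Ex P (fun w => h (S w)) - I = v * Ex P (fun w => F1 (S w)) - Ex P (fun w => S w * F (S w)).
  have e2 := ExZ v LF1.
  have e3 := ExD (L2M LSn LFS) LhS.
  have e4 := ExB (L1D (L2M LSn LFS) LhS) (L1_cst P I).
  rewrite e3 Ex_cst in e4.
  have e5 : Ex P (fun w => v * F1 (S w)) = Ex P (fun w => S w * F (S w) + h (S w) - I).
    by apply: eq_Ex => w; rewrite eF.
  by rewrite -e2 e5 e4; ring.
have bF1 : `|Ex P (fun w => F1 (S w))| <= C.
  by apply: Ex_bounded => [|w]; [exact: (measurableT_comp mF1 LSn.1)|exact: (bF _).2].
have h3 : `|(v - Var P S) * Ex P (fun w => F1 (S w))| <= C * eps.
  by rewrite normrM mulrC ler_pM// distrC.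
have nmSle : norm2 P S <= v + eps + 1.
  have e3 := nmS _ LSn ESn.
  have : norm2 P S ^+ 2 <= v + eps by move: vn; rewrite e3 ler_norml; lra.
  by have := nm_ge0 P S; nra.
have h4 : C * (N%:R * (K / c * ((2 * k + 1)%:R * (K / c)) ^+ 2 * (1 + norm2 P S)) +
     Num.sqrt (N%:R * ((2 * (3 * k) + 1)%:R * (K / c * ((2 * k + 1)%:R * (K / c))) ^+ 2))) <= D / c.
  rewrite /D -[leRHS]mulrA ler_wpM2l// mulrDl lerD//.
    have -> : K ^+ 3 * q ^+ 2 * (1 + (v + eps + 1)) / c =
      c ^+ 2 * (K / c * (q * (K / c)) ^+ 2 * (1 + (v + eps + 1))).
      by field; rewrite gt_eqF.
    rewrite cn ler_pM// ?ler_nat//.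
      apply: mulr_ge0; first by apply: mulr_ge0 => //; exact: sqr_ge0.
      by apply: addr_ge0 => //; exact: nm_ge0.
    by rewrite ler_wpM2l ?lerD2l//; apply: mulr_ge0 => //; exact: sqr_ge0.
  have -> : K ^+ 2 * q * Num.sqrt (2 * (3 * k) + 1)%:R / c =
      Num.sqrt (c ^+ 2 * ((2 * (3 * k) + 1)%:R * (K / c * (q * (K / c))) ^+ 2)).
    rewrite mulrCA sqrtrM// -exprMn sqrtr_sqr ger0_norm; last first.
      by apply: mulr_ge0; [exact: ltW|apply: mulr_ge0 => //; exact: mulr_ge0].
    by field; rewrite gt_eqF.
  by apply: ler_wsqrtr; rewrite cn ler_wpM2r ?ler_nat//; apply: mulr_ge0 => //; exact: sqr_ge0.
rewrite distrC.
have -> : Ex P (fun w => h (W n w)) - I =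
    (Ex P (fun w => h (W n w)) - Ex P (fun w => h (S w))) +
    ((v - Var P S) * Ex P (fun w => F1 (S w)) -
    (Ex P (fun w => S w * F (S w)) - Var P S * Ex P (fun w => F1 (S w)))).
  by rewrite (_ : Ex P (fun w => h (W n w)) - I = (Ex P (fun w => h (W n w)) - Ex P (fun w => h (S w))) +
    (Ex P (fun w => h (S w)) - I)); [rewrite e1; ring|ring].
rewrite (le_trans (ler_normD _ _))//.
have h5 := ler_wpM2l L_ge0 Wn.
have h6 := le_trans h2 (le_trans h4 Dn).
have h7 := le_trans (ler_normB ((v - Var P S) * Ex P (fun w => F1 (S w)))
    (Ex P (fun w => S w * F (S w)) - Var P S * Ex P (fun w => F1 (S w)))) (lerD h3 h6).
rewrite (le_trans (lerD (le_trans h1 h5) h7))//.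
rewrite mulrDl in epsE; lra.
Unshelve. all: by end_near. Qed.

End normal_approximation.

(** * The series for tau *)

Section basel.
Context (R : realType).
Implicit Types x y : R.

Lemma sin_le_id x : 0 <= x -> sin x <= x.
Proof.
rewrite le_eqVlt => /predU1P[<-|x0]; first by rewrite sin0.
have [z _ e] : exists2 z, z \in `]0, x[%R & sin x - sin 0 = cos z * (x - 0).
  apply: (@MVT _ sin cos) => //.
  by apply: continuous_subspaceT => z; exact: continuous_sin.
by move: e; rewrite sin0 !subr0 => ->; rewrite ler_piMl ?cos_le1// ltW.
Qed.

Lemma id_cos_le_sin x : 0 <= x -> x < pi / 2 -> x * cos x <= sin x.
Proof.
rewrite le_eqVlt => /predU1P[<-|x0] xpi; first by rewrite mul0r sin0.
have [z] : exists2 z, z \in `]0, x[%R &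
    (fun y : R => sin y - y * cos y) x - (fun y : R => sin y - y * cos y) 0 = z * sin z * (x - 0).
  apply: (@MVT _ (fun y : R => sin y - y * cos y) (fun y => y * sin y)) => //.
    move=> z _; apply: is_derive_eq; rewrite /GRing.scale/=; ring.
  apply: continuous_subspaceT => z; apply: cvgB; first exact: continuous_sin.
  by apply: cvgM; [exact: cvg_id|exact: continuous_cos].
rewrite in_itv/= => /andP[z0 zx]; rewrite sin0 mul0r !subr0 => e.
rewrite -subr_ge0 e !mulr_ge0// ?ltW// sin_gt0_pi// z0/=.
have : pi / 2 <= pi :> R by rewrite ler_pdivrMr// ler_peMr ?pi_ge0// ler1n.
by apply: lt_le_trans; exact: lt_trans zx xpi.
Qed.

(** Squares of cos x <= sin x / x <= 1, together with 1 / sin^2 - 1 = cos^2 / sin^2. *)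
Lemma inv_sqr_sin_bounds x : 0 < x -> x < pi / 2 ->
  (sin x ^+ 2)^-1 - 1 <= (x ^+ 2)^-1 <= (sin x ^+ 2)^-1.
Proof.
move=> x0 xpi; have s1 := sin_le_id (ltW x0); have s2 := id_cos_le_sin (ltW x0) xpi.
have s0 : 0 < sin x.
  rewrite sin_gt0_pi// x0/= (lt_le_trans xpi)//.
  by rewrite ler_pdivrMr// ler_peMr ?pi_ge0// ler1n.
have c0 : 0 < cos x by rewrite cos_gt0_pihalf// xpi andbT (lt_trans _ x0)// oppr_lt0 divr_gt0// pi_gt0.
apply/andP; split; last by rewrite lef_pV2 ?posrE ?exprn_gt0// ler_pXn2r// nnegrE ltW.
have -> : (sin x ^+ 2)^-1 - 1 = cos x ^+ 2 / sin x ^+ 2.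
  by rewrite cos2sin2; field; rewrite gt_eqF.
rewrite ler_pdivrMr ?exprn_gt0// mulrC ler_pdivlMr ?exprn_gt0// -exprMn.
rewrite mulrC ler_pXn2r//; first by rewrite nnegrE; apply: mulr_ge0; exact: ltW.
by rewrite nnegrE; exact: ltW.
Qed.

(* Iterating this duplication formula gives a finite Basel identity. *)
Lemma inv_sqr_sin_double x : sin x != 0 -> cos x != 0 ->
  (sin x ^+ 2)^-1 + (cos x ^+ 2)^-1 = 4 / sin (x *+ 2) ^+ 2.
Proof.
move=> s0 c0; rewrite sin_mulr2n.
have -> : (sin x ^+ 2)^-1 + (cos x ^+ 2)^-1 = (cos x ^+ 2 + sin x ^+ 2) / (sin x ^+ 2 * cos x ^+ 2).
  by field; rewrite s0 c0.
rewrite cos2Dsin2; field; by rewrite s0 c0.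
Qed.

(** The terms j and j + 2^n of level n + 1 have arguments that differ by pi / 2, and the duplication
    formula merges each such pair into one term of level n. *)
Lemma sum_inv_sqr_sin n x : 0 < x -> x < pi ->
  \sum_(0 <= j < 2 ^ n) (sin ((x + j%:R * pi) / 2 ^+ n) ^+ 2)^-1 = 4 ^+ n / sin x ^+ 2.
Proof.
move=> x0 xpi; elim: n => [|n ih].
  by rewrite expn0 big_nat1 mul0r addr0 !expr0 divr1 mul1r.
rewrite expnS mul2n -addnn (big_cat_nat _ (n := 2 ^ n))//= ?leq_addr//.
rewrite -{2}[(2 ^ n)%N]add0n big_addn addnK -big_split/=.
have -> : 4 ^+ n.+1 / sin x ^+ 2 = 4 * (4 ^+ n / sin x ^+ 2) by rewrite exprS mulrA.
rewrite -ih mulr_sumr big_nat_cond [RHS]big_nat_cond.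
apply: eq_bigr => j /andP[/= jn _].
set y := (x + j%:R * pi) / 2 ^+ n.+1.
have p0 : 0 < (2 : R) ^+ n.+1 by exact: exprn_gt0.
have pn0 : 0 < (2 : R) ^+ n by exact: exprn_gt0.
have -> : (x + (j + 2 ^ n)%:R * pi) / 2 ^+ n.+1 = y + pi / 2.
  rewrite /y natrD natrX exprS; field; by rewrite gt_eqF.
have -> : (x + j%:R * pi) / 2 ^+ n = y *+ 2.
  by rewrite /y exprS; field; rewrite gt_eqF.
have y0 : 0 < y by rewrite divr_gt0// ltr_wpDr// mulr_ge0// pi_ge0.
have ypi : y < pi / 2.
  rewrite /y ltr_pdivrMr// exprS.
  have -> : pi / 2 * (2 * 2 ^+ n) = pi * 2 ^+ n :> R by field.
  rewrite (@lt_le_trans _ _ (pi + j%:R * pi))// ?ltrD2r//.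
  rewrite -[X in X + _]mul1r -mulrDl mulrC ler_wpM2l ?pi_ge0//.
  by rewrite -natrX -(natrD R 1) ler_nat.
rewrite sinDpihalf inv_sqr_sin_double//.
- rewrite gt_eqF// sin_gt0_pi// y0/= (lt_le_trans ypi)//.
  by rewrite ler_pdivrMr// ler_peMr ?pi_ge0// ler1n.
- by rewrite gt_eqF// cos_gt0_pihalf// ypi andbT (lt_trans _ y0)// oppr_lt0 divr_gt0// pi_gt0.
Qed.

Let O (M : nat) : R := \sum_(0 <= j < M) ((2 * j + 1)%:R ^+ 2)^-1.
Let S (M : nat) : R := \sum_(0 <= j < M) (j.+1%:R ^+ 2)^-1.

Let theta n (j : nat) : R := (pi / 2 + j%:R * pi) / 2 ^+ n.

(** An index and its mirror image have angles theta and pi - theta, so the first half of the terms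
    carries half of the sum. *)
Let sum_half n : \sum_(0 <= j < 2 ^ n) (sin (theta n.+1 j) ^+ 2)^-1 = 4 ^+ n.+1 / 2.
Proof.
have p0 := @pi_gt0 R.
have := @sum_inv_sqr_sin n.+1 (pi / 2); rewrite sin_pihalf expr1n divr1.
move=> /(_ _ _)/wrap[||e]; [by rewrite divr_gt0|by rewrite ltr_pdivrMr// ltr_pMr// ltr1n|].
suff : (\sum_(0 <= j < 2 ^ n) (sin (theta n.+1 j) ^+ 2)^-1) * 2 = 4 ^+ n.+1 by move=> <-; rewrite mulfK.
rewrite -e expnS mul2n -addnn mulr_natr [RHS](big_cat_nat _ (n := (2 ^ n)%N))//= ?leq_addr// mulr2n.
congr (_ + _).
rewrite -[X in _ = \sum_(X <= _ < _) _]add0n big_addn addnK [RHS]big_nat_rev/= add0n.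
rewrite big_nat_cond [RHS]big_nat_cond; apply: eq_bigr => j /andP[/= jn _].
congr ((_ ^+ 2)^-1); rewrite -/(theta n.+1 _).
have -> : theta n.+1 (2 ^ n - j.+1 + 2 ^ n)%N = pi - theta n.+1 j.
  rewrite /theta natrD natrB// natrX exprS -natr1; field.
  by rewrite gt_eqF// exprn_gt0.
by rewrite sinB sinpi cospi mul0r mulN1r opprK add0r.
Qed.

(** The sandwich 1 / sin^2 - 1 <= 1 / theta^2 <= 1 / sin^2 is summed over 2^n angles; the total
    error 2^n is small against 4^n. *)
Let O_bounds n : pi ^+ 2 / 8 - pi ^+ 2 / 16 / 2 ^+ n <= O (2 ^ n) <= pi ^+ 2 / 8.
Proof.
have p0 := @pi_gt0 R.
have q0 : 0 < (2 : R) ^+ n by exact: exprn_gt0.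
have hth j : (j < 2 ^ n)%N -> 0 < theta n.+1 j /\ theta n.+1 j < pi / 2.
  move=> jn; split.
    by rewrite divr_gt0 ?exprn_gt0// ltr_pwDl ?divr_gt0// mulr_ge0// ltW.
  rewrite ltr_pdivrMr ?exprn_gt0// exprS.
  have -> : pi / 2 * (2 * 2 ^+ n) = pi * 2 ^+ n :> R by field.
  rewrite (@lt_le_trans _ _ (pi + j%:R * pi))// ?ltrD2r.
    by rewrite ltr_pdivrMr// ltr_pMr// ltr1n.
  rewrite -[X in X + _]mul1r -mulrDl mulrC ler_wpM2l ?(ltW p0)//.
  by rewrite -natrX -(natrD R 1) ler_nat.
pose c : R := pi ^+ 2 / 4 ^+ n.+2.
have q40 : 0 < (4 : R) ^+ n by exact: exprn_gt0.
have c0 : 0 < c by rewrite divr_gt0 ?exprn_gt0.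
have e42 : (4 : R) ^+ n = 2 ^+ n * 2 ^+ n by rewrite -exprMn; congr (_ ^+ _); ring.
have eO j : ((2 * j + 1)%:R ^+ 2)^-1 = c * (theta n.+1 j ^+ 2)^-1.
  have z : (2 * j + 1)%:R != 0 :> R by rewrite pnatr_eq0 addn1.
  have -> : theta n.+1 j = (2 * j + 1)%:R * pi / (4 * 2 ^+ n).
    rewrite /theta natrD natrM exprS; field; by rewrite gt_eqF.
  rewrite /c !exprS e42; have := z; have := q0; have := p0.
  move: ((2 * j + 1)%:R : R) (2 ^+ n : R) (pi : R) => a b p h1 h2 h3; field.
  by rewrite ?h3 ?(gt_eqF h1) ?(gt_eqF h2).
have -> : O (2 ^ n) = c * \sum_(0 <= j < 2 ^ n) (theta n.+1 j ^+ 2)^-1.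
  by rewrite mulr_sumr; apply: eq_bigr => j _.
have cE : c * (4 ^+ n.+1 / 2) = pi ^+ 2 / 8.
  by rewrite /c !exprS; field; rewrite gt_eqF.
apply/andP; split; last first.
  rewrite -cE -sum_half ler_wpM2l ?(ltW c0)//.
  rewrite big_nat_cond [leRHS]big_nat_cond; apply: ler_sum => j /andP[/andP[_ jn] _].
  by have [h1 h2] := hth j jn; have /andP[] := inv_sqr_sin_bounds h1 h2.
have -> : pi ^+ 2 / 8 - pi ^+ 2 / 16 / 2 ^+ n = c * (4 ^+ n.+1 / 2 - 2 ^+ n).
  by rewrite mulrBr cE; congr (_ - _); rewrite /c !exprS e42; field; rewrite gt_eqF.
rewrite ler_wpM2l ?(ltW c0)// -sum_half.
have -> : (2 : R) ^+ n = \sum_(0 <= j < 2 ^ n) 1.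
  by rewrite big_const_nat subn0 iter_addr_0 natrX.
rewrite -sumrB big_nat_cond [leRHS]big_nat_cond; apply: ler_sum => j /andP[/andP[_ jn] _].
by have [h1 h2] := hth j jn; have /andP[] := inv_sqr_sin_bounds h1 h2.
Qed.

Let S_double M : S (2 * M) = O M + S M / 4.
Proof.
elim: M => [|M ih].
  by rewrite muln0 /S /O !big_nil mul0r addr0.
rewrite mulnS add2n /S !big_nat_recr//= -/(S _) ih /O big_nat_recr//= -/(O _) -/(S _).
have -> : (2 * M).+1 = (2 * M + 1)%N by rewrite addn1.
have -> : (2 * M + 1).+1%:R = 2 * M.+1%:R :> R by rewrite -natrM; congr (_%:R); lia.
have z1 : (2 * M + 1)%:R != 0 :> R by rewrite pnatr_eq0 addn1.
have z2 : M.+1%:R != 0 :> R by rewrite pnatr_eq0.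
by move: z1 z2; move: ((2 * M + 1)%:R : R) (M.+1%:R : R) => a b z1 z2; field; rewrite z1 z2.
Qed.

Let S_nd : {homo S : m n / (m <= n)%N >-> m <= n}.
Proof.
move=> m n mn; rewrite /S (big_cat_nat (n := m) (p := n))//= lerDl.
by apply: sumr_ge0 => j _; rewrite invr_ge0 sqr_ge0.
Qed.

Let S_le M : S M <= pi ^+ 2 / 6.
Proof.
have h1 : S M <= S (2 * M) by apply: S_nd; lia.
have h2 : O M <= pi ^+ 2 / 8.
  have /andP[_] := O_bounds M; apply: le_trans.
  rewrite /O (big_cat_nat (n := M) (p := (2 ^ M)%N))//= ?lerDl; last exact/ltnW/ltn_expl.
  by apply: sumr_ge0 => j _; rewrite invr_ge0 sqr_ge0.
rewrite S_double in h1; lra.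
Qed.

(** Separating odd and even terms gives S (2M) = O M + S M / 4, so the limit solves l = pi^2 / 8 + l
    / 4. The lower bound on the odd sum is available along powers of 2 only; convergence of [S]
    therefore comes from monotonicity. *)
Lemma basel : \sum_(0 <= j < M) (j.+1%:R ^+ 2)^-1 @[M --> \oo] --> (pi ^+ 2 / 6 : R).
Proof.
have cS : cvgn S.
  apply: nondecreasing_is_cvgn => //.
  by exists (pi ^+ 2 / 6) => _ [M _ <-]; exact: S_le.
have /cvg_ex[l Sl] := cS.
have c2 : (2 ^ n)%N @[n --> \oo] --> \oo.
  by move=> A [N _ NA]; exists N => // n /= Nn; apply: NA => /=; rewrite (leq_trans Nn)// ltnW// ltn_expl.
have S2 : S (2 ^ n)%N @[n --> \oo] --> l by apply: cvg_comp c2 Sl.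
have S2' : S (2 ^ n.+1)%N @[n --> \oo] --> l by have := S2; rewrite -(cvg_shiftS (fun n => S (2 ^ n)%N)).
have O2 : O (2 ^ n)%N @[n --> \oo] --> (pi ^+ 2 / 8 : R).
  apply: (@squeeze_cvgr _ _ _ _ (fun n => pi ^+ 2 / 8 - pi ^+ 2 / 16 / 2 ^+ n) (fun=> pi ^+ 2 / 8)).
  - by apply: nearW => n; exact: O_bounds.
  - rewrite -[X in _ --> X]subr0; apply: cvgB; first exact: cvg_cst.
    rewrite -(mulr0 (pi ^+ 2 / 16)); apply: cvgM; first exact: cvg_cst.
    under eq_fun do rewrite -exprVn; apply: cvg_expr.
    by rewrite ger0_norm ?invr_ge0// invf_lt1// ltr1n.
  - exact: cvg_cst.
have e : l = pi ^+ 2 / 8 + l / 4.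
  have S2e : (fun n => S (2 ^ n.+1)%N) = fun n => O (2 ^ n) + S (2 ^ n) / 4.
    by apply/funext => n; rewrite expnS S_double.
  rewrite S2e in S2'; apply: (cvg_unique _ S2') => //.
  by apply: cvgD => //; apply: cvgM => //; exact: cvg_cst.
have -> : pi ^+ 2 / 6 = l by lra.
exact: Sl.
Qed.

End basel.

(** * Series of Beta values *)

Section beta_coefficients.
Context (R : realType).

(** Euler's B(m + 1, k + 1), with both arguments shifted by one; windows of length k use it at
    [k.-1]. *)
Definition beta_coef (m k : nat) : R := m`!%:R * k`!%:R / (m + k).+1`!%:R.

Let f0 n : n`!%:R != 0 :> R. Proof. by rewrite pnatr_eq0 -lt0n fact_gt0. Qed.
Let s0 n : n.+1%:R != 0 :> R. Proof. by rewrite pnatr_eq0. Qed.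
Let fS n : n.+1`!%:R = n.+1%:R * n`!%:R :> R. Proof. by rewrite factS natrM. Qed.

Lemma bet_ge0 m k : 0 <= beta_coef m k.
Proof. by rewrite divr_ge0// mulr_ge0. Qed.

Lemma bet0r m : beta_coef m 0 = m.+1%:R^-1.
Proof.
rewrite /beta_coef addn0 fS mulr1; have := f0 m; have := s0 m.
by move: (m.+1%:R : R) (m`!%:R : R) => a b h1 h2; field; rewrite h1 h2.
Qed.

Lemma bet0l k : beta_coef 0 k = k.+1%:R^-1.
Proof.
rewrite /beta_coef add0n fS mul1r; have := f0 k; have := s0 k.
by move: (k.+1%:R : R) (k`!%:R : R) => a b h1 h2; field; rewrite h1 h2.
Qed.

Lemma bet_rec m k : beta_coef m k.+1 = beta_coef m k - beta_coef m.+1 k.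
Proof.
rewrite /beta_coef addSn addnS (fS (m + k).+1) (fS k) (fS m).
have e : (m + k).+2%:R = k.+1%:R + m.+1%:R :> R by rewrite -natrD; congr (_%:R); lia.
have := s0 (m + k).+1; have := f0 (m + k).+1; rewrite e.
move: (m.+1%:R : R) (k.+1%:R : R) (m`!%:R : R) (k`!%:R : R) (((m + k).+1)`!%:R : R) => a b c x y h1 h2.
by field; rewrite h1 h2.
Qed.

Lemma bet_le m k : beta_coef m k <= m.+1%:R^-1.
Proof.
elim: k m => [|k ih] m; first by rewrite bet0r.
by rewrite bet_rec (le_trans _ (ih m))// gerBl bet_ge0.
Qed.

Lemma bet_cvg0 k : beta_coef m k @[m --> \oo] --> (0 : R).
Proof.
apply: (@squeeze_cvgr _ _ _ _ (fun=> 0) (fun m => m.+1%:R^-1)).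
- by apply: nearW => m; rewrite bet_ge0 bet_le.
- exact: cvg_cst.
- exact: cvg_harmonic.
Qed.

Lemma sum_bet k : \sum_(0 <= m < M) beta_coef m k.+1 @[M --> \oo] --> (k.+1%:R^-1 : R).
Proof.
rewrite (_ : (fun M => _) = fun M => k.+1%:R^-1 - beta_coef M k).
  by rewrite -[X in _ --> X]subr0; apply: cvgB; [exact: cvg_cst|exact: bet_cvg0].
apply/funext => M; rewrite (@telescope_sumr_eq _ 0 M (fun m => - beta_coef m k))//.
  by rewrite bet0l opprK addrC.
by move=> m _; rewrite bet_rec; ring.
Qed.

(** Since [beta_coef m.+1 k] / (m + 1) equals [beta_coef m k.+1] / (k + 1), raising k by one
    subtracts (k + 1)^-2 from the sum. This is the recurrence of the trigamma function, and k = 0 is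
    Basel's sum. *)
Lemma sum_bet_div_succ k :
  \sum_(0 <= m < M) beta_coef m k / m.+1%:R @[M --> \oo] --> trigamma_nat R k.+1.
Proof.
elim: k => [|k ih].
  rewrite /trigamma_nat big_geq// subr0.
  rewrite (_ : (fun M => _) = fun M => \sum_(0 <= j < M) (j.+1%:R ^+ 2)^-1); first exact: basel.
  by apply/funext => M; apply: eq_bigr => m _; rewrite bet0r -invfM expr2.
have -> : trigamma_nat R k.+2 = trigamma_nat R k.+1 - k.+1%:R^-1 * k.+1%:R^-1.
  by rewrite /trigamma_nat [in LHS]big_nat_recr//= opprD addrA -invfM expr2.
rewrite (_ : (fun M => _) = fun M => \sum_(0 <= m < M) beta_coef m k / m.+1%:R -
    k.+1%:R^-1 * \sum_(0 <= m < M) beta_coef m k.+1).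
  by apply: cvgB => //; apply: cvgM; [exact: cvg_cst|exact: sum_bet].
apply/funext => M; rewrite mulr_sumr -sumrB; apply: eq_bigr => m _.
rewrite [in LHS]bet_rec mulrBl; congr (_ - _).
rewrite /beta_coef addSn addnS (fS k) (fS m).
have := s0 m; have := s0 k; have := f0 (m + k).+2.
move: (m.+1%:R : R) (k.+1%:R : R) (m`!%:R : R) (k`!%:R : R) (((m + k).+2)`!%:R : R) => a b c x y h1 h2 h3.
by field; rewrite h1 h2 h3.
Qed.

Lemma sum_bet_div_succ2 k :
  \sum_(0 <= m < M) beta_coef m k / m.+2%:R @[M --> \oo] --> 1 - k%:R * trigamma_nat R k.+1.
Proof.
(* Telescoping witness: [t m - t m.+1] is [beta_coef m k] times k / (m + 1) + 1 / (m + 2). *)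
pose t m : R := beta_coef m k * (m + k).+1%:R / m.+1%:R.
have tS m : t m.+1 = beta_coef m k * (m.+1%:R / m.+2%:R).
  rewrite /t /beta_coef addSn (fS (m + k).+1) (fS m).
  have := s0 m.+1; have := s0 (m + k).+1; have := f0 (m + k).+1.
  move: (m.+1%:R : R) (m.+2%:R : R) ((m + k).+2%:R : R) (m`!%:R : R) (k`!%:R : R) (((m + k).+1)`!%:R : R) => a b z c x y h1 h2 h3.
  by field; rewrite h1 h2 h3.
have t0 : t 0%N = 1 by rewrite /t bet0l add0n divr1 mulVf.
have tcvg : t M @[M --> \oo] --> (0 : R).
  rewrite -cvg_shiftS; apply: (@squeeze_cvgr _ _ _ _ (fun=> 0) (fun m => beta_coef m k)).
  - apply: nearW => m; rewrite /= tS mulr_ge0 ?bet_ge0 ?divr_ge0//= ler_piMr ?bet_ge0//.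
    by rewrite ler_pdivrMr// mul1r ler_nat.
  - exact: cvg_cst.
  - exact: bet_cvg0.
rewrite (_ : (fun M => _) = fun M => (1 - t M) - k%:R * \sum_(0 <= m < M) beta_coef m k / m.+1%:R).
  apply: cvgB; last by apply: cvgM; [exact: cvg_cst|exact: sum_bet_div_succ].
  by rewrite -[X in _ --> X]subr0; apply: cvgB; [exact: cvg_cst|].
apply/funext => M; apply/eqP; rewrite -subr_eq opprK addrC; apply/eqP.
rewrite mulr_sumr -big_split/= (@telescope_sumr_eq _ 0 M (fun m => - t m))//.
  by rewrite t0 opprK addrC.
move=> m _; rewrite tS /t.
have -> : (m + k).+1%:R = m.+1%:R + k%:R :> R by rewrite -natrD; congr (_%:R); lia.
have e2 : m.+2%:R = m.+1%:R + 1 :> R by rewrite natr1.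
have := s0 m; have := s0 m.+1; rewrite !e2.
move: (m.+1%:R : R) => a z2 z1.
by field; rewrite z2 z1.
Qed.

(** Partial fractions of 1 / ((m + 1) (m + 2)) reduce the series to the two preceding ones. *)
Lemma sum_bet_tau k : (0 < k)%N ->
  \sum_(0 <= m < M) beta_coef m k.-1 * (m.+1%:R^-1 * (1 + 2 * (k.-1)%:R / m.+2%:R)) @[M --> \oo]
    --> tau R k + 1.
Proof.
case: k => // k _ /=; rewrite /tau.
have -> : (2 * k.+1%:R ^+ 2 - 2 * k.+1%:R + 1) * trigamma_nat R k.+1 - 2 * k.+1%:R + 1 + 1 =
   (1 + 2 * k%:R) * trigamma_nat R k.+1 - 2 * k%:R * (1 - k%:R * trigamma_nat R k.+1).
  by rewrite -[k.+1%:R]natr1; ring.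
rewrite (_ : (fun M => _) = fun M => (1 + 2 * k%:R) * \sum_(0 <= m < M) beta_coef m k / m.+1%:R -
   2 * k%:R * \sum_(0 <= m < M) beta_coef m k / m.+2%:R).
  by apply: cvgB; (apply: cvgM; first exact: cvg_cst);
    [exact: sum_bet_div_succ|exact: sum_bet_div_succ2].
apply/funext => M; rewrite !mulr_sumr -sumrB; apply: eq_bigr => m _.
have e2 : m.+2%:R = m.+1%:R + 1 :> R by rewrite natr1.
have := s0 m; have := s0 m.+1; rewrite !e2.
move: (m.+1%:R : R) => a z2 z1.
by field; rewrite z2 z1.
Qed.

End beta_coefficients.

Lemma measurable_inv (R : realType) : measurable_fun [set: R] (@GRing.inv R).
Proof.
rewrite -(setUv [set (0 : R)]); apply/measurable_funU => //.
  by apply: measurableC; exact: measurable_set1.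
split; first exact: measurable_fun_set1.
apply: open_continuous_measurable_fun => [|x]; first by apply: closed_openC; exact: closed_eq.
by rewrite inE/= => /eqP x0; exact: inv_continuous.
Qed.

Lemma measurable_natmul_bool d (S : measurableType d) (R : realType) (c : S -> bool) :
  measurable_fun [set: S] c -> measurable_fun [set: S] (fun w => (c w)%:R : R).
Proof.
move=> mc; rewrite (_ : (fun t => _) = \1_[set t | c t]).
  apply: measurable_indic; have := mc measurableT [set true] I; rewrite setTI.
  by congr measurable; apply/seteqP; split => t /=; case: (c t).
by apply/funext => t; rewrite indicE; congr (_%:R); rewrite mem_setE.
Qed.

Lemma is_derive_continuous (R : realType) (F : R -> R) (x l : R) :
  is_derive x 1 F l -> {for x, continuous F}.
Proof.
by move=> h; apply: differentiable_continuous; apply/derivable1_diffP; exact: ex_derive.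
Qed.

(** * Covariances of logarithms of windows *)

Section binomial_series.
Context (R : realType).

(** Induction on s by Pascal's rule: multiplying the partial sum by 1 - x lowers s by one, up to the
    next term. That term tends to 0 because the increasing partial sums are bounded, hence
    converge. *)
Lemma binomial_series (s : nat) (x : R) : 0 <= x < 1 ->
  \sum_(0 <= m < M) 'C(s + m, m)%:R * x ^+ m @[M --> \oo] --> (1 - x) ^- s.+1.
Proof.
move=> /andP[x0 x1]; have y0 : 0 < 1 - x by rewrite subr_gt0.
pose p s M : R := \sum_(0 <= m < M) 'C(s + m, m)%:R * x ^+ m.
have p_nd s' : nondecreasing_seq (p s').
  move=> M N MN; rewrite /p (big_cat_nat (n := M) (p := N))//= lerDl.
  by apply: sumr_ge0 => j _; rewrite mulr_ge0// exprn_ge0.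
have rec s' M : (1 - x) * p s'.+1 M.+1 = p s' M.+1 - 'C(s'.+1 + M, M)%:R * x ^+ M.+1.
  elim: M => [|M ih].
    by rewrite /p !big_nat1 !bin0 !expr0 expr1; ring.
  rewrite /p big_nat_recr//= mulrDr -/(p _ _) ih [in RHS]big_nat_recr//= -/(p _ _).
  have -> : 'C(s'.+1 + M.+1, M.+1)%:R = 'C(s' + M.+1, M.+1)%:R + 'C(s'.+1 + M, M)%:R :> R.
    by rewrite -natrD; congr (_%:R); rewrite addSn addnS binS.
  by rewrite !exprS; ring.
rewrite -/(p s).
elim: s => [|s ih].
  rewrite (_ : p 0%N = fun M => (1 - x ^+ M) / (1 - x)).
    rewrite -[X in _ --> X]mul1r expr1; apply: cvgM; last exact: cvg_cst.
    rewrite -[X in _ --> X]subr0; apply: cvgB; first exact: cvg_cst.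
    by apply: cvg_expr; rewrite ger0_norm.
  apply/funext; elim=> [|M ihM]; first by rewrite /p big_nil expr0 subrr mul0r.
  rewrite /p big_nat_recr//= -/(p _ _) ihM add0n binn mul1r exprS.
  by field; rewrite gt_eqF.
have cp : cvgn (p s.+1).
  apply: nondecreasing_is_cvgn => //; exists ((1 - x) ^- s.+2) => _ [M _ <-].
  rewrite (le_trans (p_nd s.+1 _ _ (leqnSn M)))// -[X in X <= _](mulKf (lt0r_neq0 y0)).
  rewrite rec [in leRHS]exprS invfM ler_wpM2l ?invr_ge0 ?(ltW y0)//.
  rewrite (@le_trans _ _ (p s M.+1))// ?gerBl ?mulr_ge0 ?exprn_ge0//.
  by rewrite -(cvg_lim _ ih)//; apply: nondecreasing_cvgn_le => //; apply/cvg_ex; eexists; exact: ih.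
have /cvg_ex[l pl] := cp.
have t0 : 'C(s.+1 + M, M)%:R * x ^+ M @[M --> \oo] --> (0 : R).
  by have := cvg_series_cvg_0 cp; apply: cvg_trans; apply: near_eq_cvg; apply: nearW.
have pS : p s.+1 M.+1 @[M --> \oo] --> l by rewrite (cvg_shiftS (p s.+1)).
have h : (1 - x) * p s.+1 M.+1 @[M --> \oo] --> (1 - x) ^- s.+1.
  have -> : (fun M => (1 - x) * p s.+1 M.+1) =
      fun M => p s M.+1 - x * ('C(s.+1 + M, M)%:R * x ^+ M).
    by apply/funext => M; rewrite rec exprS mulrCA.
  rewrite -[X in _ --> X]subr0 -(mulr0 x); apply: cvgB.
    by rewrite (cvg_shiftS (p s)).
  by apply: cvgM => //; exact: cvg_cst.
have h' : (1 - x) * p s.+1 M.+1 @[M --> \oo] --> (1 - x) * l.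
  by apply: cvgM => //; exact: cvg_cst.
have e : (1 - x) * l = (1 - x) ^- s.+1 by apply: (cvg_unique _ h' h).
by rewrite [X in X^-1]exprS invfM -e mulKf// gt_eqF.
Qed.

End binomial_series.

(** * Beta and Frullani integrals *)

Section beta_integral.
Context (R : realType).
Notation mu := (@lebesgue_measure R).

Let m_frac m n : measurable_fun [set: R] (fun t : R => t ^+ m / (1 + t) ^+ n).
Proof.
apply: measurable_funM; first exact: exprn_measurable.
apply: (measurableT_comp (f := @GRing.inv R)); first exact: measurable_inv.
by apply: measurable_funX; exact: measurable_funD.
Qed.

(** Writing 1 = 1 / (1 + t) + t / (1 + t) splits the integrand as [bet_rec] splits the Beta values;
    for k = 0 a primitive is (t / (1 + t))^(m + 1) / (m + 1). *)
Lemma integral_beta (m k : nat) :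
  (\int[mu]_(t in `]0%R, +oo[) (t ^+ m / (1 + t) ^+ (m + k).+2)%:E = (beta_coef R m k)%:E)%E.
Proof.
have ge (t : R) n1 n2 : 0 < t -> 0 <= t ^+ n1 / (1 + t) ^+ n2.
  by move=> t0; rewrite divr_ge0 ?exprn_ge0 ?addr_ge0// ltW.
elim: k m => [|k ih] m.
  rewrite addn0 bet0r.
  have dF (t : R) : 0 <= t -> is_derive t 1 (fun t : R => m.+1%:R^-1 * (1 - (1 + t)^-1) ^+ m.+1) (t ^+ m / (1 + t) ^+ m.+2).
    move=> t0; have z : 1 + t != 0 by rewrite gt_eqF// ltr_pwDl.
    have dV : is_derive t 1 (fun t : R => (1 + t)^-1) (- (1 + t) ^- 2 *: (0 + 1)) by apply: is_deriveV.
    have dB : is_derive t 1 (fun t : R => 1 - (1 + t)^-1) (0 - (- (1 + t) ^- 2 *: (0 + 1))).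
      exact: is_deriveB.
    have dX := is_deriveX m.+1 dB.
    have dZ := is_deriveZ (m.+1%:R^-1 : R) dX.
    have eF : m.+1%:R^-1 \*: (fun t : R => 1 - (1 + t)^-1) ^+ m.+1 =
        (fun t : R => m.+1%:R^-1 * (1 - (1 + t)^-1) ^+ m.+1).
      by apply/funext => r; rewrite /= fctE.
    rewrite eF in dZ; apply: (is_derive_eq dZ); rewrite /GRing.scale/=.
    have -> : 1 - (1 + t)^-1 = t / (1 + t) by field.
    rewrite exprMn exprVn !exprS expr0.
    have : m.+1%:R != 0 :> R by rewrite pnatr_eq0.
    have : (1 + t) ^+ m != 0 by rewrite expf_neq0.
    move: ((1 + t) ^+ m) (t ^+ m) (m.+1%:R : R) => a b c h1 h2.
    by field; rewrite z h1 h2.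
  rewrite integral_itv_obnd_cbnd; last first.
    by apply/measurable_EFinP/measurable_funTS; exact: m_frac.
  rewrite (@ge0_continuous_FTC2y _ _ (fun t : R => m.+1%:R^-1 * (1 - (1 + t)^-1) ^+ m.+1) 0 m.+1%:R^-1).
  - by rewrite addr0 invr1 subrr expr0n mulr0 sube0.
  - by move=> t t0; rewrite divr_ge0 ?exprn_ge0 ?addr_ge0.
  - apply: continuous_in_subspaceT => t; rewrite inE/= in_itv/= andbT => t0.
    apply: cvgM; first exact: exprn_continuous.
    apply: cvgV; first by rewrite expf_neq0// gt_eqF// ltr_pwDl.
    apply: (@cvg_comp _ _ _ (fun r : R => 1 + r) (fun r => r ^+ m.+2) _ (nbhs (1 + t))).
      by apply: cvgD; [exact: cvg_cst|exact: cvg_id].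
    exact: exprn_continuous.
  - rewrite -[X in _ --> X]mulr1; apply: cvgM; first exact: cvg_cst.
    rewrite -[X in _ --> X](expr1n R m.+1); apply: (@cvg_comp _ _ _ _ (fun y : R => y ^+ m.+1) _ (nbhs (1 : R))); last exact: exprn_continuous.
    suff : 1 - (1 + x)^-1 @[x --> +oo] --> (1 - 0 : R) by rewrite subr0.
    apply: cvgB; first exact: cvg_cst.
    apply/gtr0_cvgV0; last by apply: cvg_addrl.
    by near=> t; rewrite addr_gt0//; near: t; exact: nbhs_pinfty_gt.
  - by move=> t t0; have ? := dF t (ltW t0); exact: ex_derive.
  - by apply: cvg_at_right_filter; exact: is_derive_continuous (dF 0 (lexx _)).
  - move=> t; rewrite in_itv/= andbT => t0; rewrite derive1E; have ? := dF t (ltW t0).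
    exact: derive_val.
have e : (\int[mu]_(t in `]0%R, +oo[) (t ^+ m / (1 + t) ^+ (m + k).+2)%:E =
    \int[mu]_(t in `]0%R, +oo[) (t ^+ m / (1 + t) ^+ (m + k.+1).+2)%:E +
    \int[mu]_(t in `]0%R, +oo[) (t ^+ m.+1 / (1 + t) ^+ (m.+1 + k).+2)%:E)%E.
  rewrite -ge0_integralD//=.
  - apply: eq_integral => t; rewrite inE/= in_itv/= andbT => t0.
    have z : 1 + t != 0 by rewrite gt_eqF// ltr_pwDl// ltW.
    rewrite -EFinD addnS addSn [(1 + t) ^+ (m + k).+3]exprS [t ^+ m.+1]exprS; congr EFin.
    have : (1 + t) ^+ (m + k).+2 != 0 by rewrite expf_neq0.
    by move: (_ ^+ (m + k).+2) (t ^+ m) => a b h1; field; rewrite h1 z.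
  - by move=> t; rewrite in_itv/= andbT => t0; rewrite lee_fin ge.
  - by apply/measurable_EFinP/measurable_funTS; exact: m_frac.
  - by move=> t; rewrite in_itv/= andbT => t0; rewrite lee_fin ge.
  - by apply/measurable_EFinP/measurable_funTS; exact: m_frac.
rewrite !ih in e; rewrite bet_rec EFinB e.
by rewrite addeK.
Unshelve. all: by end_near. Qed.

End beta_integral.

Section frullani.
Context (R : realType).
Notation mu := (@lebesgue_measure R).

Lemma integral_expR_itv (a b t : R) : a < b -> 0 < t ->
  (\int[mu]_(r in `[a, b]) (expR (- (t * r)))%:E =
   ((expR (- (t * a)) - expR (- (t * b))) / t)%:E)%E.
Proof.
move=> ab t0; have z : t != 0 by rewrite gt_eqF.
have dF (r : R) : is_derive r 1 (fun r : R => - t^-1 * expR (- (t * r))) (expR (- (t * r))).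
  by apply: is_derive_eq; rewrite /GRing.scale/=; field.
rewrite (@continuous_FTC2 _ _ (fun r : R => - t^-1 * expR (- (t * r))) a b)//.
- by rewrite -EFinB; congr EFin; field.
- apply: continuous_subspaceT => r; apply: differentiable_continuous.
  exact/derivable1_diffP.
- split.
  + by move=> r _; have ? := dF r; exact: ex_derive.
  + by apply: cvg_at_right_filter; exact: is_derive_continuous (dF a).
  + by apply: cvg_at_left_filter; exact: is_derive_continuous (dF b).
- by move=> r _; rewrite derive1E; have ? := dF r; exact: derive_val.
Qed.

Lemma integral_inv_itv (a b : R) : 0 < a -> a < b ->
  (\int[mu]_(r in `[a, b]) (r^-1)%:E = (ln b - ln a)%:E)%E.
Proof.
move=> a0 ab.
have ci (r : R) : a <= r -> {for r, continuous (@GRing.inv R)}.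
  by move=> ar; apply: inv_continuous; rewrite gt_eqF// (lt_le_trans a0).
have dl (r : R) : a <= r -> is_derive r 1 (@ln R) r^-1.
  by move=> ar; apply: is_derive1_ln; exact: lt_le_trans ar.
rewrite (@continuous_FTC2 _ _ (@ln R) a b)//.
- apply: continuous_in_subspaceT => r; rewrite inE/= in_itv/= => /andP[ar _].
  exact: ci.
- split.
  + by move=> r; rewrite in_itv/= => /andP[/ltW ar _]; have ? := dl r ar; exact: ex_derive.
  + apply: cvg_at_right_filter; apply: continuous_ln => //.
  + by apply: cvg_at_left_filter; apply: continuous_ln; exact: lt_trans ab.
- move=> r; rewrite in_itv/= => /andP[/ltW ar _]; rewrite derive1E.
  by have ? := dl r ar; exact: derive_val.
Qed.

(** The quotient is the integral of exp (- t r) over r in [a, b]; by Tonelli's theorem t may be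
    integrated first, which leaves 1 / r. *)
Lemma frullani_le (a b : R) : 0 < a -> a <= b ->
  (\int[mu]_(t in `]0%R, +oo[) ((expR (- (t * a)) - expR (- (t * b))) / t)%:E =
   (ln b - ln a)%:E)%E.
Proof.
move=> a0; rewrite le_eqVlt => /predU1P[<-|ab].
  by rewrite subrr; apply: integral0_eq => t _; rewrite subrr mul0r.
pose f (z : R * R) : \bar R := ((0 < z.1)%R%:R * (a <= z.2 <= b)%R%:R * expR (- (z.1 * z.2)))%:E.

have mf : measurable_fun setT f.
  apply/measurable_EFinP; apply: measurable_funM.
    apply: measurable_funM.
      by apply: measurable_natmul_bool; apply: measurable_fun_ltr.
    by apply: measurable_natmul_bool; apply: measurable_and; apply: measurable_fun_ler.
  apply: measurableT_comp => //; apply: measurableT_comp => //.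
  exact: measurable_funM.
have f0 z : (0 <= f z)%E by rewrite lee_fin !mulr_ge0// expR_ge0.
have := @fubini_tonelli _ _ _ _ _ mu mu f mf f0.
have -> : (\int[mu]_x \int[mu]_y f (x, y) =
   \int[mu]_(t in `]0%R, +oo[) ((expR (- (t * a)) - expR (- (t * b))) / t)%:E)%E.
  rewrite [RHS]integral_mkcond; apply: eq_integral => t _.
  rewrite patchE mem_setE in_itv/= andbT; case: ifPn => t0.
    rewrite -integral_expR_itv// [RHS]integral_mkcond; apply: eq_integral => r _.
    rewrite patchE mem_setE in_itv/= /f/= t0 mul1r; case: ifPn => h.
      by rewrite mul1r.
    by rewrite mul0r.
  by apply: integral0_eq => r _; rewrite /f/= (negbTE t0) !mul0r.
move=> ->; rewrite -integral_inv_itv// [RHS]integral_mkcond; apply: eq_integral => r _.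
rewrite patchE mem_setE in_itv/=; case: ifPn => h.
  have r0 : 0 < r by rewrite (lt_le_trans a0)//; case/andP: h.
  have := integral_expR_tail 0 r0; rewrite mulr0 oppr0 expR0 mul1r => <-.
  rewrite -integral_itv_obnd_cbnd; last first.
    apply/measurable_EFinP/measurable_funTS; apply: measurableT_comp => //.
    by apply: measurableT_comp => //; exact: measurable_funM.
  rewrite [RHS]integral_mkcond; apply: eq_integral => t _.
  rewrite patchE mem_setE in_itv/= andbT /f/= h mulr1; case: ifPn => t0.
    by rewrite mul1r mulrC.
  by rewrite mul0r.
by apply: integral0_eq => t _; rewrite /f/= (negbTE h) mulr0 mul0r.
Qed.

(** The integrand has constant sign for fixed x, so its absolute value integrates to |ln x|. The
    absolute version supplies the integrability required by Fubini's theorem. *)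
Lemma frullani (x : R) : 0 < x ->
  (\int[mu]_(t in `]0%R, +oo[) ((expR (- t) - expR (- (t * x))) / t)%:E = (ln x)%:E /\
   \int[mu]_(t in `]0%R, +oo[) (`|(expR (- t) - expR (- (t * x))) / t|)%:E = `|ln x|%:E)%E.
Proof.
move=> x0; have [x1|x1] := leP 1 x.
  have := frullani_le ltr01 x1; rewrite ln1 subr0 => e.
  have e1 : (\int[mu]_(t in `]0%R, +oo[) ((expR (- t) - expR (- (t * x))) / t)%:E = (ln x)%:E)%E.
    by rewrite -e; apply: eq_integral => t _; rewrite mulr1.
  split => //; rewrite (ger0_norm (ln_ge0 x1)) -e1.
  apply: eq_integral => t; rewrite inE/= in_itv/= andbT => t0; congr EFin.
  rewrite ger0_norm// divr_ge0 ?(ltW t0)// subr_ge0 ler_expR lerN2.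
  by rewrite ler_peMr// ltW.
have := frullani_le x0 (ltW x1); rewrite ln1 sub0r => e.
have e1 : (\int[mu]_(t in `]0%R, +oo[) (`|(expR (- t) - expR (- (t * x))) / t|)%:E = `|ln x|%:E)%E.
  rewrite (ltr0_norm (ln_lt0 _)) ?x0// -e.
  apply: eq_integral => t; rewrite inE/= in_itv/= andbT => t0; congr EFin.
  rewrite -normrN -mulNr opprB mulr1 ger0_norm// divr_ge0 ?(ltW t0)//.
  by rewrite subr_ge0 ler_expR lerN2 ler_piMr// ltW.
split => //; rewrite -[ln x]opprK EFinN -e.
rewrite -integral_ge0N; last first.
  move=> t; rewrite /= in_itv/= andbT => t0; rewrite lee_fin divr_ge0 ?(ltW t0)//.
  by rewrite mulr1 subr_ge0 ler_expR lerN2 ler_piMr// ltW.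
by apply: eq_integral => t _; rewrite -EFinN; congr EFin; rewrite (mulr1 t); ring.
Qed.

End frullani.

Section log_covariance.
Context d (T : measurableType d) (R : realType) (P : probability T R).
Notation mu := (@lebesgue_measure R).
Implicit Types (G Z : T -> R).

Lemma Cov_ctr Y Z : L2 P Y -> L2 P Z -> Cov P Y Z = Ex P (fun w => Y w * ctr P Z w).
Proof.
move=> hY hZ; rewrite /Cov.
have e := ExB (L2M hY hZ) (L1Z (Ex P Z) (L2_L1 hY)).
rewrite ExZ in e; last exact: L2_L1.
by rewrite mulrC -e; apply: eq_Ex => w; rewrite /ctr; ring.
Qed.

(* Frullani: ln a is the integral of (exp (- t) - exp (- t a)) / t over t > 0. *)
Lemma Cov_ln G Z : measurable_fun [set: T] G -> (forall w, 0 <= G w) ->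
  {ae P, forall w, 0 < G w} -> L2 P (fun w => ln (G w)) -> L2 P Z ->
  ((Cov P (fun w => ln (G w)) Z)%:E =
   \int[mu]_(t in `]0%R, +oo[) (- Cov P (fun w => expR (- (t * G w))) Z / t)%:E)%E.
Proof.
move=> mG G0 Gpos LG LZ.
(* Centring Z makes the term exp (- t), constant in w, disappear from the expectation. *)
pose Y := ctr P Z; have LY : L2 P Y by exact: L2_ctr.
pose f (z : T * R) : R := (0 < z.2)%R%:R * (expR (- z.2) - expR (- (z.2 * G z.1))) / z.2 * Y z.1.
have mf : measurable_fun setT f.
  apply: measurable_funM; last exact: (measurableT_comp LY.1).
  apply: measurable_funM; last first.
    by apply: (measurableT_comp (f := @GRing.inv R)); first exact: measurable_inv.
  apply: measurable_funM.
    by apply: measurable_natmul_bool; exact: measurable_fun_ltr.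
  apply: measurable_funB.
    by apply: measurableT_comp => //; exact: measurableT_comp.
  apply: measurableT_comp => //; apply: measurableT_comp => //.
  by apply: measurable_funM => //; exact: (measurableT_comp mG).
have inner w : 0 < G w ->
   (\int[mu]_t (f (w, t))%:E = (ln (G w) * Y w)%:E /\
    \int[mu]_t `|(f (w, t))%:E| = `|ln (G w) * Y w|%:E)%E.
  move=> Gw; have [e1 e2] := frullani Gw.
  have mg : measurable_fun (`]0%R, +oo[%classic : set R) (fun t : R => (expR (- t) - expR (- (t * G w))) / t).
    apply: measurable_funTS; apply: measurable_funM; last exact: measurable_inv.
    apply: measurable_funB; first by apply: measurableT_comp => //; exact: measurable_oppr.
    apply: measurableT_comp => //; apply: measurableT_comp => //; exact: measurable_funM.
  have ig : mu.-integrable (`]0%R, +oo[%classic : set R) (EFin \o (fun t : R => (expR (- t) - expR (- (t * G w))) / t)).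
    apply/integrableP; split; first exact/measurable_EFinP.
    by under eq_integral do rewrite /=; rewrite e2 ltry.
  split.
    rewrite mulrC EFinM -e1 -integralZl// [RHS]integral_mkcond.
    apply: eq_integral => t _; rewrite patchE mem_setE in_itv/= andbT /f/=.
    case: ifPn => t0; last by rewrite !mul0r.
    by rewrite -EFinM mul1r mulrC.
  rewrite normrM mulrC EFinM -e2 -ge0_integralZl//; last first.
    by apply/measurable_EFinP; exact: measurableT_comp.
  rewrite [RHS]integral_mkcond.
  apply: eq_integral => t _; rewrite patchE mem_setE in_itv/= andbT /f/=.
  case: ifPn => t0; last by rewrite !mul0r normr0.
  by rewrite -EFinM mul1r normrM mulrC.
have mfE : measurable_fun setT (EFin \o f) by exact/measurable_EFinP.
have LGY := L2M LG LY.
have mIn : measurable_fun [set: T] (fun w => (ln (G w) * Y w)%:E) by apply/measurable_EFinP; exact: L1_mf LGY.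
(* By Tonelli's theorem, since the inner integral of |f| is |Y ln G|, a product of two
   square-integrable functions. *)
have intf : (P \x mu)%E.-integrable setT (EFin \o f).
  apply/integrableP; split => //.
  have := @fubini_tonelli1 _ _ _ _ _ P mu (fun z => `|(f z)%:E|)%E.
  move=> -> //; last exact: measurableT_comp.
  rewrite /fubini_F.
  rewrite (@ae_eq_integral _ _ R P setT (fun w => `|ln (G w) * Y w|%:E))//.
  - by have /integrableP[_] := LGY.
  - apply: (@measurable_fun_fubini_tonelli_F _ _ _ _ _ mu (fun z => `|(f z)%:E|)%E) => //.
    exact: measurableT_comp.
  - by apply/measurable_EFinP; apply: measurableT_comp => //; exact: L1_mf LGY.
  - by apply: filterS Gpos => w Gw _; exact: (inner w Gw).2.
have := Fubini intf; rewrite /comp.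
rewrite (@ae_eq_integral _ _ R P setT (fun w => (ln (G w) * Y w)%:E))//; first last.
- by apply: filterS Gpos => w Gw _; exact: (inner w Gw).1.
- exact: (measurable_fubini_F intf).
rewrite ExE// -(Cov_ctr LG LZ) => ->.
rewrite [RHS]integral_mkcond; apply: eq_integral => t _.
rewrite patchE mem_setE in_itv/= andbT; case: ifPn => t0; last first.
  by apply: integral0_eq => w _; rewrite /f/= (negbTE t0) !mul0r.
have LE : L2 P (fun w => expR (- (t * G w))).
  apply: (@L2_bounded _ _ _ P 1) => [|w].
    by apply: measurableT_comp => //; apply: measurableT_comp => //; exact: measurable_funM.
  by rewrite ger0_norm ?expR_ge0// -expR0 ler_expR oppr_le0 mulr_ge0// ltW.
have e0 : Ex P Y = 0 by apply: Ex_ctr; exact: L2_L1.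
have e1 := ExB (L1Z (expR (- t)) (L2_L1 LY)) (L2M LE LY).
rewrite ExZ in e1; last exact: L2_L1.
rewrite e0 mulr0 sub0r -(Cov_ctr LE LZ) in e1.
have e2 := ExZ t^-1 (L1B (L1Z (expR (- t)) (L2_L1 LY)) (L2M LE LY)).
rewrite mulrC -e1 -e2 -ExE; last first.
  by apply: L1Z; apply: L1B; [apply: L1Z; exact: L2_L1|exact: L2M].
apply: eq_integral => w _; rewrite /f/= t0 (_ : true%:R = 1 :> R)//; congr EFin.
by ring.
Qed.

End log_covariance.

(** * Laplace transforms and covariances of windows *)

Section exponential_windows.
Context d (T : measurableType d) (R : realType) (P : probability T R).
Notation mu := (@lebesgue_measure R).
Variables (n : nat) (e : nat -> T -> R).
Hypothesis me : forall i, measurable_fun [set: T] (e i).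
Hypothesis ie : indep P n e.
Hypothesis he : forall i, (i < n)%N -> expo P (e i).

Lemma laplace_sum (a : nat -> R) (m : nat) : (m <= n)%N -> (forall i, 0 <= a i) ->
  Ex P (fun w => expR (- \sum_(0 <= i < m) a i * e i w)) = \prod_(0 <= i < m) (1 + a i)^-1.
Proof.
move=> mn a0; elim: m mn => [|m ih] mn.
  by rewrite big_nil -[RHS](Ex_cst P); apply: eq_Ex => w; rewrite big_nil oppr0 expR0.
rewrite [RHS]big_nat_recr; last by []. rewrite /= -ih; last exact: ltnW.
have [L1e Ee] := expo_laplace (he mn) (a0 m); rewrite -Ee.
have mS : sgm e `I_m (fun w => expR (- \sum_(0 <= i < m) a i * e i w)).
  apply: measurableT_comp => //; apply: measurableT_comp => //.
  rewrite (_ : (fun w => _) = fun w => \sum_(i < m) a i * e i w); last first.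
    by apply/funext => w; rewrite big_mkord.
  by apply: measurable_sum => i; apply: measurable_funM => //; apply: sg_coord => /=.
have mE : sgm e [set m] (fun w => expR (- (a m * e m w))).
  apply: measurableT_comp => //; apply: measurableT_comp => //.
  by apply: measurable_funM => //; apply: sg_coord.
have b1 (x : R) : 0 <= x -> `|expR (- x)| <= 1.
  by move=> x0; rewrite ger0_norm ?expR_ge0// -expR0 ler_expR oppr_le0.
have L2S : L2 P (fun w => expR (- \sum_(0 <= i < m) a i * e i w)).
  apply: (@L2_bounded _ _ _ P 1) => [|w]; first exact: sg_mf mS.
  apply: b1; rewrite big_nat_cond; apply: sumr_ge0 => i /andP[/andP[_ im] _].
  by rewrite mulr_ge0//; have [_ e0 _] := he (ltn_trans im mn).
have L2E : L2 P (fun w => expR (- (a m * e m w))).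
  apply: (@L2_bounded _ _ _ P 1) => [|w]; first exact: sg_mf mE.
  by apply: b1; rewrite mulr_ge0//; have [_ e0 _] := he mn.
have := @indep_ExM _ T R P n `I_m [set m] e _ _ me ie _ _ _ mS mE L2S L2E.
move=> <-.
- by apply: eq_Ex => w; rewrite big_nat_recr//= opprD expRD.
- by move=> i /= h; rewrite (leq_trans h)// ltnW.
- by move=> i /= ->.
- by apply/seteqP; split => // i /= [h1 h2]; move: h1; rewrite h2 ltnn.
Qed.

Variable k : nat.
Hypothesis k0 : (0 < k)%N.

Definition win (i : nat) (w : T) : R := \sum_(i <= j < i + k) e j w.

Lemma win_ind i w : (i + k <= n)%N ->
  win i w = \sum_(0 <= j < n) (i <= j < i + k)%N%:R * e j w.
Proof.
move=> ik; rewrite /win (big_nat_widenl i 0)// (big_nat_widen 0 (i + k) n)// big_mkcond/=.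
by apply: eq_bigr => j _; case: (i <= j)%N => /=; case: (j < i + k)%N; rewrite ?mul1r ?mul0r.
Qed.

Lemma measurable_win i : measurable_fun [set: T] (win i).
Proof. exact: measurable_sum. Qed.

Lemma sg_win i : sgm e [set j | (i <= j < i + k)%N] (win i).
Proof.
rewrite /win (_ : (fun w => _) = fun w => \sum_(l < k) e (l + i)%N w).
  by apply: measurable_sum => l; apply: sg_coord => /=; have := ltn_ord l; lia.
apply/funext => w; rewrite -{1}[i]add0n [(0 + i + _)%N]addnC big_addn.
rewrite (_ : (k + (0 + i) - i = k)%N); last by lia.
by rewrite big_mkord.
Qed.

Lemma win_ge0 i w : (i + k <= n)%N -> 0 <= win i w.
Proof.
move=> ik; rewrite /win big_nat_cond; apply: sumr_ge0 => j /andP[/andP[_ jk] _].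
by have [_ + _] := he (leq_trans jk ik); exact.
Qed.

Lemma win_ae_gt0 i : (i + k <= n)%N -> {ae P, forall w, 0 < win i w}.
Proof.
move=> ik; have iN : (i < n)%N by rewrite (leq_trans _ ik)// -addn1 leq_add2l.
apply: filterS (expo_ae_gt0 (he iN)) => w ei.
rewrite /win big_ltn; last by rewrite -addn1 leq_add2l.
rewrite ltr_pwDl// big_nat_cond; apply: sumr_ge0 => j /andP[/andP[_ jk] _].
by have [_ + _] := he (leq_trans jk ik); exact.
Qed.

Let prod_cst (F : nat -> R) (a b : nat) (c : R) : (forall j, (a <= j < b)%N -> F j = c) ->
  \prod_(a <= j < b) F j = c ^+ (b - a).
Proof.
move=> h; rewrite (eq_big_nat _ _ h) big_const_nat.
by elim: (b - a)%N => [|m ih]; rewrite ?expr0// exprS -ih.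
Qed.

(** Coordinates in the first window only, in both, and in the second only have Laplace parameters t,
    t + u and u; there are r, k - r and r of them. *)
Lemma laplace_win2 i r t u : (i + r + k <= n)%N -> (r <= k)%N -> 0 <= t -> 0 <= u ->
  Ex P (fun w => expR (- (t * win i w)) * expR (- (u * win (i + r) w))) =
  ((1 + t) ^+ r * (1 + u) ^+ r * (1 + t + u) ^+ (k - r))^-1.
Proof.
move=> irk rk t0 u0.
pose a j : R := t * (i <= j < i + k)%N%:R + u * (i + r <= j < i + r + k)%N%:R.
have a0 j : 0 <= a j by rewrite addr_ge0// mulr_ge0.
have := @laplace_sum a n (leqnn n) a0.
have -> : Ex P (fun w => expR (- \sum_(0 <= j < n) a j * e j w)) =
    Ex P (fun w => expR (- (t * win i w)) * expR (- (u * win (i + r) w))).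
  apply: eq_Ex => w; rewrite -expRD -opprD; congr (expR (- _)).
  rewrite !win_ind; [|lia|lia]; rewrite !mulr_sumr -big_split/=.
  by apply: eq_bigr => j _; rewrite /a; ring.
move=> ->.
rewrite (big_cat_nat (n := i))/=; [|by []|lia].
rewrite (big_cat_nat (n := (i + r)%N) (m := i))/=; [|lia|lia].
rewrite (big_cat_nat (n := (i + k)%N) (m := (i + r)%N))/=; [|lia|lia].
rewrite (big_cat_nat (n := (i + r + k)%N) (m := (i + k)%N))/=; [|lia|lia].
have aE j (b1 b2 : bool) : (i <= j < i + k)%N = b1 -> (i + r <= j < i + r + k)%N = b2 ->
  (1 + a j)^-1 = (1 + t * b1%:R + u * b2%:R)^-1 by move=> h1 h2; rewrite /a h1 h2 addrA.
rewrite (@prod_cst _ 0 i 1); last first.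
  by move=> j jb; rewrite (aE j false false) ?mulr0 ?addr0 ?invr1//; apply/negbTE; lia.
rewrite (@prod_cst _ i (i + r) (1 + t)^-1); last first.
  by move=> j jb; rewrite (aE j true false) ?mulr0 ?addr0 ?mulr1//; [lia|apply/negbTE; lia].
rewrite (@prod_cst _ (i + r) (i + k) (1 + t + u)^-1); last first.
  by move=> j jb; rewrite (aE j true true) ?mulr1//; lia.
rewrite (@prod_cst _ (i + k) (i + r + k) (1 + u)^-1); last first.
  by move=> j jb; rewrite (aE j false true) ?mulr0 ?addr0 ?mulr1//; [apply/negbTE; lia|lia].
rewrite (@prod_cst _ (i + r + k) n 1); last first.
  by move=> j jb; rewrite (aE j false false) ?mulr0 ?addr0 ?invr1//; apply/negbTE; lia.
rewrite !expr1n mul1r mulr1.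
have -> : (i + r - i = r)%N by lia.
have -> : (i + k - (i + r) = k - r)%N by lia.
have -> : (i + r + k - (i + k) = r)%N by lia.
by rewrite !exprVn !invfM; ring.
Qed.

Lemma laplace_win i t : (i + k <= n)%N -> 0 <= t ->
  Ex P (fun w => expR (- (t * win i w))) = ((1 + t) ^+ k)^-1.
Proof.
move=> ik t0; have := @laplace_win2 i 0 t 0; rewrite addn0 subn0 !expr0 !mul1r addr0.
move=> <-//; apply: eq_Ex => w; by rewrite mul0r oppr0 expR0 mulr1.
Qed.

Lemma L2_expR_win i t : (i + k <= n)%N -> 0 <= t -> L2 P (fun w => expR (- (t * win i w))).
Proof.
move=> ik t0; apply: (@L2_bounded _ _ _ P 1) => [|w].
  apply: measurableT_comp => //; apply: measurableT_comp => //.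
  by apply: measurable_funM => //; exact: measurable_win.
by rewrite ger0_norm ?expR_ge0// -expR0 ler_expR oppr_le0 mulr_ge0// win_ge0.
Qed.

Lemma Cov_expR_win i r t u : (i + r + k <= n)%N -> (r <= k)%N -> 0 <= t -> 0 <= u ->
  Cov P (fun w => expR (- (t * win i w))) (fun w => expR (- (u * win (i + r) w))) =
  ((1 + t) ^+ r * (1 + u) ^+ r * (1 + t + u) ^+ (k - r))^-1 - ((1 + t) ^+ k * (1 + u) ^+ k)^-1.
Proof.
move=> irk rk t0 u0; rewrite /Cov laplace_win2// !laplace_win//; last by lia.
by congr (_ - _); rewrite invfM.
Qed.

(** Coordinate j is separated from its window: it contributes E e exp (- t e) = (1 + t)^-2, and each
    of the k - 1 others (1 + t)^-1. *)
Lemma Cov_expR_win_coord i j t : (i + k <= n)%N -> (i <= j < i + k)%N -> 0 <= t ->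
  Cov P (fun w => expR (- (t * win i w))) (e j) = - t / (1 + t) ^+ k.+1.
Proof.
move=> ik ij t0; have jn : (j < n)%N by lia.
have [L1j Ej] := expo_mean (he jn); have [_ Exj] := expo_xlaplace (he jn) t0.
rewrite /Cov laplace_win// Ej mulr1.
pose a l : R := t * ((i <= l < i + k) && (l != j))%N%:R.
have a0 l : 0 <= a l by rewrite mulr_ge0.
have La := @laplace_sum a n (leqnn n) a0.
have pE : \prod_(0 <= l < n) (1 + a l)^-1 = ((1 + t) ^+ k.-1)^-1.
  have aE l (b : bool) : ((i <= l < i + k) && (l != j))%N = b -> (1 + a l)^-1 = (1 + t * b%:R)^-1.
    by move=> h1; rewrite /a h1.
  rewrite (big_cat_nat (n := i))/=; [|by []|lia].
  rewrite (big_cat_nat (n := j) (m := i))/=; [|lia|lia].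
  rewrite (big_cat_nat (n := j.+1) (m := j))/=; [|lia|lia].
  rewrite (big_cat_nat (n := (i + k)%N) (m := j.+1))/=; [|lia|lia].
  rewrite (@prod_cst _ 0 i 1); last first.
    by move=> l lb; rewrite (aE l false) ?mulr0 ?addr0 ?invr1//; apply/negbTE; lia.
  rewrite (@prod_cst _ i j (1 + t)^-1); last first.
    by move=> l lb; rewrite (aE l true) ?mulr1//; lia.
  rewrite (@prod_cst _ j j.+1 1); last first.
    by move=> l lb; rewrite (aE l false) ?mulr0 ?addr0 ?invr1//; apply/negbTE; lia.
  rewrite (@prod_cst _ j.+1 (i + k) (1 + t)^-1); last first.
    by move=> l lb; rewrite (aE l true) ?mulr1//; lia.
  rewrite (@prod_cst _ (i + k) n 1); last first.
    by move=> l lb; rewrite (aE l false) ?mulr0 ?addr0 ?invr1//; apply/negbTE; lia.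
  rewrite !expr1n !mul1r mulr1 -exprD exprVn; congr ((_ ^+ _)^-1); lia.
have winE w : t * win i w = \sum_(0 <= l < n) a l * e l w + t * e j w.
  rewrite win_ind// mulr_sumr (bigD1_seq j)/= ?mem_index_iota ?iota_uniq//.
  rewrite [in RHS](bigD1_seq j)/= ?mem_index_iota ?iota_uniq//.
  rewrite /a eqxx andbF mulr0 mul0r add0r ij mul1r addrC; congr (_ + _).
  by apply: eq_bigr => l lj; rewrite lj andbT mulrA.
have sS : sgm e [set l | (l < n)%N /\ l != j] (fun w => expR (- \sum_(0 <= l < n) a l * e l w)).
  apply: measurableT_comp => //; apply: measurableT_comp => //.
  rewrite (_ : (fun w => _) = fun w => \sum_(l < n) a l * e l w); last first.
    by apply/funext => w; rewrite big_mkord.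
  apply: measurable_sum => l; case: (eqVneq (l : nat) j) => [->|lj].
    rewrite (_ : (fun w => _) = fun=> 0) ?measurable_cst//.
    by apply/funext => w; rewrite /a eqxx andbF mulr0 mul0r.
  by apply: measurable_funM => //; apply: sg_coord => /=.
have sE : sgm e [set j] (fun w => e j w * expR (- (t * e j w))).
  apply: measurable_funM; first by apply: sg_coord.
  apply: measurableT_comp => //; apply: measurableT_comp => //.
  by apply: measurable_funM => //; apply: sg_coord.
have L2S : L2 P (fun w => expR (- \sum_(0 <= l < n) a l * e l w)).
  apply: (@L2_bounded _ _ _ P 1) => [|w]; first exact: sg_mf sS.
  rewrite ger0_norm ?expR_ge0// -expR0 ler_expR oppr_le0 big_nat_cond.
  apply: sumr_ge0 => l /andP[/andP[_ ln] _]; rewrite mulr_ge0//.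
  by have [_ + _] := he ln; exact.
have e0 w : 0 <= e j w by have [_ + _] := he jn; exact.
have L2E : L2 P (fun w => e j w * expR (- (t * e j w))).
  apply: (@L2_le _ _ _ P _ (e j)) (expo_L2 (he jn)).1 => [|w]; first exact: sg_mf sE.
  rewrite normrM (ger0_norm (e0 w)) ger0_norm ?expR_ge0// ler_piMr//.
  by rewrite -expR0 ler_expR oppr_le0 mulr_ge0.
have := @indep_ExM _ T R P n [set l | (l < n)%N /\ l != j] [set j] e _ _ me ie _ _ _ sS sE L2S L2E.
rewrite La pE Exj => H.
have -> : Ex P (fun w => expR (- (t * win i w)) * e j w) = ((1 + t) ^+ k.-1)^-1 * (1 + t) ^- 2.
  rewrite -H; [|by move=> l []|by move=> l ->|].
    by apply: eq_Ex => w; rewrite winE opprD expRD; ring.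
  by apply/seteqP; split => // l /= [[_ /eqP h1] h2].
have z : 1 + t != 0 by rewrite gt_eqF// ltr_pwDl.
have [k' ->] : exists k', k = k'.+1 by exists k.-1; rewrite prednK.
rewrite /= !exprS expr0.
have : (1 + t) ^+ k' != 0 by rewrite expf_neq0.
by move: ((1 + t) ^+ k') => b h; field; rewrite h z.
Qed.

Notation bt := (@beta_coef R).

Hypothesis Lln : forall i, (i + k <= n)%N -> L2 P (fun w => ln (win i w)).

(** Frullani's formula leaves the integral of (1 + t)^(- k - 1), a Beta value. *)
Lemma Cov_ln_win_coord i j : (i + k <= n)%N -> (i <= j < i + k)%N ->
  Cov P (fun w => ln (win i w)) (e j) = k%:R^-1.
Proof.
move=> ik ij; have jn : (j < n)%N by lia.
apply/EFin_inj; rewrite Cov_ln//.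
- have := @integral_beta R 0 k.-1; rewrite bet0l prednK// => <-.
  apply: eq_integral => t; rewrite inE/= in_itv/= andbT => t0.
  rewrite Cov_expR_win_coord// ?ltW// expr0; congr EFin.
  have z : 1 + t != 0 by rewrite gt_eqF// ltr_pwDl// ltW.
  have : (1 + t) ^+ k.+1 != 0 by rewrite expf_neq0.
  by move: (_ ^+ k.+1) => b hb; field; rewrite hb gt_eqF.
- exact: measurable_win.
- by move=> w; exact: win_ge0.
- exact: win_ae_gt0.
- exact: Lln.
- exact: (expo_L2 (he jn)).1.
Qed.

Let beta_mf (c : R) m : measurable_fun (`]0%R, +oo[%classic : set R)
  (fun t : R => (c * (t ^+ m / (1 + t) ^+ (m + k.-1).+2))%:E).
Proof.
apply/measurable_EFinP/measurable_funTS; apply: measurable_funM => //.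
apply: measurable_funM; first exact: exprn_measurable.
apply: (measurableT_comp (f := @GRing.inv R)); first exact: measurable_inv.
by apply: measurable_funX; exact: measurable_funD.
Qed.

Let beta_ge0 (t : R) m : 0 < t -> 0 <= t ^+ m / (1 + t) ^+ (m + k.-1).+2.
Proof. by move=> t0; rewrite divr_ge0 ?exprn_ge0 ?addr_ge0// ltW. Qed.

Let integral_betaZ (c : R) m : 0 <= c ->
  (\int[mu]_(t in `]0%R, +oo[) (c * (t ^+ m / (1 + t) ^+ (m + k.-1).+2))%:E = (c * bt m k.-1)%:E)%E.
Proof.
move=> c0; under eq_integral do rewrite EFinM.
rewrite ge0_integralZl//=; first by rewrite integral_beta -EFinM.
  by apply: eq_measurable_fun (beta_mf 1 m) => u _; rewrite mul1r.
by move=> u; rewrite in_itv/= andbT => u0; rewrite lee_fin beta_ge0.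
Qed.

(** Frullani's formula is applied to both logarithms. As 1 + t + u = (1 + t) (1 + u) (1 - x) with x
    = t u / ((1 + t) (1 + u)), the covariance of the exponentials is a binomial series in x with
    nonnegative terms, which may be integrated term by term; the integrals in t and in u are Beta
    values. *)
Lemma Cov_ln_win i r : (i + r + k <= n)%N -> (r < k)%N ->
  \sum_(0 <= m < M) 'C(k - r + m, m.+1)%:R * bt m k.-1 ^+ 2 @[M --> \oo]
   --> Cov P (fun w => ln (win i w)) (fun w => ln (win (i + r) w)).
Proof.
move=> irk rk; have ik : (i + k <= n)%N by lia.
set s := (k - r)%N; have s0 : (0 < s)%N by rewrite subn_gt0.
pose tm m (t u : R) : R := 'C(s + m, m.+1)%:R * (t ^+ m / (1 + t) ^+ (m + k.-1).+2) * (u ^+ m / (1 + u) ^+ (m + k.-1).+2).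
have ptw (t u : R) : 0 < t -> 0 < u ->
   \sum_(0 <= m < M) tm m t u @[M --> \oo] -->
   Cov P (fun w => expR (- (t * win i w))) (fun w => expR (- (u * win (i + r) w))) / (t * u).
  move=> t0 u0.
  have t1 : 0 < 1 + t by rewrite ltr_pwDl// ltW.
  have u1 : 0 < 1 + u by rewrite ltr_pwDl// ltW.
  pose x := t * u / ((1 + t) * (1 + u)).
  have x01 : 0 <= x < 1.
    rewrite /x ltr_pdivrMr ?mulr_gt0// mul1r divr_ge0 ?mulr_ge0 ?(ltW t1) ?(ltW u1) ?(ltW t0) ?(ltW u0)//=.
    nra.
  (* The series of (1 - x)^(- s) is shifted by one because its first term, 1, cancels against the
     product of the means. *)
  have := @binomial_series R s.-1 x x01; rewrite prednK// -cvg_shiftS => bs.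
  rewrite Cov_expR_win ?(ltW t0) ?(ltW u0)//; last exact: ltnW.
  have -> : (((1 + t) ^+ r * (1 + u) ^+ r * (1 + t + u) ^+ (k - r))^-1 -
       ((1 + t) ^+ k * (1 + u) ^+ k)^-1) / (t * u) =
     ((1 - x) ^- s - 1) * (((1 + t) ^+ k * (1 + u) ^+ k)^-1 / (t * u)).
    have -> : 1 - x = (1 + t + u) / ((1 + t) * (1 + u)).
      by rewrite /x; field; rewrite !gt_eqF.
    rewrite -/s; have -> : k = (r + s)%N by rewrite subnKC// ltnW.
    rewrite !exprD expr_div_n !exprMn.
    have := lt0r_neq0 (exprn_gt0 r t1); have := lt0r_neq0 (exprn_gt0 r u1).
    have := lt0r_neq0 (exprn_gt0 s t1); have := lt0r_neq0 (exprn_gt0 s u1).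
    have tu1 : 0 < 1 + t + u by rewrite addr_gt0.
    have := lt0r_neq0 (exprn_gt0 s tu1).
    move: ((1 + t) ^+ r) ((1 + u) ^+ r) ((1 + t) ^+ s) ((1 + u) ^+ s) ((1 + t + u) ^+ s) => a1 a2 a3 a4 a5 h1 h2 h3 h4 h5.
    by field; rewrite h1 h2 h3 h4 h5 !gt_eqF.
  have -> : (fun M => \sum_(0 <= m < M) tm m t u) =
     fun M => (\sum_(0 <= m < M.+1) 'C(s.-1 + m, m)%:R * x ^+ m - 1) *
      (((1 + t) ^+ k * (1 + u) ^+ k)^-1 / (t * u)).
    apply/funext => M; rewrite big_nat_recl//= bin0 expr0 mulr1 addrAC subrr add0r mulr_suml.
    apply: eq_bigr => m _; rewrite /tm.
    have -> : (s.-1 + m.+1 = s + m)%N by lia.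
    have -> : (m + k.-1).+2 = (m.+1 + k)%N by lia.
    rewrite /x !expr_div_n !exprMn !exprD.
    have := lt0r_neq0 (exprn_gt0 m t1); have := lt0r_neq0 (exprn_gt0 m u1).
    have := lt0r_neq0 (exprn_gt0 k t1); have := lt0r_neq0 (exprn_gt0 k u1).
    rewrite !exprS; move: ((1 + t) ^+ m) ((1 + u) ^+ m) ((1 + t) ^+ k) ((1 + u) ^+ k) => a1 a2 a3 a4 h1 h2 h3 h4.
    by field; rewrite h1 h2 h3 h4 !gt_eqF.
  by apply: cvgM; [apply: cvgB => //; exact: cvg_cst|exact: cvg_cst].
have tm0 m t u : 0 < t -> 0 < u -> 0 <= tm m t u.
  by move=> t0 u0; rewrite !mulr_ge0// ?exprn_ge0 ?invr_ge0 ?exprn_ge0 ?addr_ge0// ltW.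
have eseries (a : nat -> R) (l : R) : \sum_(0 <= m < M) a m @[M --> \oo] --> l ->
    (\sum_(m <oo) (a m)%:E = l%:E)%E.
  move=> al; apply/cvg_lim => //.
  have -> : (fun M => \sum_(0 <= m < M) (a m)%:E)%E = fun M => (\sum_(0 <= m < M) a m)%:E.
    by apply/funext => M; rewrite sumEFin.
  by apply: cvg_EFin => //; exact: nearW.
have CE : ((Cov P (fun w => ln (win i w)) (fun w => ln (win (i + r) w)))%:E =
   \sum_(m <oo) ('C(s + m, m.+1)%:R * bt m k.-1 ^+ 2)%:E)%E.
  rewrite Cov_ln//; [|exact: measurable_win|by move=> w; exact: win_ge0|exact: win_ae_gt0|exact: Lln|exact: Lln].
  transitivity (\int[mu]_(t in `]0%R, +oo[) \int[mu]_(u in `]0%R, +oo[) \sum_(m <oo) (tm m t u)%:E)%E.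
    apply: eq_integral => t; rewrite inE/= in_itv/= andbT => t0.
    have LE := L2_expR_win ik (ltW t0).
    have mtm m : measurable_fun (`]0%R, +oo[%classic : set R) (fun u : R => (tm m t u)%:E).
      exact: beta_mf.
    have tmE m u : u \in `]0, +oo[%R -> (0 <= (tm m t u)%:E)%E.
      by rewrite in_itv/= andbT => u0; rewrite lee_fin tm0.
    have e1 : ((Cov P (fun w => ln (win (i + r) w)) (fun w => expR (- (t * win i w))))%:E =
        - (t%:E * \int[mu]_(u in `]0%R, +oo[) \sum_(m <oo) (tm m t u)%:E))%E.
      rewrite Cov_ln//; [|exact: measurable_win|by move=> w; exact: win_ge0|exact: win_ae_gt0|exact: Lln].
      rewrite -ge0_integralZl//=; last 3 first.
      - by apply: (@ge0_emeasurable_sum _ _ _ _ (fun m u => (tm m t u)%:E) xpredT) => [m u u0 _|m _];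
          [exact: tmE|exact: mtm].
      - by move=> u u0; apply: nneseries_ge0 => m _ _; exact: tmE.
      - by rewrite lee_fin ltW.
      rewrite -integral_ge0N; last first.
        move=> u u0; apply: mule_ge0; first by rewrite lee_fin ltW.
        by apply: nneseries_ge0 => m _ _; exact: tmE.
      apply: eq_integral => u; rewrite inE/= in_itv/= andbT => u0.
      rewrite (eseries _ _ (ptw t u t0 u0)) -EFinM -EFinN; congr EFin.
      by rewrite CovC; field; rewrite !gt_eqF.
    set I := (\int[mu]_(u in _) _)%E in e1 *.
    have -> : (- Cov P (fun w => expR (- (t * win i w))) (fun w => ln (win (i + r) w)) / t)%:E =
      ((t^-1)%:E * - (Cov P (fun w => ln (win (i + r) w)) (fun w => expR (- (t * win i w))))%:E)%E.
      by rewrite -EFinN -EFinM CovC mulrC.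
    by rewrite e1 oppeK muleA -EFinM mulVf ?mul1e// gt_eqF.
  transitivity (\int[mu]_(t in `]0%R, +oo[)
     \sum_(m <oo) (('C(s + m, m.+1)%:R * bt m k.-1) * (t ^+ m / (1 + t) ^+ (m + k.-1).+2))%:E)%E.
    apply: eq_integral => t; rewrite inE/= in_itv/= andbT => t0.
    rewrite integral_nneseries//=; last 2 first.
    - by move=> m; exact: beta_mf.
    - by move=> m u; rewrite in_itv/= andbT => u0; rewrite lee_fin tm0.
    apply: eq_eseriesr => m _; rewrite integral_betaZ; last by rewrite mulr_ge0 ?beta_ge0.
    by congr EFin; ring.
  rewrite integral_nneseries//=; last 2 first.
  - by move=> m; exact: beta_mf.
  - by move=> m u; rewrite in_itv/= andbT => u0; rewrite lee_fin mulr_ge0 ?beta_ge0// mulr_ge0 ?bet_ge0.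
  apply: eq_eseriesr => m _; rewrite integral_betaZ; last by rewrite mulr_ge0 ?bet_ge0.
  by congr EFin; ring.
have : (\sum_(0 <= m < M) ('C(s + m, m.+1)%:R * bt m k.-1 ^+ 2)%:E @[M --> \oo] -->
   (Cov P (fun w => ln (win i w)) (fun w => ln (win (i + r) w)))%:E)%E.
  rewrite CE; apply: is_cvg_nneseries => m _ _.
  by rewrite lee_fin mulr_ge0 ?sqr_ge0.
have -> : (fun M => \sum_(0 <= m < M) ('C(s + m, m.+1)%:R * bt m k.-1 ^+ 2)%:E)%E =
   fun M => (\sum_(0 <= m < M) 'C(s + m, m.+1)%:R * bt m k.-1 ^+ 2)%:E.
  by apply/funext => M; rewrite sumEFin.
by move=> /fine_cvgP[_].
Qed.

End exponential_windows.

Section tau_identity.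
Context (R : realType).
Notation bt := (@beta_coef R).

(** Hockey-stick identity. *)
Lemma sum_binS (k m : nat) : (\sum_(1 <= s < k) 'C(s + m, m.+1) = 'C(k + m, m.+2))%N.
Proof.
elim: k => [|k ih]; first by rewrite big_geq// add0n bin_small.
case: k ih => [|k] ih; first by rewrite big_geq// add1n bin_small.
by rewrite big_nat_recr//= ih [in RHS]addSn binS addnC.
Qed.

Lemma bin_bet (k m : nat) : (0 < k)%N -> 'C(k + m, m.+1)%:R * bt m k.-1 = m.+1%:R^-1.
Proof.
case: k => // k _ /=.
have := @bin_fact (k.+1 + m) m.+1; rewrite (_ : (k.+1 + m - m.+1 = k)%N); last by lia.
move=> /(_ _)/wrap[|h]; first by lia.
have hR : 'C(k.+1 + m, m.+1)%:R * (m.+1%:R * m`!%:R * k`!%:R) = (m + k).+1`!%:R :> R.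
  by rewrite -!natrM; congr (_%:R); rewrite -factS h; congr (_`!); lia.
rewrite /beta_coef -hR.
have h1 : m.+1%:R != 0 :> R by rewrite pnatr_eq0.
have h2 : m`!%:R != 0 :> R by rewrite pnatr_eq0 -lt0n fact_gt0.
have h3 : k`!%:R != 0 :> R by rewrite pnatr_eq0 -lt0n fact_gt0.
have h4 : 'C(k.+1 + m, m.+1)%:R != 0 :> R.
  by rewrite pnatr_eq0 -lt0n bin_gt0; lia.
move: h1 h2 h3 h4; move: (m.+1%:R : R) (m`!%:R : R) (k`!%:R : R) ('C(k.+1 + m, m.+1)%:R : R) => a b c x h1 h2 h3 h4.
by field; rewrite h1 h2 h3 h4.
Qed.

(** [c s] stands for the covariance of two windows sharing s indices, so the left side is the
    variance per term. The hockey-stick identity sums the binomials over s, and [bin_bet] absorbs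
    one of the two Beta factors. *)
Lemma sum_cov_tau (k : nat) (c : nat -> R) : (0 < k)%N ->
  (forall s, (0 < s <= k)%N ->
    \sum_(0 <= m < M) 'C(s + m, m.+1)%:R * bt m k.-1 ^+ 2 @[M --> \oo] --> c s) ->
  c k + 2 * \sum_(1 <= s < k) c s = tau R k + 1.
Proof.
move=> k0 h; apply: (cvg_unique _ _ (@sum_bet_tau R k k0)) => //.
have h2 : \sum_(1 <= s < k) \sum_(0 <= m < M) 'C(s + m, m.+1)%:R * bt m k.-1 ^+ 2 @[M --> \oo]
    --> \sum_(1 <= s < k) c s.
  have : forall j, (j <= k)%N -> \sum_(1 <= s < j) \sum_(0 <= m < M) 'C(s + m, m.+1)%:R * bt m k.-1 ^+ 2 @[M --> \oo]
    --> \sum_(1 <= s < j) c s.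
    elim=> [_|[|j] ih jk].
    - by rewrite big_geq//; under eq_fun do rewrite big_geq//; exact: cvg_cst.
    - by rewrite big_geq//; under eq_fun do rewrite big_geq//; exact: cvg_cst.
    - rewrite big_nat_recr//=; under eq_fun do rewrite big_nat_recr//=.
      by apply: cvgD; [apply: ih; exact: ltnW|apply: h; exact: ltnW].
  exact.
have h1 := h k; rewrite k0 leqnn in h1; have {}h1 := h1 isT.
have h3 : (\sum_(0 <= m < M) 'C(k + m, m.+1)%:R * bt m k.-1 ^+ 2) +
   2 * (\sum_(1 <= s < k) \sum_(0 <= m < M) 'C(s + m, m.+1)%:R * bt m k.-1 ^+ 2) @[M --> \oo]
   --> c k + 2 * \sum_(1 <= s < k) c s.
  by apply: cvgD => //; apply: cvgM => //; exact: cvg_cst.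
rewrite /= (_ : (fun M => _) = fun M => (\sum_(0 <= m < M) 'C(k + m, m.+1)%:R * bt m k.-1 ^+ 2) +
   2 * (\sum_(1 <= s < k) \sum_(0 <= m < M) 'C(s + m, m.+1)%:R * bt m k.-1 ^+ 2))//.
apply/funext => M; symmetry.
rewrite exchange_big/= mulr_sumr -big_split/=; apply: eq_bigr => m _.
rewrite -mulr_suml -natr_sum sum_binS.
have e1 := bin_bet m k0.
have e2 : 'C(k + m, m.+2)%:R * m.+2%:R = 'C(k + m, m.+1)%:R * k.-1%:R :> R.
  rewrite -!natrM; congr (_%:R); have := mul_bin_left (k + m) m.+1.
  by rewrite (_ : (k + m - m.+1 = k.-1)%N); [lia|lia].
have e3 : 'C(k + m, m.+2)%:R = 'C(k + m, m.+1)%:R * k.-1%:R / m.+2%:R :> R.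
  by rewrite -e2 mulfK// pnatr_eq0.
rewrite e3 expr2 -e1.
have : m.+2%:R != 0 :> R by rewrite pnatr_eq0.
by move: (m.+2%:R : R) => a ha; field.
Qed.

End tau_identity.

(** * Fourth moments of logarithms of windows *)

Section log_moments.
Context d (T : measurableType d) (R : realType) (P : probability T R).
Notation mu := (@lebesgue_measure R).

(** exp (- e) is uniform on [0, 1], hence so is 1 - exp (- e). As 1 - exp (- e) <= e, the dual
    variable dominates - ln e and tames the singularity of the logarithm at 0. *)
Lemma expo_dual (e : T -> R) : expo P e -> expo P (fun w => - ln (1 - expR (- e w))).
Proof.
move=> he; have [me e0 te] := he; split.
- apply: measurableT_comp => //; apply: measurableT_comp; first exact: measurable_ln.
  by apply: measurable_funB => //; apply: measurableT_comp => //; exact: measurableT_comp.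
- move=> w; rewrite oppr_ge0 ln_le0// gerBl expR_ge0.
- move=> t t0; have gtc c : 0 <= c -> P [set w | c <= e w] = (expR (- c))%:E.
    move=> c0; rewrite -integral_bool; last exact: measurable_fun_ler.
    rewrite (@expo_integral _ _ _ _ e (fun x => (c <= x)%R%:R%:E)) => //.
      have := integral_expR_tail c (@ltr01 R); rewrite divr1 mul1r => <-.
      rewrite [LHS]integral_mkcond [RHS]integral_mkcond; apply: eq_integral => x _.
      rewrite !patchE !mem_setE !in_itv/= !andbT mul1r; have [cx|cx] := leP c x.
        by rewrite (le_trans c0 cx) mul1e.
      by rewrite mul0e if_same.
    by apply/measurable_EFinP; apply: measurable_natmul_bool; exact: measurable_fun_ler.
  have m0e : measurable [set w | 0 < e w].
    by rewrite -[X in measurable X]setTI; apply: (measurable_fun_ltr _ _) (measurableT) [set true] _ => //.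
  have p0e : P [set w | 0 < e w] = 1%E by rewrite te// oppr0 expR0.
  have lt1 w : 0 < e w -> 0 < 1 - expR (- e w) /\ 1 - expR (- e w) < 1.
    move=> ew; split; first by rewrite subr_gt0 -expR0 ltr_expR oppr_lt0.
    by rewrite gtrBl expR_gt0.
  (* For e = 0 the convention ln 0 = 0 gives the value 0; at t = 0 the event is therefore exactly 0
     < e. *)
  move: t0; rewrite le_eqVlt => /predU1P[<-|t0].
    rewrite oppr0 expR0 -p0e; congr (P _); apply/seteqP; split => w /=.
      have := e0 w; rewrite le_eqVlt => /predU1P[<-|//].
      by rewrite oppr0 expR0 subrr ln0// oppr0 ltxx.
    by move=> /lt1[h1 h2]; rewrite oppr_gt0 ln_lt0// h1.
  have y0 : 0 < 1 - expR (- t) by rewrite subr_gt0 -expR0 ltr_expR oppr_lt0.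
  have y1 : 1 - expR (- t) < 1 by rewrite gtrBl expR_gt0.
  pose c := - ln (1 - expR (- t)).
  have c0 : 0 < c by rewrite oppr_gt0 ln_lt0// y0.
  have -> : [set w | t < - ln (1 - expR (- e w))] = [set w | 0 < e w] `\` [set w | c <= e w].
    apply/seteqP; split => w /=.
      have := e0 w; rewrite le_eqVlt => /predU1P[<-|ew].
        by rewrite oppr0 expR0 subrr ln0// oppr0 ltNge (ltW t0).
      have [h1 h2] := lt1 _ ew; move=> h; split => //; apply/negP; rewrite -ltNge.
      move: h; rewrite ltrNr -ltr_expR lnK ?posrE// => h.
      by rewrite /c ltrNr -ltr_expR lnK ?posrE//; lra.
    move=> [ew /negP]; rewrite -ltNge => h; have [h1 h2] := lt1 _ ew.
    rewrite ltrNr -ltr_expR lnK ?posrE//.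
    by rewrite /c ltrNr -ltr_expR lnK ?posrE// in h; lra.
  have mce : measurable [set w | c <= e w].
    by rewrite -[X in measurable X]setTI; apply: (measurable_fun_ler _ _) (measurableT) [set true] _ => //.
  rewrite measureD//; last by rewrite -ge0_fin_numE// fin_num_measure.
  transitivity (1%:E - (expR (- c))%:E)%E.
    congr (_ - _)%E; first exact: p0e.
    rewrite -gtc ?(ltW c0)//; congr (P _).
    by apply/seteqP; split => w /=; [case|move=> h; split => //; exact: lt_le_trans h].
  by rewrite /c opprK lnK ?posrE// -EFinB; congr EFin; ring.
Qed.

Lemma pow4D_le (a b : R) : (a + b) ^+ 4 <= 8 * (a ^+ 4 + b ^+ 4).
Proof.
have h1 : (a + b) ^+ 2 <= 2 * (a ^+ 2 + b ^+ 2) by have := sqr_ge0 (a - b); lra.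
have h2 : (a ^+ 2 + b ^+ 2) ^+ 2 <= 2 * (a ^+ 4 + b ^+ 4).
  have -> : a ^+ 4 = (a ^+ 2) ^+ 2 by rewrite -exprM.
  have -> : b ^+ 4 = (b ^+ 2) ^+ 2 by rewrite -exprM.
  by have := sqr_ge0 (a ^+ 2 - b ^+ 2); lra.
have h3 : ((a + b) ^+ 2) ^+ 2 <= (2 * (a ^+ 2 + b ^+ 2)) ^+ 2.
  by rewrite ler_pXn2r// nnegrE ?sqr_ge0// mulr_ge0// addr_ge0// sqr_ge0.
rewrite -exprM in h3; apply: le_trans h3 _; rewrite exprMn; lra.
Qed.

Lemma pow4_sum_le (a : nat -> R) (i m : nat) :
  (\sum_(i <= l < i + m) a l) ^+ 4 <= 8 ^+ m * \sum_(i <= l < i + m) a l ^+ 4.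
Proof.
elim: m => [|m ih]; first by rewrite addn0 !big_geq// expr0n mulr0.
rewrite addnS !big_nat_recr ?leq_addr//=; apply: le_trans (pow4D_le _ _) _.
have -> (z : R) : 8 ^+ m.+1 * z = 8 * (8 ^+ m * z) by rewrite exprS mulrA.
rewrite ler_wpM2l// mulrDr lerD// ler_peMl ?exprn_even_ge0//.
by rewrite exprn_ege1// ler1n.
Qed.

Section window.
Variables (n : nat) (e : nat -> T -> R).
Hypothesis he : forall i, (i < n)%N -> expo P (e i).
Variable k : nat.
Hypothesis k0 : (0 < k)%N.
Let me i : (i < n)%N -> measurable_fun [set: T] (e i).
Proof. by move=> /he[]. Qed.

(** k exponential variables and one dual variable, each with fourth moment at most 2 * 8^4; the
    powers of 8 come from repeated use of [pow4D_le]. *)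
Definition ln_win_pow4_bound : R := 8 ^+ k.+1 * (k.+1%:R * (2 * 8 ^+ 4)).

(** |ln W| is at most W if W >= 1, and at most the dual variable of e_i if W < 1, because W >=
    e_i. *)
Lemma ln_win_pow4 i : (i + k <= n)%N -> measurable_fun [set: T] (win e k i) ->
  L1 P (fun w => ln (win e k i w) ^+ 4) /\ Ex P (fun w => ln (win e k i w) ^+ 4) <= ln_win_pow4_bound.
Proof.
move=> ik mw; have iN : (i < n)%N by lia.
pose e' w := - ln (1 - expR (- e i w)).
have he' : expo P e' := expo_dual (he iN).
have e0 j w : (j < n)%N -> 0 <= e j w by move=> /he[_ + _]; exact.
(* The indicator of 0 < e_i, almost surely 1, makes the bound hold at every point. *)
pose Y w := (0 < e i w)%R%:R * ln (win e k i w).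
have mY : measurable_fun [set: T] Y.
  apply: measurable_funM.
    by apply: measurable_natmul_bool; apply: measurable_fun_ltr => //; exact: me.
  by apply: measurableT_comp => //; exact: measurable_ln.
have YE : {ae P, forall w, ln (win e k i w) ^+ 4 = Y w ^+ 4}.
  by apply: filterS (expo_ae_gt0 (he iN)) => w ei; rewrite /Y ei mul1r.
pose S w := 8 * (8 ^+ k * \sum_(i <= l < i + k) e l w ^+ 4 + e' w ^+ 4).
have winE w : win e k i w = e i w + \sum_(i.+1 <= l < i + k) e l w.
  by rewrite /win big_ltn//; lia.
have rest0 w : 0 <= \sum_(i.+1 <= l < i + k) e l w.
  rewrite big_nat_cond; apply: sumr_ge0 => l /andP[/andP[_ lk] _].
  by apply: e0; lia.
have YS w : `|Y w ^+ 4| <= S w.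
  rewrite ger0_norm ?exprn_even_ge0//.
  have Yb : `|Y w| <= win e k i w + e' w.
    have e'0 : 0 <= e' w by case: he' => _ + _; exact.
    have w0 : 0 <= win e k i w by rewrite winE addr_ge0// e0.
    rewrite /Y; have [ei|ei] := ltP 0 (e i w); last by rewrite mul0r normr0 addr_ge0.
    rewrite mul1r; have wp : 0 < win e k i w by rewrite winE ltr_wpDr.
    have [w1|w1] := leP 1 (win e k i w).
      rewrite ger0_norm ?ln_ge0// (@le_trans _ _ (win e k i w))// ?lerDl//.
      by have := expR_ge1Dx (ln (win e k i w)); rewrite lnK ?posrE//; lra.
    rewrite ltr0_norm ?ln_lt0 ?wp// (@le_trans _ _ (e' w))// ?lerDr// /e' lerN2.
    have h1 : 0 < 1 - expR (- e i w) by rewrite subr_gt0 -expR0 ltr_expR oppr_lt0.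
    rewrite ler_ln ?posrE// (@le_trans _ _ (e i w))//.
      by have := expR_ge1Dx (- e i w); lra.
    by rewrite winE lerDl.
  have -> : Y w ^+ 4 = `|Y w| ^+ 4 by rewrite -normrX ger0_norm// exprn_even_ge0.
  apply: (@le_trans _ _ ((win e k i w + e' w) ^+ 4)).
    by rewrite ler_pXn2r// nnegrE// (le_trans _ Yb).
  apply: le_trans (pow4D_le _ _) _; rewrite /S ler_wpM2l// lerD2r.
  exact: pow4_sum_le.
pose c4 := 2 * (8 : R) ^+ 4.
have Lp l : (l < n)%N -> L1 P (fun w => e l w ^+ 4) /\ Ex P (fun w => e l w ^+ 4) <= c4.
  by move=> ln; exact: expo_pow4 (he ln).
have Lsum : L1 P (fun w => \sum_(i <= l < i + k) e l w ^+ 4) /\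
    Ex P (fun w => \sum_(i <= l < i + k) e l w ^+ 4) <= k%:R * c4.
  have Ls l : (i <= l < i + k)%N -> L1 P (fun w => e l w ^+ 4) by move=> lk; apply: (Lp l _).1; lia.
  have eqs w : \sum_(i <= l < i + k) e l w ^+ 4 = \sum_(i <= l < i + k | (i <= l < i + k)%N) e l w ^+ 4.
    by rewrite [LHS]big_nat_cond; apply: eq_bigl => l; rewrite andbT.
  have LLs := @L1_sum _ _ _ P nat (index_iota i (i + k)) _ (fun l w => e l w ^+ 4) Ls.
  split; first by apply: eq_L1 LLs => w; rewrite eqs.
  rewrite (eq_Ex _ eqs) (@Ex_sum _ _ _ P nat (index_iota i (i + k)) _ (fun l w => e l w ^+ 4) Ls).
  rewrite (@le_trans _ _ (\sum_(i <= l < i + k | (i <= l < i + k)%N) c4))//.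
    by apply: ler_sum => l lk; apply: (Lp l _).2; lia.
  rewrite (eq_bigl (fun l => (i <= l < i + k)%N && true)) -?big_nat_cond; last by move=> l; rewrite andbT.
  by rewrite big_const_nat iter_addr_0 addKn mulr_natl.
have [Le' Ee'] := expo_pow4 he'.
have LS : L1 P S by apply: L1Z; apply: L1D => //; apply: L1Z; exact: Lsum.1.
have LY : L1 P (fun w => Y w ^+ 4).
  by apply: (L1_le _ YS LS); exact: measurable_funX.
have mln : measurable_fun [set: T] (fun w => ln (win e k i w) ^+ 4).
  by apply: measurable_funX; apply: measurableT_comp => //; exact: measurable_ln.
split; first by apply: (L1_ae mln (L1_mf LY) YE).
rewrite (Ex_ae mln (L1_mf LY) YE).
apply: (@le_trans _ _ (Ex P S)).
  by apply: Ex_le => // w; exact: le_trans (ler_norm _) (YS w).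
have LL := L1Z (8 ^+ k) Lsum.1.
have e1 := ExZ 8 (L1D LL Le'); have e2 := ExD LL Le'; have e3 := ExZ (8 ^+ k) Lsum.1.
rewrite /S e1 e2 e3 /ln_win_pow4_bound exprS -/c4 -mulrA ler_wpM2l//.
have -> : 8 ^+ k * (k.+1%:R * c4) = 8 ^+ k * (k%:R * c4) + 8 ^+ k * c4.
  by rewrite -[k.+1%:R]natr1; ring.
rewrite lerD//.
  by rewrite ler_wpM2l ?exprn_ge0// Lsum.2.
by rewrite (le_trans Ee')// -/c4 ler_peMl ?exprn_ege1 ?ler1n// mulr_ge0// exprn_ge0.
Qed.

Lemma L2_ln_win i : (i + k <= n)%N -> measurable_fun [set: T] (win e k i) ->
  L2 P (fun w => ln (win e k i w)).
Proof.
move=> ik mw; have [h _] := ln_win_pow4 ik mw.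
have ml : measurable_fun [set: T] (fun w => ln (win e k i w)).
  by apply: measurableT_comp => //; exact: measurable_ln.
split=> //; apply: (L1_le _ _ (L1D (L1_cst P 1) h)); first exact: measurable_funX.
move=> w; rewrite ger0_norm ?sqr_ge0//.
have -> : ln (win e k i w) ^+ 4 = (ln (win e k i w) ^+ 2) ^+ 2 by rewrite -exprM.
have h1 := sqr_ge0 (ln (win e k i w) ^+ 2 - 1); have h2 := sqr_ge0 (ln (win e k i w)).
by lra.
Qed.

End window.

End log_moments.

(** * Distribution functions and spacings *)

Section distribution_function.
Context (R : realType).
Notation mu := (@lebesgue_measure R).
Variable f : R -> R.
Hypothesis hf : unit_interval_density f.
Let F := dist_fun f.

Lemma density_bounds : exists M m : R, [/\ 0 < m, m <= M,
  (forall x : R, 0 <= f x <= M) & forall x : R, 0 <= x <= 1 -> m <= f x].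
Proof.
have [mf v [M hM] [m m0 hm] _] := hf.
have mM : m <= M.
  have h0 : (0 : R) \in `[0, 1] by rewrite in_itv/= lexx ler01.
  exact: le_trans (hm 0 h0) (hM 0 h0).
exists M, m; split => // x.
have [xi|xi] := boolP (x \in `[0, 1]); first by rewrite hM// (le_trans _ (hm x xi))// ltW.
by rewrite v// lexx (le_trans _ mM)// ltW.
Qed.

Let mf : measurable_fun setT f. Proof. by case: hf. Qed.

Lemma density_ge0 x : 0 <= f x.
Proof. by have [M [m [_ _ h _]]] := density_bounds; case/andP: (h x). Qed.

Lemma integrable_density : mu.-integrable setT (EFin \o f).
Proof.
apply/integrableP; split; first exact/measurable_EFinP.
under eq_integral do rewrite /= ger0_norm ?density_ge0//.
by case: hf => _ _ _ _ ->; rewrite ltry.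
Qed.

Let fiS D : measurable D -> mu.-integrable D (EFin \o f).
Proof. by move=> mD; apply: integrableS integrable_density. Qed.

Lemma dist_funB (a b : R) : a <= b -> F b - F a = \int[mu]_(x in `]a, b]) f x.
Proof.
move=> ab; rewrite /F /dist_fun; have := @Rintegral_itvB R f -oo%O (BRight b) a.
move=> -> //; first exact: fiS.
Qed.

Let length_itv (a b : R) : a <= b -> \int[mu]_(x in `]a, b]) (1 : R) = b - a.
Proof.
move=> ab; rewrite /Rintegral integral_cst//= mul1e lebesgue_measure_itv/= lte_fin.
by case: ltP => // ba; rewrite (le_anti (introT andP (conj ab ba))) subrr.
Qed.

Let cst_int (a b c : R) : mu.-integrable (`]a, b]%classic : set R) (EFin \o (fun=> c)).
Proof.
apply/integrableP; split; first exact/measurable_EFinP.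
rewrite /= integral_cst//= lebesgue_measure_itv/=; case: ifP => _.
  by rewrite -EFinD -EFinM ltry.
by rewrite mule0 ltry.
Qed.

Lemma dist_funB_bounds (M m : R) :
  (forall x : R, 0 <= f x <= M) -> (forall x : R, 0 <= x <= 1 -> m <= f x) ->
  (forall a b : R, a <= b -> 0 <= F b - F a <= M * (b - a)) /\
  (forall a b : R, 0 <= a -> a <= b -> b <= 1 -> m * (b - a) <= F b - F a).
Proof.
move=> fM fm; split=> [a b ab|a b a0 ab b1]; rewrite dist_funB//.
  apply/andP; split; first by apply: Rintegral_ge0 => x _; case/andP: (fM x).
  rewrite -length_itv// -RintegralZl//.
  apply: le_Rintegral => //; first exact: fiS.
  by move=> x _; rewrite mulr1; case/andP: (fM x).
rewrite -length_itv// -RintegralZl//.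
apply: le_Rintegral => //; last first.
- move=> x; rewrite /= in_itv/= => /andP[ax xb]; rewrite mulr1; apply: fm.
  by rewrite (le_trans a0 (ltW ax)) (le_trans xb).
- exact: fiS.
Qed.

Lemma dist_fun_le : {homo F : a b / a <= b}.
Proof.
move=> a b ab; have [M [m [_ _ fM fm]]] := density_bounds.
by have /andP[+ _] := (dist_funB_bounds fM fm).1 a b ab; rewrite subr_ge0.
Qed.

Lemma dist_fun_lt a b : 0 <= a -> a < b -> b <= 1 -> F a < F b.
Proof.
move=> a0 ab b1; have [M [m [m0 _ fM fm]]] := density_bounds.
have := (dist_funB_bounds fM fm).2 a b a0 (ltW ab) b1; rewrite -subr_gt0.
by apply: lt_le_trans; rewrite mulr_gt0// subr_gt0.
Qed.

Lemma continuous_dist_fun : continuous F.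
Proof.
have [M [m [m0 mM fM fm]]] := density_bounds.
have [h _] := dist_funB_bounds fM fm.
apply: (@lipschitz_continuous _ _ M) => x y.
have [xy|/ltW xy] := leP x y; have /andP[h1 h2] := h _ _ xy.
  by rewrite distrC (distrC x) ger0_norm// ger0_norm ?subr_ge0.
by rewrite ger0_norm// ger0_norm ?subr_ge0.
Qed.

Lemma measurable_dist_fun : measurable_fun setT F.
Proof. by apply: continuous_measurable_fun; exact: continuous_dist_fun. Qed.

Lemma dist_fun0 x : x <= 0 -> F x = 0.
Proof.
move=> x0; rewrite /F /dist_fun -Rintegral_itv_bndo_bndc; last exact: fiS.
rewrite /Rintegral integral0_eq// => y; rewrite /= in_itv/= => yx.
case: hf => _ v _ _ _; rewrite v// in_itv/= negb_and -ltNge (lt_le_trans yx)//.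
Qed.

Lemma dist_fun1 x : 1 <= x -> F x = 1.
Proof.
move=> x1; rewrite /F /dist_fun; have := @Rintegral_itvB R f -oo%O +oo%O x.
rewrite set_itvNyy => /(_ (fiS measurableT) isT isT).
have -> : \int[mu]_(t in [set: R]) f t = 1.
  by rewrite /Rintegral; case: hf => _ _ _ _ ->.
rewrite [X in _ = X -> _](_ : _ = 0); first by move=> h; lra.
rewrite /Rintegral integral0_eq// => y; rewrite /= in_itv/= andbT => yx.
case: hf => _ v _ _ _; rewrite v// in_itv/= negb_and -!ltNge (le_lt_trans x1 yx) orbT//.
Qed.

Lemma dist_fun_itv x : 0 < x < 1 -> 0 < F x < 1.
Proof.
move=> /andP[x0 x1]; rewrite -{1}(dist_fun0 (lexx 0)) -(dist_fun1 (lexx 1)).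
by rewrite !dist_fun_lt// ltW.
Qed.

Lemma dist_fun_derive :
  {ae mu, forall x : R, is_derive x 1 F (f x)}.
Proof.
have : locally_integrable [set: R] f.
  split => //; first exact: openT.
  move=> K _ cK; have mK : measurable K by exact: compact_measurable.
  by have /integrableP[_] := fiS mK.
move=> /(FTC1Ny (fun y => fiS (measurable_itv `]-oo, y])));
  apply: filterS; first exact: (ae_filter_ringOfSetsType mu).
move=> x [dF eF].
by apply: (DeriveDef dF); rewrite -derive1E.
Qed.

Lemma dist_fun_onto (c : R) : 0 <= c < 1 -> exists2 x, 0 <= x <= 1 & F x = c.
Proof.
move=> /andP[c0 c1]; have [x xi <-] : exists2 x, x \in `[0, 1]%R & F x = c.
  apply: (@IVT _ F 0 1 c ler01); first exact: continuous_subspaceT continuous_dist_fun.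
  rewrite (dist_fun0 (lexx 0)) (dist_fun1 (lexx 1)) min_l// max_r// c0/= ltW//.
by exists x => //; move: xi; rewrite in_itv.
Qed.

(** The function l of the overview. By the convention ln 0 = 0 it drops to 0 from x = 1 on, so it is
    increasing on ]0, 1[ only; this is why monotonicity is stated at sample values in the section on
    order statistics. *)
Definition cum_hazard (x : R) : R := - ln (1 - F x).

Lemma measurable_ellf : measurable_fun setT cum_hazard.
Proof.
apply: measurableT_comp => //; apply: measurableT_comp; first exact: measurable_ln.
by apply: measurable_funB => //; exact: measurable_dist_fun.
Qed.

Lemma expR_ellf x : 0 < x < 1 -> expR (- cum_hazard x) = 1 - F x.
Proof. by move=> /dist_fun_itv/andP[h1 h2]; rewrite /cum_hazard opprK lnK// posrE subr_gt0. Qed.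

Lemma ellf_lt x y : 0 < x < 1 -> 0 < y < 1 -> x < y -> cum_hazard x < cum_hazard y.
Proof.
move=> hx hy xy; rewrite -ltrN2 -ltr_expR !expR_ellf// ltrD2l ltrN2.
by move: hx hy => /andP[x0 _] /andP[_ y1]; rewrite dist_fun_lt// ltW.
Qed.

Section law.
Context d (T : measurableType d) (P : probability T R).
Variable Y : T -> R.
Hypothesis mY : measurable_fun [set: T] Y.
Hypothesis Y01 : forall w, 0 < Y w < 1.
Hypothesis lawY : forall A : set R, measurable A ->
  (P (Y @^-1` A) = \int[mu]_(x in A) (f x)%:E)%E.

(** The event is Y > x for a point x with F x = 1 - exp (- t), which exists by the intermediate
    value theorem. *)
Lemma expo_ellf : expo P (fun w => cum_hazard (Y w)).
Proof.
split.
- exact: (measurableT_comp measurable_ellf mY).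
- move=> w; have /andP[h1 h2] := dist_fun_itv (Y01 w).
  by rewrite /cum_hazard oppr_ge0 ln_le0// gerBl ltW.
- move=> t t0; pose c := 1 - expR (- t).
  have c01 : 0 <= c < 1.
    by rewrite subr_ge0 gtrBl expR_gt0 andbT -expR0 ler_expR oppr_le0.
  have [x x01 xc] := dist_fun_onto c01.
  have -> : [set w | t < cum_hazard (Y w)] = Y @^-1` `]x, +oo[.
    apply/seteqP; split => w /=; rewrite in_itv/= andbT.
      rewrite -ltrN2 -ltr_expR expR_ellf// => h; rewrite ltNge; apply/negP => yx.
      by have := dist_fun_le yx; rewrite xc /c; lra.
    move=> h; rewrite -ltrN2 -ltr_expR expR_ellf//.
    have /andP[y0 y1] := Y01 w; have := dist_fun_lt _ h (ltW y1).
    by rewrite xc /c; case/andP: x01 => -> _ /(_ isT); lra.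
  rewrite lawY//.
  have e := @Rintegral_itvB R f -oo%O +oo%O x.
  rewrite set_itvNyy in e; have {}e := e (fiS measurableT) isT isT.
  rewrite [X in X - _](_ : _ = 1) in e; last by rewrite /Rintegral; case: hf => _ _ _ _ ->.
  rewrite -/(dist_fun f x) -/F xc in e.
  rewrite -[LHS]fineK; last by apply: integrable_fin_num => //; exact: fiS.
  by rewrite -/(Rintegral _ _ _) -e /c; congr EFin; ring.
Qed.

Lemma law_ae (p : R -> Prop) : {ae mu, forall x, p x} -> {ae P, forall w, p (Y w)}.
Proof.
move=> [N [mN N0 pN]]; exists (Y @^-1` N); split.
- by rewrite -[X in measurable X]setTI; exact: mY.
- rewrite lawY// (@null_set_integral _ _ _ mu)//.
  by apply/measurable_EFinP; exact: measurable_funTS.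
- by move=> w /= nw; apply: pN.
Qed.

End law.

End distribution_function.

(** * The logarithm of the ratio of spacings *)

Section log_ratio.
Context (R : realType).
Notation mu := (@lebesgue_measure R).
Variables f g : R -> R.
Hypothesis hf : unit_interval_density f.
Hypothesis hg : unit_interval_density g.
Let F := dist_fun f.
Let G := dist_fun g.

(** The sign is opposite to that of the theorem, because ln (g / f) is what a G-spacing adds to an
    F-spacing; the variance is the same. *)
Definition logratio (x : R) : R := ln (g x / f x).

(* Set to 0 when a and b are tied or lie outside ]0, 1[, so that it is bounded
   everywhere. *)
Definition logdev (a b : R) : R :=
  if [&& 0 < a, a < b & b < 1] then ln ((G b - G a) / (F b - F a)) - logratio a else 0.

Let mf : measurable_fun setT f. Proof. by case: hf. Qed.
Let mg : measurable_fun setT g. Proof. by case: hg. Qed.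

Lemma measurable_logratio : measurable_fun setT logratio.
Proof.
apply: measurableT_comp; first exact: measurable_ln.
apply: measurable_funM => //; apply: (measurableT_comp (f := @GRing.inv R)) => //.
exact: measurable_inv.
Qed.

(** Difference quotients of F and G obey the bounds of f and g, so both logarithms lie in the same
    interval from [lo] to [hi]. *)
Lemma log_ratio_bounds : exists C : R, [/\ 0 <= C,
  (forall x, 0 < x < 1 -> `|logratio x| <= C) & forall a b, `|logdev a b| <= C].
Proof.
have [Mf [mf' [mf0 mMf fM fm]]] := density_bounds hf.
have [Mg [mg' [mg0 mMg gM gm]]] := density_bounds hg.
have [hF1 hF2] := dist_funB_bounds hf fM fm; have [hG1 hG2] := dist_funB_bounds hg gM gm.
have Mf0 : 0 < Mf := lt_le_trans mf0 mMf; have Mg0 : 0 < Mg := lt_le_trans mg0 mMg.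
pose lo := ln (mg' / Mf); pose hi := ln (Mg / mf').
have rng (x y : R) : 0 < x -> 0 < y -> mg' * y <= Mf * x -> mf' * x <= Mg * y -> lo <= ln (x / y) <= hi.
  move=> x0 y0 h1 h2; rewrite /lo /hi !ler_ln ?posrE ?divr_gt0//.
  by rewrite !ler_pdivrMr// mulrAC ler_pdivlMr// [x * _]mulrC h1/= mulrAC ler_pdivlMr// [x * _]mulrC.
have r1 x : 0 < x < 1 -> lo <= logratio x <= hi.
  move=> /andP[x0 x1]; have x01 : 0 <= x <= 1 by rewrite !ltW.
  have /andP[_ fM'] := fM x; have /andP[_ gM'] := gM x.
  have fm1 := fm x x01; have gm1 := gm x x01.
  apply: rng; [exact: lt_le_trans gm1|exact: lt_le_trans fm1|nra|nra].
have r2 a b : [&& 0 < a, a < b & b < 1] -> lo <= ln ((G b - G a) / (F b - F a)) <= hi.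
  move=> /and3P[a0 ab b1]; have ba : 0 < b - a by rewrite subr_gt0.
  have /andP[_ u1] := hF1 a b (ltW ab); have /andP[_ u2] := hG1 a b (ltW ab).
  have l1 := hF2 a b (ltW a0) (ltW ab) (ltW b1); have l2 := hG2 a b (ltW a0) (ltW ab) (ltW b1).
  apply: rng.
  - by apply: lt_le_trans l2; rewrite mulr_gt0.
  - by apply: lt_le_trans l1; rewrite mulr_gt0.
  - rewrite (@le_trans _ _ (mg' * (Mf * (b - a))))//; first by rewrite ler_wpM2l// ltW.
    by rewrite mulrCA ler_wpM2l// ltW.
  - rewrite (@le_trans _ _ (mf' * (Mg * (b - a))))//; first by rewrite ler_wpM2l// ltW.
    by rewrite mulrCA ler_wpM2l// ltW.
exists (`|lo| + `|hi|); split; first by rewrite addr_ge0.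
  move=> x /r1 /andP[h1 h2]; rewrite ler_norml; apply/andP; split.
    by have := ler_norm (- lo); rewrite normrN; have := normr_ge0 hi; lra.
  by have := ler_norm hi; have := normr_ge0 lo; lra.
move=> a b; rewrite /logdev; case: ifPn => [h|_]; last by rewrite normr0 addr_ge0.
have /andP[h1 h2] := r2 _ _ h.
have /andP[h3 h4] : lo <= logratio a <= hi.
  by apply: r1; case/and3P: h => -> /= ab b1; exact: lt_trans b1.
have := ler_norm (- lo); rewrite normrN => h5; have h6 := ler_norm hi.
by rewrite ler_norml; lra.
Qed.

Lemma measurable_logdev : measurable_fun [set: R * R] (fun p : R * R => logdev p.1 p.2).
Proof.
have mF := measurable_dist_fun hf; have mG := measurable_dist_fun hg.
have mF1 : measurable_fun [set: R * R] (fun p : R * R => F p.1) by exact: measurableT_comp.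
have mF2 : measurable_fun [set: R * R] (fun p : R * R => F p.2) by exact: measurableT_comp.
have mG1 : measurable_fun [set: R * R] (fun p : R * R => G p.1) by exact: measurableT_comp.
have mG2 : measurable_fun [set: R * R] (fun p : R * R => G p.2) by exact: measurableT_comp.
rewrite (_ : (fun p : R * R => _) = fun p => [&& 0 < p.1, p.1 < p.2 & p.2 < 1]%R%:R *
  (ln ((G p.2 - G p.1) / (F p.2 - F p.1)) - logratio p.1)); last first.
  by apply/funext => p; rewrite /logdev; case: ifP; rewrite ?mul1r ?mul0r.
apply: measurable_funM.
  apply: measurable_natmul_bool; apply: measurable_and; first exact: measurable_fun_ltr.
  by apply: measurable_and; exact: measurable_fun_ltr.
apply: measurable_funB; last by apply: (measurableT_comp measurable_logratio).
apply: measurableT_comp; first exact: measurable_ln.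
apply: measurable_funM; first exact: measurable_funB.
apply: (measurableT_comp (f := @GRing.inv R)); first exact: measurable_inv.
exact: measurable_funB.
Qed.

Lemma derive_ratio (H : R -> R) (a l : R) : is_derive a 1 H l ->
  (H (h + a) - H a) / h @[h --> 0^'] --> l.
Proof.
move=> [dH <-]; move: dH; rewrite /derivable /derive => /cvgP.
move=> dH; apply: cvg_trans dH; apply: near_eq_cvg; apply: nearW => h.
by rewrite /GRing.scale/= mulr1 mulrC.
Qed.

(** At a common point of differentiability the ratio of difference quotients tends to g a / f a, and
    the logarithm is continuous there. *)
Lemma logdev_small (a : R) : 0 < a < 1 -> is_derive a 1 F (f a) -> is_derive a 1 G (g a) ->
  forall eps, 0 < eps -> exists2 dl, 0 < dl & forall b, a < b < a + dl -> `|logdev a b| <= eps.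
Proof.
move=> a01 dF dG eps eps0.
have a01' : 0 <= a <= 1 by case/andP: a01 => *; rewrite !ltW.
have [Mf [mf' [mf0 mMf fM fm]]] := density_bounds hf.
have [Mg [mg' [mg0 mMg gM gm]]] := density_bounds hg.
have f0 : 0 < f a := lt_le_trans mf0 (fm a a01').
have g0 : 0 < g a := lt_le_trans mg0 (gm a a01').
have c1 : ln (((G (h + a) - G a) / h) / ((F (h + a) - F a) / h)) @[h --> 0^'] --> ln (g a / f a).
  apply: (@cvg_comp _ _ _ (fun h => ((G (h + a) - G a) / h) / ((F (h + a) - F a) / h)) (@ln R) _ (nbhs (g a / f a))).
    apply: cvgM; first exact: derive_ratio.
    by apply: cvgV; [rewrite gt_eqF|exact: derive_ratio].
  by apply: continuous_ln; rewrite divr_gt0.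
have /cvgrPdist_le /(_ eps eps0) [dl /= dl0 H] := c1.
exists dl => // b /andP[ab bd].
rewrite /logdev; case: ifPn => [/and3P[_ _ b1]|_]; last by rewrite normr0 ltW.
have h0 : 0 < b - a by rewrite subr_gt0.
have := H (b - a) _ _; rewrite /ball/= sub0r normrN gtr0_norm// subrK.
move=> /(_ _ _)/wrap[|| H']; [by lra|by rewrite gt_eqF|].
rewrite distrC; apply: le_trans H'; rewrite le_eqVlt; apply/orP; left; apply/eqP.
congr (`|_ - ln _|).
have Fab : F b - F a != 0.
  by rewrite gt_eqF// subr_gt0 dist_fun_lt// ltW//; case/andP: a01.
by field; rewrite Fab gt_eqF.
Qed.

(** Continuity in the second argument, used to pass from rational to real offsets in
    [logdev_le_devsup]. *)
Lemma logdev_continuous (a b : R) : 0 < a -> a < b -> b < 1 -> {for b, continuous (logdev a)}.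
Proof.
move=> a0 ab b1.
have c : {for b, continuous (fun b => ln ((G b - G a) / (F b - F a)) - logratio a)}.
  apply: cvgB; last exact: cvg_cst.
  have Fab : 0 < F b - F a by rewrite subr_gt0 dist_fun_lt// ltW.
  have Gab : 0 < G b - G a by rewrite subr_gt0 dist_fun_lt// ltW.
  apply: (@cvg_comp _ _ _ (fun b => (G b - G a) / (F b - F a)) (@ln R) _ (nbhs ((G b - G a) / (F b - F a)))).
    apply: cvgM; first by apply: cvgB; [exact: continuous_dist_fun|exact: cvg_cst].
    apply: cvgV; first by rewrite gt_eqF.
    by apply: cvgB; [exact: continuous_dist_fun|exact: cvg_cst].
  by apply: continuous_ln; rewrite divr_gt0.
have E : logdev a b = ln ((G b - G a) / (F b - F a)) - logratio a by rewrite /logdev a0 ab b1.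
rewrite /prop_for /continuous_at E; apply: cvg_trans c; apply: near_eq_cvg.
near=> y; rewrite /logdev a0/=.
have -> : a < y by near: y; exact: lt_nbhsr.
by have -> : y < 1 by near: y; exact: lt_nbhsl.
Unshelve. all: by end_near. Qed.

Let ratn (p : nat) : R := if @choice.unpickle rat p is Some q then ratr q else 0.

Definition devterm (j p : nat) (a : R) : R :=
  (0 < ratn p <= j.+1%:R^-1)%R%:R * `|logdev a (a + ratn p)|.

(** Modulus of deviation at scale 1 / (j + 1). The supremum runs over an enumeration of the rational
    offsets, which keeps it measurable in a. *)
Definition devsup (j : nat) (a : R) : R := sups (fun p => devterm j p a) 0.

Lemma devsup_props : exists C : R, [/\ 0 <= C,
  (forall x, 0 < x < 1 -> `|logratio x| <= C), (forall a b, `|logdev a b| <= C) &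
  forall j a, 0 <= devsup j a <= C].
Proof.
have [C [C0 h1 h2]] := log_ratio_bounds; exists C; split => // j a.
have tC p : 0 <= devterm j p a <= C.
  rewrite /devterm mulr_ge0//=; case: (_ && _); rewrite ?mul1r ?mul0r//.
have ub : has_ubound (sdrop (fun p => devterm j p a) 0).
  by exists C => _ [p _ <-]; case/andP: (tC p).
apply/andP; split.
  have /andP[h _] := tC 0%N; apply: le_trans h _; apply: ub_le_sup => //.
  by exists 0%N.
apply: ge_sup; first by exists (devterm j 0 a), 0%N.
by move=> _ [p _ <-]; case/andP: (tC p).
Qed.

Let devterm_has_ub j a : has_ubound (range (fun p => devterm j p a)).
Proof.
have [C [C0 _ h2]] := log_ratio_bounds; exists C => _ [p _ <-].
by rewrite /devterm; case: (_ && _); rewrite ?mul1r ?mul0r.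
Qed.

Lemma measurable_devsup j : measurable_fun setT (devsup j).
Proof.
apply: measurable_fun_sups => [a _|p]; first exact: devterm_has_ub.
apply: measurable_funM => //; apply: measurableT_comp => //.
have h : measurable_fun [set: R] (fun a : R => (a, a + ratn p)).
  by apply: measurable_fun_pair => //; exact: measurable_funD.
exact: (measurableT_comp measurable_logdev h).
Qed.

(** A rational offset close to b - a gives nearly the same deviation, by continuity in b. *)
Lemma logdev_le_devsup j (a b : R) : b - a < j.+1%:R^-1 -> `|logdev a b| <= devsup j a.
Proof.
move=> bj; have ub : has_ubound (sdrop (fun p => devterm j p a) 0).
  have [C hC] := devterm_has_ub j a; exists C => _ [p _ <-]; apply: hC; by exists p.
have [C [_ _ _ hC]] := devsup_props.
have [/and3P[a0 ab b1]|h] := boolP [&& 0 < a, a < b & b < 1]; last first.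
  by rewrite /logdev (negbTE h) normr0; case/andP: (hC j a).
apply/ler_addgt0Pr => eps eps0.
have /cvgrPdist_le /(_ eps eps0) [dl /= dl0 H] := logdev_continuous a0 ab b1.
pose u := Num.min (b + dl) (a + j.+1%:R^-1).
have bu : b - a < u - a by rewrite ltrD2r lt_min ltrDl dl0/= -ltrBlDl.
have [q] := rat_in_itvoo bu; rewrite in_itv/=; set r : R := ratr q => /andP[rb ru].
have r0 : 0 < r by apply: lt_trans rb; rewrite subr_gt0.
have ru1 : r < b + dl - a by apply: lt_le_trans ru _; rewrite lerD2r ge_min lexx.
have ru2 : r < j.+1%:R^-1.
  by apply: lt_le_trans ru _; rewrite lerBlDl ge_min lexx orbT.
have := H (a + r); rewrite /ball_/= => /(_ _)/wrap[|h1].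
  by rewrite distrC ger0_norm; lra.
have h2 : `|logdev a (a + r)| <= devsup j a.
  apply: ub_le_sup => //; exists (choice.pickle q) => //.
  by rewrite /devterm /ratn choice.pickleK -/r r0 (ltW ru2) mul1r.
have := ler_normD (logdev a b - logdev a (a + r)) (logdev a (a + r)).
rewrite subrK; lra.
Qed.

Lemma devsup_small (a : R) : 0 < a < 1 -> is_derive a 1 F (f a) -> is_derive a 1 G (g a) ->
  devsup j a @[j --> \oo] --> (0 : R).
Proof.
move=> a01 dF dG; apply/cvgrPdist_le => eps eps0.
have [dl dl0 H] := logdev_small a01 dF dG eps0.
near=> j; have jd : j.+1%:R^-1 < dl.
  near: j; have /cvgrPdist_lt /(_ dl dl0) := @cvg_harmonic R.
  by apply: filterS => j; rewrite sub0r normrN ger0_norm// invr_ge0.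
have [C [_ _ _ hC]] := devsup_props.
rewrite sub0r normrN ger0_norm; last by case/andP: (hC j a).
apply: ge_sup; first by exists (devterm j 0 a), 0%N.
move=> _ [p _ <-]; rewrite /devterm; case: (boolP (_ && _)) => [/andP[h1 h2]|_].
  by rewrite mul1r H// ltrDl h1/= ltrD2l (le_lt_trans h2).
by rewrite mul0r ltW.
Unshelve. all: by end_near. Qed.

Section spacing_sums.
Context d (T : measurableType d) (P : probability T R).
Variable Y : nat -> T -> R.
Hypothesis mY : forall i, measurable_fun [set: T] (Y i).
Hypothesis Y01 : forall i w, 0 < Y i w < 1.
Hypothesis lawY : forall i (A : set R), measurable A ->
  (P (Y i @^-1` A) = \int[mu]_(x in A) (f x)%:E)%E.

(** Telescoping leaves only k differences at distance N; for values in [0, 1] the sum is thus at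
    most k, whatever N is. *)
Let shift_sum (s : nat -> R) (N k : nat) :
  \sum_(0 <= i < N) (s (i + k)%N - s i) = \sum_(0 <= i < k) (s (i + N)%N - s i).
Proof.
elim: N => [|N ih].
  by rewrite big_geq// big1// => i _; rewrite addn0 subrr.
rewrite big_nat_recr//= ih.
have -> : s (N + k)%N - s N = \sum_(0 <= i < k) (s (i + N.+1)%N - s (i + N)%N).
  rewrite (@telescope_sumr_eq _ 0 k (fun i => s (i + N)%N))//.
    by rewrite addnC add0n.
  by move=> i _; rewrite addnS addSn.
by rewrite -big_split/=; apply: eq_bigr => i _; ring.
Qed.

(** A pair at distance below 1 / (j + 1) is bounded by [devsup]. For any other pair C^2 is charged
    to the distance at the rate j + 1, and the distances add up to at most k. *)
Lemma locsum_logdev_le (C : R) j k (s : seq R) : (forall a b, `|logdev a b| <= C) ->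
  sorted <=%R s -> (forall x, x \in s -> 0 < x < 1) ->
  locsum (fun x y => logdev x y ^+ 2) k s <=
  \sum_(x <- s) devsup j x ^+ 2 + C ^+ 2 * (j.+1%:R * k%:R).
Proof.
move=> hC ss s01; rewrite /locsum.
have C0 : 0 <= C by rewrite (le_trans _ (hC 0 0)).
pose t i := nth 0 s i; pose N := (size s - k)%N.
have tle i i' : (i <= i')%N -> (i' < size s)%N -> t i <= t i'.
  by move=> ii' i's; apply: (sorted_leq_nth le_trans le_refl) => //; rewrite inE (leq_ltn_trans ii').
have step i : (i < N)%N -> logdev (t i) (t (i + k)%N) ^+ 2 <=
    devsup j (t i) ^+ 2 + C ^+ 2 * (j.+1%:R * (t (i + k)%N - t i)).
  move=> iN; have iks : (i + k < size s)%N by move: iN; rewrite /N; lia.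
  have d0 : 0 <= t (i + k)%N - t i by rewrite subr_ge0 tle// leq_addr.
  have [h|h] := ltP (t (i + k)%N - t i) j.+1%:R^-1.
    rewrite (@le_trans _ _ (devsup j (t i) ^+ 2))//; last by rewrite lerDl !mulr_ge0// sqr_ge0.
    rewrite -[leLHS]ger0_norm ?sqr_ge0// normrX ler_pXn2r ?nnegrE//.
      exact: logdev_le_devsup.
    by rewrite (le_trans (normr_ge0 _) (logdev_le_devsup h)).
  rewrite (@le_trans _ _ (C ^+ 2))//.
    by rewrite -[leLHS]ger0_norm ?sqr_ge0// normrX ler_pXn2r ?nnegrE.
  rewrite (@le_trans _ _ (C ^+ 2 * (j.+1%:R * (t (i + k)%N - t i))))//; last by rewrite lerDr sqr_ge0.
  rewrite -{1}[C ^+ 2]mulr1 ler_wpM2l ?sqr_ge0//.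
  by rewrite mulrC -ler_pdivrMr ?ltr0n// mul1r.
apply: (@le_trans _ _ (\sum_(0 <= i < N) (devsup j (t i) ^+ 2 + C ^+ 2 * (j.+1%:R * (t (i + k)%N - t i))))).
  by rewrite big_nat_cond [leRHS]big_nat_cond; apply: ler_sum => i /andP[/andP[_ iN] _]; exact: step.
rewrite big_split/=; apply: lerD.
  rewrite [leRHS](big_nth 0) [leRHS](big_cat_nat (n := N) (p := size s))//= ?leq_subr// lerDl.
  by apply: sumr_ge0 => i _; exact: sqr_ge0.
rewrite -mulr_sumr -mulr_sumr ler_wpM2l ?sqr_ge0// ler_wpM2l// shift_sum.
have -> : k%:R = \sum_(0 <= i < k) 1 :> R by rewrite big_const_nat subn0 iter_addr_0.
rewrite big_nat_cond [leRHS]big_nat_cond; apply: ler_sum => i /andP[/andP[_ ik] _].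
have [ks|sk] := leqP k (size s); last first.
  by rewrite (_ : N = 0%N) ?addn0 ?subrr//; apply/eqP; rewrite subn_eq0 ltnW.
have i1 : (i + N < size s)%N by rewrite /N; lia.
have i2 : (i < size s)%N by lia.
have /andP[_ h1] := s01 _ (mem_nth 0 i1); have /andP[h2 _] := s01 _ (mem_nth 0 i2).
rewrite /t; lra.
Qed.

Lemma law_integral i (h : R -> \bar R) : measurable_fun setT h -> (forall x, (0 <= h x)%E) ->
  (\int[P]_w h (Y i w) = \int[mu]_x (h x * (f x)%:E))%E.
Proof.
move=> mh h0.
pose er : {RV P >-> measurableTypeR R} :=
  HB.pack (Y i : T -> measurableTypeR R) (isMeasurableFun.Build _ _ T (measurableTypeR R) _ (mY i)).
have -> : (\int[P]_w h (Y i w) = \int[distribution P er]_x h x)%E by rewrite ge0_integral_distribution.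
apply: (@ge0_integral_density _ _ _ (distribution P er) mu f) => //.
- by move=> x; exact: density_ge0.
- by move=> A mA; exact: lawY.
Qed.

Lemma law_Ex i j (h : R -> R) : measurable_fun setT h -> (forall x, 0 <= h x) ->
  Ex P (fun w => h (Y i w)) = Ex P (fun w => h (Y j w)).
Proof.
move=> mh h0; rewrite /Ex; congr fine.
have mhE : measurable_fun setT (EFin \o h) by exact/measurable_EFinP.
by rewrite (@law_integral i (EFin \o h))// (@law_integral j (EFin \o h)).
Qed.

Hypothesis iY : forall m, indep P m Y.

(** Index 0 is given the set [setT]. The sample starts at index 1, whereas [Var_locsum] counts from
    0. *)
Lemma indep_shift m : indep P m (fun i => Y i.+1).
Proof.
move=> A mA; pose A' i := if i is i'.+1 then A i' else setT.
have mA' i : measurable (A' i) by case: i => [|i]; [exact: measurableT|exact: mA].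
have := @iY m.+1 A' mA'; rewrite big_ord_recl/= preimage_setT probability_setT mul1e => <-.
congr (P _); apply/seteqP; split => w h.
  by case=> [|i] //= im; apply: h.
by move=> i im; exact: (h i.+1).
Qed.

(** [devsup j] is bounded and tends to 0 at almost every point, so its mean square tends to 0. The
    scale j is fixed first; the remaining constant, which depends on j, is absorbed by large n. *)
Lemma Var_locsum_logdev k eps : (0 < k)%N -> 0 < eps ->
  \forall n \near \oo,
  Var P (fun w => locsum logdev k (sort <=%R [seq Y j w | j <- iota 1 n])) <= eps * n%:R.
Proof.
move=> k0 eps0; have [C [C0 _ hC hS]] := devsup_props.
have mS := measurable_devsup.
have cS : Ex P (fun w => devsup j (Y 0%N w) ^+ 2) @[j --> \oo] --> (0 : R).
  rewrite -[X in _ --> X](Ex_cst P 0).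
  apply: (@Ex_dominated _ _ _ P (fun j w => devsup j (Y 0%N w) ^+ 2) (fun=> 0) (C ^+ 2)) => //.
  - by move=> j; apply: measurable_funX; exact: (measurableT_comp (mS j)).
  - move=> j w; have /andP[h1 h2] := hS j (Y 0%N w).
    by rewrite ger0_norm ?sqr_ge0// ler_pXn2r// nnegrE.
  - have := law_ae hf (mY 0) (lawY 0) (dist_fun_derive hf).
    have := law_ae hf (mY 0) (lawY 0) (dist_fun_derive hg).
    apply: filterS2 => w dG dF; rewrite -[X in _ --> X](mulr0 0).
    by apply: cvgM; exact: devsup_small.
pose K := 2 * (2 * k%:R + 1) ^+ 2 : R.
have K0 : 0 < K by rewrite mulr_gt0// exprn_gt0// ltr_wpDl// mulr_ge0.
have e40 : 0 < eps / (4 * K) by rewrite divr_gt0// mulr_gt0.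
have /cvgrPdist_le /(_ _ e40) [j _ /(_ j (leqnn j)) /= hj] := cS.
rewrite sub0r normrN ger0_norm in hj; last by apply: Ex_ge0 => w; exact: sqr_ge0.
pose c := C ^+ 2 * (j.+1%:R * k%:R) + C ^+ 2 * (j.+1%:R * k.+1%:R).
have := nbhs_infty_ger (2 * K * c / eps); apply: filterS => n hn.
pose X i := Y i.+1.
have sE w : [seq Y j w | j <- iota 1 n] = [seq X j w | j <- iota 0 n].
  by rewrite (iotaDl 1 0) -map_comp.
have -> : (fun w => locsum logdev k (sort <=%R [seq Y j w | j <- iota 1 n])) =
   fun w => locsum logdev k (sort <=%R [seq X j w | j <- iota 0 n]).
  by apply/funext => w; rewrite sE.
have mX i : measurable_fun [set: T] (X i) by exact: mY.
have lawX i i' A : measurable A -> P (X i @^-1` A) = P (X i' @^-1` A).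
  by move=> mA; rewrite /X !lawY.
apply: le_trans (Var_locsum mX (@indep_shift (n + n)%N) lawX measurable_logdev hC k0) _.
rewrite -/K.
have mLS k' : measurable_fun [set: T] (fun w => locsum (fun x y => logdev x y ^+ 2) k' (sort <=%R [seq X j w | j <- iota 0 n])).
  apply: measurable_locsum => //.
  exact: measurable_funX measurable_logdev.
pose S w := \sum_(i < n) devsup j (X i w) ^+ 2.
have LSi i : L1 P (fun w => devsup j (X i w) ^+ 2).
  apply: (@L1_bounded _ _ _ P (C ^+ 2)) => [|w].
    by apply: measurable_funX; exact: (measurableT_comp (mS j)).
  have /andP[h1 h2] := hS j (X i w).
  by rewrite ger0_norm ?sqr_ge0// ler_pXn2r// nnegrE.
have LS : L1 P S by apply: L1_sum.
have bnd w : locsum (fun x y => logdev x y ^+ 2) k (sort <=%R [seq X j w | j <- iota 0 n]) +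
    locsum (fun x y => logdev x y ^+ 2) k.+1 (sort <=%R [seq X j w | j <- iota 0 n]) <= 2 * S w + c.
  set s := sort _ _.
  have ss : sorted <=%R s by apply: sort_sorted; exact: le_total.
  have s01 x : x \in s -> 0 < x < 1 by rewrite mem_sort => /mapP[i _ ->]; exact: Y01.
  have eS : \sum_(x <- s) devsup j x ^+ 2 = S w.
    rewrite (perm_big _ (permEl (perm_sort _ _)))/= big_map /S.
    by rewrite -(big_mkord xpredT (fun i => devsup j (X i w) ^+ 2)) /index_iota subn0.
  have := locsum_logdev_le j k hC ss s01; have := locsum_logdev_le j k.+1 hC ss s01.
  rewrite eS /c; lra.
have ls0 k' s : 0 <= locsum (fun x y => logdev x y ^+ 2) k' s.
  by apply: sumr_ge0 => i _; exact: sqr_ge0.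
have L2S : L1 P (fun w => 2 * S w + c) by apply: L1D; [exact: L1Z|exact: L1_cst].
have h1 : Ex P (fun w => locsum (fun x y => logdev x y ^+ 2) k (sort <=%R [seq X j w | j <- iota 0 n]) +
    locsum (fun x y => logdev x y ^+ 2) k.+1 (sort <=%R [seq X j w | j <- iota 0 n])) <= 2 * Ex P S + c.
  have e1 := ExD (L1Z 2 LS) (L1_cst P c); rewrite ExZ// Ex_cst in e1.
  rewrite -e1; apply: Ex_le => //.
  apply: (L1_le _ _ L2S); first exact: measurable_funD.
  by move=> w; rewrite ger0_norm ?addr_ge0.
have h2 : Ex P S <= n%:R * (eps / (4 * K)).
  rewrite Ex_sum// (@le_trans _ _ (\sum_(i < n) (eps / (4 * K))))//.
    apply: ler_sum => i _; apply: le_trans hj; rewrite le_eqVlt; apply/orP; left; apply/eqP.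
    apply: (@law_Ex i.+1 0%N (fun x => devsup j x ^+ 2)); first exact: measurable_funX.
    by move=> x; exact: sqr_ge0.
  by rewrite sumr_const card_ord [leRHS]mulr_natl.
have h3 := ler_wpM2l (ltW K0) (le_trans h1 (lerD (ler_wpM2l (ler0n R 2) h2) (lexx c))).
apply: le_trans h3 _.
rewrite ler_pdivrMr// in hn.
have -> : K * (2 * (n%:R * (eps / (4 * K))) + c) = eps * n%:R / 2 + K * c.
  by field; rewrite gt_eqF.
lra.
Qed.

End spacing_sums.

End log_ratio.

(** * Smooth approximation *)

Section smooth_functions.
Context (R : realType).
(** [chi'] plays the part of the derivative, and the second-order Taylor bound is all that ties it
    to [chi]. One constant serves for every bound. *)
Definition smooth_bound (chi chi' : R -> R) (K : R) : Prop :=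
  [/\ measurable_fun [set: R] chi, (forall x, `|chi x| <= K), (forall x, `|chi' x| <= K) &
    forall x y, `|chi x - chi y - chi' y * (x - y)| <= K * (x - y) ^+ 2].

Lemma smooth_bound_cst (c : R) : smooth_bound (fun=> c) (fun=> 0) `|c|.
Proof.
split => // [x|x y]; first by rewrite normr0.
by rewrite mul0r subrr subr0 normr0 mulr_ge0// sqr_ge0.
Qed.

Lemma smooth_bound_lin (a b : R) (chi1 chi1' : R -> R) (K1 : R) (chi2 chi2' : R -> R) (K2 : R) :
  smooth_bound chi1 chi1' K1 -> smooth_bound chi2 chi2' K2 ->
  smooth_bound (fun x => a * chi1 x + b * chi2 x) (fun x => a * chi1' x + b * chi2' x)
    (`|a| * K1 + `|b| * K2).
Proof.
move=> [m1 h1 h1' h1''] [m2 h2 h2' h2'']; split.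
- by apply: measurable_funD; exact: measurable_funM.
- move=> x; rewrite (le_trans (ler_normD _ _))// !normrM lerD// ler_wpM2l//.
- move=> x; rewrite (le_trans (ler_normD _ _))// !normrM lerD// ler_wpM2l//.
- move=> x y.
  have -> : a * chi1 x + b * chi2 x - (a * chi1 y + b * chi2 y) - (a * chi1' y + b * chi2' y) * (x - y) =
    a * (chi1 x - chi1 y - chi1' y * (x - y)) + b * (chi2 x - chi2 y - chi2' y * (x - y)) by ring.
  rewrite (le_trans (ler_normD _ _))// !normrM mulrDl -!mulrA lerD// ler_wpM2l//.
Qed.

Lemma smooth_bound_affine (a b : R) (chi chi' : R -> R) (K : R) : 0 <= K -> smooth_bound chi chi' K ->
  smooth_bound (fun x => chi (a * x + b)) (fun x => a * chi' (a * x + b))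
    (K * (1 + `|a| + a ^+ 2)).
Proof.
move=> K0 [m h1 h2 h3]; have a20 := sqr_ge0 a; have a0 := normr_ge0 a; split.
- by apply: measurableT_comp => //; apply: measurable_funD => //; exact: measurable_funM.
- by move=> x; apply: le_trans (h1 _) _; rewrite ler_peMr//; lra.
- move=> x; rewrite normrM (le_trans (ler_wpM2l a0 (h2 _)))// mulrC ler_wpM2l//; lra.
- move=> x y; have := h3 (a * x + b) (a * y + b).
  have -> : a * x + b - (a * y + b) = a * (x - y) by ring.
  have -> : a * chi' (a * y + b) * (x - y) = chi' (a * y + b) * (a * (x - y)) by ring.
  move/le_trans; apply; rewrite exprMn mulrA ler_wpM2r ?sqr_ge0// ler_wpM2l//; lra.
Qed.

(** A bounded smooth step whose derivative is a polynomial in itself, which makes the bounds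
    explicit. *)
Definition logistic (z : R) : R := (1 + expR (- z))^-1.

Lemma logistic_itv z : 0 < logistic z < 1.
Proof.
rewrite /logistic invr_gt0 addr_gt0 ?expR_gt0//= invf_lt1 ?addr_gt0 ?expR_gt0//.
by rewrite ltrDl expR_gt0.
Qed.

Let dlogistic (z : R) : is_derive z 1 logistic (logistic z * (1 - logistic z)).
Proof.
have p0 : 1 + expR (- z) != 0 by rewrite gt_eqF// addr_gt0// expR_gt0.
have d1 : is_derive z 1 (fun z : R => 1 + expR (- z)) (- expR (- z)).
  by apply: is_derive_eq; rewrite /GRing.scale/=; ring.
have d2 := @is_deriveV R (fun z => 1 + expR (- z)) z _ 1 p0 d1.
apply: (is_derive_eq d2); rewrite /GRing.scale/= /logistic.
by field.
Qed.

Lemma smooth_bound_logistic : smooth_bound logistic (fun z => logistic z * (1 - logistic z)) 1.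
Proof.
have b1 z : 0 <= logistic z * (1 - logistic z) <= 1.
  by have := logistic_itv z; move: (logistic z) => y /andP[y0 y1]; nra.
have d2 (z : R) : is_derive z 1 (fun z => logistic z * (1 - logistic z))
   (logistic z * (1 - logistic z) * (1 - 2 * logistic z)).
  have ? := dlogistic z; apply: is_derive_eq; rewrite /GRing.scale/=; ring.
have lip : forall x y, `|logistic x * (1 - logistic x) - logistic y * (1 - logistic y)| <= 1 * `|x - y|.
  apply: (derive_bound_lipschitz d2) => z; rewrite normrM -[leRHS]mulr1 ler_pM//.
    by have /andP[h1 h2] := b1 z; rewrite ger0_norm.
  by have /andP[h1 h2] := logistic_itv z; rewrite ler_norml /=; lra.
split.
- apply: continuous_measurable_fun => z; exact: (is_derive_continuous (dlogistic z)).
- by move=> x; have /andP[h1 h2] := logistic_itv x; rewrite ger0_norm ltW.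
- by move=> x; have /andP[h1 h2] := b1 x; rewrite ger0_norm.
- move=> x y; have := second_order_bound (K := fun=> 1) dlogistic lip (fun=> ler01) y (y - x).
  rewrite (_ : y - (y - x) = x); last by ring.
  have -> : logistic y - logistic x - (y - x) * (logistic y * (1 - logistic y)) =
    - (logistic x - logistic y - logistic y * (1 - logistic y) * (x - y)) by ring.
  by rewrite normrN -[(y - x) ^+ 2]sqrrN opprB.
Qed.

(* The slope is j^2 and the centre a + 1/j, so that the limit at u = a is 0. *)
Lemma logistic_step (a u : R) :
  logistic (j%:R ^+ 2 * u + (- (j%:R ^+ 2 * a) - j%:R)) @[j --> \oo] --> ((a < u)%R%:R : R).
Proof.
have h1 (z : R) : 0 <= z -> 1 - logistic z <= (1 + z)^-1.
  move=> z0; have e0 := expR_gt0 (- z); have ez := expR_ge1Dx z.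
  have -> : 1 - logistic z = expR (- z) / (1 + expR (- z)) by rewrite /logistic; field; rewrite gt_eqF// addr_gt0.
  rewrite (@le_trans _ _ (expR (- z)))//; first by rewrite ler_pdivrMr ?addr_gt0// ler_peMr ?(ltW e0)// lerDl ltW.
  by rewrite expRN lef_pV2 ?posrE ?expR_gt0// ltr_wpDr.
have h2 (z : R) : z <= 0 -> logistic z <= (1 - z)^-1.
  move=> z0; have ez := expR_ge1Dx (- z).
  have e0 := expR_gt0 (- z).
  by rewrite /logistic lef_pV2 ?posrE; lra.
apply/cvgrPdist_le => eps eps0.
have /cvgrPdist_le /(_ eps eps0) Hh := @cvg_harmonic R.
have [au|ua] := ltP a u; last first.
  apply: filterS Hh => j; rewrite sub0r normrN /= ger0_norm ?invr_ge0// => hj.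
  rewrite sub0r normrN; set z : R := (X in logistic X).
  have zj : z <= - j%:R.
    have -> : z = j%:R ^+ 2 * (u - a) - j%:R by rewrite /z; ring.
    have : j%:R ^+ 2 * (u - a) <= 0 by rewrite mulr_ge0_le0 ?sqr_ge0// subr_le0.
    lra.
  have j0 : 0 <= j%:R :> R by [].
  have /andP[l0 _] := logistic_itv z; rewrite gtr0_norm//.
  apply: le_trans (h2 z _) _; first by lra.
  by apply: le_trans hj; rewrite lef_pV2 ?posrE -?[j.+1%:R]natr1; lra.
have Hj := nbhs_infty_ger (2 / (u - a)).
apply: filterS2 Hh Hj => j; rewrite sub0r normrN /= ger0_norm ?invr_ge0// => hj ju.
set z : R := (X in logistic X); have j0 : 0 <= j%:R :> R by [].
rewrite ler_pdivrMr ?subr_gt0// in ju.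
have zj : j%:R <= z.
  have -> : z = j%:R * (j%:R * (u - a) - 1) by rewrite /z; ring.
  by rewrite ler_peMr//; lra.
have /andP[l0 l1] := logistic_itv z.
rewrite ger0_norm; last by rewrite subr_ge0 ltW.
apply: le_trans (h1 z _) _; first by lra.
by apply: le_trans hj; rewrite lef_pV2 ?posrE -?[j.+1%:R]natr1; lra.
Qed.

End smooth_functions.

Section approximation.
Context d (T : measurableType d) (R : realType) (P : probability T R).
Variable e : T -> R.
Hypothesis me : measurable_fun [set: T] e.

(* Approximation in L2 by smooth functions of e. Indicators of half-lines are
   reached through the logistic function, Borel sets by Dynkin induction. *)
Definition approximable (Z : T -> R) : Prop := L2 P Z /\
  forall eps : R, 0 < eps -> exists (chi chi' : R -> R) (K : R),
    smooth_bound chi chi' K /\ norm2 P (fun w => Z w - chi (e w)) <= eps.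

Let L2chi chi chi' K : smooth_bound chi chi' K -> L2 P (fun w => chi (e w)).
Proof.
by move=> [m h _ _]; apply: (@L2_bounded _ _ _ P K) => [|w] //; exact: measurableT_comp.
Qed.

Lemma eq_approximable Z Z' : Z =1 Z' -> approximable Z -> approximable Z'.
Proof. by move=> /funext ->. Qed.

Lemma approximable_lin (a b : R) Z1 Z2 : approximable Z1 -> approximable Z2 ->
  approximable (fun w => a * Z1 w + b * Z2 w).
Proof.
move=> [L1Z1 h1] [L1Z2 h2]; split; first by apply: L2D; exact: L2Z.
move=> eps eps0; pose dl := eps / (`|a| + `|b| + 1).
have c0 : 0 < `|a| + `|b| + 1 by rewrite ltr_wpDl// addr_ge0.
have dl0 : 0 < dl by rewrite divr_gt0.
have [chi1 [chi1' [K1 [s1 n1]]]] := h1 dl dl0; have [chi2 [chi2' [K2 [s2 n2]]]] := h2 dl dl0.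
exists (fun x => a * chi1 x + b * chi2 x), (fun x => a * chi1' x + b * chi2' x), (`|a| * K1 + `|b| * K2).
split; first exact: smooth_bound_lin.
have LL1 := L2B L1Z1 (L2chi s1); have LL2 := L2B L1Z2 (L2chi s2).
rewrite (@eq_nm _ _ _ P _ (fun w => a * (Z1 w - chi1 (e w)) + b * (Z2 w - chi2 (e w)))); last by move=> w; ring.
apply: le_trans (nmD (L2Z a LL1) (L2Z b LL2)) _.
rewrite !nmZ//; apply: (@le_trans _ _ ((`|a| + `|b|) * dl)).
  by rewrite mulrDl lerD// ler_wpM2l.
have -> : eps = (`|a| + `|b| + 1) * dl by rewrite /dl; field; rewrite gt_eqF.
by rewrite ler_wpM2r ?(ltW dl0)// lerDl.
Qed.

Lemma approximable_cst (c : R) : approximable (fun=> c).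
Proof.
split; first exact: L2_cst.
move=> eps eps0; exists (fun=> c), (fun=> 0), `|c|; split; first exact: smooth_bound_cst.
by rewrite subrr nm_cst normr0 ltW.
Qed.

Lemma approximable_lim Z : L2 P Z ->
  (forall eps : R, 0 < eps -> exists2 Z', approximable Z' & norm2 P (fun w => Z w - Z' w) <= eps) ->
  approximable Z.
Proof.
move=> LZ h; split => // eps eps0; have e2 : 0 < eps / 2 by rewrite divr_gt0.
have [Z' [LZ' aZ'] n1] := h _ e2; have [chi [chi' [K [s n2]]]] := aZ' _ e2.
exists chi, chi', K; split => //.
rewrite (@eq_nm _ _ _ P _ (fun w => (Z w - Z' w) + (Z' w - chi (e w)))); last by move=> w; ring.
apply: le_trans (nmD (L2B LZ LZ') (L2B LZ' (L2chi s))) _; lra.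
Qed.

Lemma nm_dominated (Y : nat -> T -> R) (c : R) : (forall j, measurable_fun [set: T] (Y j)) ->
  (forall j w, `|Y j w| <= c) -> (forall w, Y j w @[j --> \oo] --> (0 : R)) ->
  forall eps : R, 0 < eps -> exists j, norm2 P (Y j) <= eps.
Proof.
move=> mY bY cY eps eps0.
have : Ex P (fun w => Y j w ^+ 2) @[j --> \oo] --> (0 : R).
  rewrite -[X in _ --> X](Ex_cst P 0).
  apply: (@Ex_dominated _ _ _ P (fun j w => Y j w ^+ 2) (fun=> 0) (c ^+ 2)) => //.
  - by move=> j; exact: measurable_funX.
  - move=> j w; rewrite normrX ler_pXn2r// nnegrE//; exact: le_trans (bY j w).
  - by apply: aeW => w; rewrite -[X in _ --> X](mulr0 0); apply: cvgM; exact: cY.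
move=> /cvgrPdist_le /(_ _ (exprn_gt0 2 eps0)) [j _ /(_ j (leqnn j)) /=].
rewrite sub0r normrN => h; exists j.
rewrite -(@ler_pXn2r _ 2)// ?nnegrE ?nm_ge0 ?(ltW eps0)// sqr_nm.
exact: le_trans (ler_norm _) h.
Qed.

Lemma approximable_step (a : R) : approximable (fun w => (a < e w)%R%:R).
Proof.
have L2s : L2 P (fun w => (a < e w)%R%:R).
  apply: (@L2_bounded _ _ _ P 1) => [|w].
    by apply: measurable_natmul_bool; exact: measurable_fun_ltr.
  by case: (a < e w); rewrite ?normr1 ?normr0.
split => // eps eps0.
pose chi j x : R := logistic (j%:R ^+ 2 * x + (- (j%:R ^+ 2 * a) - j%:R)).
have sc j := @smooth_bound_affine R (j%:R ^+ 2) (- (j%:R ^+ 2 * a) - j%:R) _ _ _ ler01 (smooth_bound_logistic R).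
have [j hj] : exists j, norm2 P (fun w => (a < e w)%R%:R - chi j (e w)) <= eps.
  apply: (@nm_dominated (fun j w => (a < e w)%R%:R - chi j (e w)) 2) => //.
  - move=> j; apply: measurable_funB; first exact: L2s.1.
    by apply: (measurableT_comp _ me); have [] := sc j.
  - move=> j w; have /andP[h1 h2] := logistic_itv (j%:R ^+ 2 * e w + (- (j%:R ^+ 2 * a) - j%:R)).
    by rewrite /chi ler_norml; case: (a < e w) => /=; lra.
  - move=> w; rewrite -(subrr ((a < e w)%R%:R : R)); apply: cvgB; first exact: cvg_cst.
    exact: logistic_step.
by do 3 eexists; split; first exact: (sc j).
Qed.

End approximation.

Section approximation_borel.
Context d (T : measurableType d) (R : realType) (P : probability T R).
Variables (f : R -> R) (hf : unit_interval_density f) (Y : T -> R).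
Hypothesis mY : measurable_fun [set: T] Y.
Hypothesis Y01 : forall w, 0 < Y w < 1.

Let e w := cum_hazard f (Y w).

Let me : measurable_fun [set: T] e.
Proof. exact: (measurableT_comp (measurable_ellf hf) mY). Qed.

Lemma approximable_sum (n : nat) (c : nat -> R) (Z : nat -> T -> R) : (forall i, approximable P e (Z i)) ->
  approximable P e (fun w => \sum_(i < n) c i * Z i w).
Proof.
move=> h; elim: n => [|n IH].
  by apply: eq_approximable (approximable_cst P e 0) => w; rewrite big_ord0.
apply: eq_approximable (approximable_lin me 1 (c n) IH (h n)) => w.
by rewrite big_ord_recr/= mul1r.
Qed.

(** A ray for Y is a ray for e, since [cum_hazard] is strictly increasing on ]0, 1[. Countable
    disjoint unions are limits in L2 of finite ones by dominated convergence. *)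
Lemma approximable_indic (A : set R) : measurable A -> approximable P e (fun w => \1_A (Y w)).
Proof.
move=> mA; pose Q (A : set R) := approximable P e (fun w => \1_A (Y w)).
have mI (B : set R) : measurable B -> measurable_fun [set: T] (fun w => \1_B (Y w) : R).
  by move=> mB; apply: (measurableT_comp _ mY); exact: measurable_indic.
have := @dynkin_induction _ (measurableTypeR R) [set X | exists c : R, X = `]c, +oo[%classic] Q.
apply => //.
- exact: RGenOInfty.measurableE.
- move=> _ _ [x ->] [y ->]; exists (Num.max x y).
  by apply/seteqP; split => z /=; rewrite !in_itv/= !andbT gt_max => /andP.
- by apply: eq_approximable (approximable_cst P e 1) => w; rewrite indicE in_setT.
- move=> _ [c ->]; rewrite /Q.
  have E w : \1_(`]c, +oo[%classic : set R) (Y w) = (c < Y w)%R%:R :> R.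
    by rewrite indicE mem_setE in_itv/= andbT.
  have [c0|c0] := leP c 0.
    apply: eq_approximable (approximable_cst P e 1) => w; rewrite E.
    by rewrite (le_lt_trans c0)//; have /andP[] := Y01 w.
  have [c1|c1] := leP 1 c.
    apply: eq_approximable (approximable_cst P e 0) => w; rewrite E.
    by rewrite ltNge (le_trans (ltW (proj2 (andP (Y01 w)))) c1).
  apply: eq_approximable (@approximable_step _ _ _ P _ me (cum_hazard f c)) => w; rewrite E; congr _%:R.
  have c01 : 0 < c < 1 by rewrite c0.
  have [cY|Yc|cY] := ltgtP c (Y w); last by rewrite /e cY ltxx.
    by rewrite (ellf_lt hf).
  by rewrite ltNge ltW// (ellf_lt hf).
- move=> S mS QS.
  apply: eq_approximable (approximable_lin me 1 (-1) (approximable_cst P e 1) QS) => w.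
  by rewrite !indicE in_setC; case: (_ \in S); rewrite /=; ring.
- move=> F mF tF QF.
  apply: approximable_lim => //.
    apply: (@L2_bounded _ _ _ P 1); first by apply: mI; exact: bigcupT_measurable.
    by move=> w; rewrite indicE; case: (_ \in _); rewrite ?normr1 ?normr0.
  move=> eps eps0.
  (* [D n w] is 1 if Y w falls in some [F i] with i >= n, and 0 otherwise. *)
  pose D n w : R := \1_(\bigcup_i F i) (Y w) - \sum_(i < n) 1 * \1_(F i) (Y w).
  have D1 n w i : F i (Y w) -> \sum_(i < n) 1 * \1_(F i) (Y w) = (i < n)%N%:R :> R.
    move=> Fi; rewrite (eq_bigr (fun j : 'I_n => (nat_of_ord j == i)%:R)); last first.
      move=> j _; rewrite mul1r indicE; have [->|ji] := eqVneq (nat_of_ord j) i; first by rewrite mem_set.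
      rewrite memNset// => Fj; move/eqP: ji; apply.
      by apply: (tF j i) => //; exists (Y w).
    have [lin|nli] := ltnP i n; last first.
      by rewrite big1// => j _; rewrite ltn_eqF// (leq_trans _ nli).
    rewrite (bigD1 (Ordinal lin))//= eqxx big1 ?addr0// => j.
    by rewrite -val_eqE/= => /negbTE ->.
  have D0 n w : ~ (\bigcup_i F i) (Y w) -> D n w = 0.
    move=> nF; rewrite /D indicE memNset// sub0r big1 ?oppr0// => i _.
    by rewrite indicE memNset ?mulr0// => Fi; apply: nF; exists i.
  have DE n w i : F i (Y w) -> D n w = 1 - (i < n)%N%:R.
    by move=> Fi; rewrite /D (D1 n w i)// indicE mem_set//; exists i.
  have [n hn] : exists n, norm2 P (D n) <= eps.
    apply: (@nm_dominated _ _ _ P D 1) => // [n|n w|w].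
    + apply: measurable_funB; first by apply: mI; exact: bigcupT_measurable.
      by apply: measurable_sum => i; apply: measurable_funM => //; exact: (mI _ (mF i)).
    + have [[i _ Fi]|nF] := pselect ((\bigcup_i F i) (Y w)); last by rewrite D0// normr0.
      by rewrite (DE n w i)//; case: ltnP; rewrite ?subrr ?subr0 ?normr0 ?normr1.
    + have [[i _ Fi]|nF] := pselect ((\bigcup_i F i) (Y w)); last first.
        by rewrite (_ : (fun n => D n w) = fun=> 0) ?(funext (fun n => D0 n w nF))//; exact: cvg_cst.
      apply/cvgrPdist_le => dl dl0; near=> n; rewrite (DE n w i)//.
      have -> : (i < n)%N by near: n; exists i.+1.
      by rewrite subrr subr0 normr0 ltW.
  exists (fun w => \sum_(i < n) 1 * \1_(F i) (Y w)) => //.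
  exact: (@approximable_sum n (fun=> 1) (fun i w => \1_(F i) (Y w))).
- have E : @measurable _ (measurableTypeR R) =
    <<s [set X | exists c : R, X = `]c, +oo[%classic] >> by exact: RGenOInfty.measurableE.
  by rewrite -E.
Unshelve. all: by end_near. Qed.

(** The number of integers in [1, N] not above t is the integer part of t. Applied to a function,
    this writes it uniformly as a sum of indicators of superlevel sets. *)
Lemma unary_digits (t : R) (N : nat) : 0 <= t <= N%:R -> `|t - \sum_(i < N) (i.+1%:R <= t)%R%:R| <= 1.
Proof.
elim: N t => [|N IH] t /andP[t0 tN].
  by rewrite big_ord0 (_ : t = 0) ?subrr ?normr0//; apply/eqP; rewrite eq_le tN.
rewrite big_ord_recr/=; have [tN'|Nt] := leP t N%:R.
  rewrite (_ : (N.+1%:R <= t) = false) ?addr0 ?IH ?t0//.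
  by apply/negbTE; rewrite -ltNge (le_lt_trans tN')// ltr_nat.
rewrite (eq_bigr (fun=> 1)) => [|i _]; last by rewrite (le_trans _ (ltW Nt))// ler_nat.
rewrite sumr_const card_ord -natr1 in tN *.
have [e1|_] := leP (N%:R + 1) t; rewrite ler_norml /=; lra.
Qed.

(** The values of phi lie in [- c, c]. Cutting this range into N steps of height b <= eps writes
    phi, up to b, as - c plus b times the number of levels reached. *)
Lemma approximable_bounded (phi : R -> R) (C : R) : measurable_fun [set: R] phi ->
  (forall x, 0 < x < 1 -> `|phi x| <= C) -> approximable P e (fun w => phi (Y w)).
Proof.
move=> mphi bphi; pose c := `|C| + 1; have c0 : 0 < c by rewrite ltr_wpDl.
have pc w : - c <= phi (Y w) <= c.
  by have := bphi _ (Y01 w); rewrite -ler_norml => /le_trans; apply; have := ler_norm C; rewrite /c; lra.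
have mp : measurable_fun [set: T] (fun w => phi (Y w)) by exact: measurableT_comp.
have L2p : L2 P (fun w => phi (Y w)).
  by apply: (@L2_bounded _ _ _ P c) => // w; rewrite ler_norml.
apply: approximable_lim => // eps eps0.
have q0 : 0 < 2 * c / eps by rewrite divr_gt0// mulr_gt0.
pose N := Num.bound (2 * c / eps); pose b : R := 2 * c / N%:R.
have N0 : 0 < N%:R :> R.
  exact: lt_trans (archi_boundP (ltW q0)).
have b0 : 0 < b by rewrite divr_gt0// mulr_gt0.
have beps : b <= eps.
  rewrite ler_pdivrMr// [leRHS]mulrC -ler_pdivrMr//.
  exact: ltW (archi_boundP (ltW q0)).
pose A i : set R := [set x | i.+1%:R <= (phi x + c) / b].
have mA i : measurable (A i).
  rewrite -[A i]setTI; have : measurable_fun [set: R] (fun x => (phi x + c) / b).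
    by apply: measurable_funM => //; exact: measurable_funD.
  move=> /(_ measurableT _ (measurable_itv `[(i.+1%:R : R), +oo[)).
  by congr (measurable (_ `&` _)); apply/seteqP; split => x /=; rewrite in_itv/= andbT.
have aZ : approximable P e (fun w => (-1) * c + 1 * \sum_(i < N) b * \1_(A i) (Y w)).
  apply: approximable_lin => //; first exact: approximable_cst.
  by apply: (@approximable_sum N (fun=> b) (fun i w => \1_(A i) (Y w))) => i; exact: approximable_indic.
exists (fun w => (-1) * c + 1 * \sum_(i < N) b * \1_(A i) (Y w)) => //.
have LZ := aZ.1; apply: le_trans beps; rewrite -[leRHS](ger0_norm (ltW b0)) -[leRHS](nm_cst P b).
apply: nm_le; [exact: L2B|exact: L2_cst|move=> w].
have := @unary_digits ((phi (Y w) + c) / b) N.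
have -> : 0 <= (phi (Y w) + c) / b <= N%:R.
  have /andP[p1 p2] := pc w; rewrite divr_ge0 ?(ltW b0)//=; last by lra.
  rewrite ler_pdivrMr//; have -> : N%:R * b = 2 * c by rewrite /b; field; rewrite gt_eqF.
  lra.
move=> /(_ isT); rewrite (eq_bigr (fun i : 'I_N => \1_(A i) (Y w))) => [h|i _]; last first.
  by rewrite indicE; congr ((nat_of_bool _)%:R); apply/idP/idP => [h|/set_mem//]; exact: mem_set.
have -> : phi (Y w) - (-1 * c + 1 * \sum_(i < N) b * \1_(A i) (Y w)) =
   b * ((phi (Y w) + c) / b - \sum_(i < N) \1_(A i) (Y w)).
  by rewrite -mulr_sumr; field; rewrite gt_eqF.
by rewrite normrM gtr0_norm// ler_piMr// ltW.
Qed.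

End approximation_borel.

(** * Linearization *)

Section almost_everywhere_domination.
Context d (T : measurableType d) (R : realType) (P : probability T R).

(** [Y'] clips Y to [- |Z|, |Z|] at every point and agrees with Y almost everywhere. *)
Lemma nm_le_ae (Y Z : T -> R) : measurable_fun [set: T] Y -> L2 P Z ->
  (\forall w \ae P, `|Y w| <= Z w) -> L2 P Y /\ norm2 P Y <= norm2 P Z.
Proof.
move=> mY LZ YZ.
have LZ' := L2_norm LZ.
pose Y' w := Num.max (- `|Z w|) (Num.min (Y w) `|Z w|).
have Y'Z w : `|Y' w| <= `|Z w|.
  have := normr_ge0 (Z w); rewrite /Y' ler_norml; move: `|Z w| => z z0.
  by rewrite le_max lexx/= ge_max ge_min lexx orbT andbT; lra.
have mY' : measurable_fun [set: T] Y'.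
  apply: measurable_maxr; first by apply: measurableT_comp => //; exact: LZ'.1.
  by apply: measurable_minr => //; exact: LZ'.1.
have LY' : L2 P Y' by apply: L2_le LZ'.
have eY : \forall w \ae P, Y w = Y' w.
  apply: filterS YZ => w h; have z0 : 0 <= Z w := le_trans (normr_ge0 _) h.
  rewrite /Y' (ger0_norm z0); move: h; rewrite ler_norml => /andP[h1 h2].
  by rewrite (min_idPl h2) (max_idPr h1).
split; first exact: L2_ae LY'.
have -> : norm2 P Y = norm2 P Y'.
  rewrite /norm2; congr Num.sqrt; apply: Ex_ae; try exact: measurable_funX.
  by apply: filterS eY => w ->.
have -> : norm2 P Z = norm2 P (fun w => `|Z w|).
  by rewrite /norm2; congr Num.sqrt; apply: eq_Ex => w; rewrite real_normK ?num_real.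
exact: nm_le.
Qed.

Lemma L2_sum_nat (m n : nat) (Y : nat -> T -> R) : (forall i, (m <= i < n)%N -> L2 P (Y i)) ->
  L2 P (fun w => \sum_(m <= i < n) Y i w).
Proof.
move=> h; apply: (eq_L2 (Y := fun w => \sum_(i <- index_iota m n | (m <= i < n)%N) Y i w)) => [w|].
  by rewrite [RHS]big_nat.
exact: L2_sum.
Qed.

Lemma nm_sum_nat (m n : nat) (Y : nat -> T -> R) : (forall i, (m <= i < n)%N -> L2 P (Y i)) ->
  norm2 P (fun w => \sum_(m <= i < n) Y i w) <= \sum_(m <= i < n) norm2 P (Y i).
Proof.
move=> h; rewrite big_nat (@eq_nm _ _ _ P _ (fun w => \sum_(i <- index_iota m n | (m <= i < n)%N) Y i w)).
  exact: nm_sum.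
by move=> w; rewrite [LHS]big_nat.
Qed.

End almost_everywhere_domination.

(** * Harmonic error terms and logarithms of spacings *)

Section harmonic.
Context (R : realType).

Definition harm (n : nat) : R := \sum_(0 <= i < n) i.+1%:R^-1.

Lemma harm_ge0 n : 0 <= harm n.
Proof. by apply: sumr_ge0 => i _. Qed.

Lemma harm_mono m n : (m <= n)%N -> harm m <= harm n.
Proof.
by move=> mn; rewrite /harm (@big_cat_nat _ _ _ m 0 n)//= lerDl; apply: sumr_ge0.
Qed.

Lemma harm_rev n : \sum_(0 <= i < n) (n - i)%:R^-1 = harm n.
Proof.
rewrite big_nat_rev/= /harm; apply: eq_big_nat => i /andP[_ lin].
by rewrite add0n subKn.
Qed.

(** ln n = 4 ln s with s = n^(1/4), and ln s <= s - 1. The exponent only has to be below 1/2, as the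
    errors are compared with sqrt n. *)
Lemma harm_le n : harm n <= 4 * Num.sqrt (Num.sqrt n%:R).
Proof.
have H m : harm m.+1 <= 1 + ln m.+1%:R.
  elim: m => [|m IH]; first by rewrite /harm big_nat1 ln1 invr1 addr0.
  rewrite /harm big_nat_recr//= -/(harm m.+1).
  apply: le_trans (lerD IH (lexx _)) _; rewrite -addrA lerD2l.
  have p1 : 0 < m.+1%:R :> R by []. have p2 : 0 < m.+2%:R :> R by [].
  have := @le_ln1Dx R (m.+1%:R / m.+2%:R - 1).
  rewrite -[m.+2%:R]natr1 in p2 *; move: (m.+1%:R : R) p1 p2 => x p1 p2.
  rewrite [1 + _]addrC subrK ln_div ?posrE//.
  have -> : x / (x + 1) - 1 = - (x + 1)^-1 by field; rewrite gt_eqF.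
  have q : (x + 1)^-1 < 1 by rewrite invf_lt1//; lra.
  by move=> h; have := h ltac:(lra); lra.
case: n => [|m]; first by rewrite /harm big_geq// mulr_ge0// sqrtr_ge0.
apply: le_trans (H m) _; set s := Num.sqrt _.
have s0 : 0 < s by rewrite !sqrtr_gt0.
have -> : m.+1%:R = s ^+ 4 :> R.
  by rewrite (_ : 4 = 2 * 2)%N// exprM !sqr_sqrtr// sqrtr_ge0.
rewrite lnXn//; have := @le_ln1Dx R (s - 1); rewrite [1 + _]addrC subrK => h.
by have := h ltac:(lra); rewrite -mulr_natl; lra.
Qed.

Lemma harm_sqrt (c eps : R) : 0 <= c -> 0 < eps -> \forall n \near \oo, c * harm n <= eps * Num.sqrt n%:R.
Proof.
move=> c0 eps0; near=> n.
apply: le_trans (ler_wpM2l c0 (harm_le n)) _.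
set s := Num.sqrt (Num.sqrt n%:R).
have -> : Num.sqrt n%:R = s * s :> R by rewrite -expr2 sqr_sqrtr// sqrtr_ge0.
rewrite !mulrA ler_wpM2r ?sqrtr_ge0//.
have h : (c * 4 / eps) ^+ 4 <= n%:R by near: n; exact: nbhs_infty_ger.
rewrite [leRHS]mulrC -ler_pdivrMr//.
rewrite -(@ler_pXn2r _ 4) ?nnegrE ?sqrtr_ge0// ?divr_ge0 ?mulr_ge0 ?(ltW eps0)//.
by apply: le_trans h _; rewrite [leRHS](@exprM _ s 2 2) !sqr_sqrtr// sqrtr_ge0.
Unshelve. all: by end_near. Qed.

End harmonic.

Lemma sum_weighted_partial_sums (R : realType) (c x : nat -> R) N :
  \sum_(1 <= i < N.+1) c i * \sum_(0 <= j < i) x j = \sum_(0 <= j < N) x j * \sum_(j.+1 <= i < N.+1) c i.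
Proof.
elim: N => [|N IH]; first by rewrite !big_geq.
rewrite big_nat_recr//= IH [in RHS]big_nat_recr//= big_nat1.
have -> : \sum_(0 <= j < N) x j * \sum_(j.+1 <= i < N.+2) c i =
    \sum_(0 <= j < N) (x j * \sum_(j.+1 <= i < N.+1) c i + x j * c N.+1).
  by apply: eq_big_nat => j /andP[_ jN]; rewrite -mulrDr big_nat_recr//= ltnS ltnW.
by rewrite big_split/= -addrA -mulr_suml -mulrDl -big_nat_recr//= [c _ * _]mulrC.
Qed.

Section log_spacing.
Context (R : realType) (a : nat -> R) (n k : nat).
Hypothesis a0 : forall j, 0 <= a j.
Hypothesis k0 : (0 < k)%N.

Let S m : R := \sum_(0 <= j < m) a j / (n - j)%:R.

(** Let H be the increment of l between the two order statistics. Then H exp (- H) <= 1 - exp (- H)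
    <= H, and H lies between W / p and W / q because the denominators n - j vary by less than k over
    the window. *)
Lemma log_spacing_linear i : (i + k <= n)%N -> 0 < \sum_(i <= j < i + k) a j ->
  `|ln (n%:R * (expR (- S i) - expR (- S (i + k)))) -
    (ln (\sum_(i <= j < i + k) a j) - S i + (ln n%:R - ln (n - i)%:R))|
  <= (\sum_(i <= j < i + k) a j + k%:R) / (n - i - k).+1%:R.
Proof.
move=> ikn; set W := \sum_(i <= j < i + k) a j => W0.
pose H := \sum_(i <= j < i + k) a j / (n - j)%:R.
have SE : S (i + k) = S i + H by rewrite /S (@big_cat_nat _ _ _ i)//= leq_addr.
set q : R := (n - i - k).+1%:R; set p : R := (n - i)%:R.
have q0 : 0 < q by []. have p0 : 0 < p by rewrite ltr0n; lia.
have pq : p = q + k%:R - 1.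
  by rewrite /p /q -natrD -[X in _ - X]/(1%:R) -natrB; [congr _%:R; lia|lia].
have H1 : W / p <= H.
  rewrite /W mulr_suml ler_sum_nat// => j /andP[j1 j2].
  by rewrite ler_wpM2l// lef_pV2 ?posrE ?ltr0n ?ler_nat; lia.
have H2 : H <= W / q.
  rewrite /W mulr_suml ler_sum_nat// => j /andP[j1 j2].
  by rewrite ler_wpM2l// lef_pV2 ?posrE ?ltr0n ?ler_nat; lia.
have H0 : 0 < H by apply: lt_le_trans H1; rewrite divr_gt0.
have e0 := expR_gt0 (- H).
have f1 : 0 < 1 - expR (- H) by rewrite subr_gt0 expR_lt1; lra.
have n0 : 0 < n%:R :> R by rewrite ltr0n; lia.
rewrite SE opprD expRD.
have -> : ln (n%:R * (expR (- S i) - expR (- S i) * expR (- H))) = ln n%:R - S i + ln (1 - expR (- H)).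
  rewrite -{1}[expR (- S i)]mulr1 -mulrBr !lnM ?posrE ?mulr_gt0 ?expR_gt0// expRK; ring.
have u1 : ln (1 - expR (- H)) <= ln H.
  by rewrite ler_ln ?posrE//; have := expR_ge1Dx (- H); lra.
have u2 : ln H - H <= ln (1 - expR (- H)).
  rewrite -[X in _ - X]expRK -ln_div ?posrE ?expR_gt0// -expRN ler_ln ?posrE ?mulr_gt0//.
  have h : expR (- H) * expR H = 1 by rewrite -expRD addNr expR0.
  by have := ler_wpM2l (ltW e0) (expR_ge1Dx H); rewrite h mulrDr mulr1 [H * _]mulrC; lra.
have v1 : ln W - ln p <= ln H by rewrite -ln_div ?posrE// ler_ln ?posrE// divr_gt0.
have v2 : ln H <= ln W - ln q by rewrite -ln_div ?posrE// ler_ln ?posrE// divr_gt0.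
have v3 : ln p - ln q <= (k%:R - 1) / q.
  rewrite -ln_div ?posrE//; have pq0 : 0 < p / q by rewrite divr_gt0.
  have := @le_ln1Dx R (p / q - 1); rewrite [1 + _]addrC subrK.
  have -> : (k%:R - 1) / q = p / q - 1 by rewrite pq; field; rewrite gt_eqF.
  by move: pq0; move: (p / q) => x x0; apply; lra.
have kq : 0 <= k%:R / q by rewrite divr_ge0// ltW.
have Wq : 0 <= W / q by rewrite divr_ge0// ltW.
have q1 : 0 < q^-1 by rewrite invr_gt0.
rewrite mulrBl mul1r in v3; rewrite mulrDl ler_norml.
clear SE H1 pq; clearbody W H q p.
move: (ln _) (ln _) (ln _) (ln _) (W / q) (k%:R / q) q^-1 (S i) u1 u2 v1 v2 v3 kq Wq q1 H2 => *.
apply/andP; split; lra.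
Qed.

Lemma sum_partial_sums N : (N <= n)%N -> \sum_(1 <= i < N.+1) S i = \sum_(0 <= j < N) a j * ((N - j)%:R / (n - j)%:R).
Proof.
move=> Nn.
elim: N Nn => [|N IH] Nn; first by rewrite !big_geq.
rewrite big_nat_recr//= IH ?(ltnW Nn)// /S [in RHS]big_nat_recr//= subSn// subnn.
rewrite [X in _ + X]big_nat_recr//= addrA -big_split/=; congr (_ + _); last by rewrite mul1r.
by apply: eq_big_nat => j /andP[_ jN]; rewrite subSn ?(ltnW jN)// -natr1; ring.
Qed.

End log_spacing.

(** A bound for E (e - 1)^4 obtained from (a + b)^4 <= 8 (a^4 + b^4). *)
Definition pow4_bound (R : realType) : R := 8 * (2 * 8 ^+ 4 + 1).

(** The value 3 is what the cross term of [pow4_centered_sum] asks for: 6 a^2 V <= 2 c a^2 V. *)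
Lemma pow4_bound_ge3 (R : realType) : 3 <= pow4_bound R.
Proof. by have := exprn_ge0 4 (ler0n R 8); rewrite /pow4_bound; lra. Qed.

(** * Linear and smooth statistics of independent exponential variables *)

Section exponential_sums.
Context d (T : measurableType d) (R : realType) (P : probability T R).
Variables (n : nat) (e : nat -> T -> R).
Hypothesis me : forall i, measurable_fun [set: T] (e i).
Hypothesis ie : indep P n e.
Hypothesis he : forall i, (i < n)%N -> expo P (e i).

Local Notation y i := (fun w => e i w - 1).

Let my i : measurable_fun [set: T] (y i).
Proof. exact: measurable_funB. Qed.

Lemma L2_expoB1 i : (i < n)%N -> L2 P (y i).
Proof. by move=> lin; apply: L2B; [exact: (expo_L2 (he lin)).1|exact: L2_cst]. Qed.

Lemma Ex_expoB1 i : (i < n)%N -> Ex P (y i) = 0.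
Proof.
move=> lin; have [l1 e1] := expo_mean (he lin).
by rewrite (ExB l1 (L1_cst P 1)) e1 Ex_cst subrr.
Qed.

Lemma Ex_sqr_expoB1 i : (i < n)%N -> Ex P (fun w => (e i w - 1) ^+ 2) = 1.
Proof.
move=> lin; have [l2 e2] := expo_L2 (he lin); have [l1 e1] := expo_mean (he lin).
have h := ExB l2.2 (L1B (L1Z 2 l1) (L1_cst P 1)).
have h' := ExB (L1Z 2 l1) (L1_cst P 1).
rewrite (@eq_Ex _ _ _ _ _ (fun w => e i w ^+ 2 - (2 * e i w - 1))); last by move=> w; ring.
by rewrite h h' ExZ// e1 e2 Ex_cst; ring.
Qed.

Lemma expoB1_pow4 i : (i < n)%N -> L1 P (fun w => (e i w - 1) ^+ 4) /\ Ex P (fun w => (e i w - 1) ^+ 4) <= pow4_bound R.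
Proof.
move=> lin; have [l4 e4] := expo_pow4 (he lin).
have hD := L1Z 8 (L1D l4 (L1_cst P 1)).
have b w : (e i w - 1) ^+ 4 <= 8 * (e i w ^+ 4 + 1).
  by have := pow4D_le (e i w) (-1); rewrite -signr_odd/= expr0.
have l : L1 P (fun w => (e i w - 1) ^+ 4).
  apply: (L1_le _ _ hD); first exact: measurable_funX.
  by move=> w; rewrite ger0_norm// (_ : 4 = 2 * 2)%N// exprM sqr_ge0.
split => //; apply: le_trans (Ex_le l hD b) _.
have h := ExD l4 (L1_cst P 1).
by rewrite ExZ ?h ?Ex_cst; [rewrite /pow4_bound ler_wpM2l// lerD2r|exact: L1D l4 (L1_cst P 1)].
Qed.

(** When an independent centred term is added, the odd cross terms vanish, each having a factor of
    mean 0, and E D^4 grows by 6 a^2 V + a^4 E y^4. The fourth moment controls the L2 norm of D^2,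
    the error of a first-order expansion. *)
Lemma pow4_centered_sum (a : nat -> R) i : (i <= n)%N ->
  let D w := \sum_(j < i) a j * (e j w - 1) in
  let V := \sum_(j < i) a j ^+ 2 in
  [/\ L2 P D, L1 P (fun w => D w ^+ 4), Ex P D = 0, Ex P (fun w => D w ^+ 2) = V &
    Ex P (fun w => D w ^+ 4) <= pow4_bound R * V ^+ 2].
Proof.
elim: i => [|i IH] lin /=.
  have E w : \sum_(j < 0) a j * (e j w - 1) = 0 by rewrite big_ord0.
  rewrite !big_ord0 (_ : (fun w => _) = fun=> 0); last by apply/funext.
  rewrite (_ : (fun w => _ ^+ 4) = fun=> 0); last by apply/funext => w; rewrite E expr0n.
  rewrite (_ : (fun w => _ ^+ 2) = fun=> 0); last by apply/funext => w; rewrite E expr0n.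
  rewrite !Ex_cst expr0n/= mulr0; split => //; [exact: L2_cst|exact: L1_cst].
have {IH} := IH (ltnW lin).
set D := fun w : T => \sum_(j < i) a j * (e j w - 1); set V := \sum_(j < i) a j ^+ 2.
move=> [LD LD4 ED ED2 ED4].
have Ly := L2_expoB1 lin; have Ey := Ex_expoB1 lin; have Ey2 := Ex_sqr_expoB1 lin.
have [Ly4 Ey4] := expoB1_pow4 lin.
have mD := LD.1.
have DE w : \sum_(j < i.+1) a j * (e j w - 1) = D w + a i * (e i w - 1) by rewrite big_ord_recr.
have VE : \sum_(j < i.+1) a j ^+ 2 = V + a i ^+ 2 by rewrite big_ord_recr.
have X4 (x : R) : x ^+ 4 = (x ^+ 2) ^+ 2 by rewrite -exprM.
have LD2 : L2 P (fun w => D w ^+ 2).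
  split; first exact: measurable_funX.
  by apply: eq_L1 LD4 => w; rewrite X4.
have Ly2 : L2 P (fun w => (e i w - 1) ^+ 2).
  split; first exact: measurable_funX.
  by apply: eq_L1 Ly4 => w; rewrite X4.
have L22 := L2M LD2 Ly2.
have am (u v : R) : `|u ^+ 3 * v| <= u ^+ 4 + u ^+ 2 * v ^+ 2.
  rewrite (_ : u ^+ 3 * v = u ^+ 2 * (u * v)); last by ring.
  rewrite (_ : u ^+ 4 + _ = u ^+ 2 * (u ^+ 2 + v ^+ 2)); last by ring.
  rewrite normrM (ger0_norm (sqr_ge0 u)) ler_wpM2l ?sqr_ge0//.
  by rewrite ler_norml; apply/andP; split; have := sqr_ge0 (u + v); have := sqr_ge0 (u - v); have := sqr_ge0 u; have := sqr_ge0 v; nra.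
have pw (u : R) : `|u ^+ 3| <= u ^+ 4 + u ^+ 2.
  by have := am u 1; rewrite mulr1 expr1n mulr1.
have L31 : L1 P (fun w => D w ^+ 3 * (e i w - 1)).
  by apply: (L1_le _ _ (L1D LD4 L22)) => [|w] //; apply: measurable_funM => //; exact: measurable_funX.
have L13 : L1 P (fun w => D w * (e i w - 1) ^+ 3).
  apply: (L1_le _ _ (L1D Ly4 L22)) => [|w]; first by apply: measurable_funM => //; exact: measurable_funX.
  by have := am ((e i w - 1)) (D w); rewrite mulrC [_ * D w ^+ 2]mulrC.
have L3 : L1 P (fun w => D w ^+ 3).
  by apply: (L1_le _ _ (L1D LD4 LD.2)) => [|w] //; exact: measurable_funX.
have L3' : L1 P (fun w => (e i w - 1) ^+ 3).
  by apply: (L1_le _ _ (L1D Ly4 Ly.2)) => [|w] //; exact: measurable_funX.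
have sD : sgm e [set j | (j < i)%N] D.
  apply: measurable_sum => j; apply: measurable_funM; first exact: measurable_cst.
  by apply: measurable_funB; [apply: sg_coord => /=|exact: measurable_cst].
have sy : sgm e [set i] (y i) by apply: measurable_funB; [exact: sg_coord|exact: measurable_cst].
have prod (p q : nat) : L1 P (fun w => D w ^+ p) -> L1 P (fun w => (e i w - 1) ^+ q) ->
    L1 P (fun w => D w ^+ p * (e i w - 1) ^+ q) ->
    Ex P (fun w => D w ^+ p * (e i w - 1) ^+ q) = Ex P (fun w => D w ^+ p) * Ex P (fun w => (e i w - 1) ^+ q).
  apply: (@indep_ExM_L1 _ _ _ P n [set j | (j < i)%N] [set i]) => //.
  - by move=> j /= ji; rewrite (ltn_trans ji).
  - by move=> j /= ->.
  - by apply/seteqP; split => // j /= [ji jE]; rewrite jE ltnn in ji.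
  - exact: measurable_funX.
  - exact: measurable_funX.
have LDy := L2M LD Ly.
have p11 : Ex P (fun w => D w * (e i w - 1)) = Ex P D * Ex P (y i) := prod 1%N 1%N (L2_L1 LD) (L2_L1 Ly) LDy.
have p31 : Ex P (fun w => D w ^+ 3 * (e i w - 1)) = Ex P (fun w => D w ^+ 3) * Ex P (y i) := prod 3%N 1%N L3 (L2_L1 Ly) L31.
have p13 : Ex P (fun w => D w * (e i w - 1) ^+ 3) = Ex P D * Ex P (fun w => (e i w - 1) ^+ 3) := prod 1%N 3%N (L2_L1 LD) L3' L13.
have p22 := prod 2%N 2%N LD.2 Ly.2 L22.
have q11 : Ex P (fun w => D w * (e i w - 1)) = 0 by rewrite p11 ED mul0r.
have q31 : Ex P (fun w => D w ^+ 3 * (e i w - 1)) = 0 by rewrite p31 Ey mulr0.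
have q13 : Ex P (fun w => D w * (e i w - 1) ^+ 3) = 0 by rewrite p13 ED mul0r.
have q22 : Ex P (fun w => D w ^+ 2 * (e i w - 1) ^+ 2) = V by rewrite p22 ED2 Ey2 mulr1.
have f1 : L2 P (fun w => \sum_(j < i.+1) a j * (e j w - 1)).
  by apply: (eq_L2 (Y := fun w => D w + a i * (e i w - 1))) => [w|]; [rewrite DE|exact: L2D LD (L2Z _ Ly)].
have s2 := L1D (L1Z (2 * a i) LDy) (L1Z (a i ^+ 2) Ly.2).
have s4a := L1D (L1Z (4 * a i ^+ 3) L13) (L1Z (a i ^+ 4) Ly4).
have s4b := L1D (L1Z (4 * a i) L31) (L1Z (6 * a i ^+ 2) L22).
have s4c := L1D s4b s4a. have s4 := L1D LD4 s4c.
have E4 w : (\sum_(j < i.+1) a j * (e j w - 1)) ^+ 4 = D w ^+ 4 + ((4 * a i * (D w ^+ 3 * (e i w - 1)) + 6 * a i ^+ 2 * (D w ^+ 2 * (e i w - 1) ^+ 2)) + (4 * a i ^+ 3 * (D w * (e i w - 1) ^+ 3) + a i ^+ 4 * (e i w - 1) ^+ 4)).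
  by rewrite DE; ring.
split => //.
- by apply: eq_L1 s4 => w; rewrite E4.
- rewrite (eq_Ex P DE); have h := ExD (L2_L1 LD) (L1Z (a i) (L2_L1 Ly)); rewrite h ED ExZ ?Ey ?mulr0 ?addr0//; exact: L2_L1.
- rewrite (@eq_Ex _ _ _ P _ (fun w => D w ^+ 2 + (2 * a i * (D w * (e i w - 1)) + a i ^+ 2 * (e i w - 1) ^+ 2))); last first.
    by move=> w; rewrite DE; ring.
  have h := ExD LD.2 s2; have h' := ExD (L1Z (2 * a i) LDy) (L1Z (a i ^+ 2) Ly.2).
  by rewrite h h' !ExZ ?ED2 ?q11 ?Ey2 ?VE; [ring|exact: Ly.2|].
rewrite (eq_Ex P E4) VE.
have h := ExD LD4 s4c; have h1 := ExD s4b s4a.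
have h2 := ExD (L1Z (4 * a i) L31) (L1Z (6 * a i ^+ 2) L22).
have h3 := ExD (L1Z (4 * a i ^+ 3) L13) (L1Z (a i ^+ 4) Ly4).
rewrite h h1 h2 h3 (ExZ _ L31) (ExZ _ L22) (ExZ _ L13) (ExZ _ Ly4) q31 q22 q13 !mulr0 !add0r.
have V0 : 0 <= V by apply: sumr_ge0 => j _; exact: sqr_ge0.
have a0 := sqr_ge0 (a i).
have a4 : 0 <= a i ^+ 4 by rewrite X4 sqr_ge0.
have := ler_wpM2l a4 Ey4; have := mulr_ge0 a0 V0.
rewrite (_ : pow4_bound R * (V + a i ^+ 2) ^+ 2 = pow4_bound R * V ^+ 2 + 2 * pow4_bound R * (a i ^+ 2 * V) + a i ^+ 4 * pow4_bound R); last by ring.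
have := ler_wpM2r (mulr_ge0 a0 V0) (pow4_bound_ge3 R).
move: ED4; move: (pow4_bound R) => c *; lra.
Qed.


(** Renyi's sum: l at the i-th order statistic, when [e] is the family of normalized gaps. *)
Definition psum i w : R := \sum_(0 <= j < i) e j w / (n - j)%:R.

Lemma measurable_psum i : measurable_fun [set: T] (psum i).
Proof. by apply: measurable_sum => j; apply: measurable_funM. Qed.

Lemma nm_expo j : (j < n)%N -> norm2 P (e j) <= 2.
Proof.
move=> jn; rewrite -(@ler_pXn2r _ 2) ?nnegrE ?nm_ge0// sqr_nm (expo_L2 (he jn)).2.
by rewrite expr2; lra.
Qed.

Lemma L2_win k i : (i + k <= n)%N -> L2 P (win e k i).
Proof.
move=> ikn; rewrite /win (_ : (fun w => _) = fun w => \sum_(j < k) e (j + i)%N w); last first.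
  apply/funext => w; rewrite -{1}[i]add0n [(0 + i + _)%N]addnC big_addn.
  by rewrite (_ : (k + (0 + i) - i = k)%N) ?big_mkord//; lia.
by apply: L2_sum => j _; apply: (expo_L2 (he _)).1; have := ltn_ord j; lia.
Qed.

Lemma nm_win k i : (i + k <= n)%N -> norm2 P (win e k i) <= 2 * k%:R.
Proof.
move=> ikn; rewrite /win (_ : (fun w => _) = fun w => \sum_(j < k) e (j + i)%N w); last first.
  apply/funext => w; rewrite -{1}[i]add0n [(0 + i + _)%N]addnC big_addn.
  by rewrite (_ : (k + (0 + i) - i = k)%N) ?big_mkord//; lia.
have jn (j : 'I_k) : (j + i < n)%N by have := ltn_ord j; lia.
have h := @nm_sum _ _ _ P _ (index_enum 'I_k) xpredT (fun j : 'I_k => e (j + i)%N) (fun j _ => (expo_L2 (he (jn j))).1).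
apply: le_trans h _.
apply: le_trans (ler_sum _ (fun j _ => nm_expo (jn j))) _.
by rewrite sumr_const card_ord mulr_natr.
Qed.

(** Summing [psum i] over i <= n - k gives e_j the weight (n - k - j) / (n - j) = 1 - k / (n - j).
    The 1 is the source of the term - e_i, and the rest has harmonic weights. The constant 5 k is 3
    k from the windows plus 2 k from these weights. *)
Lemma log_spacings_linear k : (0 < k <= n)%N -> exists c : R,
  let Y w := \sum_(1 <= i < (n - k).+1) ln (n%:R * (expR (- psum i w) - expR (- psum (i + k) w))) -
    c - \sum_(i < n - k) (ln (win e k i.+1 w) - e i w) in
  L2 P Y /\ norm2 P Y <= 5 * k%:R * harm R n.
Proof.
move=> /andP[k0 kn].
exists (\sum_(1 <= i < (n - k).+1) (ln n%:R - ln (n - i)%:R)) => Y.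
pose Z w := \sum_(1 <= i < (n - k).+1) (n - i - k).+1%:R^-1 * (win e k i w + k%:R) +
  \sum_(0 <= j < n - k) (k%:R / (n - j)%:R) * e j w.
have iP i : (1 <= i < (n - k).+1)%N -> (i + k <= n)%N by lia.
have mY : measurable_fun [set: T] Y.
  apply: measurable_funB; last first.
    apply: measurable_sum => i; apply: measurable_funB => //.
    by apply: measurableT_comp; [exact: measurable_ln|exact: measurable_win].
  apply: measurable_funB => //; apply: measurable_sum => i.
  apply: measurableT_comp; first exact: measurable_ln.
  apply: measurable_funM => //.
  by apply: measurable_funB; apply: measurableT_comp => //; apply: measurableT_comp => //; exact: measurable_psum.
have LW i : (i + k <= n)%N -> L2 P (fun w => (n - i - k).+1%:R^-1 * (win e k i w + k%:R)).
  by move=> ikn; apply: L2Z; apply: L2D; [exact: L2_win|exact: L2_cst].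
have LZ1 : L2 P (fun w => \sum_(1 <= i < (n - k).+1) (n - i - k).+1%:R^-1 * (win e k i w + k%:R)).
  by apply: L2_sum_nat => i /iP; exact: LW.
have LZ2 : L2 P (fun w => \sum_(0 <= j < n - k) (k%:R / (n - j)%:R) * e j w).
  by apply: L2_sum_nat => j /andP[_ jk]; apply: L2Z; apply: (expo_L2 (he _)).1; lia.
have LZ : L2 P Z by exact: L2D.
have YZ : \forall w \ae P, `|Y w| <= Z w.
  have Wpos : \forall w \ae P, forall i, (i + k <= n)%N -> 0 < win e k i w.
    apply/ae_foralln => i; have [ikn|nik] := leqP (i + k) n; last by apply: aeW => w.
    by apply: filterS (win_ae_gt0 he k0 ikn) => w h _.
  apply: filterS Wpos => w Wpos.
  have e0 j : (j < n)%N -> 0 <= e j w by move=> jn; have [_ + _] := he jn; exact.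
  pose a j := if (j < n)%N then e j w else 0.
  have a0 j : 0 <= a j by rewrite /a; case: ifPn => // /e0.
  have aW i : (i + k <= n)%N -> \sum_(i <= j < i + k) a j = win e k i w.
    by move=> ikn; rewrite /win; apply: eq_big_nat => j /andP[_ jk]; rewrite /a (leq_trans jk).
  have aS i : (i <= n)%N -> \sum_(0 <= j < i) a j / (n - j)%:R = psum i w.
    by move=> lin; apply: eq_big_nat => j /andP[_ ji]; rewrite /a (leq_trans ji).
  have err i : (1 <= i < (n - k).+1)%N ->
     `|ln (n%:R * (expR (- psum i w) - expR (- psum (i + k) w))) -
       (ln (win e k i w) - psum i w + (ln n%:R - ln (n - i)%:R))| <=
     (n - i - k).+1%:R^-1 * (win e k i w + k%:R).
    move=> /iP ikn; have := @log_spacing_linear R a n k a0 k0 i ikn.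
    rewrite aW// !aS//; last exact: leq_trans (leq_addr _ _) ikn.
    by rewrite [leRHS]mulrC; apply; exact: Wpos.
  have sS : \sum_(1 <= i < (n - k).+1) psum i w = \sum_(0 <= j < n - k) e j w - \sum_(0 <= j < n - k) (k%:R / (n - j)%:R) * e j w.
    have := @sum_partial_sums R a n (n - k) (leq_subr _ _).
    rewrite (eq_big_nat _ _ (F2 := fun i => psum i w)); last by move=> i /iP ikn; rewrite aS//; lia.
    move=> ->; rewrite -sumrB; apply: eq_big_nat => j /andP[_ jk].
    have jn : (j < n)%N by lia.
    have p0 : (n - j)%:R != 0 :> R by rewrite pnatr_eq0 -lt0n subn_gt0.
    rewrite /a jn (_ : (n - k - j)%:R = (n - j)%:R - k%:R); last by rewrite -natrB; [congr _%:R; lia|lia].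
    by field.
  have -> : Y w = \sum_(1 <= i < (n - k).+1) (ln (n%:R * (expR (- psum i w) - expR (- psum (i + k) w))) -
       (ln (win e k i w) - psum i w + (ln n%:R - ln (n - i)%:R))) +
     \sum_(0 <= j < n - k) (k%:R / (n - j)%:R) * e j w.
    rewrite /Y !sumrB big_split/= sumrB sS sumrB.
    rewrite (_ : \sum_(1 <= i < (n - k).+1) ln (win e k i w) = \sum_(i < n - k) ln (win e k i.+1 w)); last first.
      by rewrite big_add1 big_mkord.
    by rewrite (big_mkord _ (fun j => e j w)); ring.
  apply: le_trans (ler_normD _ _) _; apply: lerD.
    by apply: le_trans (ler_norm_sum _ _ _) _; apply: ler_sum_nat => i /err.
  rewrite ger0_norm//; rewrite big_nat; apply: sumr_ge0 => j /andP[_ jk].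
  by rewrite mulr_ge0// e0; lia.
have [LY nY] := nm_le_ae mY LZ YZ; split => //; apply: le_trans nY _.
apply: le_trans (nmD LZ1 LZ2) _.
have -> : 5 * k%:R * harm R n = 3 * k%:R * harm R n + 2 * k%:R * harm R n by ring.
apply: lerD.
  apply: le_trans (nm_sum_nat (fun i h => LW i (iP i h))) _.
  apply: (@le_trans _ _ (\sum_(1 <= i < (n - k).+1) (3 * k%:R) * (n - k - i).+1%:R^-1)).
    apply: ler_sum_nat => i /iP ikn; rewrite nmZ; last by apply: L2D; [exact: L2_win|exact: L2_cst].
    rewrite ger0_norm ?invr_ge0// [leRHS]mulrC (_ : n - i - k = n - k - i)%N; last by lia.
    rewrite ler_wpM2l ?invr_ge0//; apply: le_trans (nmD (L2_win ikn) (L2_cst P _)) _.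
    by rewrite nm_cst ger0_norm//; have := nm_win ikn; lra.
  rewrite -mulr_sumr ler_wpM2l ?mulr_ge0// big_add1/=.
  apply: le_trans (harm_mono R (leq_subr k n)); rewrite -harm_rev.
  by apply: ler_sum_nat => i /andP[_ ink]; rewrite subnSK.
have jP j : (0 <= j < n - k)%N -> (j < n)%N by lia.
apply: le_trans (nm_sum_nat (fun j h => L2Z _ (expo_L2 (he (jP j h))).1)) _.
apply: (@le_trans _ _ (\sum_(0 <= j < n - k) (2 * k%:R) * (n - j)%:R^-1)).
  apply: ler_sum_nat => j /jP jn; rewrite nmZ; last exact: (expo_L2 (he jn)).1.
  rewrite ger0_norm; last by rewrite divr_ge0.
  have -> : 2 * k%:R / (n - j)%:R = k%:R / (n - j)%:R * 2 :> R by ring.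
  by rewrite ler_wpM2l ?divr_ge0//; exact: nm_expo.
rewrite -mulr_sumr ler_wpM2l ?mulr_ge0// -[leRHS]harm_rev.
by rewrite [leRHS](@big_cat_nat _ _ _ (n - k))//= ?leq_subr// lerDl; apply: sumr_ge0.
Qed.

Section smooth_statistic.
Context (chi chi' : R -> R) (K : R).
Hypothesis sb : smooth_bound chi chi' K.

Let K0 : 0 <= K. Proof. by have [_ h _ _] := sb; exact: le_trans (normr_ge0 _) (h 0). Qed.

(* The coefficient of e_j - 1 in sum_i chi' (E l_i) (l_i - E l_i). *)
Definition renyi_coef j : R :=
  (n - j)%:R^-1 * \sum_(j.+1 <= i < n.+1) chi' (\sum_(0 <= l < i) (n - l)%:R^-1).

(** There are n - j summands of size at most K; for j >= n the convention 0^-1 = 0 gives the value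
    0. *)
Lemma normr_renyi_coef j : `|renyi_coef j| <= K.
Proof.
have [_ _ h _] := sb; rewrite /renyi_coef normrM ger0_norm ?invr_ge0//.
apply: (@le_trans _ _ ((n - j)%:R^-1 * ((n - j)%:R * K))).
  rewrite ler_wpM2l// (le_trans (ler_norm_sum _ _ _))//.
  apply: le_trans (ler_sum _ (fun i _ => h _)) _.
  by rewrite sumr_const_nat subSS mulr_natl.
have [->|p0] := eqVneq ((n - j)%:R : R) 0; first by rewrite invr0 mul0r.
by rewrite mulKf.
Qed.

(** The Taylor error at i is at most K D_i^2 with D_i the centred [psum i]. Its L2 norm is of the
    order of Var D_i <= 2 / (n - i + 1), which sums to a harmonic number. Exchanging the two sums in
    the linear part produces [renyi_coef]. *)
Lemma smooth_statistic_linear : exists c : R,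
  let Y w := \sum_(1 <= i < n.+1) chi (psum i w) - c - \sum_(j < n) renyi_coef j * (e j w - 1) in
  L2 P Y /\ norm2 P Y <= K * (2 * pow4_bound R) * harm R n.
Proof.
have [mchi chiK chi'K chiT] := sb.
pose mu i : R := \sum_(0 <= l < i) (n - l)%:R^-1.
exists (\sum_(1 <= i < n.+1) chi (mu i)) => Y.
pose D i w := \sum_(j < i) (n - j)%:R^-1 * (e j w - 1).
have DE i w : D i w = psum i w - mu i.
  by rewrite /D /psum /mu -sumrB big_mkord; apply: eq_bigr => j _; ring.
have iP i : (1 <= i < n.+1)%N -> (i <= n)%N by lia.
have D4 i : (i <= n)%N -> L2 P (fun w => D i w ^+ 2) /\ norm2 P (fun w => D i w ^+ 2) <= 2 * pow4_bound R * (n - i).+1%:R^-1.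
  move=> lin; have [LD LD4 _ _ ED4] := @pow4_centered_sum (fun j => (n - j)%:R^-1) i lin.
  have X4 (x : R) : x ^+ 4 = (x ^+ 2) ^+ 2 by rewrite -exprM.
  split.
    by split; [exact: measurable_funX LD.1|apply: eq_L1 LD4 => w; rewrite X4].
  have V i' : (i' <= n)%N -> \sum_(j < i') (n - j)%:R^-1 ^+ 2 <= 2 * (n - i').+1%:R^-1 :> R.
    elim: i' => [|i' IH] i'n; first by rewrite big_ord0 mulr_ge0// invr_ge0.
    rewrite big_ord_recr/=; apply: le_trans (lerD (IH (ltnW i'n)) (lexx _)) _.
    rewrite subnSK//; set q : R := (n - i')%:R.
    have q1 : 1 <= q by rewrite /q ler1n; lia.
    rewrite -[(n - i').+1%:R]natr1 -/q -subr_ge0.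
    have -> : 2 * q^-1 - (2 * (q + 1)^-1 + q^-1 ^+ 2) = (q - 1) / (q ^+ 2 * (q + 1)).
      by field; rewrite !gt_eqF//; lra.
    by rewrite divr_ge0// ?mulr_ge0 ?sqr_ge0//; lra.
  have c1 : 1 <= pow4_bound R by have := pow4_bound_ge3 R; lra.
  have V0 : 0 <= \sum_(j < i) (n - j)%:R^-1 ^+ 2 :> R by apply: sumr_ge0 => j _; exact: sqr_ge0.
  apply: (@le_trans _ _ (pow4_bound R * \sum_(j < i) (n - j)%:R^-1 ^+ 2)); last first.
    by rewrite (_ : _ * _ * _ = pow4_bound R * (2 * (n - i).+1%:R^-1)); [rewrite ler_wpM2l// ?V//; lra|ring].
  rewrite -(@ler_pXn2r _ 2) ?nnegrE ?nm_ge0// ?mulr_ge0 ?(le_trans ler01 c1)//.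
  rewrite sqr_nm (@eq_Ex _ _ _ P _ (fun w => D i w ^+ 4)); last by move=> w; rewrite X4.
  apply: le_trans ED4 _; rewrite exprMn ler_wpM2r ?sqr_ge0//.
  by rewrite expr2 ler_peMr//; lra.
have YE w : Y w = \sum_(1 <= i < n.+1) (chi (psum i w) - chi (mu i) - chi' (mu i) * (psum i w - mu i)).
  rewrite /Y !sumrB; congr (_ - _ - _).
  transitivity (\sum_(1 <= i < n.+1) chi' (mu i) * \sum_(0 <= j < i) (n - j)%:R^-1 * (e j w - 1)).
    rewrite sum_weighted_partial_sums big_mkord; apply: eq_bigr => j _; rewrite /renyi_coef /mu; ring.
  by apply: eq_bigr => i _; rewrite -DE /D big_mkord.
pose Z w := \sum_(1 <= i < n.+1) K * D i w ^+ 2.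
have LZ : L2 P Z by apply: L2_sum_nat => i /iP lin; apply: L2Z; exact: (D4 i lin).1.
have YZ w : `|Y w| <= Z w.
  rewrite YE; apply: le_trans (ler_norm_sum _ _ _) _; apply: ler_sum => i _.
  by rewrite DE; exact: chiT.
have mY : measurable_fun [set: T] Y.
  apply: measurable_funB; last by apply: measurable_sum => i; apply: measurable_funM => //; exact: measurable_funB.
  apply: measurable_funB => //; apply: measurable_sum => i.
  by apply: measurableT_comp => //; exact: measurable_psum.
have LY : L2 P Y := L2_le mY YZ LZ.
split => //; apply: le_trans (nm_le LY LZ YZ) _.
apply: le_trans (nm_sum_nat (fun i h => L2Z K (D4 i (iP i h)).1)) _.
apply: (@le_trans _ _ (\sum_(1 <= i < n.+1) (K * (2 * pow4_bound R)) * (n - i).+1%:R^-1)).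
  apply: ler_sum_nat => i /iP lin; rewrite nmZ; last exact: (D4 i lin).1.
  by rewrite (ger0_norm K0) -mulrA ler_wpM2l//; exact: (D4 i lin).2.
have c0 : 0 <= pow4_bound R by have := pow4_bound_ge3 R; lra.
rewrite -mulr_sumr ler_wpM2l ?mulr_ge0// big_add1/=.
rewrite -harm_rev; apply: ler_sum_nat => i /andP[_ ink]; by rewrite subnSK.
Qed.

End smooth_statistic.

End exponential_sums.

(** * Variance of the linear statistic *)

Section toeplitz.
Context (R : realType) (gam : nat -> R) (k : nat) (c : R).
Hypotheses (gam0 : forall r, (k <= r)%N -> gam r = 0) (gamc : forall r, `|gam r| <= c) (k0 : (0 < k)%N).

Let Q N := \sum_(i < N) \sum_(j < N) gam (i - j + (j - i))%N.

(** With truncated subtraction, i - j + (j - i) is |i - j|. From N = k on, one more row and column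
    add exactly the coefficient of N, so the error is the one at N = k: k^2 c from the double sum
    and 2 k^2 c from the linear term. *)
Lemma toeplitz_sum N : (k <= N)%N ->
  `|\sum_(i < N) \sum_(j < N) gam (i - j + (j - i))%N - N%:R * (gam 0%N + 2 * \sum_(1 <= r < k) gam r)|
  <= 3 * k%:R ^+ 2 * c.
Proof.
rewrite -/(Q N); set g := gam 0%N + _.
have QS M : (k <= M.+1)%N -> Q M.+1 = Q M + g.
  move=> kM; rewrite /Q big_ord_recr/=.
  under eq_bigr do rewrite big_ord_recr/=.
  rewrite big_split/= -addrA; congr (_ + _).
  rewrite big_ord_recr/= subnn addn0.
  rewrite (eq_bigr (fun i : 'I_M => gam (M - i)%N)); last first.
    by move=> i _; rewrite (_ : i - M = 0)%N ?add0n//; have := ltn_ord i; lia.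
  rewrite [X in _ + (X + _)](eq_bigr (fun i : 'I_M => gam (M - i)%N)); last first.
    by move=> i _; rewrite (_ : i - M = 0)%N ?addn0//; have := ltn_ord i; lia.
  have -> : \sum_(i < M) gam (M - i)%N = \sum_(1 <= r < k) gam r.
    rewrite -(big_mkord xpredT (fun i => gam (M - i)%N)) big_nat_rev/= add0n.
    rewrite (eq_big_nat _ _ (F2 := fun i => gam i.+1)) => [|i /andP[_ iM]]; last by rewrite subKn.
    rewrite -(big_add1 _ _ 0 M.+1 xpredT gam) (@big_cat_nat _ _ _ k)//=.
    by rewrite [X in _ + X]big1_seq ?addr0// => i; rewrite mem_index_iota => /andP[_ /andP[/gam0]].
  by rewrite /g; ring.
have c0 : 0 <= c := le_trans (normr_ge0 _) (gamc 0%N).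
have Qk M : `|Q M| <= M%:R ^+ 2 * c.
  apply: le_trans (ler_norm_sum _ _ _) _.
  apply: (@le_trans _ _ (\sum_(i < M) M%:R * c)).
    apply: ler_sum => i _; apply: le_trans (ler_norm_sum _ _ _) _.
    apply: le_trans (ler_sum _ (fun j _ => gamc _)) _.
    by rewrite sumr_const card_ord -[leLHS]mulr_natl.
  by rewrite sumr_const card_ord -[leLHS]mulr_natl mulrA expr2.
have gb : `|g| <= 2 * k%:R * c.
  apply: le_trans (ler_normD _ _) _; rewrite normrM (ger0_norm (ler0n _ 2)).
  have h : `|\sum_(1 <= r < k) gam r| <= (k%:R - 1) * c.
    apply: le_trans (ler_norm_sum _ _ _) _; apply: le_trans (ler_sum _ (fun j _ => gamc _)) _.
    by rewrite sumr_const_nat -[leLHS]mulr_natl natrB.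
  have := gamc 0%N; rewrite (_ : 2 * k%:R * c = c + 2 * ((k%:R - 1) * c) + c); last by ring.
  lra.
move=> kN; rewrite -(subnK kN); elim: (N - k)%N => [|m IH]; last first.
  rewrite addSn QS; last by lia.
  by rewrite -natr1 (_ : Q _ + g - _ = Q (m + k)%N - (m + k)%:R * g)//; ring.
rewrite add0n; apply: le_trans (ler_normB _ _) _; rewrite normrM ger0_norm//.
have := ler_wpM2l (ler0n R k) gb; have := Qk k.
rewrite (_ : k%:R * (2 * k%:R * c) = 2 * (k%:R ^+ 2 * c)); last by ring.
lra.
Qed.

End toeplitz.

Section truncation.
Context (R : realType).

Definition truncate (A x : R) : R := Num.max (- A) (Num.min x A).

Lemma measurable_truncate (A : R) : measurable_fun [set: R] (truncate A).
Proof. by apply: measurable_maxr => //; exact: measurable_minr. Qed.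

Lemma normr_truncate (A x : R) : 0 <= A -> `|truncate A x| <= A.
Proof. by move=> A0; rewrite ler_norml /truncate le_max lexx/= ge_max ge_min lexx orbT andbT; lra. Qed.

(** The difference vanishes unless |x| > A; then it is at most |x|, while x^2 / A^2 >= 1. *)
Lemma sqr_truncateB (A x : R) : 0 < A -> (x - truncate A x) ^+ 2 <= x ^+ 4 / A ^+ 2.
Proof.
move=> A0; rewrite ler_pdivlMr ?exprn_gt0//.
have [xA|xA] := lerP x A; last first.
  rewrite /truncate (min_idPr (ltW xA)) (max_idPr _); last by lra.
  by rewrite -exprMn (_ : x ^+ 4 = (x ^+ 2) ^+ 2) ?ler_pXn2r ?nnegrE ?sqr_ge0 -?exprM//; nra.
rewrite /truncate (min_idPl xA).
have [Ax|Ax] := lerP (- A) x; first by rewrite subrr expr0n mul0r (_ : 4 = 2 * 2)%N// exprM sqr_ge0.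
have -> : (x - - A) ^+ 2 * A ^+ 2 = (- (x + A) * A) ^+ 2 by ring.
have -> : x ^+ 4 = (x ^+ 2) ^+ 2 by rewrite -exprM.
rewrite ler_pXn2r ?nnegrE ?sqr_ge0//; nra.
Qed.

End truncation.

Section linear_statistic.
Context d (T : measurableType d) (R : realType) (P : probability T R).
Variables (n k : nat) (e : nat -> T -> R).
Hypothesis me : forall i, measurable_fun [set: T] (e i).
Hypothesis ie : indep P n e.
Hypothesis he : forall i, (i < n)%N -> expo P (e i).
Hypotheses (k0 : (0 < k)%N) (kn : (2 * k <= n)%N).

Local Notation G i := (fun w => ln (win e k i w)).
Local Notation y i := (fun w => e i w - 1).

Let LG i : (i + k <= n)%N -> L2 P (G i).
Proof. by move=> ikn; apply: (L2_ln_win he k0 ikn); exact: measurable_win. Qed.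

Let Ly i : (i < n)%N -> L2 P (y i).
Proof. exact: L2_expoB1. Qed.

Let sG i : sgm e [set j | (i <= j < i + k)%N] (G i).
Proof.
have h := @sg_win _ _ _ e k k0 i; apply: measurableT_comp; [exact: measurable_ln|exact: h].
Qed.

Let sy i : sgm e [set i] (y i).
Proof. by apply: measurable_funB; [exact: sg_coord|exact: measurable_cst]. Qed.

Let Var_G i : (i + k <= n)%N -> Var P (G i) <= ln_win_pow4_bound R k + 1.
Proof.
move=> ikn; have L := LG ikn; apply: le_trans (Var_le L) _.
have [l4 e4] := ln_win_pow4 he k0 ikn (measurable_win me k i).
have h := ExD l4 (L1_cst P 1); rewrite Ex_cst in h.
apply: (@le_trans _ _ (Ex P (fun w => ln (win e k i w) ^+ 4) + 1)); last by rewrite lerD2r.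
rewrite -h; apply: Ex_le => [||w]; [exact: L.2|exact: L1D l4 (L1_cst P 1)|].
have X4 (x : R) : x ^+ 4 = (x ^+ 2) ^+ 2 by rewrite -exprM.
by rewrite X4; have := sqr_ge0 (ln (win e k i w) ^+ 2 - 1); move: (_ ^+ 2) (sqr_ge0 (ln (win e k i w))) => t t0; nra.
Qed.

(** Stationarity: the covariance is the sum of a series that depends only on the distance of the
    windows, and windows at distance k or more are independent. *)
Let cov_GG i j : (i + k <= n)%N -> (j + k <= n)%N -> Cov P (G i) (G j) =
  if (i - j + (j - i) < k)%N then Cov P (G 0%N) (G (i - j + (j - i))%N) else 0.
Proof.
wlog : i j / (i <= j)%N => [H|ij] ikn jkn.
  have [ij|/ltnW ji] := leqP i j; first exact: H.
  by rewrite CovC [in RHS]addnC; exact: H.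
rewrite (_ : i - j + (j - i) = j - i)%N; last by lia.
case: ltnP => [r|r]; last first.
  apply: (Cov_indep me ie (I := [set l | (i <= l < i + k)%N]) (J := [set l | (j <= l < j + k)%N])) => //; try exact: LG.
  - by move=> l /= /andP[_ lk]; rewrite (leq_trans lk).
  - by move=> l /= /andP[_ lk]; rewrite (leq_trans lk).
  - by apply/seteqP; split => // l /= []; lia.
have h1 := @Cov_ln_win _ _ _ P n e me ie he k k0 LG i (j - i).
have h2 := @Cov_ln_win _ _ _ P n e me ie he k k0 LG 0 (j - i).
rewrite subnKC// in h1; rewrite add0n in h2.
have c1 := h1 jkn r; have c2 := h2 (ltac:(lia)) r.
by rewrite -(cvg_lim (@Rhausdorff R) c1) -(cvg_lim (@Rhausdorff R) c2).
Qed.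

(** The covariance matrix is a banded Toeplitz matrix, in which lag r corresponds to an overlap of k
    - r in [sum_cov_tau]. *)
Lemma Var_sum_ln_win N : (N + k <= n)%N -> (k <= N)%N ->
  `|Var P (fun w => \sum_(i < N) ln (win e k i.+1 w)) - N%:R * (tau R k + 1)| <= 3 * k%:R ^+ 2 * (ln_win_pow4_bound R k + 1).
Proof.
move=> Nkn kN.
pose gam r := if (r < k)%N then Cov P (G 0%N) (G r) else 0.
have iN (i : 'I_N) : (i.+1 + k <= n)%N by have := ltn_ord i; lia.
have LS : L2 P (fun w => \sum_(i < N) ln (win e k i.+1 w)) by apply: L2_sum => i _; exact: LG.
have -> : Var P (fun w => \sum_(i < N) ln (win e k i.+1 w)) = \sum_(i < N) \sum_(j < N) gam (i - j + (j - i))%N.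
  rewrite /Var (@Cov_suml _ _ _ P _ _ _ (fun (i : 'I_N) => G i.+1) _ (fun i _ => LG (iN i)) LS).
  apply: eq_bigr => i _.
  rewrite (@Cov_sumr _ _ _ P _ _ _ (fun (i : 'I_N) => G i.+1) _ (fun i _ => LG (iN i)) (LG (iN i))).
  by apply: eq_bigr => j _; rewrite cov_GG// !subSS /gam.
have <- : gam 0%N + 2 * \sum_(1 <= r < k) gam r = tau R k + 1.
  rewrite -(@sum_cov_tau R k (fun s => gam (k - s)%N) k0); last first.
    move=> s /andP[s0 sk].
    have h := @Cov_ln_win _ _ _ P n e me ie he k k0 LG 0 (k - s).
    rewrite add0n subKn// in h; rewrite /gam; have -> : (k - s < k)%N by lia.
    by apply: h; lia.
  rewrite subnn; congr (_ + _ * _); rewrite big_nat_rev/=; apply: eq_big_nat => i /andP[i1 ik].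
  by congr gam; lia.
apply: toeplitz_sum => // r; first by rewrite /gam ltnNge => ->.
rewrite /gam; case: ifP => rk; last first.
  by rewrite normr0 addr_ge0// /ln_win_pow4_bound mulr_ge0// mulr_ge0// mulr_ge0.
by apply: normr_Cov_le; try apply: LG; try apply: Var_G; lia.
Qed.

Let cov_Gy i j : (i + k <= n)%N -> (j < n)%N -> Cov P (G i) (y j) = (i <= j < i + k)%N%:R / k%:R.
Proof.
move=> ikn jn; have Le : L2 P (e j) := (expo_L2 (he jn)).1.
have -> : Cov P (G i) (y j) = Cov P (G i) (e j).
  have h := CovBr Le (L2_cst P 1) (LG ikn); rewrite h [X in _ - X]CovC Cov_cstl ?subr0//; exact: LG.
case: (boolP (i <= j < i + k)%N) => [ij|nij]; first by rewrite (Cov_ln_win_coord me ie he k0 LG)// mul1r.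
rewrite mul0r; apply: (Cov_indep me ie (I := [set l | (i <= l < i + k)%N]) (J := [set j])) => //; try exact: LG.
- by move=> l /= /andP[_ lk]; rewrite (leq_trans lk).
- by move=> l /= ->.
- by apply/seteqP; split => // l /= [h lj]; rewrite lj in h; rewrite h in nij.
- exact: sg_coord.
Qed.

Variables (b : nat -> R) (K : R).
Hypothesis bK : forall j, `|b j| <= K.

(** The - 1 beside b_i comes from the term - e_i of [log_spacings_linear]. The window starts at i +
    1, so the whole depends on e_i, ..., e_(i+k). *)
Definition linear_term i w : R := ln (win e k i.+1 w) + (b i - 1) * (e i w - 1).

Let K0 : 0 <= K. Proof. exact: le_trans (normr_ge0 _) (bK 0%N). Qed.

Let b1 j : `|b j - 1| <= K + 1.
Proof. by apply: le_trans (ler_normB _ _) _; rewrite normr1 lerD2r. Qed.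

Lemma L2_linear_term i : (i + k < n)%N -> L2 P (linear_term i).
Proof. by move=> ikn; apply: L2D; [apply: LG; lia|apply/L2Z/Ly; lia]. Qed.

Lemma sg_linear_term i : sgm e [set j | (i <= j <= i + k)%N] (linear_term i).
Proof.
have s1 : [set j | (i.+1 <= j < i.+1 + k)%N] `<=` [set j | (i <= j <= i + k)%N] by move=> j /=; lia.
have s2 : [set i] `<=` [set j | (i <= j <= i + k)%N] by move=> j /= ->; lia.
have m1 : sgm e [set j | (i <= j <= i + k)%N] (G i.+1) := sg_mfS s1 (@sG i.+1).
have m2 : sgm e [set j | (i <= j <= i + k)%N] (y i) := sg_mfS s2 (@sy i).
by apply: measurable_funD => //; apply: measurable_funM => //; exact: measurable_cst.
Qed.

Lemma linear_term_pow4 i : (i + k < n)%N -> L1 P (fun w => linear_term i w ^+ 4) /\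
  Ex P (fun w => linear_term i w ^+ 4) <= 8 * (ln_win_pow4_bound R k + (K + 1) ^+ 4 * pow4_bound R).
Proof.
move=> ikn; have ikn' : (i.+1 + k <= n)%N by lia.
have [l4 e4] := ln_win_pow4 he k0 ikn' (measurable_win me k i.+1).
have [ly4 ey4] := expoB1_pow4 me he (ltac:(lia) : (i < n)%N).
have hz := L1Z ((b i - 1) ^+ 4) ly4.
have hD := L1Z 8 (L1D l4 hz).
have bd w : linear_term i w ^+ 4 <= 8 * (ln (win e k i.+1 w) ^+ 4 + (b i - 1) ^+ 4 * (e i w - 1) ^+ 4).
  by rewrite -exprMn; exact: pow4D_le.
have p4 (x : R) : 0 <= x ^+ 4 by rewrite (_ : 4 = 2 * 2)%N// exprM sqr_ge0.
have l : L1 P (fun w => linear_term i w ^+ 4).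
  apply: (L1_le _ _ hD) => [|w]; last by rewrite ger0_norm.
  by apply: measurable_funX; exact: (L2_linear_term ikn).1.
split => //; apply: le_trans (Ex_le l hD bd) _.
have h := ExD l4 hz; rewrite ExZ ?h; last exact: L1D.
rewrite ler_wpM2l// lerD// ExZ// ler_pM//; first exact: Ex_ge0.
rewrite (_ : 4 = 2 * 2)%N// !exprM ler_pXn2r ?nnegrE ?sqr_ge0// -[leLHS]real_normK ?num_real//.
by rewrite ler_pXn2r ?nnegrE// addr_ge0.
Qed.

(** For j >= k the logarithms together have covariance 1 with e_j. Such an index contributes tau_k +
    1 + 2 (b_j - 1) + (b_j - 1)^2 = tau_k + b_j^2. The bound collects the error of the Toeplitz sum,
    the indices j < k, and the last k indices. *)
Lemma Var_linear_sum : `|Var P (fun w => \sum_(i < n - k) linear_term i w) - (n%:R * tau R k + \sum_(j < n) b j ^+ 2)| <=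
   3 * k%:R ^+ 2 * (ln_win_pow4_bound R k + 1) + 2 * k%:R * (K + 1) + k%:R * K ^+ 2 + k%:R * `|tau R k|.
Proof.
pose N := (n - k)%N; rewrite -/N.
have nE : n = (N + k)%N by rewrite /N; lia.
have kN : (k <= N)%N by rewrite /N; lia.
have NN (i : 'I_N) : (i + k < n)%N by have := ltn_ord i; rewrite nE; lia.
have LGi (i : 'I_N) : L2 P (G i.+1) by apply: LG; have := NN i; lia.
have Lyi (i : 'I_N) : L2 P (y i) by apply: Ly; have := NN i; lia.
pose M w := \sum_(i < N) ln (win e k i.+1 w).
pose B w := \sum_(j < N) (b j - 1) * (e j w - 1).
have LM : L2 P M by apply: L2_sum => i _; exact: LGi.
have Lby (j : 'I_N) : L2 P (fun w => (b j - 1) * (e j w - 1)) by exact: L2Z.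
have LB : L2 P B by apply: L2_sum => i _.
have TE w : \sum_(i < N) linear_term i w = M w + B w by rewrite -big_split.
have VB : Var P B = \sum_(j < N) (b j - 1) ^+ 2.
  have [] := @pow4_centered_sum _ _ _ P n e me ie he (fun j => b j - 1) N; first by rewrite nE leq_addr.
  by move=> _ _ E1 E2 _; rewrite VarE//; rewrite -E2; apply: eq_Ex => w; rewrite E1 subr0.
(* The windows containing j start at i + 1 with j - k <= i < j: there are [minn j k] of them. *)
have CMB : Cov P M B = \sum_(j < N) (b j - 1) * ((minn j k)%:R / k%:R).
  rewrite (@Cov_sumr _ _ _ P _ _ _ (fun (j : 'I_N) w => (b j - 1) * (e j w - 1)) _ (fun i _ => Lby i) LM).
  apply: eq_bigr => j _; rewrite CovZr//; congr (_ * _).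
  rewrite (@Cov_suml _ _ _ P _ _ _ (fun (i : 'I_N) => G i.+1) _ (fun i _ => LGi i) (Lyi j)).
  rewrite (eq_bigr (fun i : 'I_N => (i < j <= i + k)%N%:R / k%:R)); last first.
    move=> i _; rewrite cov_Gy; [|have := NN i; lia|have := NN j; lia].
    by congr (_%:R / _); congr nat_of_bool; lia.
  rewrite -mulr_suml; congr (_ / _).
  rewrite -(big_mkord xpredT (fun i => (i < j <= i + k)%N%:R)) (@big_cat_nat _ _ _ (j - k))//=; last by have := ltn_ord j; lia.
  rewrite big_nat big1 ?add0r; last by move=> i ik; rewrite (_ : (_ && _) = false)//; lia.
  rewrite (@big_cat_nat _ _ _ j)//=; [|by lia|by have := ltn_ord j; lia].
  rewrite [X in _ + X]big_nat [X in _ + X]big1 ?addr0; last by move=> i ik; rewrite (_ : (_ && _) = false)//; lia.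
  rewrite (eq_big_nat _ _ (F2 := fun=> 1)); last by move=> i ik; rewrite (_ : (_ && _) = true)//; lia.
  by rewrite sumr_const_nat; congr _%:R; lia.
have VT : Var P (fun w => \sum_(i < N) linear_term i w) = Var P M + 2 * Cov P M B + Var P B.
  rewrite (_ : (fun w => _) = fun w => M w + B w); last exact/funext.
  rewrite /Var CovDl ?CovDr//; [|exact: L2D]. by rewrite [Cov P B M]CovC; ring.
have NE : \sum_(j < N) (1 : R) = N%:R by rewrite sumr_const card_ord.
have key : 2 * Cov P M B + Var P B = \sum_(j < N) b j ^+ 2 - N%:R - 2 * \sum_(j < N) (b j - 1) * (1 - (minn j k)%:R / k%:R).
  have e1 : \sum_(j < N) (b j - 1) * (1 - (minn j k)%:R / k%:R) =
      \sum_(j < N) (b j - 1) - \sum_(j < N) (b j - 1) * ((minn j k)%:R / k%:R).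
    by rewrite -sumrB; apply: eq_bigr => j _; rewrite mulrBr mulr1.
  have e2 : \sum_(j < N) b j ^+ 2 = \sum_(j < N) (b j - 1) ^+ 2 + 2 * \sum_(j < N) (b j - 1) + N%:R.
    by rewrite -NE mulr_sumr -!big_split/=; apply: eq_bigr => j _; ring.
  rewrite CMB VB e1 e2; ring.
have r0 : `|\sum_(j < N) (b j - 1) * (1 - (minn j k)%:R / k%:R)| <= k%:R * (K + 1).
  rewrite -(big_mkord xpredT (fun j => (b j - 1) * (1 - (minn j k)%:R / k%:R))) (@big_cat_nat _ _ _ k)//=.
  rewrite [X in _ + X]big_nat [X in _ + X]big1 ?addr0; last first.
    by move=> j /andP[kj _]; rewrite (minn_idPr kj) divff ?subrr ?mulr0// pnatr_eq0 -lt0n.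
  apply: le_trans (ler_norm_sum _ _ _) _.
  apply: (@le_trans _ _ (\sum_(0 <= j < k) (K + 1))); last by rewrite sumr_const_nat subn0 -[leLHS]mulr_natl.
  apply: ler_sum => j _; rewrite normrM -[leRHS]mulr1 ler_pM//.
  have kk : 0 < k%:R :> R by rewrite ltr0n.
  rewrite ger0_norm; first by rewrite gerBl divr_ge0.
  by rewrite subr_ge0 ler_pdivrMr// mul1r ler_nat geq_minr.
have bb : \sum_(j < n) b j ^+ 2 = \sum_(j < N) b j ^+ 2 + \sum_(N <= j < n) b j ^+ 2.
  by rewrite -!(big_mkord xpredT (fun j => b j ^+ 2)) (@big_cat_nat _ _ _ N 0 n)//= nE leq_addr.
have bk : 0 <= \sum_(N <= j < n) b j ^+ 2 <= k%:R * K ^+ 2.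
  rewrite sumr_ge0/=; last by move=> j _; exact: sqr_ge0.
  apply: (@le_trans _ _ (\sum_(N <= j < n) K ^+ 2)).
    by apply: ler_sum => j _; rewrite -[leLHS]real_normK ?num_real// ler_pXn2r ?nnegrE.
  by rewrite sumr_const_nat -[leLHS]mulr_natl {1}nE addKn.
have := Var_sum_ln_win (N := N) (ltac:(by rewrite -nE) : (N + k <= n)%N) kN.
rewrite -/M VT bb -[Var P M + _ + _]addrA key.
have -> : n%:R = N%:R + k%:R :> R by rewrite nE natrD.
move: r0 bk; set r := \sum_(j < N) _ * _; set s := \sum_(N <= j < n) _; set q := \sum_(j < N) _.
move: (Var P M) => v r0 /andP[s0 s1] h.
rewrite (_ : v + _ - _ = (v - N%:R * (tau R k + 1)) - 2 * r - s - k%:R * tau R k); last by ring.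
apply: le_trans (ler_normB _ _) _; rewrite normrM (ger0_norm (ler0n _ k)); apply: lerD => //.
apply: le_trans (ler_normB _ _) _; rewrite (ger0_norm s0); apply: lerD => //.
apply: le_trans (ler_normB _ _) _; rewrite normrM (ger0_norm (ler0n _ 2)) -[X in _ <= _ + X]mulrA; apply: lerD => //.
by rewrite ler_wpM2l.
Qed.

(** Terms more than k apart are independent, and truncating a term x at A costs at most E x^4 / A^2,
    uniformly in n. *)
Lemma Var_truncated_sum (A : R) : 0 < A ->
  Var P (fun w => \sum_(i < n - k) (linear_term i w - truncate A (linear_term i w))) <=
  n%:R * ((2 * k + 1)%:R * (8 * (ln_win_pow4_bound R k + (K + 1) ^+ 4 * pow4_bound R) / A ^+ 2)).
Proof.
move=> A0; set c := _ / A ^+ 2.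
have LU i : (i < n - k)%N -> L2 P (linear_term i) by move=> ink; apply: L2_linear_term; lia.
have LV i : (i < n - k)%N -> L2 P (fun w => linear_term i w - truncate A (linear_term i w)).
  move=> /LU L; apply: L2B => //; apply: (@L2_bounded _ _ _ P A) => [|w].
    exact: measurableT_comp (measurable_truncate A) L.1.
  by apply: normr_truncate; exact: ltW.
have c0 : 0 <= c.
  have h := pow4_bound_ge3 R; have l0 : 0 <= ln_win_pow4_bound R k by rewrite /ln_win_pow4_bound mulr_ge0// mulr_ge0// mulr_ge0.
  rewrite /c divr_ge0 ?sqr_ge0// mulr_ge0// addr_ge0// mulr_ge0//; last by lra.
  by rewrite (_ : 4 = 2 * 2)%N// exprM sqr_ge0.
apply: (@le_trans _ _ ((n - k)%:R * ((2 * k + 1)%:R * c))); last first.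
  by apply: ler_wpM2r; [exact: mulr_ge0|rewrite ler_nat leq_subr].
apply: (@Var_sum_dependent _ _ _ P n e me ie (n - k) k (fun i => [set j | (i <= j <= i + k)%N])
  (fun i w => linear_term i w - truncate A (linear_term i w))) => //.
- by move=> i ink j /=; lia.
- by move=> i j ikj jn; apply/seteqP; split => // l /= []; lia.
- move=> i ink; have s := @sg_linear_term i; apply: measurable_funB => //.
  exact: (measurableT_comp (measurable_truncate A) s).
- move=> i ink; apply: le_trans (Var_le (LV i ink)) _.
  have [l4 e4] := linear_term_pow4 (ltac:(lia) : (i + k < n)%N).
  apply: (@le_trans _ _ (Ex P (fun w => (A ^+ 2)^-1 * linear_term i w ^+ 4))).
    apply: Ex_le => [||w]; [exact: (LV i ink).2|exact: L1Z|].
    by rewrite mulrC; exact: sqr_truncateB.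
  by rewrite ExZ// mulrC /c ler_wpM2r// invr_ge0 sqr_ge0.
Qed.

End linear_statistic.

(** * The limit theorem *)

Section standard_deviation.
Context d (T : measurableType d) (R : realType) (P : probability T R).

Lemma eq_Cov (Y Y' Z Z' : T -> R) : Y =1 Y' -> Z =1 Z' -> Cov P Y Z = Cov P Y' Z'.
Proof. by move=> /funext -> /funext ->. Qed.

Lemma eq_sd (Y Y' : T -> R) : Y =1 Y' -> sd P Y = sd P Y'.
Proof. by move=> /funext ->. Qed.

Lemma sdN (Y : T -> R) : L2 P Y -> sd P (fun w => - Y w) = sd P Y.
Proof. by move=> LY; rewrite /sd /Var CovNl ?[Cov P Y _]CovC ?CovNl ?opprK//; exact: L2N. Qed.

Lemma sdB (Y Z : T -> R) : L2 P Y -> L2 P Z -> `|sd P Y - sd P Z| <= sd P (fun w => Y w - Z w).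
Proof.
move=> LY LZ; have LB := L2B LY LZ; have LB' := L2B LZ LY.
have e1 := sdD LB LZ; have e2 := sdD LB' LY.
rewrite (@eq_sd _ Y) in e1 => [|w]; last by rewrite subrK.
rewrite (@eq_sd _ Z) in e2 => [|w]; last by rewrite subrK.
have e3 := sdN LB; rewrite (@eq_sd _ (fun w => Z w - Y w)) in e3 => [|w]; last by rewrite opprB.
by rewrite ler_norml; lra.
Qed.

Lemma sd_shift (Y : T -> R) (c : R) : L2 P Y -> sd P (fun w => Y w + c) = sd P Y.
Proof. by move=> LY; rewrite /sd VarD_cst. Qed.

Lemma sd_ae (Y Z : T -> R) : measurable_fun [set: T] Y -> L2 P Z -> (\forall w \ae P, Y w = Z w) ->
  L2 P Y /\ sd P Y = sd P Z.
Proof.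
move=> mY LZ YZ; have LY := L2_ae mY LZ.1 YZ LZ; split => //.
have h1 : Ex P Y = Ex P Z := Ex_ae mY LZ.1 YZ.
have h2 : Ex P (fun w => Y w * Y w) = Ex P (fun w => Z w * Z w).
  apply: Ex_ae; [exact: measurable_funM|apply: measurable_funM; exact: LZ.1|].
  by apply: filterS YZ => w ->.
by rewrite /sd /Var /Cov h1 h2.
Qed.

End standard_deviation.

(** * The statistic as a function of the normalized gaps *)

Section sample_statistics.
Context (R : realType) (f g : R -> R).
Hypotheses (hf : unit_interval_density f) (hg : unit_interval_density g).
Context d (T : measurableType d) (P : probability T R) (Y : nat -> T -> R).
Hypothesis mY : forall i, measurable_fun [set: T] (Y i).
Hypothesis Y01 : forall i w, 0 < Y i w < 1.
Hypothesis lawY : forall i (A : set R), measurable A ->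
  (P (Y i @^-1` A) = \int[lebesgue_measure]_(x in A) (f x)%:E)%E.
Hypothesis iY : forall m, indep P m Y.

Lemma Var_sum_iid (h : R -> R) (C : R) (n : nat) : measurable_fun [set: R] h ->
  (forall x, 0 < x < 1 -> `|h x| <= C) ->
  Var P (fun w => \sum_(1 <= j < n.+1) h (Y j w)) = n%:R * Var P (fun w => h (Y 0%N w)).
Proof.
move=> mh hC.
have L i : L2 P (fun w => h (Y i w)).
  by apply: (@L2_bounded _ _ _ P C) => [|w]; [exact: measurableT_comp|exact: hC].
have E1 i : Ex P (fun w => h (Y i w)) = Ex P (fun w => h (Y 0%N w)).
  (* [law_Ex] asks for a nonnegative function, hence the shift by C; the maximum is inactive on ]0,
     1[. *)
  pose h' x := Num.max (h x + C) 0.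
  have h'E j : Ex P (fun w => h' (Y j w)) = Ex P (fun w => h (Y j w)) + C.
    have e1 := ExD (L2_L1 (L j)) (L1_cst P C); rewrite Ex_cst in e1; rewrite -e1.
    apply: eq_Ex => w; rewrite /h' (max_idPl _)//.
    by have := hC _ (Y01 j w); rewrite ler_norml; lra.
  apply: (addIr C); rewrite -!h'E; apply: (law_Ex hf mY lawY).
    by apply: measurable_maxr => //; exact: measurable_funD.
  by move=> x; rewrite le_max lexx orbT.
have V i : Var P (fun w => h (Y i w)) = Var P (fun w => h (Y 0%N w)).
  rewrite /Var /Cov E1; congr (_ - _); apply: (@law_Ex _ _ hf _ _ _ _ mY lawY i 0%N (fun x => h x * h x)).
    exact: measurable_funM.
  by move=> x; rewrite -expr2 sqr_ge0.
rewrite (_ : (fun w => _) = fun w => \sum_(j < n) h (Y j.+1 w)); last first.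
  by apply/funext => w; rewrite big_add1 big_mkord.
have LS : L2 P (fun w => \sum_(j < n) h (Y j.+1 w)) by apply: L2_sum => j _; exact: L.
rewrite /Var (@Cov_suml _ _ _ P _ _ _ (fun (i : 'I_n) w => h (Y i.+1 w)) _ (fun i _ => L i.+1) LS).
rewrite (eq_bigr (fun=> Var P (fun w => h (Y 0%N w)))); first by rewrite sumr_const card_ord [RHS]mulr_natl.
move=> i _; rewrite (@Cov_sumr _ _ _ P _ _ _ (fun (j : 'I_n) w => h (Y j.+1 w)) _ (fun j _ => L j.+1) (L i.+1)).
rewrite (bigD1 i)//= big1 ?addr0; first exact: V.
move=> j ji; apply: (@Cov_indep _ _ _ P n (fun i => Y i.+1) (fun i => mY i.+1) (indep_shift iY n) [set nat_of_ord i] [set nat_of_ord j]) => //.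
- by move=> _ /= ->.
- by move=> _ /= ->.
- by apply/seteqP; split => // l /= [-> e]; move/eqP: ji; apply; apply/val_inj.
- by apply: (measurableT_comp mh); exact: (@sg_coord _ _ _ (fun i => Y i.+1)).
- by apply: (measurableT_comp mh); exact: (@sg_coord _ _ _ (fun i => Y i.+1)).
Qed.

Let ell_mono i j w : Y i w < Y j w -> cum_hazard f (Y i w) < cum_hazard f (Y j w).
Proof. exact: ellf_lt. Qed.

Let ell_expo i : expo P (fun w => cum_hazard f (Y i w)).
Proof. exact: (expo_ellf hf (mY i) (Y01 i) (@lawY i)). Qed.

Let ell_indep m : indep P m (fun i w => cum_hazard f (Y i w)).
Proof.
move=> A mA; have mE i : measurable (cum_hazard f @^-1` A i).
  by rewrite -[_ @^-1` _]setTI; exact: measurable_ellf.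
exact: (@iY m (fun i => cum_hazard f @^-1` A i) mE).
Qed.

Let m_ell : measurable_fun [set: R] (cum_hazard f) := measurable_ellf hf.

Section fixed_size.
Variables (n k : nat).
Hypotheses (k0 : (0 < k)%N) (kn : (2 * k <= n)%N).

Definition renyi : nat -> T -> R := normalized_gap n Y (cum_hazard f).

Definition sorted_sample w : seq R := sort <=%R [seq Y j w | j <- iota 1 n].

Local Notation srt := sorted_sample.

Let size_srt w : size (srt w) = n.
Proof. by rewrite size_sort size_map size_iota. Qed.

Let sorted_srt w : sorted <=%R (srt w).
Proof. by apply: sort_sorted; exact: le_total. Qed.

Let srt01 w i : (i < n)%N -> 0 < (srt w)`_i < 1.
Proof.
move=> lin; have : (srt w)`_i \in srt w by rewrite mem_nth ?size_srt.
by rewrite mem_sort => /mapP[j _ ->].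
Qed.

Lemma renyi_measurable i : measurable_fun [set: T] (renyi i).
Proof. exact: measurable_egap. Qed.

Lemma renyi_exponential i : (i < n)%N -> expo P (renyi i).
Proof. exact: (renyi_expo mY m_ell ell_mono (fun j _ => ell_expo j) (@ell_indep n.+1)). Qed.

Lemma renyi_independent : indep P n renyi.
Proof. exact: (renyi_indep mY m_ell ell_mono (fun j _ => ell_expo j) (@ell_indep n.+1)). Qed.

Let psum_lam i w : (i <= n)%N -> psum n renyi i w = lam n Y (cum_hazard f) i w.
Proof.
elim: i => [|i IH] lin; first by rewrite /psum big_geq.
rewrite /psum big_nat_recr//= -/(psum n renyi i w) IH ?(ltnW lin)// /renyi /normalized_gap.
have p0 : (n - i)%:R != 0 :> R by rewrite pnatr_eq0 -lt0n subn_gt0.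
by rewrite [X in _ + X]mulrAC divff// mul1r /=; ring.
Qed.

Let sum_srt (h : R -> R) w : \sum_(0 <= i < n) h (srt w)`_i = \sum_(1 <= j < n.+1) h (Y j w).
Proof.
have -> : \sum_(0 <= i < n) h (srt w)`_i = \sum_(x <- srt w) h x.
  by rewrite [RHS](big_nth 0) size_srt.
rewrite (perm_big _ (permEl (perm_sort _ _)))/= big_map /index_iota subSS subn0.
by [].
Qed.

Definition spacing_sum w : R := \sum_(1 <= i < (n - k).+1)
    ln (n%:R * (dist_fun g (order_stat (fun j => Y j w) n (i + k)) - dist_fun g (order_stat (fun j => Y j w) n i))).

Local Notation S := spacing_sum.

Lemma measurable_spacings : measurable_fun [set: T] S.
Proof.
apply: measurable_sum => i; apply: measurableT_comp; first exact: measurable_ln.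
apply: measurable_funM => //; apply: measurable_funB.
  exact: (measurableT_comp (measurable_dist_fun hg) (measurable_nth_sort (iota 1 n) (i + k).-1 mY)).
exact: (measurableT_comp (measurable_dist_fun hg) (measurable_nth_sort (iota 1 n) i.-1 mY)).
Qed.

(** Almost surely there are no ties. Each summand is then the logarithm of an F-spacing, plus
    [logratio] at its left end, plus [logdev]; the left ends are the whole sample except its k
    largest points. *)
Lemma spacings_decomposition : \forall w \ae P, S w =
  \sum_(1 <= i < (n - k).+1) ln (n%:R * (expR (- psum n renyi i w) - expR (- psum n renyi (i + k) w))) +
  (\sum_(1 <= j < n.+1) logratio f g (Y j w) - \sum_(n - k <= i < n) logratio f g (srt w)`_i) +
  locsum (logdev f g) k (srt w).
Proof.
have := egap_ae_gt0 mY m_ell ell_mono (fun i _ => ell_expo i) (@ell_indep n.+1).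
apply: filterS => w pos.
have -> : \sum_(1 <= j < n.+1) logratio f g (Y j w) - \sum_(n - k <= i < n) logratio f g (srt w)`_i =
    \sum_(0 <= i < n - k) logratio f g (srt w)`_i.
  by rewrite -sum_srt (@big_cat_nat _ _ _ (n - k) 0 n)//= ?leq_subr// addrK.
rewrite /S /locsum size_srt !big_add1/= -!big_split/=.
apply: eq_big_nat => i /andP[_ ink].
have lin : (i < n)%N by lia. have likn : (i + k < n)%N by lia.
rewrite !psum_lam; [|lia|lia].
rewrite addSn /order_stat/= -/(srt w).
set a := (srt w)`_i; set b := (srt w)`_(i + k).
have a01 : 0 < a < 1 by exact: srt01.
have b01 : 0 < b < 1 by exact: srt01.
(* Strict positivity of the gaps is what excludes a = b. *)
have Lab : lam n Y (cum_hazard f) i.+1 w < lam n Y (cum_hazard f) (i + k).+1 w.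
  have mono j m : (j + m <= n)%N -> lam n Y (cum_hazard f) j w <= lam n Y (cum_hazard f) (j + m) w.
    elim: m => [|m IH] jm; first by rewrite addn0.
    apply: le_trans (IH ltac:(lia)) _; have := pos (j + m)%N ltac:(lia).
    by rewrite /normalized_gap addnS pmulr_rgt0 ?ltr0n ?subn_gt0 ?subr_gt0; [exact: ltW|lia].
  apply: (@lt_le_trans _ _ (lam n Y (cum_hazard f) i.+2 w)).
    by have := pos i.+1 ltac:(lia); rewrite /normalized_gap pmulr_rgt0 ?ltr0n ?subn_gt0 ?subr_gt0//; lia.
  by have := mono i.+2 k.-1 ltac:(lia); rewrite (_ : (i.+2 + k.-1 = (i + k).+1)%N)//; lia.
have ab : a < b.
  have : a <= b by apply: (sorted_leq_nth le_trans lexx 0 (sorted_srt w)); rewrite ?inE ?size_srt// leq_addr.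
  by rewrite le_eqVlt => /orP[/eqP ab|//]; move: Lab; rewrite /lam -/(srt w) -/a -/b ab ltxx.
rewrite /lam -/(sample n Y w) -/(srt w) -/a -/b !(expR_ellf hf)//.
rewrite (_ : 1 - dist_fun f a - (1 - dist_fun f b) = dist_fun f b - dist_fun f a); last by ring.
rewrite /logdev ab (proj1 (andP a01)) (proj2 (andP b01))/=.
have Fab : 0 < dist_fun f b - dist_fun f a by rewrite subr_gt0 dist_fun_lt//; lra.
have Gab : 0 < dist_fun g b - dist_fun g a by rewrite subr_gt0 dist_fun_lt//; lra.
have n0 : 0 < n%:R :> R by rewrite ltr0n; lia.
rewrite ln_div ?posrE// !lnM ?posrE//; ring.
Qed.

(** The remainders are the two linearization errors, the approximation of phi by chi, the last k
    terms of the sum of [logratio] and of the linear form, and the sum of deviations. *)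
Lemma spacings_linear (chi chi' : R -> R) (K C : R) : smooth_bound chi chi' K -> 0 <= C ->
  (forall x, 0 < x < 1 -> `|logratio f g x| <= C) -> (forall a b, `|logdev f g a b| <= C) ->
  let L i := linear_term k renyi (renyi_coef n chi') i in
  L2 P S /\
  sd P (fun w => S w - \sum_(i < n - k) L i w) <=
    (5 * k%:R + K * (2 * pow4_bound R)) * harm R n + k%:R * (C + K) +
    sd P (fun w => \sum_(1 <= j < n.+1) (logratio f g (Y j w) - chi (cum_hazard f (Y j w)))) +
    sd P (fun w => locsum (logdev f g) k (srt w)).
Proof.
move=> sb C0 phiC devC; set b := renyi_coef n chi' => L.
have [mchi chiK chi'K _] := sb.
have K0 : 0 <= K := le_trans (normr_ge0 _) (chiK 0).
have bK j : `|b j| <= K := normr_renyi_coef n sb j.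
have me := renyi_measurable; have he := renyi_exponential; have ie := renyi_independent.
have [c1 [L1' n1]] := log_spacings_linear me he (ltac:(lia) : (0 < k <= n)%N).
have [c2 [L2' n2]] := smooth_statistic_linear me ie he sb.
set R1 := (X in L2 P X) in L1'; rewrite -/R1 in n1.
set R2 := (X in L2 P X) in L2'; rewrite -/R2 in n2.
pose R3 w := \sum_(1 <= j < n.+1) (logratio f g (Y j w) - chi (cum_hazard f (Y j w))).
pose R4 w := - \sum_(n - k <= i < n) logratio f g (srt w)`_i.
pose R5 w := locsum (logdev f g) k (srt w).
pose R6 w := \sum_(n - k <= j < n) b j * (renyi j w - 1).
have LR3 : L2 P R3.
  apply: L2_sum_nat => j _; apply: (@L2_bounded _ _ _ P (C + K)) => [|w].
    apply: measurable_funB; first exact: (measurableT_comp (measurable_logratio hf hg)).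
    by apply: (measurableT_comp mchi); exact: (measurableT_comp m_ell).
  by rewrite (le_trans (ler_normB _ _))// lerD// phiC.
have b4 w : `|R4 w| <= k%:R * C.
  rewrite /R4 normrN; apply: le_trans (ler_norm_sum _ _ _) _.
  apply: (@le_trans _ _ (\sum_(n - k <= i < n) C)).
    by apply: ler_sum_nat => i /andP[_ lin]; exact: phiC (srt01 w lin).
  by rewrite sumr_const_nat -[leLHS]mulr_natl (_ : (n - (n - k) = k)%N)//; lia.
have mR4 : measurable_fun [set: T] R4.
  apply: measurableT_comp => //; apply: measurable_sum => i.
  exact: (measurableT_comp (measurable_logratio hf hg) (measurable_nth_sort (iota 1 n) i mY)).
have LR4 : L2 P R4 := L2_bounded P mR4 b4.
have LR5 : L2 P R5.
  apply: (@L2_bounded _ _ _ P (n%:R * C)) => [|w].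
    by apply: measurable_locsum => //; exact: measurable_logdev.
  rewrite /R5 /locsum size_srt; apply: le_trans (ler_norm_sum _ _ _) _.
  apply: (@le_trans _ _ (\sum_(0 <= i < n - k) C)); first by apply: ler_sum => i _.
  by rewrite sumr_const_nat subn0 -[leLHS]mulr_natl ler_wpM2r// ler_nat leq_subr.
have Lbe j : (n - k <= j < n)%N -> L2 P (fun w => b j * (renyi j w - 1)).
  by move=> /andP[_ jn]; apply: L2Z; exact: (L2_expoB1 he jn).
have LR6 : L2 P R6 by exact: L2_sum_nat.
have n6 : norm2 P R6 <= k%:R * K.
  apply: le_trans (nm_sum_nat Lbe) _.
  apply: (@le_trans _ _ (\sum_(n - k <= i < n) K)).
    apply: ler_sum_nat => j /andP[_ jn]; rewrite nmZ; last exact: (L2_expoB1 he jn).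
    by rewrite /norm2 (Ex_sqr_expoB1 he jn) sqrtr1 mulr1.
  by rewrite sumr_const_nat -[leLHS]mulr_natl (_ : (n - (n - k) = k)%N)//; lia.
(* The n - k comes from ln W + (b - 1) (e - 1) = (ln W - e) + b (e - 1) + 1. *)
pose c := c1 + c2 - (n - k)%:R.
have l12 := L2D L1' L2'; have l123 := L2D l12 LR3; have l1234 := L2D l123 LR4.
have l5 := L2D l1234 LR5; have l6 := L2D l5 LR6.
have lc := L2D l6 (L2_cst P c).
have LL : L2 P (fun w => \sum_(i < n - k) L i w).
  by apply: L2_sum => i _; apply: (L2_linear_term me he k0 kn bK); have := ltn_ord i; lia.
have eq_ae : \forall w \ae P, S w - \sum_(i < n - k) L i w = R1 w + R2 w + R3 w + R4 w + R5 w + R6 w + c.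
  apply: filterS spacings_decomposition => w ->.
  have e2 : \sum_(1 <= j < n.+1) chi (cum_hazard f (Y j w)) = \sum_(1 <= i < n.+1) chi (psum n renyi i w).
    rewrite -(sum_srt (fun x => chi (cum_hazard f x))) big_add1/=; apply: eq_big_nat => i /andP[_ lin].
    by rewrite psum_lam.
  have e3 : R3 w = \sum_(1 <= j < n.+1) logratio f g (Y j w) - \sum_(1 <= i < n.+1) chi (psum n renyi i w).
    by rewrite -e2 -sumrB.
  have e6 : \sum_(j < n) b j * (renyi j w - 1) = \sum_(j < n - k) b j * (renyi j w - 1) + R6 w.
    by rewrite -!(big_mkord xpredT (fun j => b j * (renyi j w - 1))) (@big_cat_nat _ _ _ (n - k) 0 n)//= leq_subr.
  have eL : \sum_(i < n - k) L i w = \sum_(i < n - k) (ln (win renyi k i.+1 w) - renyi i w) +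
      \sum_(j < n - k) b j * (renyi j w - 1) + (n - k)%:R.
    rewrite -[in X in _ + X](card_ord (n - k)) -sumr_const -!big_split/=; apply: eq_bigr => i _.
    by rewrite /L /linear_term; ring.
  by rewrite e3 eL /R1 /R2 /R4 /R5 /c e6; ring.
have mS := measurable_spacings.
have [LD eD] := sd_ae (measurable_funB mS LL.1) lc eq_ae.
split.
  by apply: (eq_L2 (Y := fun w => (S w - \sum_(i < n - k) L i w) + \sum_(i < n - k) L i w)) => [w|]; [rewrite subrK|exact: L2D].
rewrite eD sd_shift//.
have s6 := sdD l5 LR6; have s5 := sdD l1234 LR5; have s4 := sdD l123 LR4.
have s3 := sdD l12 LR3; have s2 := sdD L1' L2'.
have t6 := sd_le_nm LR6; have t4 := sd_le_nm LR4; have t1 := sd_le_nm L1'; have t2 := sd_le_nm L2'.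
have n4 : norm2 P R4 <= k%:R * C.
  have := nm_le LR4 (L2_cst P (k%:R * C)) b4; rewrite nm_cst ger0_norm//.
  by rewrite mulr_ge0.
rewrite -/R3 -/R5 mulrDl mulrDr; lra.
Qed.

(** The smooth statistic is at once a sum over the sample, close to a sum of i.i.d. terms phi, and a
    function of the partial sums, close to a linear form whose standard deviation is the norm of b.
    The triangle inequality compares the two. *)
Lemma renyi_coef_norm (chi chi' : R -> R) (K C : R) : smooth_bound chi chi' K ->
  (forall x, 0 < x < 1 -> `|logratio f g x| <= C) ->
  `|Num.sqrt (\sum_(j < n) renyi_coef n chi' j ^+ 2) - Num.sqrt n%:R * sd P (fun w => logratio f g (Y 0%N w))| <=
    K * (2 * pow4_bound R) * harm R n +
    sd P (fun w => \sum_(1 <= j < n.+1) (logratio f g (Y j w) - chi (cum_hazard f (Y j w)))).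
Proof.
move=> sb phiC; set b := renyi_coef n chi'.
have [mchi chiK chi'K _] := sb.
have me := renyi_measurable; have he := renyi_exponential; have ie := renyi_independent.
have [c2 [L2' n2]] := smooth_statistic_linear me ie he sb.
set R2 := (X in L2 P X) in L2'; rewrite -/R2 in n2.
have Lphi j : L2 P (fun w => logratio f g (Y j w)).
  apply: (@L2_bounded _ _ _ P C) => [|w]; last exact: phiC.
  exact: (measurableT_comp (measurable_logratio hf hg)).
have Lchi j : L2 P (fun w => chi (cum_hazard f (Y j w))).
  apply: (@L2_bounded _ _ _ P K) => [|w] //.
  by apply: (measurableT_comp mchi); exact: (measurableT_comp m_ell).
have LSphi : L2 P (fun w => \sum_(1 <= j < n.+1) logratio f g (Y j w)) by exact: L2_sum_nat.
have LSchi : L2 P (fun w => \sum_(1 <= j < n.+1) chi (cum_hazard f (Y j w))) by exact: L2_sum_nat.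
have LB : L2 P (fun w => \sum_(j < n) b j * (renyi j w - 1)).
  by apply: L2_sum => j _; apply: L2Z; exact: (L2_expoB1 he (ltn_ord j)).
have eB : sd P (fun w => \sum_(j < n) b j * (renyi j w - 1)) = Num.sqrt (\sum_(j < n) b j ^+ 2).
  have [_ _ E1 E2 _] := pow4_centered_sum me ie he b (leqnn n).
  by rewrite /sd VarE// -E2; congr Num.sqrt; apply: eq_Ex => w; rewrite E1 subr0.
have eP : sd P (fun w => \sum_(1 <= j < n.+1) logratio f g (Y j w)) =
    Num.sqrt n%:R * sd P (fun w => logratio f g (Y 0%N w)).
  by rewrite /sd (Var_sum_iid n (measurable_logratio hf hg) phiC) sqrtrM.
have eX w : \sum_(1 <= j < n.+1) chi (cum_hazard f (Y j w)) = \sum_(1 <= i < n.+1) chi (psum n renyi i w).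
  rewrite -(sum_srt (fun x => chi (cum_hazard f x))) big_add1/=; apply: eq_big_nat => i /andP[_ lin].
  by rewrite psum_lam.
have h1 := sdB LSphi LSchi; have h2 := sdB LSchi LB.
have e1 : sd P (fun w => \sum_(1 <= j < n.+1) logratio f g (Y j w) - \sum_(1 <= j < n.+1) chi (cum_hazard f (Y j w))) =
   sd P (fun w => \sum_(1 <= j < n.+1) (logratio f g (Y j w) - chi (cum_hazard f (Y j w)))).
  by apply: eq_sd => w; rewrite sumrB.
have e2 : sd P (fun w => \sum_(1 <= j < n.+1) chi (cum_hazard f (Y j w)) - \sum_(j < n) b j * (renyi j w - 1)) = sd P R2.
  rewrite -(sd_shift c2 L2'); apply: eq_sd => w; rewrite eX /R2 -/b; ring.
have := sd_le_nm L2'; rewrite -eB -eP.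
by move: h1 h2; rewrite e1 e2 !ler_norml; lra.
Qed.

End fixed_size.

(** The order of choice matters: first the tolerance, then chi and its bound K, and only then n. The
    coefficients b depend on n but stay bounded by K. *)
Lemma spacing_sum_approx (k : nat) (eps : R) : (0 < k)%N -> 0 < eps -> exists K : R, 0 <= K /\
  \forall n \near \oo, exists b : nat -> R,
    let L w := \sum_(i < n - k) linear_term k (renyi n) b i w in
    [/\ forall j, `|b j| <= K, L2 P (spacing_sum n k), sd P (fun w => spacing_sum n k w - L w) <= eps * Num.sqrt n%:R &
      `|Var P L - n%:R * (tau R k + Var P (fun w => logratio f g (Y 0%N w)))| <= eps * n%:R].
Proof.
move=> k0 eps0.
have [C [C0 phiC devC]] := log_ratio_bounds hf hg.
set phi := fun w => logratio f g (Y 0%N w).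
have [Lphi Aphi] := @approximable_bounded _ _ _ P f hf (Y 0%N) (mY 0) (Y01 0) _ C (measurable_logratio hf hg) phiC.
have V0 := Var_ge0 Lphi; have s0 := sd_ge0 P phi.
(* Four errors of size eps1 enter the standard deviation; the factor sd phi + 1 pays for squaring
   the comparison of norms. *)
pose eps1 := Num.min 1 (eps / (8 * (sd P phi + 1))).
have q0 : 0 < 8 * (sd P phi + 1) by rewrite mulr_gt0//; lra.
have e10 : 0 < eps1 by rewrite lt_min ltr01 divr_gt0.
have e11 : eps1 <= 1 by rewrite ge_min lexx.
have e1e : 8 * (eps1 * (sd P phi + 1)) <= eps.
  by rewrite mulrCA -ler_pdivlMr// ge_min lexx orbT.
have e18 : 8 * eps1 <= eps by have := mulr_ge0 (ltW e10) s0; lra.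
have [chi [chi' [K [sb hchi]]]] := Aphi _ e10.
have [mchi chiK chi'K _] := sb.
have K0 : 0 <= K := le_trans (normr_ge0 _) (chiK 0).
exists K; split => //.
have p0 : 0 <= pow4_bound R by have := pow4_bound_ge3 R; lra.
pose c := 5 * k%:R + K * (2 * pow4_bound R).
have c0 : 0 <= c by rewrite addr_ge0// ?mulr_ge0// mulr_ge0.
pose c1 := 3 * k%:R ^+ 2 * (ln_win_pow4_bound R k + 1) + 2 * k%:R * (K + 1) + k%:R * K ^+ 2 + k%:R * `|tau R k|.
near=> n.
have kn : (2 * k <= n)%N by near: n; exists (2 * k)%N.
have Hn : c * harm R n <= eps1 * Num.sqrt n%:R by near: n; exact: harm_sqrt.
have Cn : k%:R * (C + K) <= eps1 * Num.sqrt n%:R.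
  have h : (k%:R * (C + K) / eps1) ^+ 2 <= n%:R by near: n; exact: nbhs_infty_ger.
  rewrite [leRHS]mulrC -ler_pdivrMr// -[leLHS]ger0_norm ?divr_ge0 ?mulr_ge0 ?addr_ge0 ?(ltW e10)//.
  by rewrite -sqrtr_sqr ler_sqrt.
have Dn : Var P (fun w => locsum (logdev f g) k (sorted_sample n w)) <= eps1 ^+ 2 * n%:R.
  by near: n; apply: (Var_locsum_logdev hf hg mY Y01 lawY iY k0); rewrite exprn_gt0.
have c1n : c1 <= eps / 2 * n%:R.
  have h : c1 / (eps / 2) <= n%:R by near: n; exact: nbhs_infty_ger.
  by rewrite mulrC -ler_pdivrMr// divr_gt0.
have r0 : 0 <= Num.sqrt n%:R :> R := sqrtr_ge0 _.
have rr : Num.sqrt n%:R * Num.sqrt n%:R = n%:R :> R by rewrite -expr2 sqr_sqrtr.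
have sD : sd P (fun w => locsum (logdev f g) k (sorted_sample n w)) <= eps1 * Num.sqrt n%:R.
  rewrite -[eps1]ger0_norm ?(ltW e10)// -sqrtr_sqr -sqrtrM ?sqr_ge0// /sd.
  by rewrite ler_wsqrtr.
have sR : sd P (fun w => \sum_(1 <= j < n.+1) (logratio f g (Y j w) - chi (cum_hazard f (Y j w)))) <= eps1 * Num.sqrt n%:R.
  have mh : measurable_fun [set: R] (fun x => logratio f g x - chi (cum_hazard f x)).
    by apply: measurable_funB; [exact: measurable_logratio|exact: (measurableT_comp mchi)].
  have bh x : 0 < x < 1 -> `|logratio f g x - chi (cum_hazard f x)| <= C + K.
    by move=> x01; rewrite (le_trans (ler_normB _ _))// lerD// phiC.
  rewrite /sd (Var_sum_iid n mh bh) sqrtrM// mulrC ler_wpM2r//; apply: le_trans hchi.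
  apply: sd_le_nm; apply: (@L2_bounded _ _ _ P (C + K)) => [|w]; last exact: bh.
  exact: (measurableT_comp mh).
have [LS hS] := spacings_linear k0 kn sb C0 phiC devC.
have hb := @renyi_coef_norm n chi chi' K C sb phiC.
have bK j : `|renyi_coef n chi' j| <= K := normr_renyi_coef n sb j.
exists (renyi_coef n chi'); split => //.
  by apply: le_trans hS _; rewrite -/c; nra.
have hV := Var_linear_sum (@renyi_measurable n) (@renyi_independent n) (@renyi_exponential n) k0 kn bK.
set v := Var P _ in hV *; rewrite -/c1 in hV; move: hb hV.
set q := \sum_(j < n) _ => hb hV.
have q00 : 0 <= q by apply: sumr_ge0 => j _; exact: sqr_ge0.
have hq : `|q - n%:R * Var P phi| <= eps / 2 * n%:R.
  rewrite -(sqr_sd Lphi) -{1}(sqr_sqrtr q00) -rr.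
  have Hn' : K * (2 * pow4_bound R) * harm R n <= eps1 * Num.sqrt n%:R.
    by apply: le_trans Hn; rewrite ler_wpM2r ?harm_ge0// /c lerDr mulr_ge0.
  have {}hb : `|Num.sqrt q - Num.sqrt n%:R * sd P phi| <= 2 * eps1 * Num.sqrt n%:R.
    by apply: le_trans hb _; lra.
  set a := Num.sqrt q in hb *; set r := Num.sqrt n%:R in r0 hb *; set s := sd P phi in s0 e1e hb *.
  rewrite (_ : a ^+ 2 - _ = (a - r * s) * ((a - r * s) + 2 * (r * s))); last by ring.
  rewrite normrM; have rs0 : 0 <= r * s by rewrite mulr_ge0.
  apply: (@le_trans _ _ ((2 * eps1 * r) * (2 * eps1 * r + 2 * (r * s)))).
    rewrite ler_pM// (le_trans (ler_normD _ _))// lerD// ger0_norm// mulr_ge0//.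
  rewrite (_ : (2 * eps1 * r) * _ = (4 * (eps1 * (s + eps1))) * (r * r)); last by ring.
  rewrite ler_wpM2r ?mulr_ge0//.
  have := ler_wpM2l (ltW e10) (lerD (lexx s) e11); lra.
rewrite (_ : v - _ = (v - (n%:R * tau R k + q)) + (q - n%:R * Var P phi)); last by ring.
apply: le_trans (ler_normD _ _) _; rewrite [eps in leRHS]splitr mulrDl lerD//.
exact: le_trans hV c1n.
Unshelve. all: by end_near. Qed.

End sample_statistics.

(** s^2 - l^2 = (s - l) (s + l), where l <= (v + 1) r and s <= l + r give s + l <= (2 v + 3) r; the
    last unit of 2 v + 4 is the error on l^2. *)
Lemma sqr_close (R : realType) (s l r v eps : R) : 0 <= s -> 0 <= l -> 0 <= r -> 0 <= v -> 0 < eps <= 1 ->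
  `|s - l| <= eps * r -> `|l ^+ 2 - r ^+ 2 * v| <= eps * r ^+ 2 ->
  `|s ^+ 2 - r ^+ 2 * v| <= eps * (2 * v + 4) * r ^+ 2.
Proof.
move=> s0 l0 r0 v0 /andP[e0 e1] sl lv.
have r2 := sqr_ge0 r.
have lr : l <= r * (v + 1).
  rewrite -(@ler_pXn2r _ 2) ?nnegrE ?mulr_ge0//; last by lra.
  have h : l ^+ 2 <= r ^+ 2 * (v + 1) by move: lv; rewrite ler_norml; nra.
  by apply: le_trans h _; rewrite exprMn ler_wpM2l// expr2; nra.
rewrite (_ : s ^+ 2 - _ = (s - l) * (s + l) + (l ^+ 2 - r ^+ 2 * v)); last by ring.
apply: le_trans (ler_normD _ _) _.
have h1 : `|(s - l) * (s + l)| <= eps * (2 * v + 3) * r ^+ 2.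
  rewrite normrM (ger0_norm (addr_ge0 s0 l0)).
  have h2 : s + l <= (2 * v + 3) * r by move: sl; rewrite ler_norml; nra.
  have -> : eps * (2 * v + 3) * r ^+ 2 = eps * r * ((2 * v + 3) * r) by ring.
  by rewrite ler_pM// addr_ge0.
have -> : eps * (2 * v + 4) * r ^+ 2 = eps * (2 * v + 3) * r ^+ 2 + eps * r ^+ 2 by ring.
exact: lerD.
Qed.

Lemma cvg_in_distribution_ae d (T : measurableType d) (R : realType) (P : probability T R)
    (W W' : nat -> T -> R) (Q : probability (measurableTypeR R) R) :
  (\forall n \near \oo, [/\ measurable_fun [set: T] (W n), measurable_fun [set: T] (W' n) &
     \forall w \ae P, W n w = W' n w]) ->
  cvg_in_distribution P W' Q -> cvg_in_distribution P W Q.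
Proof.
move=> WW' cW' h ch [M hM].
have := cW' h ch (ex_intro _ M hM); apply: cvg_trans; apply: near_eq_cvg.
have mh : measurable_fun [set: R] h by exact: continuous_measurable_fun.
apply: filterS WW' => n [mW mW' eW].
have m1 : measurable_fun [set: T] (h \o W n) by exact: measurableT_comp.
have m2 : measurable_fun [set: T] (h \o W' n) by exact: measurableT_comp.
have l1 : L1 P (h \o W n) by apply: (@L1_bounded _ _ _ P M) => // w; exact: hM.
have l2 : L1 P (h \o W' n) by apply: (@L1_bounded _ _ _ P M) => // w; exact: hM.
rewrite !expectationE//; congr (_%:E); apply: Ex_ae => //.
by apply: filterS eW => w /= ->.
Qed.

Section limit_theorem.
Context (R : realType) (f g : R -> R).
Hypotheses (hf : unit_interval_density f) (hg : unit_interval_density g).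
Context d (T : measurableType d) (P : probability T R) (Y : nat -> T -> R).
Hypothesis mY : forall i, measurable_fun [set: T] (Y i).
Hypothesis Y01 : forall i w, 0 < Y i w < 1.
Hypothesis lawY : forall i (A : set R), measurable A ->
  (P (Y i @^-1` A) = \int[lebesgue_measure]_(x in A) (f x)%:E)%E.
Hypothesis iY : forall m, indep P m Y.
Variable k : nat.
Hypothesis k0 : (0 < k)%N.

Local Notation S := (spacing_sum g Y ^~ k).
Local Notation v := (tau R k + Var P (fun w => logratio f g (Y 0%N w))).

Let approx (eps : R) (eps0 : 0 < eps) := spacing_sum_approx hf hg mY Y01 lawY iY k0 eps0.

Let L2_linear_sum n (b : nat -> R) (K : R) : (2 * k <= n)%N -> (forall j, `|b j| <= K) ->
  L2 P (fun w => \sum_(i < n - k) linear_term k (renyi f Y n) b i w).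
Proof.
move=> kn bK; apply: L2_sum => i _.
apply: (L2_linear_term (renyi_measurable hf mY n) (@renyi_exponential _ _ hf _ _ _ _ mY Y01 lawY iY n) k0 kn bK).
by have := ltn_ord i; lia.
Qed.

(** Nonnegativity is read off from the approximating variances: a negative v would put them at a
    distance of at least - v n from n v, beyond the tolerance - v n / 2. *)
Lemma spacing_variance_ge0 : 0 <= v.
Proof.
rewrite leNgt; apply/negP => v0.
have e0 : 0 < - v / 2 by rewrite divr_gt0// oppr_gt0.
have [K [_ [n0 _ hn]]] := approx e0.
have [b] := hn (n0 + 2 * k)%N (leq_addr _ _); set n := (n0 + 2 * k)%N.
move=> [bK _ _ hV]; pose L w := \sum_(i < n - k) linear_term k (renyi f Y n) b i w.
have {hV} : `|Var P L - n%:R * v| <= - v / 2 * n%:R := hV; rewrite ler_norml => /andP[_ h].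
have VL : 0 <= Var P L by apply: Var_ge0; apply: L2_linear_sum bK; rewrite /n leq_addl.
have n0' : 0 < n%:R :> R by rewrite ltr0n /n; lia.
have := mulr_gt0 n0' e0; lra.
Qed.

Lemma L2_spacing_sum : \forall n \near \oo, L2 P (S n).
Proof.
have [K [_ h]] := approx ltr01.
by apply: filterS h => n [b [_ ? _ _]].
Qed.

Lemma cvg_variance_spacing_sum : (n%:R^-1 * Var P (S n)) @[n --> \oo] --> v.
Proof.
have v0 := spacing_variance_ge0.
apply/cvgrPdist_le => eps eps0.
pose eps1 := Num.min 1 (eps / (2 * v + 4)).
have q0 : 0 < 2 * v + 4 by lra.
have e10 : 0 < eps1 by rewrite lt_min ltr01 divr_gt0.
have e11 : eps1 <= 1 by rewrite ge_min lexx.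
have e1e : eps1 * (2 * v + 4) <= eps by rewrite -ler_pdivlMr// ge_min lexx orbT.
have [K [K0 h]] := approx e10.
have hk : \forall n \near \oo, (2 * k < n)%N by exists (2 * k).+1.
apply: filterS2 h hk => n [b [bK LS hS' hV']] kn; pose L w := \sum_(i < n - k) linear_term k (renyi f Y n) b i w.
have hS : sd P (fun w => S n w - L w) <= eps1 * Num.sqrt n%:R := hS'.
have {hS' hV'} hV : `|Var P L - n%:R * v| <= eps1 * n%:R := hV'.
have LL : L2 P L by exact: L2_linear_sum (ltnW kn) bK.
have := @sqr_close R (sd P (S n)) (sd P L) (Num.sqrt n%:R) v eps1 (sd_ge0 _ _) (sd_ge0 _ _) (sqrtr_ge0 _) v0.
rewrite e10 e11 !sqr_sd// sqr_sqrtr// => /(_ isT (le_trans (sdB LS LL) hS) hV) hh.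
have n0 : 0 < n%:R :> R by rewrite ltr0n (leq_ltn_trans _ kn).
rewrite distrC (_ : _ - v = n%:R^-1 * (Var P (S n) - n%:R * v)); last by field; rewrite gt_eqF.
rewrite normrM ger0_norm ?invr_ge0// ler_pdivrMl// [leRHS]mulrC.
by apply: le_trans hh _; rewrite ler_wpM2r.
Qed.

Lemma cvg_in_distribution_spacing_sum :
  cvg_in_distribution P (fun n w => (Num.sqrt n%:R)^-1 * (S n w - Ex P (S n))) (centered_normal v).
Proof.
have v0 := spacing_variance_ge0.
(* [S n] is known to be square integrable for large n only; elsewhere 0 is used, which does not
   affect the limit. *)
pose W n w := if `[< L2 P (S n) >] then (Num.sqrt n%:R)^-1 * (S n w - Ex P (S n)) else 0.
have WE n : L2 P (S n) -> W n = fun w => (Num.sqrt n%:R)^-1 * ctr P (S n) w.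
  by move=> h; apply/funext => w; rewrite /W; case: asboolP.
have LW n : L2 P (W n).
  have [h|h] := pselect (L2 P (S n)); first by rewrite WE//; apply/L2Z/L2_ctr.
  have -> : W n = (fun=> 0 : R) by apply/funext => w; rewrite /W; case: asboolP.
  exact: L2_cst.
apply: (@cvg_in_distribution_ae _ _ _ _ _ W).
  apply: filterS L2_spacing_sum => n h; split; [|exact: (LW n).1|by apply: aeW => w; rewrite WE].
  by apply: measurable_funM => //; apply: measurable_funB => //; exact: h.1.
apply: cvg_centered_normal => // eps eps0.
pose eps1 := Num.min 1 (eps / (2 * v + 4)).
have q0 : 0 < 2 * v + 4 by lra.
have e10 : 0 < eps1 by rewrite lt_min ltr01 divr_gt0.
have e11 : eps1 <= 1 by rewrite ge_min lexx.
have e1e : eps1 * (2 * v + 4) <= eps by rewrite -ler_pdivlMr// ge_min lexx orbT.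
have [K [K0 h]] := approx e10.
pose M : R := (2 * k + 1)%:R * (8 * (ln_win_pow4_bound R k + (K + 1) ^+ 4 * pow4_bound R)).
have M0 : 0 <= M.
  rewrite /M mulr_ge0// mulr_ge0// addr_ge0//; first by rewrite /ln_win_pow4_bound mulr_ge0// mulr_ge0// mulr_ge0.
  by rewrite mulr_ge0//; [rewrite (_ : 4 = 2 * 2)%N// exprM sqr_ge0|have := pow4_bound_ge3 R; lra].
(* As A >= 1, A^2 >= A >= M / eps1^2, so truncation costs at most eps1 sqrt n in standard
   deviation. *)
pose A := 1 + M / eps1 ^+ 2.
have A1 : 1 <= A by rewrite lerDl divr_ge0// sqr_ge0.
have A0 : 0 < A by lra.
have MA : M / A ^+ 2 <= eps1 ^+ 2.
  rewrite ler_pdivrMr ?exprn_gt0// mulrC -ler_pdivrMr ?exprn_gt0//.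
  by apply: (@le_trans _ _ A); [rewrite lerDr|rewrite expr2 ler_peMr// ltW].
(* A truncated term differs from its mean by at most 2 A. *)
exists (2 * A), k; split; first by rewrite mulr_ge0// ltW.
have hk : \forall n \near \oo, (2 * k < n)%N by exists (2 * k).+1.
apply: filterS2 h hk => n [b [bK LS hS' hV']] kn; pose L w := \sum_(i < n - k) linear_term k (renyi f Y n) b i w.
have hS : sd P (fun w => S n w - L w) <= eps1 * Num.sqrt n%:R := hS'.
have {hS' hV'} hV : `|Var P L - n%:R * v| <= eps1 * n%:R := hV'.
have me := renyi_measurable hf mY n.
have ie := renyi_independent hf mY Y01 lawY iY n.
have he := @renyi_exponential _ _ hf _ _ _ _ mY Y01 lawY iY n.
pose l i w := linear_term k (renyi f Y n) b i w.
have Ll i : (i < n - k)%N -> L2 P (l i).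
  by move=> ink; apply: (L2_linear_term me he k0 (ltnW kn) bK); rewrite addnC -ltn_subRL.
have LL : L2 P L by exact: L2_linear_sum (ltnW kn) bK.
pose t i w := truncate A (l i w).
have bt i w : `|t i w| <= A by apply: normr_truncate; exact: ltW.
have Lt i : (i < n - k)%N -> L2 P (t i).
  move=> /Ll Li; apply: (@L2_bounded _ _ _ P A) => //.
  exact: (measurableT_comp (measurable_truncate A) Li.1).
pose Tr w := \sum_(i < n - k) t i w.
have LTr : L2 P Tr by apply: L2_sum => i _; exact: Lt.
have n0 : 0 < n%:R :> R by rewrite ltr0n (leq_ltn_trans _ kn).
have r0 : 0 < Num.sqrt n%:R :> R by rewrite sqrtr_gt0.
have ri0 : 0 <= (Num.sqrt n%:R)^-1 :> R by rewrite invr_ge0 ltW.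
have rr : Num.sqrt n%:R ^+ 2 = n%:R :> R by rewrite sqr_sqrtr.
have sT : sd P (fun w => L w - Tr w) <= eps1 * Num.sqrt n%:R.
  have := Var_truncated_sum me ie he k0 (ltnW kn) bK A0.
  rewrite (_ : (fun w => \sum_(i < _) _) = fun w => L w - Tr w); last by apply/funext => w; rewrite -sumrB.
  rewrite [X in _ * X]mulrA -/M => hT.
  rewrite -[eps1]ger0_norm ?(ltW e10)// -sqrtr_sqr -sqrtrM ?sqr_ge0// /sd ler_wsqrtr//.
  by apply: le_trans hT _; rewrite mulrC ler_wpM2r.
have LS' := L2B LS LL. have LT' := L2B LL LTr.
pose xi i w := (Num.sqrt n%:R)^-1 * (t i w - Ex P (t i)).
have sxi w : \sum_(i < n - k) xi i w = (Num.sqrt n%:R)^-1 * ctr P Tr w.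
  rewrite -mulr_sumr sumrB /ctr; congr (_ * (_ - _)); rewrite /Tr Ex_sum// => i _.
  by apply: L2_L1; exact: Lt.
have Lxi : L2 P (fun w => (Num.sqrt n%:R)^-1 * ctr P Tr w) by apply/L2Z/L2_ctr.
exists n, (n - k)%N, (renyi f Y n), xi; split => //.
- by split; [rewrite subnK// (leq_trans (leq_pmull k (isT : 0 < 2)%N) (ltnW kn))|exact: leq_subr].
- move=> i ink; have Li := Lt i ink; split.
  + apply: measurable_funM; first exact: measurable_cst.
    apply: measurable_funB; last exact: measurable_cst.
    have s := @sg_linear_term _ _ _ n k (renyi f Y n) k0 (ltnW kn) b K bK i.
    exact: (measurableT_comp (measurable_truncate A) s).
  + move=> w; rewrite /xi normrM (ger0_norm ri0) mulrC ler_wpM2r//.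
    apply: le_trans (ler_normB _ _) _; rewrite (_ : 2 * A = A + A); last by ring.
    apply: lerD => //; apply: Ex_bounded => //; exact: Li.1.
  + rewrite ExZ; last by apply: L2_L1; exact: L2_ctr.
    by rewrite Ex_ctr ?mulr0//; exact: L2_L1.
- rewrite (@eq_nm _ _ _ P _ (fun w => (Num.sqrt n%:R)^-1 * ctr P (fun w => S n w - Tr w) w)); last first.
    move=> w; rewrite WE// sxi -mulrBr /ctr; congr (_ * _).
    by have eB := ExB (L2_L1 LS) (L2_L1 LTr); rewrite eB; ring.
  have LST := L2B LS LTr; have eN := nmZ (Num.sqrt n%:R)^-1 (L2_ctr LST).
  rewrite eN -(sdE LST) ger0_norm// mulrC ler_pdivrMr//.
  have e1 := sdD LS' LT'.
  rewrite (@eq_sd _ _ _ _ _ (fun w => S n w - Tr w)) in e1; last by move=> w; ring.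
  apply: le_trans e1 _; apply: (@le_trans _ _ (2 * eps1 * Num.sqrt n%:R)); first by lra.
  by rewrite ler_wpM2r ?sqrtr_ge0//; nra.
- have -> : Var P (fun w => \sum_(i < n - k) xi i w) = n%:R^-1 * Var P Tr.
    have eV := VarZ (Num.sqrt n%:R)^-1 (L2_ctr LTr).
    rewrite /Var (eq_Cov P sxi sxi) -/(Var P _) eV exprVn rr; congr (_ * _).
    have -> : ctr P Tr = fun w => Tr w + - Ex P Tr by [].
    exact: VarD_cst.
  have := @sqr_close R (sd P Tr) (sd P L) (Num.sqrt n%:R) v eps1 (sd_ge0 _ _) (sd_ge0 _ _) (sqrtr_ge0 _) v0.
  have e2 : `|sd P Tr - sd P L| <= eps1 * Num.sqrt n%:R by rewrite distrC; exact: le_trans (sdB LL LTr) sT.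
  rewrite e10 e11 !sqr_sd// rr => /(_ isT e2 hV) hh.
  rewrite (_ : _ - v = n%:R^-1 * (Var P Tr - n%:R * v)); last by field; rewrite gt_eqF.
  rewrite normrM ger0_norm ?invr_ge0// ler_pdivrMl// [leRHS]mulrC.
  by apply: le_trans hh _; rewrite ler_wpM2r.
Qed.

End limit_theorem.

(** f vanishes off [0, 1], and the two endpoints are Lebesgue null. *)
Lemma density_support d (T : measurableType d) (R : realType) (P : probability T R)
    (X : {RV P >-> R}) (f : R -> R) : unit_interval_density f -> has_density X f ->
  \forall w \ae P, 0 < X w < 1.
Proof.
move=> hf hX.
have mX : measurable_fun [set: T] X by [].
have null (D : set R) : measurable D -> (\int[lebesgue_measure]_(x in D) (f x)%:E = 0)%E -> \forall w \ae P, ~ D (X w).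
  move=> mD fD; exists (X @^-1` D); split.
  - by rewrite -[_ @^-1` _]setTI; exact: mX.
  - by have := hX D mD; rewrite fD.
  - by move=> w /= /contrapT.
have n0 := null [set 0] (measurable_set1 _) (integral_set1 _ _).
have n1 := null [set 1] (measurable_set1 _) (integral_set1 _ _).
have mI : measurable (~` `[0, 1]%classic : set R) by apply: measurableC; exact: measurable_itv.
have {}nI : \forall w \ae P, ~ (~` `[0, 1]%classic : set R) (X w).
  apply: null => //; apply: integral0_eq => x /= /negP xI.
  by rewrite (density_vanish hf).
apply: filterS3 n0 n1 nI => w /= w0 w1 /contrapT; rewrite in_itv/= !le_eqVlt => /andP[/orP[/eqP h|->]].
  by case: w0.
by move=> /orP[/eqP h|->].
Qed.

Lemma mutually_independent_indep d (T : measurableType d) (R : realType) (P : probability T R)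
    (X : nat -> {RV P >-> R}) (m : nat) : mutually_independent X -> indep P m (fun i => X i : T -> R).
Proof.
move=> iX A mA; have := iX [fset i in iota 0 m]%fset A mA.
rewrite (perm_big (iota 0 m)); last first.
  by apply: uniq_perm; rewrite ?fset_uniq ?iota_uniq// => i; rewrite in_fset.
rewrite -(big_mkord xpredT (fun i => P (X i @^-1` A i))) /index_iota subn0 => <-.
congr (P _); apply/seteqP; split => w h i hi; apply: h; by move: hi; rewrite /= in_fset/= mem_iota.
Qed.

(* X 0 is the generic variable X; X 1, X 2, etc. are the sample. *)
Theorem corollary3p1 (R : realType) (d : measure_display)
    (T : measurableType d) (P : probability T R) (f g : R -> R)
    (hf : unit_interval_density f) (hg : unit_interval_density g)
    (X : nat -> {RV P >-> R}) (hX : iid_with_density X f)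
    (k : nat) (hk : (0 < k)%N) :
  let S := log_spacings g k X in
  let V := 'V_P[fun w => ln (f (X 0%N w) / g (X 0%N w))]%E in
  ((n%:R^-1)%:E * 'V_P[S n] @[n --> \oo] --> (tau R k)%:E + V)%E /\
  cvg_in_distribution P
    (fun n w => (Num.sqrt n%:R)^-1 * (S n w - fine 'E_P[S n]%E))
    (centered_normal (tau R k + fine V)).
Proof.
move=> S V; have [iX dX] := hX.
(* [clip] sends exceptional values to 1/2, so that the sample lies in ]0, 1[ at every point. Almost
   surely nothing changes, and variances, expectations and limits are transferred back at the
   end. *)
pose clip (x : R) : R := if 0 < x < 1 then x else 2^-1.
have mclip : measurable_fun [set: R] clip.
  apply: measurable_fun_ifT => //.
  by apply: measurable_and; exact: measurable_fun_ltr.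
pose Y i w := clip (X i w).
have mX i : measurable_fun [set: T] (X i : T -> R) by [].
have mY i : measurable_fun [set: T] (Y i) by exact: (measurableT_comp mclip).
have Y01 i w : 0 < Y i w < 1 by rewrite /Y /clip; case: ifPn => // _; lra.
have XY : \forall w \ae P, forall i, X i w = Y i w.
  apply/ae_foralln => i; apply: filterS (density_support hf (dX i)) => w w01.
  by rewrite /Y /clip w01.
have lawY i (A : set R) : measurable A ->
    (P (Y i @^-1` A) = \int[lebesgue_measure]_(x in A) (f x)%:E)%E.
  move=> mA; rewrite -(dX i A mA).
  pose B := X i @^-1` (`]0, 1[%classic : set R).
  have mB : measurable B by rewrite -[B]setTI; apply: mX => //; exact: measurable_itv.
  have PB : P B = 1%E.
    have nB : P.-negligible (~` B).
      have [N [mN N0 subN]] := density_support hf (dX i).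
      by exists N; split => // w /= nBw; apply: subN => /= w01; apply: nBw; rewrite /B /= in_itv.
    have P0 : P (~` B) = 0%E by apply: measure_negligible => //; exact: measurableC.
    by rewrite -[B]setCK probability_setC ?P0 ?sube0//; exact: measurableC.
  have pre (Z : T -> R) : measurable_fun [set: T] Z -> measurable (Z @^-1` A).
    by move=> mZ; rewrite -[_ @^-1` _]setTI; exact: mZ.
  rewrite -(prob_setI1 (pre _ (mY i)) mB PB) -[RHS](prob_setI1 (pre _ (mX i)) mB PB).
  by congr (P _); apply/seteqP; split => w /= []; rewrite /B /= in_itv/= /Y /clip => + w01; rewrite w01.
have iY m : indep P m Y.
  move=> A mA; have mE i : measurable (clip @^-1` A i) by rewrite -[_ @^-1` _]setTI; exact: mclip.
  exact: (@mutually_independent_indep _ _ _ P X m iX (fun i => clip @^-1` A i) mE).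
pose S' n := spacing_sum g Y n k.
have SS' n : \forall w \ae P, S n w = S' n w.
  apply: filterS XY => w XYw; rewrite /S /log_spacings /S' /spacing_sum.
  by rewrite (_ : (fun j => X j w) = fun j => Y j w)//; apply/funext.
have mS n : measurable_fun [set: T] (S n) := measurable_spacings hg mX n k.
have mS' n : measurable_fun [set: T] (S' n) := measurable_spacings hg mY n k.
pose phi w := logratio f g (Y 0%N w).
have Lphi : L2 P phi.
  have [C [_ h _]] := log_ratio_bounds hf hg.
  apply: (@L2_bounded _ _ _ P C) => [|w]; last exact: h.
  exact: (measurableT_comp (measurable_logratio hf hg)).
(* The theorem has ln (f / g) and [phi] is ln (g / f): they are opposite almost surely, hence of
   equal variance. *)
have psi : \forall w \ae P, logratio g f (X 0%N w) = - phi w.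
  apply: filterS XY => w ->; rewrite /phi /logratio.
  have := Y01 0%N w; move: (Y 0%N w) => y /andP[y0 y1].
  have yI : y \in `[0, 1] by rewrite in_itv/= !ltW.
  have [m1 m10 /(_ y yI) h1] := density_away0 hf; have [m2 m20 /(_ y yI) h2] := density_away0 hg.
  have fy := lt_le_trans m10 h1; have gy := lt_le_trans m20 h2.
  by rewrite -lnV ?posrE ?divr_gt0// invf_div.
have mpsi : measurable_fun [set: T] (fun w => logratio g f (X 0%N w)).
  exact: (measurableT_comp (measurable_logratio hg hf)).
have [Lpsi sdpsi] := sd_ae mpsi (L2N Lphi) psi.
have VE : V = (Var P phi)%:E.
  by rewrite /V [LHS](varianceE Lpsi) -(sqr_sd Lpsi) sdpsi sdN// sqr_sd.
have ES n : fine 'E_P[S n]%E = Ex P (S' n) by rewrite fine_expectation; exact: Ex_ae.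
rewrite VE; split.
  have := cvg_variance_spacing_sum hf hg mY Y01 lawY iY hk.
  move=> h; rewrite -EFinD; apply: cvg_trans (cvg_EFin (f := fun n => (n%:R^-1 * Var P (S' n))%:E) _ h); last exact: nearW.
  apply: near_eq_cvg; apply: filterS (L2_spacing_sum hf hg mY Y01 lawY iY hk) => n LS'.
  have [LS sS] := sd_ae (mS n) LS' (SS' n).
  by rewrite (varianceE LS) -(sqr_sd LS) sS sqr_sd// EFinM.
apply: cvg_in_distribution_ae (cvg_in_distribution_spacing_sum hf hg mY Y01 lawY iY hk).
apply: nearW => n; split.
- by apply: measurable_funM => //; exact: measurable_funB.
- by apply: measurable_funM => //; exact: (measurable_funB (mS' n)).
- by apply: filterS (SS' n) => w ->; rewrite ES.
Qed.
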